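(* Let $\mathfrak p$ be a maximal ideal of $\mathcal O_K$, $\xi\in\mathscr X(\mathbb F_{\mathfrak p})$ a non-singular point of $\mathscr X$, and $\eta\in X(K)$ a rational point whose reduction modulo $\mathfrak p$ is $\xi$. Let $H$ be a Cartier divisor on $X$ given by a hyperplane section of $\mathbb P(\mathcal E_K)$. Then, as $D\to\infty$, \[\mathcal R_\xi(F_D)=\frac{D^{d+1}}{d!}I_X(H,\xi)+O_{d,\delta}(D^d),\] where the implied constant depends only on $d$ and $\delta$.
   Context: $K$ is a number field, $\mathcal O_K$ its ring of integers, $\mathbb F_{\mathfrak p}=\mathcal O_K/\mathfrak p$, $\mathcal O_{K,\mathfrak p}$ the localization. $\mathcal E$ is a finitely generated projective $\mathcal O_K$-module of rank $n+1$, $\mathcal E_K=\mathcal E\otimes K$, $\mathbb P(\mathcal E)$ the projective space of rank-one quotients with tautological bundle $\mathcal O(1)$, $E_D=H^0(\mathbb P(\mathcal E),\mathcal O(D))$. $X\subset\mathbb P(\mathcal E_K)$ is a closed integral subscheme of dimension $d$ and degree $\delta$, $\mathscr X$ its Zariski closure in $\mathbb P(\mathcal E)$. $F_D$ is the largest saturated sub-$\mathcal O_K$-module of $H^0(\mathscr X,\mathcal O(1)|_{\mathscr X}^{\otimes D})$ with $F_D\otimes K$ equal to the image of $E_D\otimes K\to H^0(X,\mathcal O(1)|_X^{\otimes D})$. The reduction mod $\mathfrak p$ of $\eta$ is the image of the closed point $\mathfrak p$ under the unique extension $\mathcal P:\mathrm{Spec}\,\mathcal O_K\to\mathscr X$;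 non-singular means regular local ring. $\mathcal P$ induces a local homomorphism of $\mathcal O_{K,\mathfrak p}$-algebras $\mathcal O_{\mathscr X,\xi}\to\mathcal O_{K,\mathfrak p}$ with prime kernel $\mathfrak a$; $R$ is the localization of $\mathcal O_{\mathscr X,\xi}$ at $\mathfrak a$, $\mathfrak m=\mathfrak aR$; via a local trivialization of $\mathcal O(1)^{\otimes D}$ at $\xi$, $F_D\otimes\mathcal O_{K,\mathfrak p}\subset\mathcal O_{\mathscr X,\xi}\subset R$, and $\mathcal R_\xi(F_D)=\sum_{k\geqslant1}\dim_K\big((F_D\otimes\mathcal O_{K,\mathfrak p})\cap\mathfrak m^k\big)\otimes K$. Let $\pi:\widetilde X\to X$ be the blow-up at $\eta$ with exceptional divisor $E$; for an $\mathbb R$-Cartier divisor $L$ on $\widetilde X$, $\mathrm{vol}(L)$ is the volume, defined for integral divisors by $\limsup_{D\to\infty}h^0(\widetilde X,DL)/(D^d/d!)$ and extended continuously to $\mathbb R$-divisor classes. Then $I_X(H,\xi)=\int_0^\infty\mathrm{vol}(\pi^*H-\lambda E)\,d\lambda$. *)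

(* Defs.v *)
Set Warnings "-notation-overridden,-ambiguous-paths,-notation-incompatible-prefix,-redundant-canonical-projection".
From HB Require Import structures.
From mathcomp Require Export all_boot all_order all_algebra all_field.
(* The notations of mpoly clash with those of mathcomp-analysis. *)
From mathcomp Require Export -(notations) mpoly.
From mathcomp Require Export all_classical all_reals all_analysis.

Set Implicit Arguments.
Unset Strict Implicit.
Unset Printing Implicit Defensive.

Import Order.TTheory GRing.Theory Num.Theory.
Import numFieldTopology.Exports numFieldNormedType.Exports.

Local Open Scope classical_set_scope.
Local Open Scope ring_scope.

(* Every scheme below is integral and separated, and is encoded by its set of
   points together with the local rings, all embedded in one ambient field.  The
   stalks of the invertible sheaves considered embed in the same field, and a
   global section is an element of the field that lies in every stalk. *)

Section SubringsOfAField.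
Variable F : fieldType.
Implicit Types (A B I J : set F).

Definition is_ideal A I : Prop :=
  [/\ I `<=` A, I 0, (forall x y, I x -> I y -> I (x + y)) &
      (forall a x, A a -> I x -> I (a * x))].

Definition is_prime A I : Prop :=
  [/\ is_ideal A I, ~ I 1 &
      (forall x y, A x -> A y -> I (x * y) -> I x \/ I y)].

Definition is_maximal A I : Prop :=
  [/\ is_ideal A I, ~ I 1 &
      (forall J, is_ideal A J -> I `<=` J -> ~ J 1 -> J = I)].

Definition unit_of A (u : F) : Prop := [/\ A u, u != 0 & A u^-1].

Definition nonunits A : set F := [set x | A x /\ ~ unit_of A x].

Definition localization A I : set F :=
  [set z | exists x y, [/\ A x, A y, ~ I y & z = x / y]].

Definition lin_span A B : set F :=
  [set z | exists m (a b : 'I_m -> F),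
     [/\ (forall i, A (a i)), (forall i, B (b i)) & z = \sum_i a i * b i]].

(* The A-module generated by the k-fold products of elements of B. *)
Fixpoint module_pow A B (k : nat) : set F :=
  if k is k'.+1 then
    lin_span A [set z | exists x y, [/\ B x, module_pow A B k' y & z = x * y]]
  else A.

(* [pts] is a set of prime ideals, and r the maximal length of a chain
   c_0 < c_1 < ... < c_r in it. *)
Definition has_krull_dim (pts : set (set F)) (r : nat) : Prop :=
  let chain s (c : nat -> set F) :=
    (forall i, (i <= s)%N -> pts (c i)) /\
    (forall i, (i < s)%N -> c i `<` c i.+1) in
  (exists c, chain r c) /\ (forall s c, chain s c -> (s <= r)%N).

Definition noetherian A : Prop :=
  forall I, is_ideal A I ->
    exists m (g : 'I_m -> F), I = lin_span A (range g).

Definition regular_local_ring A : Prop :=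
  noetherian A /\
  exists r, has_krull_dim (is_prime A) r /\
    exists g : 'I_r -> F, nonunits A = lin_span A (range g).

End SubringsOfAField.

(* Proj of a graded domain G_0 + G_1 + ... given inside a field F.  In the uses
   below the sum of the G_D in F is direct. *)
Section Proj.
Variables (F : fieldType) (G : nat -> set F).

Definition graded_total : set F :=
  [set z | exists m (f : nat -> F),
     (forall i, G i (f i)) /\ z = \sum_(i < m) f i].

Definition proj_points : set (set F) :=
  [set q | [/\ is_prime graded_total q,
     (forall m (f : nat -> F), (forall i, G i (f i)) ->
        q (\sum_(i < m) f i) -> forall i, (i < m)%N -> q (f i)) &
     (exists D f, [/\ (0 < D)%N, G D f & ~ q f])]].

(* The stalk at q of the sheaf O(D). *)
Definition proj_stalk (D : nat) (q : set F) : set F :=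
  [set z | exists e f g, [/\ G (D + e)%N f, G e g, ~ q g & z = f / g]].

Definition proj_local_ring (q : set F) : set F := proj_stalk 0 q.

Definition proj_sections (D : nat) : set F :=
  [set s | forall q, proj_points q -> proj_stalk D q s].

End Proj.

Section NumberField.
Variable K : fieldExtType rat.

Definition ring_of_integers : set K :=
  [set x | integralOver (intr : int -> K) x].

Definition ok_submodule (n : nat) (E : set 'rV[K]_n.+1) : Prop :=
  [/\ E 0, (forall u v, E u -> E v -> E (u + v)) &
      (forall c u, ring_of_integers c -> E u -> E (c *: u))].

(* E is a direct summand of a free module of finite rank: s maps the standard
   basis of O_K^m into E, and iota : E -> O_K^m is a section of the induced
   map. *)
Definition fg_projective (n : nat) (E : set 'rV[K]_n.+1) : Prop :=
  exists m (s : 'I_m -> 'rV[K]_n.+1) (iota : 'rV[K]_n.+1 -> 'I_m -> K),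
    [/\ (forall j, E (s j)),
        (forall u j, E u -> ring_of_integers (iota u j)),
        (forall c u v j, ring_of_integers c -> E u -> E v ->
           iota (c *: u + v) j = c * iota u j + iota v j) &
        (forall u, E u -> u = \sum_j iota u j *: s j)].

(* A finitely generated projective O_K-module E of rank n+1 is torsion free, so
   it embeds in E (x) K, identified with K^(n+1) by the choice of a basis. *)
Definition projective_lattice (n : nat) (E : set 'rV[K]_n.+1) : Prop :=
  [/\ ok_submodule E, fg_projective E &
      (forall v, exists m (c : 'I_m -> K) (u : 'I_m -> 'rV[K]_n.+1),
         (forall i, E (u i)) /\ v = \sum_i c i *: u i)].

End NumberField.

(* The quotient by a prime ideal; mathcomp gives it no unit ring structure. *)
Definition prime_quot (A : comNzRingType) (P : prime_idealr A) : Type :=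
  {ideal_quot P}.

Section PrimeQuotient.
Variables (A : comNzRingType) (P : prime_idealr A).

HB.instance Definition _ := GRing.ComNzRing.on (prime_quot P).

Let quot_unit : {pred prime_quot P} := fun x => `[< exists y, y * x = 1 >].

Let quot_inv (x : prime_quot P) : prime_quot P :=
  if pselect (exists y, y * x = 1) is left h then projT1 (cid h) else x.

Let quot_mulVx : {in quot_unit, left_inverse 1 quot_inv *%R}.
Proof.
move=> x /asboolP h; rewrite /quot_inv; case: pselect => // h'.
exact: projT2 (cid h').
Qed.

Let quot_unitPl (x y : prime_quot P) : y * x = 1 -> quot_unit x.
Proof. by move=> h; apply/asboolP; exists y. Qed.

Let quot_inv_out : {in [predC quot_unit], quot_inv =1 id}.
Proof.
by move=> x /asboolPn h; rewrite /quot_inv; case: pselect.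
Qed.

HB.instance Definition _ := GRing.ComNzRing_hasMulInverse.Build (prime_quot P)
  quot_mulVx quot_unitPl quot_inv_out.

HB.instance Definition _ := GRing.ComUnitRing_isIntegral.Build (prime_quot P)
  (@Quotient.rquot_IdomainAxiom A P).

End PrimeQuotient.

Section ProjectiveVariety.
Variables (K : fieldExtType rat) (n : nat).
Variable P : prime_idealr (mpoly n.+1 K).

(* The ideals of the integral closed subschemes of P^n_K. *)
Definition homogeneous_relevant : Prop :=
  (forall f D, f \in P -> pihomog mdeg D f \in P) /\
  (exists i : 'I_n.+1, mpolyX K (mnm1 i) \notin P).

(* The ambient field: the fractions of homogeneous elements of degree D (resp.
   0) in it are the rational sections of O(D) (resp. the functions) on X. *)
Definition hfield : fieldType := {fraction (prime_quot P)}.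

Definition hclass (f : mpoly n.+1 K) : hfield :=
  @FracField.tofrac (prime_quot P) (\pi_({ideal_quot P}) f)%qT.

Definition hconst (c : K) : hfield := hclass (mpolyC n.+1 c).

Definition hlinear (u : 'rV[K]_n.+1) : hfield :=
  hclass (\sum_i u ord0 i *: mpolyX K (mnm1 i)).

(* X is Proj of X_ring. *)
Definition X_ring (D : nat) : set hfield :=
  module_pow (range hconst) (range hlinear) D.

(* The Zariski closure of X in P(E) is Proj of the image of Sym(E). *)
Definition closure_ring (E : set 'rV[K]_n.+1) (D : nat) : set hfield :=
  module_pow (hconst @` @ring_of_integers K) (hlinear @` E) D.

Definition dimK (R : realType) (V : set hfield) : \bar R :=
  ereal_sup [set x | exists r : nat, x = (r%:R)%:E /\
    exists e : 'I_r -> hfield, (forall i, V (e i)) /\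
      (forall c : 'I_r -> K,
         \sum_i hconst (c i) * e i = 0 -> forall i, c i = 0)].

Definition has_dimension (d : nat) : Prop :=
  has_krull_dim (proj_points X_ring) d.

(* d! times the leading coefficient of the Hilbert polynomial, where d is the
   dimension of X. *)
Definition has_degree (R : realType) (d delta : nat) : Prop :=
  exists h : {poly rat},
    (exists N : nat, forall D : nat, (N <= D)%N ->
       dimK R (X_ring D) = (ratr h.[D%:R])%:E) /\
    delta%:R = d`!%:R * lead_coef h.

(* F_D: the union of all saturated submodules with the prescribed generic fibre;
   it is itself one of them, hence the largest. *)
Definition saturated_model (E : set 'rV[K]_n.+1) (D : nat)
    (M : set hfield) : Prop :=
  let OK := hconst @` @ring_of_integers K in
  let H0 := proj_sections (closure_ring E) D in
  [/\ M `<=` H0,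
      [/\ M 0, (forall x y, M x -> M y -> M (x + y)) &
          (forall c x, OK c -> M x -> M (c * x))],
      (forall c x, OK c -> c != 0 -> H0 x -> M (c * x) -> M x) &
      lin_span (range hconst) M =
      lin_span (range hconst) (closure_ring E D)].

Definition F_module (E : set 'rV[K]_n.+1) (D : nat) : set hfield :=
  \bigcup_(M in saturated_model E D) M.

(* A rational point eta of P(E_K), i.e. a rank-one quotient of K^(n+1), is given
   by a nonzero linear form eta, up to a scalar. *)
Definition rational_point (eta : 'I_n.+1 -> K) : Prop :=
  (exists i, eta i != 0) /\ (forall f, f \in P -> meval eta f = 0).

(* The rational function z is regular at eta, with value c. *)
Definition value_at (eta : 'I_n.+1 -> K) (z : hfield) (c : K) : Prop :=
  exists e f g, [/\ f \is ishomog1 e mdeg, g \is ishomog1 e mdeg,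
    meval eta g != 0, z = hclass f / hclass g &
    c = meval eta f / meval eta g].

Section AtAPrime.
Variables (E : set 'rV[K]_n.+1) (p : set K) (eta : 'I_n.+1 -> K).
Variable xi : set hfield.

Local Notation OX := (proj_local_ring (closure_ring E) xi).
Local Notation OKp := (localization (@ring_of_integers K) p).

(* The point xi lies over p and has residue field O_K / p. *)
Definition residue_rational : Prop :=
  (forall c, ring_of_integers c -> (xi (hconst c) <-> p c)) /\
  (forall z, OX z -> exists2 c, ring_of_integers c & nonunits OX (z - hconst c)).

(* A morphism Spec O_(K,p) -> closure of X extending eta and mapping the closed
   point to xi is a local homomorphism OX -> O_(K,p) extending to evaluation at
   eta; by properness it is the restriction of Spec O_K -> closure of X. *)
Definition reduces_to : Prop :=
  forall z, OX z -> exists c,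
    [/\ value_at eta z c, OKp c & (nonunits OX z -> nonunits OKp c)].

Definition eval_kernel : set hfield := [set z | OX z /\ value_at eta z 0].

Definition eval_local_ring : set hfield := localization OX eval_kernel.

Definition eval_max_ideal : set hfield := lin_span eval_local_ring eval_kernel.

(* t generates the stalk of O(D) at xi. *)
Definition trivializes (D : nat) (t : hfield) : Prop :=
  proj_stalk (closure_ring E) D xi = [set t * z | z in OX].

Definition localized_F (D : nat) (t : hfield) : set hfield :=
  [set s / t | s in lin_span (hconst @` OKp) (F_module E D)].

Definition R_xi (R : realType) (D : nat) (t : hfield) : \bar R :=
  (\sum_(1 <= k <oo)
     dimK R (lin_span (range hconst)
       (localized_F D t `&` module_pow eval_local_ring eval_max_ideal k)))%E.

End AtAPrime.

Section BlowUp.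
Variable eta : 'I_n.+1 -> K.

Local Notation OX x := (proj_local_ring X_ring x).

(* The stalk at x of the ideal sheaf of eta. *)
Definition eta_ideal (x : set hfield) : set hfield :=
  [set z | exists e f g, [/\ f \is ishomog1 e mdeg, g \is ishomog1 e mdeg,
     meval eta f = 0, ~ x (hclass g) & z = hclass f / hclass g]].

(* The ring OX[I/i], I being the ideal of eta at x: a standard chart of
   Proj (OX + I + I^2 + ...). *)
Definition blowup_chart (x : set hfield) (i : hfield) : set hfield :=
  [set z | exists k, module_pow (OX x) (eta_ideal x) k (z * i ^+ k)].

(* T is the local ring of a point of the blow-up lying above x. *)
Definition blowup_over (x T : set hfield) : Prop :=
  proj_points X_ring x /\
  exists i r, [/\ eta_ideal x i, i != 0, is_prime (blowup_chart x i) r,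
    r `&` OX x = nonunits (OX x) & T = localization (blowup_chart x i) r].

Definition blowup : set (set hfield) :=
  [set T | exists x, blowup_over x T].

(* A Cartier divisor on the blow-up is given by the set of its local equations
   at each point. *)
Definition divisor : Type := set hfield -> set hfield.

Definition div_comb (k : nat) (L : 'I_k -> divisor) (a : 'I_k -> int) : divisor :=
  fun T => [set w | exists f : 'I_k -> hfield,
    (forall i, L i T (f i)) /\ w = \prod_i f i ^ a i].

(* H^0 of O(L).  The blow-up is empty when X is the point eta, and then H^0
   vanishes. *)
Definition div_sections (L : divisor) : set hfield :=
  [set s | s = 0 \/
    (blowup !=set0 /\ forall T f, blowup T -> L T f -> T (s * f))].

Section Volume.
Variables (R : realType) (d : nat).

Definition vol_int (k : nat) (L : 'I_k -> divisor) (a : 'I_k -> int) : \bar R :=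
  limn_esup (fun D : nat =>
    dimK R (div_sections (div_comb L (fun i => (D%:Z * a i)%R)))
      * (d`!%:R / D%:R ^+ d)%:E)%E.

(* The volume is homogeneous of degree d: clear denominators. *)
Definition vol_rat (k : nat) (L : 'I_k -> divisor) (a : 'I_k -> rat) : \bar R :=
  let N : int := \prod_i denq (a i) in
  (vol_int L (fun i => numq (N%:~R * a i)) * ((N%:~R ^+ d)^-1)%:E)%E.

Definition rat_nbhs (k : nat) (c : 'I_k -> R) : set_system ('I_k -> rat) :=
  [set A | exists2 eps : R, 0 < eps &
     forall a, (forall i, `|ratr (a i) - c i| < eps) -> A a].

(* The continuous extension to R-divisors. *)
Definition vol_real (k : nat) (L : 'I_k -> divisor) (c : 'I_k -> R) : \bar R :=
  lim (fmap (vol_rat L) (rat_nbhs c)).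

End Volume.

Definition exceptional_divisor : divisor :=
  fun T => [set e | e != 0 /\ exists x, blowup_over x T /\
    lin_span T (eta_ideal x) = [set e * t | t in T]].

Definition hyperplane_section (l : 'rV[K]_n.+1) (x : set hfield) : set hfield :=
  [set h | exists u l', [/\ unit_of (OX x) u, X_ring 1 l', ~ x l' &
     h = u * (hlinear l / l')]].

Definition hyperplane_pullback (l : 'rV[K]_n.+1) : divisor :=
  fun T => [set w | exists x h u, [/\ blowup_over x T,
    hyperplane_section l x h, unit_of T u & w = u * h]].

(* The integral of vol(pi^* H - lambda E) over lambda >= 0. *)
Definition I_X (R : realType) (d : nat) (l : 'rV[K]_n.+1) : \bar R :=
  (\int[@lebesgue_measure R]_(lambda in `[0%R, +oo[)
     vol_real d
       (fun i : 'I_2 => if i == ord0 then hyperplane_pullback l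
                        else exceptional_divisor)
       (fun i : 'I_2 => if i == ord0 then 1%R else (- lambda)%R))%E.

End BlowUp.
End ProjectiveVariety.

Arguments closure_ring {K n} P E D _ : rename.
Arguments hlinear {K n} P u.

(* Main.v *)
(** A linear projection adapted to [eta] (Noether normalization) makes the
    homogeneous coordinate ring of X generically finite of degree delta over a
    polynomial ring, so its graded pieces are squeezed between binomials and m = d,
    e = delta.  Regularity at [xi] gives d parameters at [eta], hence a valuation of
    the local ring at [eta] with values in N^d: the leading exponent in graded
    lexicographic order, whose degree is the order of vanishing.  The dimension of
    the sections of degree D vanishing to order k is then the number of values of
    degree at least k, and sumset inequalities for these sets of values give, with
    constants depending only on d and delta, the comparison of the counts for D with
    the limits that define the volumes on the blow-up. *)
Require Import Defs.
From HB Require Import structures.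
From mathcomp Require Import perm zify ring lra measurable_realfun.

Set Implicit Arguments.
Unset Strict Implicit.
Unset Printing Implicit Defensive.

Import Order.TTheory GRing.Theory Num.Theory.
Local Open Scope classical_set_scope.
Local Open Scope ring_scope.

Module Sumset.

(** * Sumsets of finite sets of lattice points *)

Section Sumsets.
Local Open Scope nat_scope.

(** The constant may depend on $d$ and $\delta$ only, and this shapes everything. A Noether
    normalization brings along a common denominator of degree [c0] and a threshold [N] over which
    there is no control. They enter upper bounds only and are removed by passing from degree $D$ to
    $jD$ with $j\to\infty$; the lower bound of the Hilbert function is made uniform by taking the
    independent elements in degrees less than [e]. An upper bound for the number of values of degree
    at least $k$ does not come from sumsets directly: it results by subtraction, from a lower bound
    for the values of degree less than $k$ and the known total. On the blow-up, products of $j$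
    sections of $Q\pi^*H-kE$ are controlled only in degree $N+jQ$, and again $j\to\infty$ removes
    $N$. Regularity is given at [xi], in an unknown dimension $r$: a uniformizer of $\mathcal
    O_{K,\mathfrak p}$ accounts for one parameter, the other $r-1\le d$ generate the maximal ideal
    at [eta]. Their monomials are shown independent by comparing dimensions of truncations with
    those for the normalizing coordinates. *)

Definition addv (s t : seq nat) : seq nat := [seq p.1 + p.2 | p <- zip s t].

Fixpoint jsum (d : nat) (A : seq nat -> Prop) (j : nat) (s : seq nat) : Prop :=
  if j is j'.+1 then
    exists a s', [/\ A a, jsum d A j' s' & s = addv a s']
  else s = nseq d 0.

Lemma jsum_sub d (A A' : seq nat -> Prop) j s :
  (forall x, A x -> A' x) -> jsum d A j s -> jsum d A' j s.
Proof.
move=> AA'; elim: j s => //= j IH s [a [s' [Aa /IH Hs' ->]]].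
by exists a, s'; split=> //; apply: AA'.
Qed.

(** The translates $\min X+Y$ and $X+\max Y$ lie on the two sides of $\min X+\max Y$, so this is
    their only common element. *)
Lemma sumset_nat (X Y : seq nat) : uniq X -> uniq Y -> 0 < size X -> 0 < size Y ->
  exists L, [/\ uniq L, size L = (size X + size Y).-1 &
    forall z, z \in L -> exists x y, [/\ x \in X, y \in Y & z = x + y]].
Proof.
move=> uX uY sX sY.
have [x0 x0X x0m] : exists2 x0, x0 \in X & forall x, x \in X -> x0 <= x.
  have h : exists n, n \in X by case: X sX {uX} => // x s _; exists x; rewrite mem_head.
  by exists (ex_minn h); case: ex_minnP => // m mX mm x /mm.
have [y0 y0Y y0m] : exists2 y0, y0 \in Y & forall y, y \in Y -> y <= y0.
  have h : exists n, n \in Y by case: Y sY {uY} => // x s _; exists x; rewrite mem_head.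
  have hb : forall y, y \in Y -> y <= sumn Y.
    elim: (Y) => //= a s IH y; rewrite inE => /orP[/eqP ->|/IH]; lia.
  by exists (ex_maxn h hb); case: ex_maxnP => // m mX mm x /mm.
exists ([seq x0 + y | y <- Y] ++ [seq x + y0 | x <- rem x0 X]); split.
- rewrite cat_uniq !map_inj_uniq ?uY ?rem_uniq //; last 2 first.
  + by move=> a b /addIn.
  + by move=> a b /addnI.
  rewrite andbT /=; apply/hasPn => z /mapP[x]; rewrite mem_rem_uniq // inE => /andP[xx0 xX] ->.
  apply/negP => /mapP[y yY] E; have := x0m _ xX; have := y0m _ yY; move: xx0 => /= /eqP xx0 h1 h2; apply: xx0; lia.
- rewrite size_cat !size_map size_rem //.
  by move: sX; case: (size X) => // a _; rewrite addnC addSn.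
- move=> z; rewrite mem_cat => /orP[/mapP[y yY ->]|/mapP[x xX ->]].
    by exists x0, y.
  by exists x, y0; split=> //; apply: mem_rem xX.
Qed.

Lemma size_fibers (T T' : eqType) (f : T -> T') (W : seq T) :
  size W = \sum_(X <- undup (map f W)) size [seq w <- W | f w == X].
Proof.
under eq_bigr do rewrite size_filter -sum1_count.
rewrite -sum1_size (exchange_big_dep xpredT) //=.
rewrite big_seq [RHS]big_seq; apply: eq_bigr => w wW.
rewrite sum1_count -(eq_count (a1 := pred1 (f w))); last first.
  by move=> x /=; rewrite eq_sym.
by rewrite count_uniq_mem ?undup_uniq // mem_undup map_f.
Qed.

Lemma sum_levels (I : eqType) (s : seq I) (c : I -> nat) (N : nat) :
  (forall x, x \in s -> c x <= N) ->
  \sum_(x <- s) c x = \sum_(t < N) size [seq x <- s | t < c x].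
Proof.
move=> h; under [RHS]eq_bigr do rewrite size_filter -sum1_count.
rewrite (exchange_big_dep xpredT) //= big_seq [RHS]big_seq; apply: eq_bigr => x /h xN.
by rewrite (big_ord_narrow xN) /= sum1_card card_ord.
Qed.

Lemma jsum_fiber d (A : seq nat -> Prop) (fib : seq nat -> seq nat) t j X :
  (forall x, uniq (fib x)) -> (forall h x, h \in fib x -> A (h :: x)) ->
  jsum d (fun x => t < size (fib x)) j X ->
  exists L, [/\ uniq L, size L >= (j * t).+1 &
    forall h, h \in L -> jsum d.+1 A j (h :: X)].
Proof.
move=> uf fA; elim: j X => [|j IH] X /=.
  by move=> ->; exists [:: 0]; split=> // h; rewrite inE => /eqP ->.
move=> [a [s [ta /IH [L [uL sL hL]] ->]]].
have ta' : t < size (fib a) by [].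
have [||M [uM sM hM]] := sumset_nat (uf a) uL; [by apply: leq_trans ta'|by apply: leq_trans sL|].
exists M; split=> //.
  by rewrite sM mulSn -(ltn_predK ta') addSn /= -addnS leq_add // -ltnS (ltn_predK ta').
move=> h /hM [x [y [xa yL ->]]]; exists (x :: a), (y :: s); split=> //; auto.
Qed.

(** A discrete form of $\mathrm{vol}(jA)\ge j^d\,\mathrm{vol}(A)$ with a boundary term, for sets
    without any convexity. The set is sliced along its first coordinate, and the induction is
    applied to the projected points whose fibre has more than a given number of elements. *)
Lemma sumset_card d M j (A W : seq (seq nat)) : 0 < j -> uniq A ->
  (forall a, a \in A -> size a = d /\ all (geq M) a) ->
  uniq W -> (forall s, jsum d (fun a => a \in A) j s -> s \in W) ->
  j ^ d * size A <= size W + j ^ d * (d * M.+1 ^ d.-1).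
Proof.
move=> j0; elim: d A W => [|d IH] A W uA hA uW hW.
  rewrite !expn0 !mul1n mul0n addn0.
  have sA : size A <= 1.
    apply: (@uniq_leq_size _ A [:: [::]]) => // a /hA [sz _].
    by rewrite inE; case: a sz.
  case: A sA uA hA hW => // a [|//] _ _ hA hW; rewrite /= in hA *.
  have a0 : a = [::] by have [] := hA a (mem_head _ _); case: a {hA hW}.
  have : [::] \in W.
    apply: hW; rewrite a0; elim: j {j0 hA} => //= j IH.
    by exists [::], [::]; split.
  by case: (W).
pose fib x := [seq h <- iota 0 M.+1 | (h :: x) \in A].
have ufib x : uniq (fib x) by rewrite filter_uniq ?iota_uniq.
have fibA h x : h \in fib x -> (h :: x) \in A by rewrite mem_filter => /andP[].
have sfib x : size (fib x) <= M.+1.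
  by rewrite size_filter (leq_trans (count_size _ _)) ?size_iota.
have jf t i Y := @jsum_fiber d (fun a => a \in A) fib t i Y ufib fibA.
pose T := undup (map behead A).
have sA : size A = \sum_(x <- T) size (fib x).
  rewrite (size_fibers behead); apply: eq_bigr => x _.
  rewrite -(size_map (head 0)); apply/perm_size/uniq_perm => //.
    rewrite map_inj_in_uniq ?filter_uniq //.
    move=> a b; rewrite !mem_filter => /andP[/eqP ba /hA[sa _]] /andP[/eqP bb /hA[sb _]].
    by case: a b sa sb ba bb => [|a a'] [|b b'] //= _ _ -> -> ->.
  move=> h; rewrite mem_filter mem_iota; apply/mapP/idP.
    move=> [a]; rewrite mem_filter => /andP[/eqP ba aA] ->.
    have [sa] := hA _ aA; case: a sa ba aA => //= a a' _ -> aA /andP[aM _].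
    by rewrite aA /=; lia.
  move=> /andP[hx hM]; exists (h :: x) => //.
  by rewrite mem_filter hx /= eqxx.
(* Superlevel sets of the fibre size; the sum of their cardinalities is $|A|$. Level 0 is estimated
   trivially by $(M+1)^d$, all others by induction. *)
pose Bt t := [seq x <- T | t < size (fib x)].
have sAt : size A = \sum_(t < M.+1) size (Bt t) by rewrite sA (@sum_levels _ _ _ M.+1).
pose T' := undup (map behead W).
pose Wt t := [seq X <- T' | `[< jsum d (fun x => t < size (fib x)) j X >]].
have WtW (t : 'I_M) X : X \in Wt t.+1 -> (j * t.+1).+1 <= size [seq w <- W | behead w == X].
  rewrite mem_filter => /andP[/asboolP /jf [L [uL sL hL]] _].
  apply: leq_trans sL _; rewrite -(size_map (cons^~ X)); apply: uniq_leq_size.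
    by rewrite map_inj_uniq // => a b [].
  by move=> w /mapP[h /hL /hW hXW ->]; rewrite mem_filter hXW /= eqxx.
have key : \sum_(t < M) j * size (Wt t.+1) <= size W.
  rewrite (size_fibers behead) -/T'.
  under [leqLHS]eq_bigr do rewrite size_filter -sum1_count big_distrr /=.
  rewrite (exchange_big_dep xpredT) //= big_seq [leqRHS]big_seq; apply: leq_sum => X XT.
  have [/existsP[t0 Ht0]|/existsPn hn] := boolP [exists t : 'I_M, X \in Wt t.+1]; last first.
    rewrite big1 // => t; have := hn t; rewrite mem_filter XT andbT => /negbTE.
    by move=> ->.
  (* The largest admissible [t1] alone forces more than $j(t_1+1)$ elements of [W] above [X], while
     at most $t_1+1$ summands, each equal to [j], are nonzero. *)
  have [t1 Ht1 t1max] := @arg_maxnP _ t0 (fun t : 'I_M => X \in Wt t.+1) (fun t : 'I_M => t) Ht0.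
  apply: leq_trans (WtW _ _ Ht1).
  under eq_bigr do rewrite muln1.
  rewrite sum_nat_const mulnC leqW // leq_mul2l; apply/orP; right.
  apply: leq_trans (_ : #|[pred t : 'I_M | t < t1.+1]| <= _).
    apply: subset_leq_card; apply/fintype.subsetP => t; rewrite !inE => Ht; rewrite ltnS.
    by apply: t1max; rewrite mem_filter XT andbT; apply/asboolP.
  rewrite -sum1_card (big_ord_narrow (ltn_ord t1)) /= sum1_card card_ord //.
have IHt (t : 'I_M) : j ^ d * size (Bt t.+1) <= size (Wt t.+1) + j ^ d * (d * M.+1 ^ d.-1).
  apply: IH.
  - by rewrite filter_uniq ?undup_uniq.
  - move=> x; rewrite mem_filter mem_undup => /andP[_ /mapP[a /hA[sa aM] ->]].
    by case: a sa aM => //= a a' [->] /andP[_ ->].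
  - by rewrite filter_uniq ?undup_uniq.
  - move=> X HX.
    have HX' : jsum d (fun x => t.+1 < size (fib x)) j X.
      by apply: jsum_sub HX => x; rewrite mem_filter => /andP[].
    rewrite mem_filter; apply/andP; split; first exact/asboolP.
    have [L [_ sL hL]] := jf _ _ _ HX'.
    case: L sL hL => // h L _ /(_ h (mem_head _ _)) /hW hXW.
    by rewrite mem_undup; apply/mapP; exists (h :: X).
have B0 : size (Bt 0) <= M.+1 ^ d.
  have -> : M.+1 ^ d = size (map (fun t : d.-tuple 'I_M.+1 => map val t) (enum {: d.-tuple 'I_M.+1})).
    by rewrite size_map -cardE card_tuple card_ord.
  apply: uniq_leq_size; first by rewrite filter_uniq ?undup_uniq.
  move=> x; rewrite mem_filter mem_undup => /andP[_ /mapP[a /hA[sa aM] ->]].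
  have {sa aM}[sb bM] : size (behead a) = d /\ all (geq M) (behead a).
    by case: a sa aM => //= a a' [->] /andP[_ ->].
  have st : size (map (fun h : nat => inord h : 'I_M.+1) (behead a)) == d by rewrite size_map; apply/eqP.
  apply/mapP; exists (Tuple st : d.-tuple 'I_M.+1); rewrite ?mem_enum //=.
  rewrite -map_comp -[LHS]map_id; apply/eq_in_map => h /(allP bM) /= hM.
  by rewrite inordK.
have : \sum_(t < M) j * (j ^ d * size (Bt t.+1)) <=
       \sum_(t < M) (j * size (Wt t.+1) + j * (j ^ d * (d * M.+1 ^ d.-1))).
  by apply: leq_sum => t _; rewrite -mulnDr leq_mul2l IHt orbT.
rewrite big_split /= sum_nat_const card_ord => hsum.
rewrite sAt big_ord_recl /= mulnDr big_distrr /= expnS.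
under eq_bigr do rewrite -mulnA.
(* The [M] errors of the induction add up to at most $d(M+1)^d$; the bound for level 0 supplies the
   missing $(M+1)^d$. *)
have e1 : M * (j * (j ^ d * (d * M.+1 ^ d.-1))) <= j * j ^ d * (d * M.+1 ^ d).
  case: d {IH hA hW T jf fib ufib fibA sfib sA Bt sAt T' Wt WtW key IHt B0 hsum} => [|d].
    by rewrite !mul0n !muln0.
  rewrite /= [M.+1 ^ d.+1]expnS; set q := _ ^ d; set p := _ ^ d.+1.
  rewrite (_ : M * _ = (j * p * (d.+1 * q)) * M); last by ring.
  rewrite [leqRHS](_ : _ = (j * p * (d.+1 * q)) * M.+1); last by ring.
  by rewrite leq_mul2l leqnSn orbT.
have e2 : j * j ^ d * size (Bt 0) <= j * j ^ d * M.+1 ^ d by rewrite leq_mul2l B0 orbT.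
have -> : (d.+1 * M.+1 ^ d) = M.+1 ^ d + d * M.+1 ^ d by rewrite mulSn.
rewrite mulnDr.
apply: leq_trans (leq_add e2 hsum) _.
by rewrite addnCA; apply: leq_add => //; apply: leq_add.
Qed.

End Sumsets.

End Sumset.

Module Embedding.
Import Sumset.

(** * Linear algebra over a field embedded in another one *)

Lemma lin_dep (K : fieldType) (I J : finType) (A : I -> J -> K) :
  (#|J| < #|I|)%N ->
  exists2 c : I -> K, (exists i, c i != 0) & forall j, \sum_i c i * A i j = 0.
Proof.
move=> JI; pose M : 'M[K]_(#|I|, #|J|) := \matrix_(i, j) A (enum_val i) (enum_val j).
have : kermx M != 0.
  rewrite kermx_eq0 /row_free neq_ltn; apply/orP; left.
  exact: leq_ltn_trans (rank_leq_col _) JI.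
case/rowV0Pn => v /sub_kermxP vM v0.
exists (fun i => v ord0 (enum_rank i)).
  move/eqP: v0 => v0; apply: contrapT => h; apply: v0; apply/rowP => i; rewrite mxE.
  apply/eqP; apply: contraT => vi; exfalso; apply: h; exists (enum_val i).
  by rewrite enum_valK.
move=> j; have /rowP/(_ (enum_rank j)) := vM; rewrite !mxE => E.
rewrite -[RHS]E (reindex _ (onW_bij _ (@enum_val_bij I))) /=.
by apply: eq_bigr => i _; rewrite enum_valK !mxE enum_rankK.
Qed.

Section Independence.
Variables (K F : fieldType) (io : {rmorphism K -> F}).

(** Dimensions over [K] are handled through the sizes of independent families, without bases: [dimK]
    is the supremum of these sizes. *)
Definition ind (V : set F) (r : nat) : Prop :=
  exists e : 'I_r -> F, (forall i, V (e i)) /\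
    (forall c : 'I_r -> K, \sum_i io (c i) * e i = 0 -> forall i, c i = 0).

Definition ksub (V : set F) : Prop :=
  [/\ V 0, (forall x y, V x -> V y -> V (x + y)) & (forall c x, V x -> V (io c * x))].

Lemma ksub_sum (V : set F) (I : Type) (s : seq I) (P : pred I) (f : I -> F) :
  ksub V -> (forall i, P i -> V (f i)) -> V (\sum_(i <- s | P i) f i).
Proof. by move=> [V0 VD _] h; elim/big_ind: _. Qed.

Lemma ind_sub (V W : set F) r : V `<=` W -> ind V r -> ind W r.
Proof. by move=> VW [e [Ve he]]; exists e; split=> // i; apply: VW. Qed.

Lemma ind_le (V : set F) r s : (s <= r)%N -> ind V r -> ind V s.
Proof.
move=> sr [e [Ve he]]; exists (fun i => e (widen_ord sr i)); split=> // c h i.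
pose c' (j : 'I_r) := if insub (j : nat) is Some k then c k else 0.
have c'w k : c' (widen_ord sr k) = c k by rewrite /c' valK.
rewrite -c'w; apply: he.
rewrite (bigID (fun j : 'I_r => (j < s)%N)) /= [X in _ + X]big1 ?addr0; last first.
  by move=> j js; rewrite /c' insubN // rmorph0 mul0r.
rewrite (big_ord_narrow sr) -[RHS]h; apply: eq_bigr => k _; by rewrite c'w.
Qed.

Lemma ind_fin (V : set F) (I : finType) (e : I -> F) : (forall i, V (e i)) ->
  (forall c : I -> K, \sum_i io (c i) * e i = 0 -> forall i, c i = 0) ->
  ind V #|I|.
Proof.
move=> Ve he; exists (fun i => e (enum_val i)); split=> // c h i.
rewrite -[i]enum_valK; apply: (he (fun i => c (enum_rank i))).
rewrite -[RHS]h (reindex _ (onW_bij _ (@enum_val_bij I))) /=.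
by apply: eq_bigr => j _; rewrite enum_valK.
Qed.

(** [A] plays the role of coordinates of the family. Only one implication is asked of it, from
    vanishing coordinates to a vanishing combination, so no linear map has to be constructed. *)
Lemma ind_bound (V : set F) (J : finType) r :
  (forall e : 'I_r -> F, (forall i, V (e i)) ->
     exists A : 'I_r -> J -> K, forall c : 'I_r -> K,
       (forall j, \sum_i c i * A i j = 0) -> \sum_i io (c i) * e i = 0) ->
  ind V r -> (r <= #|J|)%N.
Proof.
move=> h [e [Ve he]]; rewrite leqNgt; apply/negP => lt.
have [A hA] := h e Ve.
have [|c [i ci] hc] := @lin_dep K 'I_r J A; first by rewrite card_ord.
by move: ci; rewrite (he c (hA c hc) i) eqxx.
Qed.

Lemma ind_scale (V W : set F) (x : F) r : x != 0 -> (forall y, V y -> W (y * x)) ->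
  ind V r -> ind W r.
Proof.
move=> x0 VW [e [Ve he]]; exists (fun i => e i * x); split=> [i|c h]; first exact: VW.
apply: he; apply/eqP; rewrite -(mulIr_eq0 _ (mulIf x0)) mulr_suml; apply/eqP; rewrite -[RHS]h.
by apply: eq_bigr => i _; rewrite mulrA.
Qed.

End Independence.

(** * Monomials *)

Definition mons n d : seq (multinom n) := [seq s2m (val t) | t in mpoly.basis n d].

Lemma mem_mons n d (m : multinom n) : (m \in mons n d) = (mdeg m == d).
Proof. by rewrite basis_cover. Qed.

Lemma size_mons n d : size (mons n.+1 d) = 'C(d + n, d).
Proof. exact: size_basis. Qed.

Lemma mons_uniq n d : uniq (mons n d).
Proof. exact: uniq_basis. Qed.

Lemma bin_bounds D m :
  ((D ^ m <= m`! * 'C(D + m, D)) && (m`! * 'C(D + m, D) <= (D + m) ^ m))%N.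
Proof.
have -> : 'C(D + m, D) = 'C(D + m, m) by rewrite -bin_sub ?leq_addr // addKn.
rewrite mulnC bin_ffact; apply/andP; split; last first.
  elim: m (D + m)%N => //= m IH N; rewrite ffactnS expnS leq_mul //.
  apply: leq_trans (IH _) _; case: m {IH} => // m.
  by rewrite leq_exp2r // leq_pred.
elim: m => [|m IH] //; rewrite addnS ffactSS expnS leq_mul //; lia.
Qed.

Lemma growth M c m : exists X0, forall X, (X0 <= X)%N ->
  (M * (X + c) ^ m < M.+1 * X ^ m)%N.
Proof.
exists (c + (M * 3 ^ m * c)).+1 => X hX.
have X0 : (0 < X)%N by lia.
(* A Bernoulli inequality for $c\le X$: writing $q=3^m$, the product $(X+qc)(X+c)$ exceeds $X^2$ by
   three terms, each at most $qcX$. *)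
have : (X * (X + c) ^ m <= X ^ m * (X + 3 ^ m * c))%N.
  have cX : (c <= X)%N by lia.
  elim: m {hX} => [|m IH]; first by rewrite !expn0; lia.
  rewrite expnSr mulnA; apply: leq_trans (leq_mul IH (leqnn _)) _.
  rewrite [X in (_ <= X * _)%N]expnSr -!mulnA leq_mul2l; apply/orP; right.
  rewrite expnS; set q := (3 ^ m)%N; have q1 : (0 < q)%N by rewrite expn_gt0.
  have h1 : (q * c * c <= q * c * X)%N by rewrite leq_mul2l cX orbT.
  have h2 : (1 * (c * X) <= q * (c * X))%N by rewrite leq_mul2r q1 orbT.
  lia.
move=> h; rewrite -(ltn_pmul2l X0) !mulnA ![(X * _)%N]mulnC -!mulnA.
apply: leq_ltn_trans (leq_mul (leqnn M) h) _.
have Xm : (0 < X ^ m)%N by rewrite expn_gt0 X0.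
set p := (X ^ m)%N in Xm *; set q := (3 ^ m)%N in hX *.
have : (M * (X + q * c) < M.+1 * X)%N by nia.
nia.
Qed.

Lemma digits_inj r b (f g : 'I_r -> nat) :
  (forall i, f i < b)%N -> (forall i, g i < b)%N ->
  (\sum_i f i * b ^ i = \sum_i g i * b ^ i)%N -> f =1 g.
Proof.
elim: r f g => [|r IH] f g fb gb; first by move=> _ [].
rewrite !big_ord_recl /= !muln1.
have E (h : 'I_r.+1 -> nat) : (\sum_(i < r) h (lift ord0 i) * b ^ bump 0 i =
    b * \sum_(i < r) h (lift ord0 i) * b ^ i)%N.
  by rewrite big_distrr /=; apply: eq_bigr => i _; rewrite /bump /= expnS mulnCA.
rewrite !E => h.
have f0g0 : f ord0 = g ord0.
  have := congr1 (modn^~ b) h; rewrite ![(b * _)%N]mulnC.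
  by rewrite ![(_ + _ * b)%N]addnC !modnMDl !modn_small.
move/eqP: h; rewrite f0g0 eqn_add2l eqn_pmul2l; last exact: leq_ltn_trans (gb ord0).
move/eqP/IH => h i; case: (unliftP ord0 i) => [j ->|->] //; apply: h => k; auto.
Qed.

(** Kronecker substitution: at the point $(t^{b^i})_i$, with [b] larger than all exponents, distinct
    monomials become distinct powers of [t]. The resulting polynomial in one variable is nonzero,
    and one of the integers, distinct in [K], is not a root. *)
Lemma meval_neq0 (K : fieldType) r (p : mpoly r K) :
  (forall a b : nat, a%:R = b%:R :> K -> a = b) -> p != 0 ->
  exists c, meval c p != 0.
Proof.
move=> inj p0; pose b := (msize p).+1.
pose W (m : multinom r) := (\sum_i m i * b ^ i)%N.
pose q : {poly K} := \sum_(m <- msupp p) mcoeff m p *: 'X^(W m).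
have Winj m m' : m \in msupp p -> m' \in msupp p -> W m = W m' -> m = m'.
  have hb k : k \in msupp p -> forall i, (k i < b)%N.
    move=> /msize_mdeg_lt kp i; apply: leq_trans (ltnW kp); rewrite mdegE.
    by rewrite (bigD1 i) //= leq_addr.
  by move=> /hb h1 /hb h2 /(digits_inj h1 h2) /mnmP.
have q0 : q != 0.
  apply/eqP => /polyP /(_ (W (mlead p))); rewrite coef0 /q coef_sum.
  rewrite (bigD1_seq (mlead p)) ?mlead_supp ?msupp_uniq //= coefZ coefXn eqxx mulr1.
  rewrite big_seq_cond big1 ?addr0; last first.
    move=> m /andP[mp /eqP mn]; rewrite coefZ coefXn; case: eqP => [|_]; last by rewrite mulr0.
    by move/Winj => h; case: mn; rewrite h ?mlead_supp.
  by apply/eqP; rewrite mleadc_eq0.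
have [t ht] : exists t, ~~ root q t.
  apply: contrapT => h; have := max_poly_roots q0 (rs := [seq i%:R | i <- iota 0 (size q)]).
  rewrite size_map size_iota ltnn map_inj_uniq ?iota_uniq; last exact: inj.
  have -> : all (root q) [seq i%:R | i <- iota 0 (size q)].
    by apply/allP => x _; apply: contraT => hx; exfalso; apply: h; exists x.
  by move=> /(_ isT isT).
exists (fun i : 'I_r => t ^+ (b ^ i)).
move: ht; rewrite /root; congr (_ != 0).
rewrite mevalE horner_sum; apply: eq_bigr => m _; rewrite hornerZ hornerXn; congr (_ * _).
rewrite /W -[LHS]/(t ^+ _) -prodrXr; apply: eq_bigr => i _.
by rewrite -exprM mulnC.
Qed.

End Embedding.

Module Normalization.
Import Sumset Embedding.

(** * Noether normalization of a graded domain generated in degree one *)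

Local Notation homog q := (ishomog1 q mdeg).

Lemma homogX_mon n (R : nzRingType) (m : multinom n) : mpolyX R m \is homog (mdeg m).
Proof. by rewrite dhomogX. Qed.

Lemma homog_sum n (R : nzRingType) (I : Type) (s : seq I) (P : pred I)
    (f : I -> mpoly n R) q :
  (forall i, P i -> f i \is homog q) -> \sum_(i <- s | P i) f i \is homog q.
Proof. by move=> h; apply: rpred_sum => i /h. Qed.

Lemma mdegS_split n D (m : multinom n) : mdeg m = D.+1 ->
  exists i (m' : multinom n), m = mnm_add (mnm1 i) m' /\ mdeg m' = D.
Proof.
move=> hm; have [i mi] : exists i, (0 < m i)%N.
  apply: contrapT => h; have : mdeg m = 0%N.
    rewrite mdegE big1 // => i _; apply/eqP; rewrite -leqn0 leqNgt.
    by apply/negP => mi; apply: h; exists i.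
  by rewrite hm.
exists i, (mnm_sub m (mnm1 i)).
have E : m = mnm_add (mnm1 i) (mnm_sub m (mnm1 i)).
  by rewrite addmC submK // lep1mP -lt0n.
by split=> //; move: hm; rewrite {1}E mdegD mdeg1 add1n => -[].
Qed.

Section GradedDomain.
Variables (K F : fieldType) (io : {rmorphism K -> F}) (n : nat) (X : 'I_n -> F).

Local Notation cl := (mmap io X).

Definition S (D : nat) : set F := [set s | exists2 f, f \is homog D & s = cl f].

Lemma mmap1D r (z : 'I_r -> F) (a b : multinom r) :
  mmap1 z (mnm_add a b) = mmap1 z a * mmap1 z b.
Proof. by rewrite /mmap1 -big_split /=; apply: eq_bigr => i _; rewrite mnmDE exprD. Qed.

Lemma S_ksub D : ksub io (S D).
Proof.
split=> [|x y [f hf ->] [g hg ->]|c x [f hf ->]].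
- by exists 0; rewrite ?dhomog0 // mmap0.
- by exists (f + g); rewrite ?dhomogD // mmapD.
- by exists (c *: f); rewrite ?dhomogZ // mmapZ.
Qed.

Lemma S_0 D : S D 0. Proof. by case: (S_ksub D). Qed.
Lemma S_D D x y : S D x -> S D y -> S D (x + y). Proof. by case: (S_ksub D) => _ + _; apply. Qed.
Lemma S_Z D c x : S D x -> S D (io c * x). Proof. by case: (S_ksub D) => _ _; apply. Qed.

Lemma S_N D x : S D x -> S D (- x).
Proof. by move=> /(S_Z (-1)); rewrite rmorphN1 mulN1r. Qed.

Lemma S_B D x y : S D x -> S D y -> S D (x - y).
Proof. by move=> hx /S_N; apply: S_D. Qed.

Lemma S_sum D (I : Type) (s : seq I) (P : pred I) (f : I -> F) :
  (forall i, P i -> S D (f i)) -> S D (\sum_(i <- s | P i) f i).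
Proof. exact: ksub_sum (S_ksub D). Qed.

Lemma S_M a b x y : S a x -> S b y -> S (a + b) (x * y).
Proof.
by move=> [f hf ->] [g hg ->]; exists (f * g); rewrite ?dhomogM // rmorphM.
Qed.

Lemma S_io c : S 0 (io c).
Proof.
by exists (mpolyC n c); rewrite ?mmapC // -mul_mpolyC mulr1 || rewrite -[mpolyC n c]mulr1 mul_mpolyC dhomogZ // dhomog1.
Qed.

Lemma S_1 : S 0 1. Proof. by rewrite -(rmorph1 io); apply: S_io. Qed.

Lemma S_X i : S 1 (X i).
Proof.
exists (mpolyX K (mnm1 i)); last by rewrite mmapX mmap1U.
by have := homogX_mon K (mnm1 i); rewrite mdeg1.
Qed.

Lemma S_exp a x k : S a x -> S (k * a) (x ^+ k).
Proof.
move=> hx; elim: k => [|k IH]; first by rewrite expr0 mul0n; apply: S_1.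
by rewrite exprS mulSn; apply: S_M.
Qed.

Lemma S_exp1 x k : S 1 x -> S k (x ^+ k).
Proof. by move=> /(S_exp k); rewrite muln1. Qed.

Lemma S_mmap1 r (z : 'I_r -> F) E (m : multinom r) : (forall i, S E (z i)) ->
  S (mdeg m * E) (mmap1 z m).
Proof.
move=> hz; have [q] := ubnP (mdeg m); elim: q m => // q IH m hm.
case D : (mdeg m) => [|k].
  move/eqP: D; rewrite mdeg_eq0 => /eqP ->; rewrite mmap11; exact: S_1.
have [i [m' [-> dm']]] := mdegS_split D.
rewrite mmap1D mmap1U mulSn; apply: S_M => //.
by rewrite -dm'; apply: IH; rewrite dm' -ltnS -D.
Qed.

Lemma S_mmap r (z : 'I_r -> F) E q (p : mpoly r K) : (forall i, S E (z i)) ->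
  p \is homog q -> S (q * E) (mmap io z p).
Proof.
move=> hz hp; rewrite /mmap big_seq; apply: S_sum => m mp; apply: S_Z.
by rewrite -(dhomog_mf hp mp); apply: S_mmap1.
Qed.

Lemma S_mmapl r (z : 'I_r -> F) q (p : mpoly r K) : (forall i, S 1 (z i)) ->
  p \is homog q -> S q (mmap io z p).
Proof. by move=> hz hp; rewrite -[q]muln1; apply: S_mmap. Qed.

Lemma S_0P x : S 0 x -> exists c, x = io c.
Proof.
move=> [f hf ->]; exists (mcoeff mnm0 f).
by rewrite -(mmapC X io) ; congr mmap; apply/mpolyP => m; rewrite mcoeffC; case: eqP => [->|/eqP h];
  rewrite ?mulr1 ?mulr0 //; apply: (dhomog_nemf_coeff hf); rewrite mdeg_eq0.
Qed.

Lemma S_succ D s : S D.+1 s ->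
  exists y : 'I_n -> F, (forall i, S D (y i)) /\ s = \sum_i X i * y i.
Proof.
move=> [f hf ->]; rewrite /mmap big_seq.
elim/big_ind: _ => [|x y [u [hu ->]] [v [hv ->]]|m mf].
- by exists (fun=> 0); split=> [i|]; [exact: S_0|rewrite big1 // => i _; rewrite mulr0].
- exists (fun i => u i + v i); split=> [i|]; first exact: S_D.
  by rewrite -big_split; apply: eq_bigr => i _; rewrite mulrDr.
have [i [m' [-> dm']]] := mdegS_split (dhomog_mf hf mf).
exists (fun j => if j == i then io (mcoeff (mnm_add (mnm1 i) m') f) * mmap1 X m' else 0); split.
  move=> j; case: eqP => _; last exact: S_0.
  by apply: S_Z; rewrite -dm' -[mdeg m']muln1; apply: S_mmap1; apply: S_X.
rewrite (bigD1 i) //= eqxx big1 ?addr0; last by move=> j /negbTE ->; rewrite mulr0.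
by rewrite mmap1D mmap1U mulrCA.
Qed.

(** Finiteness over the subalgebra generated by [z], in the form that the quotient by the ideal of
    the [z i] vanishes in all degrees beyond [N]. *)
Definition finz r (z : 'I_r -> F) : Prop :=
  (forall i, S 1 (z i)) /\ exists N, forall D s, (N <= D)%N -> S D.+1 s ->
    exists y : 'I_r -> F, (forall i, S D (y i)) /\ s = \sum_i z i * y i.

Lemma finz_X : finz X.
Proof. by split; [exact: S_X|exists 0%N => D s _; apply: S_succ]. Qed.

Lemma finz_iso r (z z' : 'I_r -> F) (M : 'I_r -> 'I_r -> K) :
  (forall i, S 1 (z' i)) -> (forall i, z i = \sum_j io (M i j) * z' j) -> finz z -> finz z'.
Proof.
move=> hz' zz' [hz [N hN]]; split=> //; exists N => D s ND sD.
have [y [hy ->]] := hN D s ND sD.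
exists (fun j => \sum_i io (M i j) * y i); split=> [j|].
  by apply: S_sum => i _; apply: S_Z.
under eq_bigr do rewrite zz' mulr_suml.
rewrite exchange_big /=; apply: eq_bigr => j _; rewrite mulr_sumr.
by apply: eq_bigr => i _; rewrite mulrAC mulrC mulrA.
Qed.

(** Modulo the forms $z_i-c_iw$ every $z_i$ becomes $c_iw$, and a monomial becomes its value at [c]
    times a power of [w]. The index [k] may be left out since $z_k=c_kw$. *)
Lemma mmap1_congr r (z : 'I_r -> F) (c : 'I_r -> K) (k : 'I_r) (w : F) :
  S 1 w -> (forall i, S 1 (z i)) -> z k = io (c k) * w ->
  forall q (m : multinom r), mdeg m = q.+1 ->
  exists y : 'I_r -> F, (forall i, S q (y i)) /\
    mmap1 z m - io (\prod_i c i ^+ m i) * w ^+ q.+1 =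
    \sum_(i | i != k) (z i - io (c i) * w) * y i.
Proof.
move=> hw hz zk; elim=> [|q IH] m hm.
  have [i [m' [-> dm']]] := mdegS_split hm.
  move/eqP: dm'; rewrite mdeg_eq0 => /eqP ->; rewrite addm0 mmap1U.
  have -> : \prod_j c j ^+ mnm1 i j = c i.
    rewrite (bigD1 i) //= mnm1E eqxx expr1 big1 ?mulr1 // => j ji.
    by rewrite mnm1E eq_sym (negbTE ji) expr0.
  exists (fun j => (j == i)%:R); split=> [j|]; first by rewrite -(rmorph_nat io); apply: S_io.
  have [->|ik] := eqVneq i k.
    by rewrite zk subrr big1 // => j /negbTE ->; rewrite mulr0.
  by rewrite (bigD1 i) //= eqxx mulr1 big1 ?addr0 // => j /andP[_ /negbTE ->]; rewrite mulr0.
have [i [m' [-> dm']]] := mdegS_split hm.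
have [y [hy E]] := IH _ dm'.
have -> : \prod_j c j ^+ mnm_add (mnm1 i) m' j = c i * \prod_j c j ^+ m' j.
  under eq_bigr do rewrite mnmDE exprD.
  rewrite big_split /=; congr (_ * _).
  rewrite (bigD1 i) //= mnm1E eqxx expr1 big1 ?mulr1 // => j ji.
  by rewrite mnm1E eq_sym (negbTE ji) expr0.
set P := \prod_j c j ^+ m' j in E *.
exists (fun j => z i * y j + (if j == i then io P * w ^+ q.+1 else 0)); split.
  move=> j; apply: S_D; first by rewrite -add1n; apply: S_M.
  by case: eqP => _; [apply: S_Z; apply: S_exp1|exact: S_0].
rewrite mmap1D mmap1U rmorphM.
have -> : z i * mmap1 z m' - io (c i) * io P * w ^+ q.+2 =
   z i * (mmap1 z m' - io P * w ^+ q.+1) + (z i - io (c i) * w) * (io P * w ^+ q.+1).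
  by rewrite exprS; ring.
rewrite E mulr_sumr; under [RHS]eq_bigr do rewrite mulrDr.
rewrite [RHS]big_split /=; congr (_ + _).
  by apply: eq_bigr => j _; rewrite mulrCA.
have [->|ik] := eqVneq i k.
  by rewrite zk subrr mul0r big1 // => j /negbTE ->; rewrite mulr0.
by rewrite (bigD1 i) //= eqxx big1 ?addr0 // => j /andP[_ /negbTE ->]; rewrite mulr0.
Qed.

Hypothesis charK : forall a b : nat, a%:R = b%:R :> K -> a = b.

Lemma noether_step r (z : 'I_r.+1 -> F) e (p : mpoly r.+1 K) :
  finz z -> p \is homog e -> p != 0 -> mmap io z p = 0 -> exists z' : 'I_r -> F, finz z'.
Proof.
move=> [hz [N0 hN0]] hp p0 zp.
have [c hc] := meval_neq0 charK p0.
have mevalh (v : 'I_r.+1 -> K) : meval v p = \sum_(m <- msupp p) mcoeff m p * \prod_i v i ^+ m i.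
  by rewrite mevalE.
case: e hp => [|e] hp.
  have [t pt] : exists t, p = mpolyC r.+1 t.
    exists (mcoeff mnm0 p); apply/mpolyP => m; rewrite mcoeffC; case: eqP => [->|/eqP h];
    rewrite ?mulr1 ?mulr0 //; apply: (dhomog_nemf_coeff hp); by rewrite mdeg_eq0.
  move: zp hc; rewrite pt mmapC mevalC => /eqP; rewrite fmorph_eq0 => /eqP ->.
  by rewrite eqxx.
have [k ck] : exists k, c k != 0.
  apply: contrapT => h; move: hc; rewrite mevalh big_seq big1 ?eqxx // => m mp.
  have [i [m' [E _]]] := mdegS_split (dhomog_mf hp mp).
  have -> : c = fun=> 0.
    apply/funext => j; apply/eqP; apply: contraT => cj; exfalso; apply: h; by exists j.
  rewrite (bigD1 i) //= E mnmDE mnm1E eqxx add1n expr0n /= mul0r mulr0 //.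
pose w := z k / io (c k).
have ick : io (c k) != 0 by rewrite fmorph_eq0.
have hw : S 1 w by rewrite /w -fmorphV mulrC; apply: S_Z.
have zk : z k = io (c k) * w by rewrite /w mulrC divfK.
pose z' (i : 'I_r) := z (lift k i) - io (c (lift k i)) * w.
have hz' i : S 1 (z' i) by apply: S_B => //; apply: S_Z.
pose II D : set F := [set s | exists y : 'I_r -> F, (forall i, S D (y i)) /\ s = \sum_i z' i * y i].
have II0 D : II D 0.
  by exists (fun=> 0); split=> [i|]; [exact: S_0|rewrite big1 // => i _; rewrite mulr0].
have IID D x y : II D x -> II D y -> II D (x + y).
  move=> [u [hu ->]] [v [hv ->]]; exists (fun i => u i + v i); split=> [i|]; first exact: S_D.
  by rewrite -big_split; apply: eq_bigr => i _; rewrite mulrDr.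
have IIM D a x s : S a s -> II D x -> II (a + D)%N (s * x).
  move=> hs [u [hu ->]]; exists (fun i => s * u i); split=> [i|]; first exact: S_M.
  by rewrite mulr_sumr; apply: eq_bigr => i _; rewrite mulrCA.
have IIz D (i : 'I_r.+1) y : i != k -> S D y -> II D ((z i - io (c i) * w) * y).
  move=> ik hy; have [j Ej] : exists j, i = lift k j.
    by case: (unliftP k i) ik => [j ->|->]; [exists j|rewrite eqxx].
  exists (fun l => if l == j then y else 0); split=> [l|]; first by case: eqP => // _; apply: S_0.
  rewrite (bigD1 j) //= eqxx big1 ?addr0; first by rewrite /z' -Ej.
  by move=> l /negbTE ->; rewrite mulr0.
have IIsum D (I : Type) (s : seq I) (P : pred I) (f : I -> F) :
    (forall i, P i -> II D (f i)) -> II D (\sum_(i <- s | P i) f i).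
  by move=> h; elim/big_ind: _ => // *; apply: (IID).
have wII : II e (w ^+ e.+1).
  have : II e (mmap io z p - io (meval c p) * w ^+ e.+1).
    rewrite mevalh rmorph_sum mulr_suml /mmap -sumrB big_seq; apply: (IIsum) => m mp.
    rewrite rmorphM -mulrA -mulrBr.
    have [y [hy ->]] := mmap1_congr hw hz zk (dhomog_mf hp mp).
    rewrite -[e]add0n; apply: (IIM); first exact: S_io.
    by apply: (IIsum) => i ik; apply: (IIz).
  rewrite zp sub0r => h.
  have -> : w ^+ e.+1 = io (- (meval c p)^-1) * - (io (meval c p) * w ^+ e.+1).
    rewrite mulrN -mulNr rmorphN opprK mulrA -rmorphM mulVf // rmorph1 mul1r //.
  by rewrite -[e in II e]add0n; apply: (IIM) => //; apply: S_io.
exists z'; split=> //.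
pose N := N0.
(* Each further degree extracts one more factor [w]. Once the exponent reaches $e+1$, the second
   term lies in the ideal as well, by [wII]. *)
have split_q q : forall s, S (N + q).+1 s -> exists t y, [/\ II (N + q)%N t, S N y & s = t + w ^+ q.+1 * y].
  elim: q => [|q IH] s hs; rewrite ?addn0 in hs *.
    have [y [hy ->]] := hN0 _ _ (leqnn _) hs.
    exists (\sum_i (if i == k then 0 else (z i - io (c i) * w) * y i)), (\sum_i io (c i) * y i); split.
    - by apply: (IIsum) => i _; case: eqVneq => [_|ik]; [exact: II0|apply: (IIz)].
    - by apply: S_sum => i _; apply: S_Z.
    rewrite expr1 mulr_sumr -big_split; apply: eq_bigr => i _.
    by case: eqVneq => [->|_]; rewrite ?zk /=; ring.
  have [y [hy ->]] := hN0 _ _ (leq_trans (leq_addr q.+1 N) (leqnn _)) hs.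
  have /choice [t /choice [x htx]] i := IH (y i) (ltac:(rewrite -addnS; exact: hy)).
  exists (\sum_i (z i * t i + (if i == k then 0 else (z i - io (c i) * w) * (w ^+ q.+1 * x i)))),
    (\sum_i io (c i) * x i); split.
  - apply: (IIsum) => i _; have [h1 h2 _] := htx i; apply: (IID).
      by rewrite addnS -add1n; apply: (IIM).
    case: eqVneq => [_|ik]; first exact: II0.
    by apply: (IIz) => //; rewrite addnC; apply: S_M => //; apply: S_exp1.
  - by apply: S_sum => i _; have [h1 h2 _] := htx i; apply: S_Z.
  rewrite mulr_sumr -big_split; apply: eq_bigr => i _.
  have [_ _ ->] := htx i.
  by case: eqVneq => [->|_]; rewrite ?zk [w ^+ q.+2]exprS /=; ring.
exists (N + e)%N => D s ND hs.
have ED : D = (N + (D - N))%N by lia.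
rewrite ED in hs *.
have [t [y [ht hy ->]]] := split_q _ _ hs.
apply: (IID) => //.
have -> : (D - N).+1 = (e.+1 + (D - N - e))%N by lia.
rewrite exprD -mulrA mulrC.
have -> : (N + (D - N) = (D - N - e + N) + e)%N by lia.
by apply: (IIM) => //; apply: S_M => //; apply: S_exp1.
Qed.

Definition zfree r (z : 'I_r -> F) :=
  forall q p, p \is homog q -> mmap io z p = 0 -> p = 0.

(** The number [r] is minimal, so a relation would contradict [noether_step]. Freeness is asserted
    for every finite family of this length because the coordinates are changed linearly later on. *)
Lemma noether_normalization :
  exists r (z : 'I_r -> F), finz z /\ forall z' : 'I_r -> F, finz z' -> zfree z'.
Proof.
have ex : exists r, `[< exists z : 'I_r -> F, finz z >].
  by exists n; apply/asboolP; exists X; exact: finz_X.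
case: (ex_minnP ex) => r /asboolP [z hz] rmin; exists r, z; split=> // z' hz' q p hp zp.
apply/eqP; apply: contraT => p0; case: r rmin z hz z' hz' p hp zp p0 => [|r] rmin z hz z' hz' p hp zp p0.
  have E : p = mpolyC 0 (mcoeff mnm0 p) by exact: nvar0_mpolyC.
  move: zp p0; rewrite E mmapC => /eqP; rewrite fmorph_eq0 => /eqP ->.
  by rewrite mpolyC0 eqxx.
have [z'' hz''] := noether_step hz' hp p0 zp.
suff /rmin : `[< exists z : 'I_r -> F, finz z >] by rewrite ltnn.
by apply/asboolP; exists z''.
Qed.

End GradedDomain.

End Normalization.

(** * Rank and Hilbert function over the polynomial ring of a normalization *)

Module Coordinates.
Import Sumset Embedding Normalization.

Local Notation homog q := (ishomog1 q mdeg).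

Lemma homog_mons (R : comNzRingType) r q (f : mpoly r R) : f \is homog q ->
  f = \sum_(m <- mons r q) mcoeff m f *: mpolyX R m.
Proof.
move=> hf; apply/mpolyP => k; rewrite raddf_sum /=.
have [kq|kq] := eqVneq (mdeg k) q.
  rewrite (bigD1_seq k) ?mem_mons ?kq ?mons_uniq //= mcoeffZ mcoeffX eqxx mulr1.
  by rewrite big1 ?addr0 // => j jk; rewrite mcoeffZ mcoeffX (negbTE jk) mulr0.
rewrite (dhomog_nemf_coeff hf kq) big_seq big1 // => j; rewrite mem_mons => /eqP jq.
rewrite mcoeffZ mcoeffX; case: eqP => [jk|_]; last by rewrite mulr0.
by move: kq; rewrite -jk jq eqxx.
Qed.

Section Rank.
Variables (K F : fieldType) (io : {rmorphism K -> F}) (n : nat) (X : 'I_n -> F).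
Local Notation S := (S io X).

Lemma mmap_mons r (z : 'I_r -> F) q (f : mpoly r K) : f \is homog q ->
  mmap io z f = \sum_(i < size (mons r q))
    io (mcoeff (nth mnm0 (mons r q) i) f) * mmap1 z (nth mnm0 (mons r q) i).
Proof.
move=> hf; rewrite {1}(homog_mons hf) raddf_sum /= (big_nth mnm0) big_mkord.
by apply: eq_bigr => i _; rewrite mmapZ mmapX.
Qed.

Variables (m : nat) (z : 'I_m.+1 -> F).
Local Notation ev := (mmap io z).
Hypothesis z1 : forall i, S 1 (z i).
Hypothesis zfr : zfree io z.

Let homogX i : mpolyX K (mnm1 i : multinom m.+1) \is homog 1.
Proof. by have := homogX_mon K (mnm1 i : multinom m.+1); rewrite mdeg1. Qed.

Let evX i : ev (mpolyX K (mnm1 i)) = z i.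
Proof. by rewrite mmapX mmap1U. Qed.

Let Z0 := mpolyX K (mnm1 (ord0 : 'I_m.+1)).

Let Z0_neq0 : Z0 != 0.
Proof. by apply/eqP => /(congr1 (mcoeff (mnm1 ord0))); rewrite mcoeffX eqxx mcoeff0 => /eqP; rewrite oner_eq0. Qed.

Let homogZ0 k : Z0 ^+ k \is homog k.
Proof. by have := dhomogMn k (homogX ord0); rewrite mul1n. Qed.

Lemma z0_neq0 : z ord0 != 0.
Proof.
apply/eqP => h; move/eqP: Z0_neq0; apply; apply: (zfr (homogX ord0)).
by rewrite evX.
Qed.

Lemma comb_bound (M0 : nat) (sk : 'I_M0 -> F) (V : set F) q r :
  (forall s, V s -> exists p : 'I_M0 -> mpoly m.+1 K,
     (forall k, p k \is homog q) /\ s = \sum_k ev (p k) * sk k) ->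
  ind io V r -> (r <= M0 * 'C(q + m, q))%N.
Proof.
move=> hV.
have -> : (M0 * 'C(q + m, q) = #|{: 'I_M0 * 'I_(size (mons m.+1 q))}|)%N.
  by rewrite card_prod !card_ord size_mons.
apply: ind_bound => e Ve.
have /choice [p hp] i := hV _ (Ve i).
exists (fun i (kj : 'I_M0 * 'I_(size (mons m.+1 q))) => mcoeff (nth mnm0 (mons m.+1 q) kj.2) (p i kj.1)) => c hc.
have P0 k : \sum_i c i *: p i k = 0.
  rewrite (homog_mons (q := q) (f := \sum_i c i *: p i k)); last first.
    by apply: homog_sum => i _; rewrite dhomogZ //; case: (hp i).
  rewrite (big_nth mnm0) big_mkord big1 // => j _.
  rewrite raddf_sum /=; under eq_bigr do rewrite mcoeffZ.
  by rewrite (hc (k, j)) scale0r.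
transitivity (\sum_k ev (\sum_i c i *: p i k) * sk k); last first.
  by rewrite big1 // => k _; rewrite P0 mmap0 mul0r.
under [RHS]eq_bigr do rewrite raddf_sum mulr_suml.
rewrite exchange_big /=; apply: eq_bigr => i _; rewrite {1}(hp i).2 mulr_sumr.
by apply: eq_bigr => k _; rewrite mmapZ mulrA.
Qed.

(** Graded coefficients of total degree [D]. The alternative 0 is needed because no degree is left
    for [p i] when [D] is less than [dg i]. *)
Definition gcond e (dg : 'I_e -> nat) D (p : 'I_e -> mpoly m.+1 K) : Prop :=
  forall i, p i = 0 \/ exists2 q, (q + dg i = D)%N & p i \is homog q.

Definition gind e (b : 'I_e -> F) (dg : 'I_e -> nat) : Prop :=
  forall D p, gcond dg D p -> \sum_i ev (p i) * b i = 0 -> forall i, p i = 0.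

(** The factor $z_0^{e-\deg b_i}$ lifts every [b i] to the common degree [e], after which all
    monomials of degree $D-e$ may be used. The bound involves only [e] and [m], which is the source
    of uniformity. *)
Lemma gind_ind e (b : 'I_e -> F) dg D :
  gind b dg -> (forall i, (dg i < e)%N /\ S (dg i) (b i)) -> (e <= D)%N ->
  ind io (S D) (e * 'C(D - e + m, D - e)).
Proof.
move=> hb hdg eD.
have -> : (e * 'C(D - e + m, D - e) = #|{: 'I_e * 'I_(size (mons m.+1 (D - e)))}|)%N.
  by rewrite card_prod !card_ord size_mons.
pose mu j := nth mnm0 (mons m.+1 (D - e)) j.
have hmu (j : 'I_(size (mons m.+1 (D - e)))) : mdeg (mu j) = (D - e)%N.
  by apply/eqP; rewrite -mem_mons mem_nth.
apply: (@ind_fin _ _ _ _ _ (fun ij : 'I_e * 'I_(size (mons m.+1 (D - e))) => mmap1 z (mu ij.2) * z ord0 ^+ (e - dg ij.1) * b ij.1)).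
  move=> [i j] /=; have [di bi] := hdg i.
  have E : ((D - e) + (e - dg i) + dg i = D)%N by lia.
  apply: (eq_ind _ (fun q => S q _) _ _ E).
  apply: S_M => //; apply: S_M; last exact: S_exp1.
  by have := S_mmap1 (mu j) z1; rewrite muln1 hmu.
move=> c h [i0 j0].
pose p i := (\sum_j c (i, j) *: mpolyX K (mu j)) * Z0 ^+ (e - dg i).
have hp : gcond dg D p.
  move=> i; right; exists (D - dg i)%N; first by have [] := hdg i; lia.
  have -> : (D - dg i = (D - e) + (e - dg i))%N by have [] := hdg i; lia.
  apply: dhomogM => //; apply: homog_sum => j _; rewrite dhomogZ //.
  by have := homogX_mon K (mu j); rewrite hmu.
have := hb D p hp; rewrite {1}/p.
have -> : \sum_i ev ((\sum_j c (i, j) *: mpolyX K (mu j)) * Z0 ^+ (e - dg i)) * b i = 0.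
  transitivity (\sum_i \sum_j io (c (i, j)) * (mmap1 z (mu j) * z ord0 ^+ (e - dg i) * b i)); last first.
    by rewrite -[RHS]h pair_bigA /=; apply: eq_bigr => -[i j] _.
  apply: eq_bigr => i _; rewrite rmorphM rmorphXn /= evX raddf_sum /= !mulr_suml.
  by apply: eq_bigr => j _; rewrite mmapZ mmapX !mulrA.
move=> /(_ erefl i0) /eqP; rewrite /p mulf_eq0 expf_eq0 (negbTE Z0_neq0) andbF orbF.
move=> /eqP /(congr1 (mcoeff (mu j0))); rewrite mcoeff0 raddf_sum /= (bigD1 j0) //=.
rewrite mcoeffZ mcoeffX eqxx mulr1 big1 ?addr0 // => j jj0.
rewrite mcoeffZ mcoeffX; case: eqP => [E|_]; last by rewrite mulr0.
move/eqP: E; rewrite /mu nth_uniq ?mons_uniq // => /eqP E.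
by case/eqP: jj0; apply: val_inj.
Qed.

Hypothesis zfin : finz io X z.

Lemma S_gen : exists N M0 (sk : 'I_M0 -> F), (forall k, S N (sk k)) /\
  forall q s, S (N + q) s -> exists p : 'I_M0 -> mpoly m.+1 K,
    (forall k, p k \is homog q) /\ s = \sum_k ev (p k) * sk k.
Proof.
have [_ [N hN]] := zfin.
exists N, (size (mons n N)), (fun k => mmap1 X (nth mnm0 (mons n N) k)); split.
  move=> k; have : nth mnm0 (mons n N) k \in mons n N by rewrite mem_nth.
  by rewrite mem_mons => /eqP {1}<-; rewrite -[mdeg _]muln1; apply: S_mmap1; apply: S_X.
elim=> [|q IH] s.
  rewrite addn0 => -[f hf ->]; exists (fun k : 'I__ => mpolyC m.+1 (mcoeff (nth mnm0 (mons n N) k) f)).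
  split=> [k|]; first by rewrite -[mpolyC _ _]mulr1 mul_mpolyC dhomogZ // dhomog1.
  by rewrite (mmap_mons X hf); apply: eq_bigr => k _; rewrite mmapC.
rewrite addnS => hs; have [y [hy ->]] := hN _ _ (leq_addr _ _) hs.
have /choice [p hp] i := IH _ (hy i).
exists (fun k => \sum_i mpolyX K (mnm1 i) * p i k); split=> [k|].
  apply: homog_sum => i _; have := dhomogM (homogX i) ((hp i).1 k).
  by rewrite add1n.
under [RHS]eq_bigr do rewrite raddf_sum mulr_suml.
rewrite exchange_big /=; apply: eq_bigr => i _; rewrite {1}(hp i).2 mulr_sumr.
by apply: eq_bigr => k _; rewrite rmorphM /= evX mulrA.
Qed.

(** The number [e] is maximal among the sizes of independent families whose degrees are all less
    than that size. Such a family is a basis over the field of fractions, although its degrees are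
    controlled by [e] alone. Division by powers of $z_0$ moves it to degree 0, and [a] is a common
    denominator for all generators. *)
Lemma rank_theorem : exists e (b : 'I_e -> F) (a : mpoly m.+1 K) (c0 N : nat),
  [/\ (0 < e)%N, a != 0, a \is homog c0,
    (forall j, exists2 q, (q < e)%N & S q (b j * z ord0 ^+ q)) &
   [/\ (forall D p, (forall j, p j \is homog D) -> \sum_j ev (p j) * b j = 0 -> forall j, p j = 0),
    (forall D s, (N <= D)%N -> S D s -> exists p : 'I_e -> mpoly m.+1 K,
       (forall j, p j \is homog (D + c0)%N) /\ ev a * s = \sum_j ev (p j) * b j),
    (forall D, (e <= D)%N -> ind io (S D) (e * 'C(D - e + m, D - e))) &
    (forall D r, (N <= D)%N -> ind io (S D) r -> (r <= e * 'C(D + c0 + m, D + c0))%N)]].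
Proof.
have [N [M0 [sk [hsk gen]]]] := S_gen.
pose P e := `[< exists (b : 'I_e -> F) dg, gind b dg /\ forall i, (dg i < e)%N /\ S (dg i) (b i) >].
have exP : exists e, P e.
  by exists 0%N; apply/asboolP; exists (fun=> 0), (fun=> 0%N); split=> [D p _ _ []|[]].
(* An independent family of more than [M0] elements would outgrow, for large degrees, what [M0]
   generators can span. *)
have bP e : P e -> (e <= M0)%N.
  move=> /asboolP [b [dg [hb hdg]]]; rewrite leqNgt; apply/negP => M0e.
  have [X0 hX0] := growth M0 (e + m) m.
  pose D := (X0 + N + e)%N.
  have h1 := gind_ind hb hdg (leq_addl _ _ : (e <= D)%N).
  have h2 : (e * 'C(D - e + m, D - e) <= M0 * 'C(D - N + m, D - N))%N.
    apply: comb_bound h1 => s hs; apply: gen.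
    by have -> : (N + (D - N) = D)%N by rewrite /D; lia.
  have /andP[h3 _] := bin_bounds (D - e) m; have /andP[_ h4] := bin_bounds (D - N) m.
  have := hX0 (D - e)%N; rewrite /D addnK leq_addr => /(_ isT); rewrite ltnNge => /negP; apply.
  have h5 : (M0.+1 * (X0 + N) ^ m <= e * (m`! * 'C(D - e + m, D - e)))%N.
    by rewrite /D !addnK in h3 *; apply: leq_mul.
  apply: leq_trans h5 _; rewrite mulnCA.
  apply: leq_trans (leq_mul (leqnn _) h2) _; rewrite mulnCA leq_mul2l; apply/orP; right.
  apply: leq_trans h4 _; rewrite /D; case: (m) => // m'; rewrite leq_exp2r //; lia.
case: (ex_maxnP exP bP) => e /asboolP [b [dg [hb hdg]]] emax.
(* Without such a relation [s] could be added to the family: a degree $D\le e$ is permitted among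
   $e+1$ elements. *)
have noext D s : (D <= e)%N -> S D s ->
    exists c a (p : 'I_e -> mpoly m.+1 K), [/\ a != 0, a \is homog c, gcond dg (c + D) p &
       ev a * s = \sum_i ev (p i) * b i].
  move=> De hs; apply: contrapT => hno.
  have : P e.+1.
    apply/asboolP; exists (fun i => if unlift ord0 i is Some j then b j else s),
      (fun i => if unlift ord0 i is Some j then dg j else D); split; last first.
      by move=> i; case: unliftP => [j _|_] /=; [have [h1 h2] := hdg j; split=> //; apply: ltnW|].
    move=> D' p hp; rewrite big_ord_recl unlift_none.
    under eq_bigr do rewrite liftK; move=> hsum.
    have hp' : gcond dg D' (fun j => p (lift ord0 j)).
      by move=> j; have := hp (lift ord0 j); rewrite liftK.
    have p0 : p ord0 = 0.
      apply/eqP; apply: contraT => p0; exfalso; apply: hno.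
      have [/eqP|[q qD hq]] := hp ord0; first by rewrite (negbTE p0).
      rewrite unlift_none in qD.
      exists q, (p ord0), (fun j => - p (lift ord0 j)); split=> //.
        move=> j; have [->|[q' h1 h2]] := hp' j; first by left; rewrite oppr0.
        by right; exists q'; rewrite ?dhomogN // qD.
      under eq_bigr do rewrite rmorphN mulNr.
      by rewrite sumrN; apply/eqP; rewrite -addr_eq0; apply/eqP.
    move=> i; case: (unliftP ord0 i) => [j ->|->] //.
    by apply: (hb D' _ hp'); move: hsum; rewrite p0 mmap0 mul0r add0r.
  by move/emax; rewrite ltnn.
pose dep s := exists c a (p : 'I_e -> mpoly m.+1 K), [/\ a != 0, a \is homog c,
   (exists D', gcond dg D' p) & ev a * s = \sum_i ev (p i) * b i].
(* In degrees beyond [e], write $s=\sum X_iy_i$. The $y_i$ depend on the $b_j$ by induction, and the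
   products $X_ib_j$ have degree at most [e], where [noext] applies. *)
have depall D s : S D s -> exists c a (p : 'I_e -> mpoly m.+1 K), [/\ a != 0, a \is homog c,
   gcond dg (c + D) p & ev a * s = \sum_i ev (p i) * b i].
  elim: D s => [|D IH] s hs; first exact: (noext).
  have [De|De] := leqP D.+1 e; first exact: (noext).
  have [y [hy ->]] := S_succ hs.
  have /choice [c /choice [a /choice [p hp]]] i := IH _ (hy i).
  have /choice [c' hc'] (ij : 'I_n * 'I_e) : exists ca : nat * mpoly m.+1 K,
      exists p, [/\ ca.2 != 0, ca.2 \is homog ca.1, gcond dg (ca.1 + (dg ij.2).+1) p &
        ev ca.2 * (X ij.1 * b ij.2) = \sum_i ev (p i) * b i].
    have [d1 d2] := hdg ij.2.
    have [c1 [a1 [p1 [h1 h2 h3 h4]]]] := noext (dg ij.2).+1 (X ij.1 * b ij.2) d1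
      (ltac:(rewrite -add1n; apply: S_M => //; exact: S_X)).
    by exists (c1, a1), p1.
  have /choice [p' hp'] := hc'.
  pose A := (\prod_i a i) * \prod_ij (c' ij).2.
  pose cA := (\sum_i c i + \sum_ij (c' ij).1)%N.
  have hprod (I : finType) (f : I -> mpoly m.+1 K) (g : I -> nat) (Q : pred I) :
      (forall i, f i \is homog (g i)) -> \prod_(i | Q i) f i \is homog (\sum_(i | Q i) g i)%N.
    move=> h; elim/big_ind2: _ => [|x1 x2 y1 y2 h1 h2|i _]; [exact: dhomog1|exact: dhomogM|exact: h].
  exists cA, A, (fun k => \sum_(ij : 'I_n * 'I_e) (\prod_(l | l != ij.1) a l) * p ij.1 ij.2 *
     ((\prod_(l | l != ij) (c' l).2) * p' ij k)); split.
  - rewrite mulf_neq0 //; apply/prodf_neq0 => i _; first by case: (hp i).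
    by case: (hp' i).
  - apply: dhomogM; apply: (hprod) => i; first by case: (hp i).
    by case: (hp' i).
  - move=> k.
    have [dk|dk] := leqP (dg k) (cA + D.+1)%N; last first.
      left; rewrite big1 // => -[i j] _ /=.
      have [_ _ g1 _] := hp i; have [_ _ g2 _] := hp' (i, j).
      have [->|[q1 e1 _]] := g1 j; first by rewrite mulr0 mul0r.
      have [->|[q2 e2 _]] := g2 k; first by rewrite !mulr0.
      have : (c i <= \sum_i c i)%N by rewrite (bigD1 i) //= leq_addr.
      have : ((c' (i, j)).1 <= \sum_ij (c' ij).1)%N by rewrite (bigD1 (i, j)) //= leq_addr.
      move=> l2 l1; exfalso; move: dk; rewrite ltnNge => /negP; apply.
      have h2 : (dg k <= (c' (i, j)).1 + (dg j).+1)%N by rewrite -[X in (_ <= X)%N]e2 leq_addl.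
      apply: leq_trans h2 _; rewrite /cA (addnC (\sum_i c i)%N) -addnA leq_add // addnS ltnS.
      have h1 : (dg j <= c i + D)%N by rewrite -e1 leq_addl.
      by apply: leq_trans h1 _; rewrite leq_add2r.
    right; exists (cA + D.+1 - dg k)%N; first by rewrite subnK.
    apply: homog_sum => -[i j] _ /=.
    have [_ _ g1 _] := hp i; have [_ _ g2 _] := hp' (i, j).
    have [->|[q1 e1 h1]] := g1 j; first by rewrite mulr0 mul0r dhomog0.
    have [->|[q2 e2 h2]] := g2 k; first by rewrite !mulr0 dhomog0.
    have -> : (cA + D.+1 - dg k = (\sum_(l | l != i) c l + q1) + (\sum_(l | l != (i, j)) (c' l).1 + q2))%N.
      rewrite /cA (bigD1 i) //= [X in (_ + X + _)%N](bigD1 (i, j)) //=; rewrite /= in e2; lia.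
    apply: dhomogM; apply: dhomogM => //; apply: (hprod) => l; first by case: (hp l).
    by case: (hp' l).
  - under [RHS]eq_bigr do rewrite raddf_sum mulr_suml /=.
    rewrite exchange_big /= mulr_sumr.
    transitivity (\sum_i \sum_j \sum_k ev ((\prod_(l | l != i) a l) * p i j *
     ((\prod_(l | l != (i, j)) (c' l).2) * p' (i, j) k)) * b k); last first.
      by rewrite pair_bigA /=; apply: eq_bigr => -[i j] _.
    apply: eq_bigr => i _.
    have [_ _ _ E1] := hp i.
    rewrite /A (bigD1 i) //= !rmorphM /= -!mulrA [X i * _]mulrC.
    rewrite (mulrC (ev (\prod_ij _))) !mulrA (mulrAC _ _ (y i)) E1 -!mulrA mulr_suml.
    apply: eq_bigr => j _.
    have [_ _ _ E2] := hp' (i, j).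
    rewrite (bigD1 (i, j)) //= rmorphM /=.
    transitivity (ev (\prod_(l | l != i) a l) * ev (p i j) * ev (\prod_(l | l != (i, j)) (c' l).2) *
       (ev (c' (i, j)).2 * (X i * b j))); first by ring.
    rewrite E2 mulr_sumr; apply: eq_bigr => k _; rewrite !rmorphM /=; ring.
have e0 : (0 < e)%N.
  rewrite lt0n; apply/eqP => E; have [c [a [p [a0 ha _ h]]]] := depall 0%N 1 (S_1 io X).
  move/eqP: a0; apply; apply: (zfr ha); move: h; rewrite mulr1 => ->.
  by rewrite big1 // => -[k hk]; exfalso; rewrite E in hk.
have /choice [c /choice [a /choice [p hp]]] k := depall _ _ (hsk k).
have z00 := z0_neq0.
pose b' j := b j / z ord0 ^+ dg j.
have hprod (f : 'I_M0 -> mpoly m.+1 K) (g : 'I_M0 -> nat) (Q : pred 'I_M0) :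
    (forall i, f i \is homog (g i)) -> \prod_(i | Q i) f i \is homog (\sum_(i | Q i) g i)%N.
  move=> h; elim/big_ind2: _ => [|x1 x2 y1 y2 h1 h2|i _]; [exact: dhomog1|exact: dhomogM|exact: h].
have comb D s : (N <= D)%N -> S D s -> exists q : 'I_e -> mpoly m.+1 K,
   (forall j, q j \is homog (D + \sum_k c k)%N) /\ ev (\prod_k a k) * s = \sum_j ev (q j) * b' j.
  move=> ND hs; have [|q [hq ->]] := gen (D - N)%N s; first by rewrite subnKC.
  exists (fun j => \sum_k q k * ((\prod_(l | l != k) a l) * (p k j * Z0 ^+ dg j))); split=> [j|].
    apply: homog_sum => k _.
    have -> : (D + \sum_k c k = (D - N) + (\sum_(l | l != k) c l + (c k + N)))%N.
      by rewrite (bigD1 k) //=; lia.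
    apply: dhomogM => //; apply: dhomogM; first by apply: (hprod) => l; case: (hp l).
    have [_ _ g1 _] := hp k; have [->|[q1 <- h1]] := g1 j; first by rewrite mul0r dhomog0.
    exact: dhomogM.
  under [RHS]eq_bigr do rewrite raddf_sum mulr_suml /=.
  rewrite exchange_big /= mulr_sumr; apply: eq_bigr => k _.
  have [_ _ _ E] := hp k.
  rewrite (bigD1 k) //= rmorphM /=.
  transitivity (ev (\prod_(l | l != k) a l) * ev (q k) * (ev (a k) * sk k)); first by ring.
  rewrite E mulr_sumr; apply: eq_bigr => j _.
  rewrite /b' !rmorphM rmorphXn /= evX; field.
  by rewrite expf_neq0.
exists e, b', (\prod_k a k), (\sum_k c k)%N, N; split=> //.
- by apply/prodf_neq0 => k _; case: (hp k).
- by apply: (hprod) => l; case: (hp l).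
- by move=> j; have [h1 h2] := hdg j; exists (dg j) => //; rewrite /b' divfK // expf_neq0.
split=> //.
- move=> D q hq hsum j.
  have h := hb (D + e)%N (fun j => q j * Z0 ^+ (e - dg j)).
  have /h {}h : gcond dg (D + e) (fun j => q j * Z0 ^+ (e - dg j)).
    move=> i; right; exists (D + (e - dg i))%N; first by have [] := hdg i; lia.
    exact: dhomogM.
  suff /h /(_ j) /eqP : \sum_i ev (q i * Z0 ^+ (e - dg i)) * b i = 0.
    by rewrite mulf_eq0 expf_eq0 (negbTE Z0_neq0) andbF orbF => /eqP.
  transitivity (z ord0 ^+ e * \sum_j ev (q j) * b' j); last by rewrite hsum mulr0.
  rewrite mulr_sumr; apply: eq_bigr => i _.
  rewrite rmorphM rmorphXn /= evX /b'.
  have -> : z ord0 ^+ e = z ord0 ^+ (e - dg i) * z ord0 ^+ dg i.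
    by rewrite -exprD subnK //; have [/ltnW] := hdg i.
  by field; rewrite expf_neq0.
- by move=> D eD; apply: gind_ind hb hdg eD.
move=> D r ND hr; apply: (@comb_bound e b' [set x | exists2 s, S D s & x = ev (\prod_k a k) * s]).
  by move=> _ [s hs ->]; apply: comb.
apply: (ind_scale (x := ev (\prod_k a k))) hr => [|y hy]; last by exists y; rewrite 1?mulrC.
apply/eqP => h; have : \prod_k a k = 0.
  apply: zfr h; apply: (hprod _ c) => l; by case: (hp l).
by apply/eqP/prodf_neq0 => k _; case: (hp k).
Qed.

End Rank.

End Coordinates.

Module NoetherianLocal.
Import Sumset Embedding Normalization.

(** * Noetherian local subrings of a field *)

Section SubringTheory.
Variable F : fieldType.
Implicit Types (A I N Q : set F).

Definition sring A : Prop :=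
  [/\ A 1, (forall x y, A x -> A y -> A (x + y)), (forall x, A x -> A (- x)) &
      (forall x y, A x -> A y -> A (x * y))].

(** In contrast to [is_ideal] no inclusion in [A] is required, so modules of fractions and spaces
    over a field of constants are covered. *)
Definition amod A I : Prop :=
  [/\ I 0, (forall x y, I x -> I y -> I (x + y)) & (forall a x, A a -> I x -> I (a * x))].

Lemma sring0 A : sring A -> A 0.
Proof. by move=> [A1 AD AN _]; rewrite -(subrr 1); apply: AD => //; apply: AN. Qed.

Lemma sring_amod A : sring A -> amod A A.
Proof. by move=> hA; have [A1 AD AN AM] := hA; split=> //; exact: sring0. Qed.

Lemma sringX A x k : sring A -> A x -> A (x ^+ k).
Proof.
move=> [A1 _ _ AM] Ax; elim: k => [|k IH]; first by rewrite expr0.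
by rewrite exprS; apply: AM.
Qed.

Lemma ideal_amod A I : is_ideal A I -> amod A I.
Proof. by move=> [_ I0 ID IM]. Qed.

Lemma amod_opp A I x : sring A -> amod A I -> I x -> I (- x).
Proof.
move=> [A1 AD AN AM] [I0 ID IM] Ix; rewrite -mulN1r; apply: IM => //; exact: AN.
Qed.

Lemma amod_sub A I x y : sring A -> amod A I -> I x -> I y -> I (x - y).
Proof. by move=> sA aI Ix Iy; have [_ ID _] := aI; apply: ID => //; apply: amod_opp aI Iy. Qed.

Lemma amod_sum A I (J : Type) (s : seq J) (P : pred J) (f : J -> F) :
  amod A I -> (forall i, P i -> I (f i)) -> I (\sum_(i <- s | P i) f i).
Proof. by move=> [I0 ID _] h; elim/big_ind: _. Qed.

Lemma sring_sum A (J : Type) (s : seq J) (P : pred J) (f : J -> F) :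
  sring A -> (forall i, P i -> A (f i)) -> A (\sum_(i <- s | P i) f i).
Proof. by move=> /sring_amod; apply: amod_sum. Qed.

Arguments amod_sum {A I J s P f}.
Arguments sring_sum {A J s P f}.

Lemma sring_prod A (J : Type) (s : seq J) (P : pred J) (f : J -> F) :
  sring A -> (forall i, P i -> A (f i)) -> A (\prod_(i <- s | P i) f i).
Proof. by move=> [A1 _ _ AM] h; elim/big_ind: _. Qed.

Arguments sring_prod {A J s P f}.

Lemma lin_span_amod A (G : set F) : sring A -> amod A (lin_span A G).
Proof.
move=> sA; have [A1 AD AN AM] := sA; split.
- exists 0%N, (fun=> 0), (fun=> 0); split=> [[]//|[]//|]; by rewrite big_ord0.
- move=> _ _ [k [a [b [ha hb ->]]]] [l [c [d [hc hd ->]]]].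
  exists (k + l)%N, (fun i => match fintype.split i with inl j => a j | inr j => c j end),
    (fun i => match fintype.split i with inl j => b j | inr j => d j end); split.
  + by move=> i; case: fintype.split.
  + by move=> i; case: fintype.split.
  rewrite big_split_ord /=; congr (_ + _); apply: eq_bigr => i _.
    by rewrite (unsplitK (inl i) : fintype.split (lshift l i) = _).
  by rewrite (unsplitK (inr i) : fintype.split (rshift k i) = _).
- move=> x _ Ax [k [a [b [ha hb ->]]]]; exists k, (fun i => x * a i), b; split=> // [i|].
    exact: AM.
  by rewrite mulr_sumr; apply: eq_bigr => i _; rewrite mulrA.
Qed.

Lemma lin_span_sub A (G : set F) I : amod A I -> G `<=` I -> lin_span A G `<=` I.
Proof.
move=> aI GI _ [k [a [b [ha hb ->]]]]; refine (amod_sum aI _) => i _.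
by have [_ _ IM] := aI; apply: IM => //; apply: GI.
Qed.

Lemma lin_span_gen A (G : set F) x : sring A -> G x -> lin_span A G x.
Proof.
move=> [A1 _ _ _] Gx; exists 1%N, (fun=> 1), (fun=> x); split=> //.
by rewrite big_ord1 mul1r.
Qed.

(** * Powers of a finitely generated ideal *)

Section Gpow.
Variables (A : set F) (s : nat) (g : 'I_s -> F).
Hypothesis sA : sring A.

(** The [k]-th power of the ideal generated by [g]. It agrees with [module_pow] by [module_powE],
    but keeps the generators visible for inductions on [k]. *)
Fixpoint gpow (k : nat) : set F :=
  if k is k'.+1 then
    [set z | exists y : 'I_s -> F, (forall i, gpow k' (y i)) /\ z = \sum_i g i * y i]
  else A.

Lemma gpow_amod k : amod A (gpow k).
Proof.
elim: k => [|k [I0 ID IM]]; first exact: sring_amod.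
split=> /=.
- by exists (fun=> 0); split=> //; rewrite big1 // => i _; rewrite mulr0.
- move=> _ _ [y [hy ->]] [x [hx ->]]; exists (fun i => y i + x i); split=> [i|]; first exact: ID.
  by rewrite -big_split; apply: eq_bigr => i _; rewrite mulrDr.
- move=> a _ Aa [y [hy ->]]; exists (fun i => a * y i); split=> [i|]; first exact: IM.
  by rewrite mulr_sumr; apply: eq_bigr => i _; rewrite mulrCA.
Qed.

Lemma gpow1P z : gpow 1 z <-> exists y : 'I_s -> F, (forall i, A (y i)) /\ z = \sum_i g i * y i.
Proof. by []. Qed.

Lemma gpow_gen k i x : gpow k x -> gpow k.+1 (g i * x).
Proof.
move=> hx; have [I0 _ _] := gpow_amod k.
exists (fun j => if j == i then x else 0); split=> [j|]; first by case: eqP.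
by rewrite (bigD1 i) //= eqxx big1 ?addr0 // => j /negbTE ->; rewrite mulr0.
Qed.

Lemma gpowM k l x y : gpow k x -> gpow l y -> gpow (k + l) (x * y).
Proof.
elim: k x => [|k IH] x; first by case: (gpow_amod l) => _ _; apply.
move=> [u [hu ->]] hy; exists (fun i => u i * y); split=> [i|]; first exact: (IH _ (hu i) hy).
by rewrite mulr_suml; apply: eq_bigr => i _; rewrite mulrA.
Qed.

Lemma gpowX k x j : gpow k x -> gpow (j * k) (x ^+ j).
Proof.
move=> hx; elim: j => [|j IH]; first by rewrite expr0; have [] := sA.
by rewrite exprS mulSn; apply: gpowM.
Qed.

Hypothesis gA : forall i, A (g i).

Lemma gpow_sub_A k x : gpow k x -> A x.
Proof.
elim: k x => //= k IH _ [y [hy ->]]; refine (sring_sum sA _) => i _.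
by have [_ _ _ AM] := sA; apply: AM; auto.
Qed.

Lemma gpowS k x : gpow k.+1 x -> gpow k x.
Proof.
move=> [y [hy ->]]; refine (amod_sum (gpow_amod k) _) => i _.
have [_ _ IM] := gpow_amod k; apply: (IM _ _ (gA i)); exact: hy.
Qed.

Lemma gpow_leq k l x : (k <= l)%N -> gpow l x -> gpow k x.
Proof.
by move=> /subnK <-; elim: (l - k)%N => // j IH /gpowS.
Qed.

Lemma module_powE I : I = gpow 1 -> forall k, module_pow A I k = gpow k.
Proof.
move=> ->; elim=> //= k ->; apply/seteqP; split.
  apply: lin_span_sub; first exact: (gpow_amod k.+1).
  by move=> _ [x [y [hx hy ->]]]; exact: (@gpowM 1 k x y hx hy).
move=> _ [y [hy ->]]; have [L0 LD LM] := lin_span_amod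
  [set z | exists x y0, [/\ [set z0 | exists y1, (forall i, A (y1 i)) /\ z0 = \sum_i g i * y1 i] x, gpow k y0 & z = x * y0]] sA.
elim/big_ind: _ => // i _; apply: lin_span_gen => //; exists (g i), (y i); split=> //.
have [A1 _ _ _] := sA; exists (fun j => (j == i)%:R); split=> [j|].
  by case: eqP => _ //; apply: sring0.
by rewrite (bigD1 i) //= eqxx mulr1 big1 ?addr0 // => j /negbTE ->; rewrite mulr0.
Qed.

(** Taking off one factor $g_i$ replaces [y] by $g_iy$ and lowers [e i] by one. As [k] exceeds the
    sum of the exponents, an index with exponent 0 is met before the factors are used up. *)
Lemma pigeonhole Q : amod A Q -> forall k y (e : 'I_s -> nat),
  (forall i, Q (g i ^+ e i * y)) -> (\sum_i e i < k)%N ->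
  forall x, gpow k x -> Q (x * y).
Proof.
move=> aQ; have [Q0 QD QM] := aQ; elim=> [//|k IH] y e he hk x [u [hu ->]].
rewrite mulr_suml; refine (amod_sum aQ _) => i _.
case E : (e i) => [|ei].
  apply: QM; last by have := he i; rewrite E expr0 mul1r.
  by have [_ _ _ AM] := sA; apply: AM => //; apply: gpow_sub_A (hu i).
have -> : g i * u i * y = u i * (g i * y) by ring.
apply: (IH (g i * y) (fun j => (e j - (j == i))%N)) => //.
  move=> j; case: eqP => [->|_] /=; last first.
    by rewrite subn0 mulrCA; apply: QM.
  by rewrite E subn1 /= mulrA -exprSr -E; apply: he.
move: hk; rewrite (bigD1 i) //= E [X in _ -> (X < _)%N](bigD1 i) //= eqxx E subn1 /= !addSn ltnS.
congr (_ < _)%N; congr addn; apply: eq_bigr => j /negbTE ->; by rewrite subn0.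
exact: hu.
Qed.

End Gpow.

Definition jac A (M : set F) : Prop :=
  forall x, M x -> 1 - x != 0 /\ A (1 - x)^-1.

(** Elimination: $1-\mu$ is invertible for $\mu\in M$, so the first equation can be solved for the
    first generator and substituted in the others. *)
Lemma nakayama A M I q (y : 'I_q -> F) : sring A -> amod A M -> M `<=` A -> jac A M -> amod A I ->
  (forall i, exists a (mu : 'I_q -> F), [/\ I a, (forall j, M (mu j)) & y i = a + \sum_j mu j * y j]) ->
  forall i, I (y i).
Proof.
move=> sA aM MA jA aI; have [I0 ID IM] := aI; have [M0 MD MM] := aM.
elim: q y => [|q IH] y hy; first by case.
have hmax : exists a (mu : 'I_q -> F), [/\ I a, (forall j, M (mu j)) &
    y ord0 = a + \sum_j mu j * y (lift ord0 j)].
  have [a [mu [Ia hmu E]]] := hy ord0.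
  have [n0 Ai] := jA _ (hmu ord0).
  exists ((1 - mu ord0)^-1 * a), (fun j => (1 - mu ord0)^-1 * mu (lift ord0 j)); split.
  - exact: IM.
  - by move=> j; apply: MM.
  have : (1 - mu ord0) * y ord0 = a + \sum_j mu (lift ord0 j) * y (lift ord0 j).
    by rewrite mulrBl mul1r {1}E big_ord_recl; ring.
  move=> /(congr1 ( *%R (1 - mu ord0)^-1)); rewrite mulKf // => ->; rewrite mulrDr mulr_sumr.
  by congr (_ + _); apply: eq_bigr => j _; rewrite mulrA.
have [a0 [mu0 [Ia0 hmu0 E0]]] := hmax.
have tail : forall i, I (y (lift ord0 i)).
  apply: (IH (fun i => y (lift ord0 i))) => i.
  have [a [mu [Ia hmu E]]] := hy (lift ord0 i).
  exists (a + mu ord0 * a0), (fun j => mu (lift ord0 j) + mu ord0 * mu0 j); split.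
  - by apply: ID => //; apply: IM => //; apply: MA.
  - by move=> j; apply: MD => //; apply: MM => //; apply: MA.
  rewrite E big_ord_recl {1}E0 mulrDr mulr_sumr -!addrA; congr (_ + (_ + _)).
  by rewrite -big_split; apply: eq_bigr => j _ /=; ring.
move=> i; case: (unliftP ord0 i) => [j ->|->] //; rewrite E0.
by apply: ID => //; refine (amod_sum aI _) => j _; apply: IM => //; apply: MA.
Qed.

Lemma lin_span_range A r (g : 'I_r -> F) z : sring A ->
  lin_span A (range g) z <-> exists a : 'I_r -> F, (forall i, A (a i)) /\ z = \sum_i a i * g i.
Proof.
move=> sA; have [A1 AD AN AM] := sA; split.
  have aT : amod A [set z | exists a : 'I_r -> F, (forall i, A (a i)) /\ z = \sum_i a i * g i].
    split=> /=.
    - exists (fun=> 0); split=> [_|]; first exact: sring0.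
      by rewrite big1 // => i _; rewrite mul0r.
    - move=> _ _ [a [ha ->]] [b [hb ->]]; exists (fun i => a i + b i); split=> [i|]; first exact: AD.
      by rewrite -big_split; apply: eq_bigr => i _; rewrite mulrDl.
    - move=> c _ Ac [a [ha ->]]; exists (fun i => c * a i); split=> [i|]; first exact: AM.
      by rewrite mulr_sumr; apply: eq_bigr => i _; rewrite mulrA.
  apply: (lin_span_sub aT) => _ [i _ <-] /=.
  exists (fun j => (j == i)%:R); split=> [j|]; first by case: eqP => _ //; apply: sring0.
  by rewrite (bigD1 i) //= eqxx mul1r big1 ?addr0 // => j /negbTE ->; rewrite mul0r.
move=> [a [ha ->]]; exists r, a, g; split=> // i; by exists i.
Qed.

Lemma noetherian_acc A (I : nat -> set F) : sring A -> noetherian A ->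
  (forall k, is_ideal A (I k)) -> (forall k, I k `<=` I k.+1) ->
  exists k, forall l, (k <= l)%N -> I l = I k.
Proof.
move=> sA nA hI incr.
have mono k l : (k <= l)%N -> I k `<=` I l.
  by move=> /subnK <-; elim: (l - k)%N => // j IH x /IH /incr.
have hU : is_ideal A [set x | exists k, I k x].
  split.
  - by move=> x [k Ikx]; have [h _ _ _] := hI k; apply: h.
  - by exists 0%N; have [_ h _ _] := hI 0%N.
  - move=> x y [k hx] [l hy]; exists (maxn k l).
    have [_ _ h _] := hI (maxn k l); apply: h; [apply: mono hx|apply: mono hy];
    by rewrite ?leq_maxl ?leq_maxr.
  - by move=> a x Aa [k hx]; exists k; have [_ _ _ h] := hI k; apply: h.
have [r [g Eg]] := nA _ hU.
have /choice [k hk] i : exists k, I k (g i).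
  have : [set x | exists k, I k x] (g i) by rewrite Eg; apply: lin_span_gen => //; exists i.
  by [].
exists (\max_i k i)%N => l kl; apply/seteqP; split; last exact: mono.
move=> x Ilx; have : [set x | exists k, I k x] x by exists l.
rewrite Eg; apply: lin_span_sub; first exact: ideal_amod.
by move=> _ [i _ <-]; apply: (mono (k i)) => //; apply: leq_bigmax.
Qed.

(** Krull's theorem without the Artin-Rees lemma. Let [N] be the intersection of the $I+(g)^k$ and
    $J=I+(g)N$. An ideal [Q] that is maximal among those containing [J] and meeting [N] inside [J]
    contains a power of each generator, hence some $(g)^k$, hence [N]. So $N\subseteq J$, and
    Nakayama's lemma gives $N\subseteq I$. *)
Lemma krull_intersection A s (g : 'I_s -> F) I : sring A -> noetherian A ->
  (forall i, A (g i)) -> jac A (gpow A g 1) -> is_ideal A I ->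
  forall x, (forall k, exists a b, [/\ I a, gpow A g k b & x = a + b]) -> I x.
Proof.
move=> sA nA gA jA iI x hx; have [A1 AD AN AM] := sA.
have [IA I0 ID IM] := iI; have aI := ideal_amod iI.
pose N : set F := [set x | forall k, exists a b, [/\ I a, gpow A g k b & x = a + b]].
have NA y : N y -> A y.
  by move=> /(_ 0%N) [a [b [Ia Ab ->]]]; apply: AD => //; apply: IA.
have iN : is_ideal A N.
  split=> //.
  - move=> k; exists 0, 0; rewrite addr0; split=> //; by have [] := gpow_amod g sA k.
  - move=> y z hy hz k; have [a [b [Ia gb ->]]] := hy k; have [c [d [Ic gd ->]]] := hz k.
    exists (a + c), (b + d); split; [exact: ID| |by rewrite addrACA].
    by have [_ h _] := gpow_amod g sA k; apply: h.
  - move=> c y Ac hy k; have [a [b [Ia gb ->]]] := hy k.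
    exists (c * a), (c * b); split; [exact: IM| |by rewrite mulrDr].
    by have [_ _ h] := gpow_amod g sA k; apply: h.
have [_ N0 ND NM] := iN.
pose J : set F := [set x | exists a (y : 'I_s -> F), [/\ I a, (forall i, N (y i)) & x = a + \sum_i g i * y i]].
have iJ : is_ideal A J.
  split.
  - move=> _ [a [y [Ia hy ->]]]; apply: AD; first exact: IA.
    by refine (sring_sum sA _) => i _; apply: AM => //; apply: NA.
  - by exists 0, (fun=> 0); split=> //; rewrite big1 ?addr0 // => i _; rewrite mulr0.
  - move=> _ _ [a [y [Ia hy ->]]] [b [z [Ib hz ->]]]; exists (a + b), (fun i => y i + z i); split.
    + exact: ID.
    + by move=> i; apply: ND.
    by rewrite addrACA -big_split; congr (_ + _); apply: eq_bigr => i _; rewrite mulrDr.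
  - move=> c _ Ac [a [y [Ia hy ->]]]; exists (c * a), (fun i => c * y i); split.
    + exact: IM.
    + by move=> i; apply: NM.
    by rewrite mulrDr mulr_sumr; congr (_ + _); apply: eq_bigr => i _; rewrite mulrCA.
pose P (Q : set F) := [/\ is_ideal A Q, J `<=` Q & forall x, Q x -> N x -> J x].
(* Zorn's lemma also considers the empty chain, whose union is empty; imposing the property on the
   union with [J] covers this case. *)
have [Q0 [PQ0 Qmax]] : exists Q0, P (J `|` Q0) /\ forall B, Q0 `<` B -> ~ P (J `|` B).
  apply: (@Zorn_bigcup _ [set Q | P (J `|` Q)]) => G GP Gtot.
  have two a b : (J `|` \bigcup_(X in G) X) a -> (J `|` \bigcup_(X in G) X) b ->
      (J a /\ J b) \/ exists X, [/\ G X, (J `|` X) a & (J `|` X) b].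
    move=> [Ja|[X GX Xa]] [Jb|[Y GY Yb]]; [by left|right|right|right].
    - by exists Y; split=> //; [left|right].
    - by exists X; split=> //; [right|left].
    - have [XY|YX] := Gtot X Y GX GY.
        by exists Y; split=> //; right=> //; apply: XY.
      by exists X; split=> //; right=> //; apply: YX.
  have inG X y : G X -> (J `|` X) y -> (J `|` \bigcup_(X in G) X) y.
    by move=> GX [Jy|Xy]; [left|right; exists X].
  have [JA J0 JD JM] := iJ.
  split; last 2 first.
  - by move=> y Jy; left.
  - by move=> y [//|[X GX Xy]]; have [_ _ h] := GP X GX; apply: h; right.
  split.
  - by move=> y [/JA //|[X GX Xy]]; have [[h _ _ _] _ _] := GP X GX; apply: h; right.
  - by left.
  - move=> y z hy hz; have [[Jy Jz]|[X [GX Xy Xz]]] := two _ _ hy hz; first by left; apply: JD.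
    by apply: (inG X) => //; have [[_ _ h _] _ _] := GP X GX; apply: h.
  - move=> a y Aa hy; have [[Jy _]|[X [GX Xy _]]] := two _ _ hy hy; first by left; apply: JM.
    by apply: (inG X) => //; have [[_ _ _ h] _ _] := GP X GX; apply: h.
set Q := J `|` Q0 in PQ0.
have [iQ JQ QNJ] := PQ0; have [QA QQ0 QD QM] := iQ.
(* The ideals $(Q:g_i^t)$ become stationary. At such a [t], an element $y=q+g_i^ta$ of [N] satisfies
   $g_iy\in J$, hence $g_i^{t+1}a\in Q$, hence $g_i^ta\in Q$ and $y\in Q\cap N\subseteq J$. So
   $Q+g_i^tA$ still qualifies, and maximality forces $g_i^t\in Q$. *)
have gQ i : exists t, Q (g i ^+ t).
  have [||t ht] := @noetherian_acc A (fun t => [set y | A y /\ Q (g i ^+ t * y)]) sA nA.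
  - move=> t; split=> [y [] //| | |].
    + by split; [exact: sring0|rewrite mulr0].
    + by move=> y z [Ay Qy] [Az Qz]; split; [exact: AD|rewrite mulrDr; apply: QD].
    + by move=> a y Aa [Ay Qy]; split; [exact: AM|rewrite mulrCA; apply: QM].
  - by move=> t y [Ay Qy]; split=> //; rewrite exprS -mulrA; apply: QM.
  exists t; apply: contrapT => hnQ.
  pose Q' : set F := [set y | exists q a, [/\ Q q, A a & y = q + g i ^+ t * a]].
  have QQ' : Q `<=` Q' by move=> y Qy; exists y, 0; split=> //; [exact: sring0|rewrite mulr0 addr0].
  have gA' : A (g i ^+ t) by apply: sringX.
  have JJ' : J `|` Q' = Q'.
    by apply/seteqP; split=> [y [/JQ /QQ'|] //|y Qy]; right.
  apply: (Qmax Q').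
    split; first by move=> y Q0y; apply: QQ'; right.
    move=> /(_ (g i ^+ t)) h; apply: hnQ; right; apply: h.
    by exists 0, 1; split=> //; rewrite add0r mulr1.
  rewrite JJ'; split.
  - split.
    + by move=> _ [q [a [Qq Aa ->]]]; apply: AD; [exact: QA|exact: AM].
    + exact: QQ'.
    + move=> _ _ [q [a [Qq Aa ->]]] [r [b [Qr Ab ->]]]; exists (q + r), (a + b); split; [exact: QD|exact: AD|ring].
    + move=> c _ Ac [q [a [Qq Aa ->]]]; exists (c * q), (c * a); split; [exact: QM|exact: AM|ring].
  - by move=> y /JQ /QQ'.
  - move=> y [q [a [Qq Aa Ey]]] Ny.
    have Jgy : J (g i * y).
      exists 0, (fun j => if j == i then y else 0); split=> //.
        by move=> j; case: eqP.
      rewrite add0r (bigD1 i) //= eqxx big1 ?addr0 // => j /negbTE ->; by rewrite mulr0.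
    have : Q (g i ^+ t.+1 * a).
      have -> : g i ^+ t.+1 * a = g i * y + (-1) * (g i * q) by rewrite Ey exprS; ring.
      apply: QD; first exact: JQ.
      apply: (QM); first exact: AN.
      exact: QM.
    move=> Qga; have : [set y | A y /\ Q (g i ^+ t * y)] a by rewrite -(ht t.+1).
    move=> [_ Qta]; apply: QNJ => //; rewrite Ey; exact: QD.
have /choice [t ht] := gQ.
have NJ : N `<=` J.
  move=> y Ny; apply: (QNJ) => //.
  have [a [b [Ia gb ->]]] := Ny (\sum_i t i).+1.
  apply: QD.
    by apply: JQ; exists a, (fun=> 0); split=> //; rewrite big1 ?addr0 // => i _; rewrite mulr0.
  rewrite -[b]mulr1; apply: (pigeonhole sA gA (ideal_amod iQ)) gb => [i|//].
  by rewrite mulr1.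
have [q [y Ey]] := nA _ iN.
have Ny i : N (y i) by rewrite Ey; apply: lin_span_gen => //; exists i.
suff : forall i, I (y i).
  move=> hy; have : N x by []; rewrite Ey; apply: lin_span_sub => // _ [i _ <-]; exact: hy.
apply: (@nakayama A (gpow A g 1)) => //.
- exact: gpow_amod.
- by move=> z; apply: gpow_sub_A.
move=> i; have [a [w [Ia Nw ->]]] := NJ _ (Ny i).
have /choice [c hc] j : exists c : 'I_q -> F, (forall k, A (c k)) /\ w j = \sum_k c k * y k.
  by apply/(lin_span_range _ _ sA); rewrite -Ey.
exists a, (fun k => \sum_j g j * c j k); split=> //.
  by move=> k; exists (fun j => c j k); split=> // j; exact: (hc j).1.
congr (_ + _); under [RHS]eq_bigr do rewrite mulr_suml.
rewrite exchange_big /=; apply: eq_bigr => j _; rewrite {1}(hc j).2 mulr_sumr.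
by apply: eq_bigr => k _; rewrite mulrA.
Qed.

End SubringTheory.

Arguments amod_sum {F A I J s P f}.
Arguments sring_sum {F A J s P f}.
Arguments sring_prod {F A J s P f}.

End NoetherianLocal.

Module Vanishing.
Import Sumset Embedding Normalization Coordinates NoetherianLocal.

(** * Orders of vanishing of polynomials *)

(** Homogenization by one more exponent $q-|b|$ identifies the monomials of degree at most [q] with
    those of degree exactly [q] in $m+1$ variables. *)
Lemma card_bmultinom m q : #|{: bmultinom m q.+1}| = 'C(q + m, q).
Proof.
rewrite -size_mons cardE.
pose f (b : bmultinom m q.+1) : multinom m.+1 :=
  Multinom [tuple (if unlift ord0 i is Some j then bmnm b j else q - mdeg (bmnm b))%N | i < m.+1].
have fl b j : f b (lift ord0 j) = bmnm b j by rewrite mnmE liftK.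
have f0 b : f b ord0 = (q - mdeg (bmnm b))%N by rewrite mnmE unlift_none.
rewrite -(size_map f); apply/perm_size/uniq_perm; rewrite ?mons_uniq //.
  rewrite map_inj_uniq ?enum_uniq // => a b E; apply/val_inj/mnmP => j /=.
  by rewrite -!fl E.
move=> t; rewrite mem_mons; apply/mapP/eqP.
  move=> [b _ ->]; rewrite mdegE big_ord_recl f0.
  under eq_bigr do rewrite fl.
  by rewrite -mdegE subnK // -ltnS bmdeg.
move=> tq; pose t' : multinom m := Multinom [tuple t (lift ord0 i) | i < m].
have t'E j : t' j = t (lift ord0 j) by rewrite mnmE.
have Eq : (t ord0 + mdeg t' = q)%N.
  by rewrite -tq mdegE mdegE big_ord_recl; congr addn; apply: eq_bigr => i _; rewrite t'E.
have t'q : (mdeg t' < q.+1)%N by rewrite ltnS -Eq leq_addl.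
exists (BMultinom t'q); rewrite ?mem_enum //; apply/mnmP => i.
case: (unliftP ord0 i) => [j ->|->]; first by rewrite fl /= t'E.
by rewrite f0 /= -Eq addnK.
Qed.

Section OrderOfVanishing.
Variables (K : fieldType) (m : nat).
Implicit Types (p q : mpoly m K).

Definition ordz (k : nat) p : Prop := forall a, (mdeg a < k)%N -> mcoeff a p = 0.

Lemma ordzM k l p q : ordz k p -> ordz l q -> ordz (k + l) (p * q).
Proof.
move=> hp hq a ha; rewrite mcoeffM big1 // => -[b c] /= /eqP E.
have [bk|bk] := ltnP (mdeg (bmnm b)) k; first by rewrite hp ?mul0r.
have := congr1 (@mdeg m) E; rewrite mdegD => E'.
by rewrite [X in _ * X]hq ?mulr0 //; lia.
Qed.

Lemma ordzX i : ordz 1 (mpolyX K (mnm1 i : multinom m)).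
Proof.
move=> a; rewrite ltnS leqn0 mdeg_eq0 => /eqP ->; rewrite mcoeffX.
by case: eqP => // /(congr1 (@mdeg m)); rewrite mdeg1 mdeg0.
Qed.

Lemma ordzD k p q : ordz k p -> ordz k q -> ordz k (p + q).
Proof. by move=> hp hq a ha; rewrite mcoeffD hp // hq // addr0. Qed.

Lemma ordz0 k : ordz k 0.
Proof. by move=> a _; rewrite mcoeff0. Qed.

Lemma ordz_leq k l p : (k <= l)%N -> ordz l p -> ordz k p.
Proof. by move=> kl hp a ha; apply: hp; apply: leq_trans kl. Qed.

(** [mlast] is the smallest monomial of the support. The monomial order is compatible with addition,
    so the product of the smallest terms cannot cancel. *)
Lemma mcoeff_mlastM p q :
  mcoeff (mnm_add (mlast p) (mlast q)) (p * q) = mcoeff (mlast p) p * mcoeff (mlast q) q.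
Proof.
rewrite mcoeffM.
have h1 : (mdeg (mlast p) < (mdeg (mnm_add (mlast p) (mlast q))).+1)%N by rewrite mdegD ltnS leq_addr.
have h2 : (mdeg (mlast q) < (mdeg (mnm_add (mlast p) (mlast q))).+1)%N by rewrite mdegD ltnS leq_addl.
rewrite (bigD1 (BMultinom h1, BMultinom h2)) //= big1 ?addr0 // => -[b c] /= /andP[/eqP E ne].
have [bp|bp] := ltP (bmnm b) (mlast p); first by rewrite mcoeff_lt_mlast ?mul0r.
have [cq|cq] := ltP (bmnm c) (mlast q); first by rewrite [X in _ * X]mcoeff_lt_mlast ?mulr0.
exfalso; case/negP: ne; rewrite xpair_eqE /= -!val_eqE /=.
have Eb : bmnm b = mlast p.
  apply/eqP; rewrite eq_le bp andbT leNgt; apply/negP => lt.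
  by have := ltmc_le_add lt cq; rewrite -E ltxx.
by rewrite Eb eqxx /=; move/eqP: E; rewrite Eb eqm_add2l eq_sym.
Qed.

Lemma ordz_div k o p q a : ordz k (p * q) -> mdeg a = o -> mcoeff a q != 0 -> ordz (k - o) p.
Proof.
move=> hpq ao qa b hb; apply/eqP; apply: contraT => pb; exfalso.
have p0 : p != 0 by apply: contraNneq pb => ->; rewrite mcoeff0.
have q0 : q != 0 by apply: contraNneq qa => ->; rewrite mcoeff0.
have hpb : (mdeg (mlast p) <= mdeg b)%N by apply/lemc_mdeg/mlast_lemc; rewrite mcoeff_msupp.
have hqa : (mdeg (mlast q) <= o)%N by rewrite -ao; apply/lemc_mdeg/mlast_lemc; rewrite mcoeff_msupp.
have := hpq (mnm_add (mlast p) (mlast q)); rewrite mcoeff_mlastM mdegD => h.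
have /h /eqP : (mdeg (mlast p) + mdeg (mlast q) < k)%N by lia.
by rewrite mulf_eq0 !mcoeff_eq0 !mlast_supp.
Qed.

End OrderOfVanishing.

(** * The local ring at a rational point *)

Section LocalRing.
Variables (K F : fieldType) (io : {rmorphism K -> F}) (B : set F) (ev : F -> K).
Hypotheses (sB : sring B) (Bio : forall c, B (io c)).
Hypotheses (evD : forall x y, B x -> B y -> ev (x + y) = ev x + ev y)
  (evM : forall x y, B x -> B y -> ev (x * y) = ev x * ev y) (evio : forall c, ev (io c) = c).

Definition locring : set F := [set z | exists x y, [/\ B x, B y, ev y != 0 & z = x / y]].
Local Notation R := locring.

Lemma ev0 : ev 0 = 0. Proof. by rewrite -(rmorph0 io) evio. Qed.
Lemma ev1 : ev 1 = 1. Proof. by rewrite -(rmorph1 io) evio. Qed.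

Lemma evN x : B x -> ev (- x) = - ev x.
Proof.
move=> Bx; have [_ BD BN _] := sB; apply/eqP; rewrite -addr_eq0 -evD ?addNr ?ev0 //; exact: BN.
Qed.

Lemma evX x k : B x -> ev (x ^+ k) = ev x ^+ k.
Proof.
move=> Bx; elim: k => [|k IH]; first by rewrite !expr0 ev1.
by rewrite !exprS evM ?IH //; apply: sringX.
Qed.

Lemma ev_sum (I : Type) (s : seq I) (P : pred I) (f : I -> F) : (forall i, P i -> B (f i)) ->
  ev (\sum_(i <- s | P i) f i) = \sum_(i <- s | P i) ev (f i).
Proof.
move=> h; suff [_ ->] : B (\sum_(i <- s | P i) f i) /\
  ev (\sum_(i <- s | P i) f i) = \sum_(i <- s | P i) ev (f i) by [].
elim/big_ind2: _ => [|x1 x2 y1 y2 [B1 <-] [B2 <-]|i Pi]; [by rewrite ev0; split=> //; exact: sring0| |by split=> //; exact: h].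
by rewrite evD //; split=> //; have [_ BD _ _] := sB; apply: BD.
Qed.

Lemma ev_prod (I : Type) (s : seq I) (P : pred I) (f : I -> F) : (forall i, P i -> B (f i)) ->
  ev (\prod_(i <- s | P i) f i) = \prod_(i <- s | P i) ev (f i).
Proof.
move=> h; suff [_ ->] : B (\prod_(i <- s | P i) f i) /\
  ev (\prod_(i <- s | P i) f i) = \prod_(i <- s | P i) ev (f i) by [].
elim/big_ind2: _ => [|x1 x2 y1 y2 [B1 <-] [B2 <-]|i Pi]; [by rewrite ev1; split=> //; have [] := sB| |by split=> //; exact: h].
by rewrite evM //; split=> //; have [_ _ _ BM] := sB; apply: BM.
Qed.

Lemma ev_neq0 y : ev y != 0 -> y != 0.
Proof. by apply: contraNneq => ->; rewrite ev0. Qed.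

Lemma locring_sring : sring R.
Proof.
have [B1 BD BN BM] := sB; split.
- by exists 1, 1; rewrite ev1 oner_eq0 divr1; split.
- move=> _ _ [x [y [Bx By y0 ->]]] [x' [y' [Bx' By' y0' ->]]].
  exists (x * y' + x' * y), (y * y'); split; [by apply: BD; apply: BM|exact: BM|by rewrite evM // mulf_neq0|].
  by rewrite addf_div ?ev_neq0.
- by move=> _ [x [y [Bx By y0 ->]]]; exists (- x), y; split=> //; [exact: BN|rewrite mulNr].
- move=> _ _ [x [y [Bx By y0 ->]]] [x' [y' [Bx' By' y0' ->]]].
  exists (x * x'), (y * y'); split; [exact: BM|exact: BM|by rewrite evM // mulf_neq0|].
  by rewrite mulf_div.
Qed.
Let sR := locring_sring.

Lemma locring_B x : B x -> R x.
Proof. by move=> Bx; exists x, 1; rewrite ev1 oner_eq0 divr1; split=> //; have [] := sB. Qed.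

Lemma locring_V y : B y -> ev y != 0 -> R y^-1.
Proof. by move=> By y0; exists 1, y; rewrite div1r; split=> //; have [] := sB. Qed.

Lemma locring_io c : R (io c). Proof. exact: locring_B. Qed.

Variables (s : nat) (w : 'I_s -> F).
Hypotheses (wB : forall i, B (w i)) (evw : forall i, ev (w i) = 0).
Hypothesis wgen : forall z, B z ->
  exists y : 'I_s -> F, (forall i, B (y i)) /\ z - io (ev z) = \sum_i w i * y i.

Local Notation M := (gpow R w).
Let wR i : R (w i). Proof. exact: locring_B. Qed.

Lemma gpowB_ev x : gpow B w 1 x -> ev x = 0.
Proof.
move=> [y [hy ->]]; rewrite ev_sum; last by move=> i _; have [_ _ _ BM] := sB; apply: BM.
by rewrite big1 // => i _; rewrite evM // evw mul0r.
Qed.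

Lemma ev_gpowB x : B x -> ev x = 0 -> gpow B w 1 x.
Proof. by move=> Bx x0; have [y [hy]] := wgen Bx; rewrite x0 rmorph0 subr0 => ->; exists y. Qed.

Lemma gpowBR k x : gpow B w k x -> M k x.
Proof.
elim: k x => [|k IH] x; first exact: locring_B.
by move=> [y [hy ->]]; exists y; split=> // i; apply: IH; exact: hy.
Qed.

Lemma gpow_common k x : M k x -> exists b t, [/\ gpow B w k b, B t, ev t != 0 & x = b / t].
Proof.
elim: k x => [|k IH] x; first by move=> [a [t [Ba Bt t0 ->]]]; exists a, t.
move=> [y [hy ->]]; have /choice [b /choice [t ht]] i := IH _ (hy i).
have [_ _ _ BM] := sB.
exists (\sum_i w i * (b i * \prod_(j | j != i) t j)), (\prod_i t i); split.
- exists (fun i => b i * \prod_(j | j != i) t j); split=> // i.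
  have [_ _ h] := gpow_amod w sB k; rewrite mulrC; apply: h; last by have [] := ht i.
  by refine (sring_prod sB _) => j _; have [] := ht j.
- by refine (sring_prod sB _) => j _; have [] := ht j.
- rewrite ev_prod; last by move=> j _; have [] := ht j.
  by apply/prodf_neq0 => j _; have [] := ht j.
have t0 i : t i != 0 by apply: ev_neq0; have [] := ht i.
rewrite mulr_suml; apply: eq_bigr => i _; have [_ _ _ ->] := ht i.
have -> : \prod_j t j = t i * \prod_(j | j != i) t j by rewrite (bigD1 i).
rewrite -!mulrA; congr (_ * (_ * _)).
by rewrite invfM mulrCA mulfV ?mulr1 //; apply/prodf_neq0 => j _; exact: t0.
Qed.

Lemma M1_ev x y : B x -> B y -> ev y != 0 -> ev x = 0 -> M 1 (x / y).
Proof.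
move=> Bx By y0 x0; rewrite mulrC; have [_ _ h] := gpow_amod w sR 1; apply: h; first exact: locring_V.
exact/gpowBR/ev_gpowB.
Qed.

Lemma jac_M1 : jac R (M 1).
Proof.
move=> x /gpow_common [b [t [hb Bt t0 ->]]].
have Bb : B b by apply: (@gpow_sub_A _ _ _ w) hb.
have [_ BD BN BM] := sB.
have evtb : ev (t - b) = ev t by rewrite evD ?evN ?(gpowB_ev hb) ?subr0 //; exact: BN.
have -> : 1 - b / t = (t - b) / t by rewrite mulrBl mulfV ?ev_neq0.
have tb0 : t - b != 0 by apply: ev_neq0; rewrite evtb.
split; first by rewrite mulf_neq0 // invr_eq0 ev_neq0.
rewrite invf_div; exists t, (t - b); split=> //; last by rewrite evtb.
by apply: BD => //; apply: BN.
Qed.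

Lemma locring_split z : R z -> exists c, M 1 (z - io c).
Proof.
move=> [x [y [Bx By y0 ->]]]; have [_ BD BN BM] := sB.
exists (ev x / ev y).
have -> : x / y - io (ev x / ev y) = (x * io (ev y) - io (ev x) * y) / (y * io (ev y)).
  rewrite rmorphM fmorphV; field.
  by rewrite fmorph_eq0 y0 ev_neq0.
apply: M1_ev.
- by apply: BD; [apply: BM|apply: BN; apply: BM].
- exact: BM.
- by rewrite evM // evio mulf_neq0.
- rewrite evD ?evN ?evM ?evio ?subrr //; try exact: BM.
  by apply: BN; apply: BM.
Qed.

(** A denominator of value 1 is $1-\tau$ with $\tau$ in the maximal ideal of [B]; a finite geometric
    series in $\tau$ inverts it modulo any power of this ideal. *)
Lemma gpow_contract q x : B x -> M q x -> gpow B w q x.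
Proof.
case: q => // q Bx /gpow_common [b [t [hb Bt t0 E]]].
have [B1 BD BN BM] := sB; have [_ GD GM] := gpow_amod w sB q.+1.
pose t1 := io (ev t)^-1 * t; pose tau := 1 - t1.
have Bt1 : B t1 by apply: BM.
have Btau : B tau by apply: BD => //; apply: BN.
have htau : gpow B w 1 tau.
  apply: ev_gpowB => //; rewrite evD ?evN ?ev1 ?evM ?evio ?mulVf ?subrr //; exact: BN.
have xt1 : gpow B w q.+1 (x * t1).
  have -> : x * t1 = io (ev t)^-1 * b by rewrite E /t1 mulrCA divfK // ev_neq0.
  exact: GM.
have -> : x = (\sum_(i < q.+1) tau ^+ i) * (x * t1) + x * tau ^+ q.+1.
  have : (tau - 1) * (\sum_(i < q.+1) tau ^+ i) = tau ^+ q.+1 - 1 by rewrite subrX1.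
  have -> : tau - 1 = - t1 by rewrite /tau; ring.
  set S := \sum_(i < _) _ => h.
  have -> : tau ^+ q.+1 = 1 - t1 * S by rewrite -[LHS](subrK 1) -h; ring.
  ring.
apply: GD.
  by apply: GM => //; refine (sring_sum sB _) => i _; apply: sringX.
apply: GM => //; have := gpowX sB q.+1 htau; by rewrite muln1.
Qed.

(** * Order of vanishing compared with the order in normalizing coordinates *)

Section Finite.
Variables (m : nat) (v : 'I_m -> F).
Hypotheses (vB : forall i, B (v i)) (evv : forall i, ev (v i) = 0).
Local Notation J := (gpow B v).
Local Notation pv := (mmap io v).

Hypothesis vfin : exists M0 (b0 : 'I_M0 -> F), forall z, B z ->
  exists (c : 'I_M0 -> K) (y : 'I_m -> F), (forall i, B (y i)) /\
    z = \sum_k io (c k) * b0 k + \sum_i v i * y i.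

(** By [vfin] the powers of [x] are linearly dependent modulo the ideal $(v)$. In a relation the
    lowest power of [x] factors out, and the cofactor has a nonzero value because all its other
    terms vanish with [x]. *)
Lemma power_in_J x : B x -> ev x = 0 -> exists e b, [/\ B b, ev b = 1 & J 1 (x ^+ e * b)].
Proof.
move=> Bx x0; have [B1 BD BN BM] := sB; have [M0 [b0 hb0]] := vfin.
have [J0 JD JM] := gpow_amod v sB 1.
have /choice [c /choice [y hy]] (j : 'I_M0.+1) := hb0 _ (sringX j sB Bx).
have [|kap [i0 ki0] hk] := @lin_dep K 'I_M0.+1 'I_M0 c; first by rewrite !card_ord.
have [j0 kj0 jmin] := @arg_minnP _ i0 (fun j => kap j != 0) (fun j : 'I_M0.+1 => j : nat) ki0.
pose b' := \sum_(j : 'I_M0.+1 | (j0 <= j)%N) io (kap j) * x ^+ (j - j0).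
have Bt (j : 'I_M0.+1) : B (io (kap j) * x ^+ (j - j0)) by apply: BM => //; apply: sringX.
have Bb' : B b' by refine (sring_sum sB _) => j _; exact: Bt.
have evb' : ev b' = kap j0.
  rewrite /b' ev_sum; last by move=> j _; exact: Bt.
  rewrite (bigD1 j0) //= subnn expr0 mulr1 evio big1 ?addr0 // => j /andP[jj0 jn].
  rewrite evM ?evio ?evX ?x0 //; last exact: sringX.
  rewrite expr0n subn_eq0; case: leqP => [h|_]; last by rewrite mulr0.
  by case/eqP: jn; apply/val_inj/eqP; rewrite eqn_leq h.
have Jx : J 1 (x ^+ j0 * b').
  have -> : x ^+ j0 * b' = \sum_j io (kap j) * x ^+ j.
    rewrite [RHS](bigID (fun j : 'I_M0.+1 => (j0 <= j)%N)) /= [X in _ + X]big1 ?addr0.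
      rewrite mulr_sumr; apply: eq_bigr => j jj0; rewrite mulrCA -exprD subnKC //.
    move=> j; rewrite -ltnNge => jj0; have [->|/jmin] := eqVneq (kap j) 0; first by rewrite rmorph0 mul0r.
    by rewrite leqNgt jj0.
  have -> : \sum_j io (kap j) * x ^+ j = \sum_i v i * \sum_j io (kap j) * y j i.
    transitivity (\sum_j (\sum_k io (kap j * c j k) * b0 k + \sum_i v i * (io (kap j) * y j i))).
      apply: eq_bigr => j _; rewrite {1}(hy j).2 mulrDr !mulr_sumr; congr (_ + _); apply: eq_bigr => k _.
        by rewrite rmorphM mulrA.
      by rewrite mulrCA.
    rewrite big_split /= exchange_big /= big1 ?add0r.
      by rewrite exchange_big /=; apply: eq_bigr => i _; rewrite mulr_sumr.
    by move=> k _; rewrite -mulr_suml -rmorph_sum hk rmorph0 mul0r.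
  exists (fun i => \sum_j io (kap j) * y j i); split=> // i; refine (sring_sum sB _) => j _.
  by apply: BM => //; case: (hy j).
exists j0, (io (kap j0)^-1 * b'); split.
- exact: BM.
- by rewrite evM // evio evb' mulVf.
- by rewrite mulrCA; apply: JM.
Qed.

Lemma conductor_b : exists c b, [/\ (0 < c)%N, B b, ev b = 1 & forall x, gpow B w c x -> J 1 (x * b)].
Proof.
have /choice [e /choice [b hb]] i := power_in_J (wB i) (evw i).
have [J0 JD JM] := gpow_amod v sB 1.
exists (\sum_i e i).+1, (\prod_i b i); split=> //.
- by refine (sring_prod sB _) => i _; have [] := hb i.
- rewrite ev_prod; last by move=> i _; have [] := hb i.
  by rewrite big1 // => i _; have [] := hb i.
apply: (pigeonhole sB wB (gpow_amod v sB 1)) => // i.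
rewrite (bigD1 i) //= mulrA mulrC; apply: JM; last by have [] := hb i.
by refine (sring_prod sB _) => j _; have [] := hb j.
Qed.

(** The locus $v=0$ may contain points other than the given one, and [E i] cuts them off inside [B]:
    it has value 1 at the point and is idempotent modulo $(v)^{2^i}$. The Newton iteration
    $E\mapsto3E^2-2E^3$ squares the defect $E(1-E)$. *)
Lemma idempotents : exists c (E : nat -> F), [/\ (0 < c)%N, forall i, B (E i), forall i, ev (E i) = 1,
  forall i, J (2 ^ i) (E i * (1 - E i)) /\ J (2 ^ i) (E i.+1 - E i) &
  forall i x, gpow B w c x -> J 1 (x * E i)].
Proof.
have [c [b [c0 Bb evb hb]]] := conductor_b.
have [B1 BD BN BM] := sB; have [J0 JD JM] := gpow_amod v sB 1.
have BB x y : B x -> B y -> B (x - y) by move=> Bx By; apply: (BD) => //; apply: BN.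
have Bn (k : nat) : B k%:R by rewrite -(rmorph_nat io); apply: Bio.
pose y := 1 - b ^+ c; have By : B y by apply: (BB) => //; apply: sringX.
pose s1 := \sum_(i < c) y ^+ i; have Bs1 : B s1 by refine (sring_sum sB _) => i _; apply: sringX.
pose s2 := \sum_(i < c) b ^+ i; have Bs2 : B s2 by refine (sring_sum sB _) => i _; apply: sringX.
(* The starting value is a multiple of $b^c$, and $1-b_0$ is a multiple of $(1-b)^c$. As $1-b$ lies
   in the maximal ideal, $b_0(1-b_0)$ falls into $(v)$ by the choice of [b]. *)
pose b0 := 1 - y ^+ c; have Bb0 : B b0 by apply: (BB) => //; apply: sringX.
have e1 : b0 = b ^+ c * s1.
  have : (y - 1) * s1 = y ^+ c - 1 by rewrite subrX1.
  have -> : y - 1 = - b ^+ c by rewrite /y; ring.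
  by rewrite /b0 => h; rewrite -[RHS]opprK -mulNr h; ring.
have e2 : 1 - b0 = (1 - b) ^+ c * s2 ^+ c.
  have : (b - 1) * s2 = b ^+ c - 1 by rewrite subrX1.
  move=> h; have -> : 1 - b0 = y ^+ c by rewrite /b0; ring.
  by rewrite -exprMn; congr (_ ^+ _); rewrite /y -[RHS]opprK -mulNr -[- (1 - b)]/(- (1 - b)) opprB h opprB.
have Ebc : b ^+ c = b ^+ c.-1 * b by rewrite -exprSr prednK.
pose E := fix E i := if i is i'.+1 then E i' * (3%:R * E i' - 2%:R * E i' ^+ 2) else b0.
have BE i : B (E i).
  elim: i => //= i IH; apply: (BM) => //; apply: (BB); apply: (BM) => //; exact: sringX.
have evE i : ev (E i) = 1.
  have evBB x z : B x -> B z -> ev (x - z) = ev x - ev z.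
    by move=> Bx Bz; rewrite evD ?evN //; apply: BN.
  have evn (k : nat) : ev k%:R = k%:R by rewrite -(rmorph_nat io) evio.
  elim: i => /= [|i IH].
    rewrite /b0 evBB ?ev1 ?evX //; last exact: sringX.
    rewrite /y evBB ?ev1 ?evX //; last exact: sringX.
    by rewrite evb expr1n subrr expr0n eqn0Ngt c0 subr0.
  rewrite evM ?evBB ?evM ?evn ?evX ?IH //; try (exact: sringX); try (by apply: BM => //; exact: sringX).
    by ring.
  by apply: BB; apply: BM => //; exact: sringX.
have hEE i : J (2 ^ i) (E i * (1 - E i)).
  elim: i => [|i IH].
    rewrite expn0 -[E 0%N]/b0 e2 e1.
    have -> : b ^+ c * s1 * ((1 - b) ^+ c * s2 ^+ c) = (b ^+ c.-1 * s1 * s2 ^+ c) * ((1 - b) ^+ c * b).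
      by rewrite Ebc; ring.
    apply: JM; first by apply: (BM); [apply: (BM) => //|]; exact: sringX.
    apply: hb; have h1b : gpow B w 1 (1 - b).
      by apply: ev_gpowB; [exact: BB|rewrite evD ?evN ?ev1 ?evb ?subrr //; exact: BN].
    by have := gpowX sB c h1b; rewrite muln1.
  change (E i.+1) with (E i * (3%:R * E i - 2%:R * E i ^+ 2)).
  set e := E i in IH *.
  have -> : e * (3%:R * e - 2%:R * e ^+ 2) * (1 - e * (3%:R * e - 2%:R * e ^+ 2)) =
    ((3%:R - 2%:R * e) * (1 + 2%:R * e)) * ((e * (1 - e)) * (e * (1 - e))) by ring.
  have [_ _ h] := gpow_amod v sB (2 ^ i.+1); apply: h.
    by apply: (BM); [apply: (BB) => //; apply: (BM)|apply: (BD) => //; apply: (BM)]; rewrite ?/e.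
  by rewrite expnS mul2n -addnn; apply: gpowM.
exists c, E; split=> //.
- move=> i; split=> //=.
  have -> : E i * (3%:R * E i - 2%:R * E i ^+ 2) - E i = (2%:R * E i - 1) * (E i * (1 - E i)) by ring.
  have [_ _ h] := gpow_amod v sB (2 ^ i); apply: h => //.
  by apply: (BB) => //; apply: (BM).
elim=> [|i IH] x hx /=; last first.
  rewrite mulrA mulrC; apply: JM; last exact: IH.
  by apply: (BB); apply: (BM) => //; exact: sringX.
have -> : x * b0 = (b ^+ c.-1 * s1) * (x * b) by rewrite e1 Ebc; ring.
by apply: JM; [apply: BM => //; exact: sringX|exact: hb].
Qed.

Lemma gpow_add_ind (Q : set F) a b : amod B Q ->
  (forall x y, gpow B w a x -> gpow B w b y -> Q (x * y)) -> forall x, gpow B w (a + b) x -> Q x.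
Proof.
elim: a Q => [|a IH] Q aQ h x; first by move=> hx; rewrite -[x]mul1r; apply: h => //; have [] := sB.
move=> [y [hy ->]]; refine (amod_sum aQ _) => i _.
have [Q0 QD QM] := aQ.
apply: (IH [set z | Q (w i * z)]) (hy i).
  split=> /=; first by rewrite mulr0.
    by move=> c d hc hd; rewrite mulrDr; apply: QD.
  by move=> c d Bc hd; rewrite mulrCA; apply: QM.
by move=> c d hc hd /=; rewrite mulrA; apply: h => //; apply: gpow_gen.
Qed.

Lemma mmap1_gpow (A : set F) (r : nat) (g : 'I_r -> F) (a : multinom r) : sring A ->
  gpow A g (mdeg a) (mmap1 g a).
Proof.
move=> sA; have [q] := ubnP (mdeg a); elim: q a => // q IH a ha.
case E : (mdeg a) => [|k].
  by move/eqP: E; rewrite mdeg_eq0 => /eqP ->; rewrite mmap11; have [] := sA.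
have [i [a' [-> da']]] := mdegS_split E.
rewrite mmap1D mmap1U; apply: (gpow_gen sA).
by rewrite -da'; apply: IH; rewrite da' -ltnS -E.
Qed.

Lemma mmap_gpow (A : set F) (r : nat) (g : 'I_r -> F) (p : mpoly r K) k : sring A ->
  (forall c, A (io c)) -> (forall i, A (g i)) -> ordz k p -> gpow A g k (mmap io g p).
Proof.
move=> sA Aio gA hp; rewrite /mmap big_seq; refine (amod_sum (gpow_amod g sA k) _) => a ap.
have [_ _ h] := gpow_amod g sA k; apply: h => //.
apply: (@gpow_leq _ _ _ _ sA gA _ (mdeg a)); last exact: mmap1_gpow.
rewrite leqNgt; apply/negP => /hp; move/eqP; rewrite mcoeff_eq0.
by rewrite ap.
Qed.

Variables (e : nat) (be : 'I_e -> F) (g : F).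
Hypotheses (g0 : g != 0) (gB : B g) (beB : forall j, B (be j)).
Hypothesis C1 : forall z, B z -> exists q : 'I_e -> mpoly m K, g * z = \sum_j pv (q j) * be j.
Hypothesis C2 : forall q : 'I_e -> mpoly m K, \sum_j pv (q j) * be j = 0 -> forall j, q j = 0.

Lemma coordJ k z : J k z ->
  exists q : 'I_e -> mpoly m K, (forall j, ordz k (q j)) /\ g * z = \sum_j pv (q j) * be j.
Proof.
elim: k z => [|k IH] z; first by move=> /C1 [q hq]; exists q; split.
move=> [y [hy ->]]; have /choice [q hq] i := IH _ (hy i).
exists (fun j => \sum_i mpolyX K (mnm1 i) * q i j); split=> [j|].
  have h : forall i, ordz k.+1 (mpolyX K (mnm1 i) * q i j).
    by move=> i; rewrite -add1n; apply: ordzM; [exact: ordzX|case: (hq i)].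
  by elim/big_ind: _ => [|p p' hp hp'|i _]; [exact: ordz0|exact: ordzD|exact: h].
under [RHS]eq_bigr do rewrite raddf_sum mulr_suml.
rewrite exchange_big /= mulr_sumr; apply: eq_bigr => i _.
rewrite mulrCA {1}(hq i).2 mulr_sumr; apply: eq_bigr => j _.
by rewrite rmorphM /= mmapX mmap1U mulrA.
Qed.

Lemma coord_uniq (q q' : 'I_e -> mpoly m K) :
  \sum_j pv (q j) * be j = \sum_j pv (q' j) * be j -> forall j, q j = q' j.
Proof.
move=> h j; apply/eqP; rewrite -subr_eq0; apply/eqP; apply: (C2 (q := fun j => q j - q' j)).
under eq_bigr do rewrite rmorphB mulrBl.
by rewrite sumrB h subrr.
Qed.

Hypothesis nR : noetherian R.

(** If $p(v)$ lies in the power $ck$ of the maximal ideal, then $p(v)E_i$ lies in $(v)^k$. Its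
    coordinates on the basis [be], after multiplication by [g], are [p] times those of $gE_i$;
    dividing out a fixed nonzero coefficient of the latter costs only the constant [o]. *)
Lemma order_linear : exists o c, (0 < c)%N /\
  forall k p, M (c * k) (pv p) -> ordz (k - o) p.
Proof.
have [c [E [c0 BE evE hE hw]]] := idempotents.
have [B1 BD BN BM] := sB.
have /choice [pi hpi] i := C1 (BE i).
have JM k x : J k x -> M k x.
  elim: k x => [|k IH] x; first exact: locring_B.
  move=> [y [hy ->]]; refine (amod_sum (gpow_amod w sR k.+1) _) => i _.
  apply: (@gpowM _ _ _ w sR 1 k); last by apply: IH; exact: hy.
  by apply/gpowBR/ev_gpowB.
(* If no coordinate of $gE_i$ had such a coefficient, $gE_k$ would lie in $(v)^{2^k}$ for all [k];
   as $E_k$ is a unit at the point, Krull's theorem would give $g=0$. *)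
have [[i0 [j0 [a0 [ha0 hpa0]]]]|hno] := pselect (exists i j a, (mdeg a < 2 ^ i)%N /\ mcoeff a (pi i j) != 0);
  last first.
  exfalso; have : g = 0; last by apply/eqP.
  have i0 : is_ideal R [set 0].
    split=> [x ->||x y -> ->|a x _ ->] //=; rewrite ?addr0 ?mulr0 //.
    exact: sring0.
  apply: (krull_intersection sR nR (fun i => wR i) jac_M1 i0) => k.
  exists 0, g; split=> //; last by rewrite add0r.
  apply: (@gpow_leq _ _ _ _ sR wR _ (2 ^ k)); first exact: ltnW (ltn_expl _ _).
  have -> : g = (E k)^-1 * (g * E k) by rewrite mulrCA mulVf ?mulr1 // ev_neq0 // evE oner_eq0.
  have [_ _ h] := gpow_amod w sR (2 ^ k); apply: h.
    by apply: locring_V => //; rewrite evE oner_eq0.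
  apply: JM; rewrite hpi; refine (amod_sum (gpow_amod v sB (2 ^ k)) _) => j _.
  rewrite mulrC; have [_ _ h'] := gpow_amod v sB (2 ^ k); apply: h' => //.
  apply: mmap_gpow => // a ha; apply/eqP; apply: contraT => hh; exfalso.
  by apply: hno; exists k, j, a.
exists (mdeg a0), c; split=> // k p /(gpow_contract _) hp.
have Bpv : B (pv p) by apply: (@mmap_gpow B m v p 0).
have {}hp := hp Bpv.
pose i := maxn i0 k.
have ki : (k <= 2 ^ i)%N by apply: leq_trans (leq_maxr i0 k) _; exact: ltnW (ltn_expl _ _).
have [J0 JD JMk] := gpow_amod v sB k.
have hk : forall k x, gpow B w (c * k) x -> J k (x * E i ^+ k).
  elim=> [|l IH] x; first by rewrite muln0 expr0 mulr1.
  rewrite mulnS; apply: (@gpow_add_ind [set x | J l.+1 (x * E i ^+ l.+1)]).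
    have [h0 h1 h2] := gpow_amod v sB l.+1; split=> /=; first by rewrite mul0r.
      by move=> x1 x2 hx1 hx2; rewrite mulrDl; apply: h1.
    by move=> x1 x2 hx1 hx2; rewrite -mulrA; apply: h2.
  move=> x1 x2 hx1 hx2 /=; rewrite exprS mulrACA.
  by apply: (@gpowM _ _ _ v sB 1 l); [exact: hw|exact: IH].
(* A power of [E i] can be replaced by [E i] itself: the difference is a multiple of the defect
   $E_i(1-E_i)$, which is in $(v)^{2^i}$ and $k\le2^i$. *)
have hpE : J k (pv p * E i).
  have := hk k _ hp; case: (k) ki => [_ _|l li hl]; first exact: BM.
  have -> : pv p * E i = pv p * E i ^+ l.+1 + (pv p * (\sum_(t < l) E i ^+ t)) * (E i * (1 - E i)).
    have : (E i - 1) * (\sum_(t < l) E i ^+ t) = E i ^+ l - 1 by rewrite subrX1.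
    set S := \sum_(t < l) _ => h; rewrite exprS.
    have -> : E i ^+ l = 1 + (E i - 1) * S by rewrite h; ring.
    ring.
  have [_ h1 h2] := gpow_amod v sB l.+1; apply: h1 => //; apply: h2.
    by apply: BM => //; refine (sring_sum sB _) => t _; apply: sringX.
  by apply: (gpow_leq sB vB li); case: (hE i).
have [q [hq1 hq2]] := coordJ hpE.
have Eq j : q j = p * pi i j.
  apply: (coord_uniq (q' := fun j => p * pi i j)); rewrite -hq2 mulrCA hpi mulr_sumr.
  by apply: eq_bigr => l _; rewrite rmorphM /= mulrA.
apply: (@ordz_div _ _ k _ p (pi i j0) a0) => //; first by rewrite -Eq.
(* From [i0] on the iterates agree modulo $(v)^{2^{i_0}}$, so the coefficient at [a0], of degree
   less than $2^{i_0}$, is the same for [E i] and [E i0]. *)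
have hd : J (2 ^ i0) (E i - E i0).
  rewrite /i; elim: (k) => [|l IH]; first by rewrite maxn0 subrr; have [] := gpow_amod v sB (2 ^ i0).
  have [li|li] := leqP i0 l; last first.
    have -> : maxn i0 l.+1 = i0 by apply/maxn_idPl.
    by rewrite subrr; have [] := gpow_amod v sB (2 ^ i0).
  move: IH; have -> : maxn i0 l.+1 = l.+1 by apply/maxn_idPr/leqW.
  have -> : maxn i0 l = l by apply/maxn_idPr.
  move=> IH; have -> : E l.+1 - E i0 = (E l.+1 - E l) + (E l - E i0) by ring.
  have [_ h1 _] := gpow_amod v sB (2 ^ i0); apply: h1 => //.
  apply: (@gpow_leq _ _ _ _ sB vB _ (2 ^ l)); first by rewrite leq_exp2l.
  by case: (hE l).
have [q' [hq'1 hq'2]] := coordJ hd.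
have : q' j0 = pi i j0 - pi i0 j0.
  apply: (coord_uniq (q' := fun j => pi i j - pi i0 j)); rewrite -hq'2 mulrBr !hpi -sumrB.
  by apply: eq_bigr => l _; rewrite rmorphB mulrBl.
move=> /(congr1 (mcoeff a0)); rewrite mcoeffB hq'1 // => /esym/eqP; rewrite subr_eq0 => /eqP ->.
exact: hpa0.
Qed.

Variable u : 'I_m -> F.
Hypotheses (uR : forall i, R (u i)) (ugen : gpow R u 1 = M 1).
Local Notation pu := (mmap io u).
Local Notation U := (gpow R u).

Lemma gpow_uw k : U k = M k.
Proof.
have h1 := module_powE (g := w) sR (erefl (gpow R w 1)) k.
have h2 := module_powE (g := u) sR (erefl (gpow R u 1)) k.
by rewrite -h1 -h2 ugen.
Qed.

Lemma expand k : forall z, R z -> exists p, U k (z - pu p).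
Proof.
elim: k => [|k IH] z Rz; first by exists 0; rewrite mmap0 subr0.
have [c] := locring_split Rz; rewrite -gpow_uw => -[y [hy E]].
have /choice [p hp] i := IH _ (hy i).
exists (mpolyC m c + \sum_i mpolyX K (mnm1 i) * p i), (fun i => y i - pu (p i)); split=> //.
rewrite mmapD mmapC raddf_sum /= opprD addrA E -sumrB; apply: eq_bigr => i _.
by rewrite rmorphM /= mmapX mmap1U mulrBr.
Qed.

Lemma expand_ord k q : forall z, U k z -> exists p, ordz k p /\ U q (z - pu p).
Proof.
elim: k => [|k IH] z; first by move=> /(expand q) [p hp]; exists p.
move=> [y [hy ->]]; have /choice [p hp] i := IH _ (hy i).
exists (\sum_i mpolyX K (mnm1 i) * p i); split.
  have h i : ordz k.+1 (mpolyX K (mnm1 i) * p i).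
    by rewrite -add1n; apply: ordzM; [exact: ordzX|case: (hp i)].
  by elim/big_ind: _ => [|p1 p2 hp1 hp2|i _]; [exact: ordz0|exact: ordzD|exact: h].
rewrite (raddf_sum (mmap io u)) /= -sumrB; refine (amod_sum (gpow_amod u sR q) _) => i _.
rewrite rmorphM /= mmapX mmap1U -mulrBr.
by have [_ _ h] := gpow_amod u sR q; apply: h => //; case: (hp i).
Qed.

(** A polynomial with a nonzero coefficient in low degree [e0] but deep vanishing in [u] can be
    corrected to some [th] that vanishes to any order [q]. Then the multiples of [th] by monomials
    of degree less than $q-e_0$, and the expansions in [u] of the monomials in [v] of degree less
    than $k'-o$ with the shift $o$ of [order_linear], would be independent among the polynomials
    truncated at [q]. For $q=ck'$ large there is no room for both. *)
Theorem order_independent k p : U k (pu p) -> ordz k p.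
Proof.
move=> hp a ha; apply/eqP; apply: contraT => pa; exfalso.
have [ord [c [c0 hoc]]] := order_linear.
pose e0 := mdeg a.
pose M' := ((2 * c) ^ m)%N.
have [X0 hX0] := growth M' (e0 + m + 2) m.
(* Large enough for [growth], for $k'\le2(k'-\mathrm{ord}-1)$ and for the truncated subtractions
   below. *)
pose k' := (X0 + k + 2 * ord + e0 + 10)%N.
pose q := (c * k')%N.
have kq : (k' <= q)%N by rewrite /q leq_pmull.
have [psi [hpsi1 hpsi2]] := expand_ord q hp.
pose th := p - psi.
have tha : mcoeff a th != 0 by rewrite /th mcoeffB hpsi1 ?subr0.
have hth : U q (pu th) by rewrite /th rmorphB.
have /choice [P hP] (al : bmultinom m (k' - ord)) := expand q (locring_B (gpow_sub_A sB vB (mmap1_gpow v (bmnm al) sB))).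
have [hlt|hle] := ltnP #|{: bmultinom m q}| #|{: bmultinom m (k' - ord) + bmultinom m (q - e0)}|.
  have [cc [ii hii] hcc] := @lin_dep K _ _ (fun (i : bmultinom m (k' - ord) + bmultinom m (q - e0)) (ga : bmultinom m q) =>
    match i with inl al => mcoeff (bmnm ga) (P al) | inr b => mcoeff (bmnm ga) (th * mpolyX K (bmnm b)) end) hlt.
  pose pa' := \sum_(al : bmultinom m (k' - ord)) cc (inl al) *: P al.
  pose pb := \sum_(b : bmultinom m (q - e0)) cc (inr b) *: mpolyX K (bmnm b).
  have ho : ordz q (pa' + th * pb).
    move=> ga hga; have := hcc (BMultinom hga); rewrite big_sumType /= => h.
    rewrite mcoeffD -[RHS]h /pa' /pb mulr_sumr !raddf_sum /=; congr (_ + _); apply: eq_bigr => i _.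
      by rewrite mcoeffZ.
    by rewrite -scalerAr mcoeffZ.
  have [U0 UD UM] := gpow_amod u sR q.
  have hpa : U q (pu pa').
    have -> : pu pa' = pu (pa' + th * pb) + (- pu pb) * pu th by rewrite rmorphD rmorphM /=; ring.
    apply: UD; first by apply: mmap_gpow => // x; exact: locring_io.
    apply: UM => //; have [_ _ RN _] := sR; apply: RN.
    by apply: (@mmap_gpow R m u pb 0) => // x; exact: locring_io.
  pose pal := \sum_(al : bmultinom m (k' - ord)) cc (inl al) *: mpolyX K (bmnm al).
  have : ordz (k' - ord) pal.
    apply: hoc; rewrite -/q -gpow_uw.
    have -> : pv pal = \sum_al io (cc (inl al)) * (mmap1 v (bmnm al) - pu (P al)) + pu pa'.
      rewrite /pal /pa' !raddf_sum -big_split /=; apply: eq_bigr => al _.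
      by rewrite !mmapZ mmapX mulrBr subrK.
    apply: UD => //; refine (amod_sum (gpow_amod u sR q) _) => al _.
    by apply: UM; [exact: locring_io|exact: hP].
  move=> hal.
  have coefb N (f : bmultinom m N -> K) (b : bmultinom m N) :
      mcoeff (bmnm b) (\sum_x f x *: mpolyX K (bmnm x)) = f b.
    rewrite raddf_sum (bigD1 b) //= mcoeffZ mcoeffX eqxx mulr1 big1 ?addr0 // => x xb.
    by rewrite mcoeffZ mcoeffX -bmeqP (negbTE xb) mulr0.
  have cal al : cc (inl al) = 0 by rewrite -(coefb _ (fun al => cc (inl al))) hal // bmdeg.
  have pa'0 : pa' = 0 by rewrite /pa' big1 // => al _; rewrite cal scale0r.
  have hpb : ordz (q - e0) pb.
    apply: (@ordz_div _ _ q _ pb th a) => //; by move: ho; rewrite pa'0 add0r mulrC.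
  have cb b : cc (inr b) = 0 by rewrite -(coefb _ (fun b => cc (inr b))) hpb // bmdeg.
  by move: hii; case: ii => [al|b]; rewrite ?cal ?cb eqxx.
have k'ord : (0 < k' - ord)%N by rewrite /k'; lia.
have qe : (0 < q - e0)%N by rewrite subn_gt0; apply: leq_trans kq; rewrite /k'; lia.
have q0 : (0 < q)%N by apply: leq_trans kq; rewrite /k'; lia.
have cN N : (0 < N)%N -> #|{: bmultinom m N}| = 'C(N.-1 + m, N.-1) by case: N => // N _; exact: card_bmultinom.
move: hle; rewrite card_sum !cN // => hle.
have /andP[h1 _] := bin_bounds (k' - ord).-1 m.
have /andP[h2 _] := bin_bounds (q - e0).-1 m.
have /andP[_ h3] := bin_bounds q.-1 m.
(* If there is no dependence, both families fit into the truncated polynomials. The first is at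
   least the fraction $1/(2c)^m$ of $X^m$ with $X=q-e_0-1$, which [growth] rules out. *)
have hsum : ((k' - ord).-1 ^ m + (q - e0).-1 ^ m <= (q.-1 + m) ^ m)%N.
  apply: leq_trans (leq_add h1 h2) _; rewrite -mulnDr; apply: leq_trans h3.
  by rewrite leq_mul2l hle orbT.
pose X := (q - e0).-1.
have hX : (X0 <= X)%N by rewrite /X; move: (q) kq => q1; rewrite /k'; lia.
have := hX0 X hX; rewrite ltnNge => /negP; apply.
have hX1 : (X ^ m <= M' * (k' - ord).-1 ^ m)%N.
  rewrite /M' -expnMn; case: (m) => // m'; rewrite leq_exp2r //.
  have h : (k' <= 2 * (k' - ord).-1)%N by rewrite /k'; lia.
  apply: (@leq_trans q); first by rewrite /X (leq_trans (leq_pred _)) // leq_subr.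
  by rewrite -mulnA mulnCA leq_mul2l h orbT.
rewrite mulSn; apply: leq_trans (leq_add hX1 (leqnn _)) _.
rewrite -mulnDr; apply: leq_trans (leq_mul (leqnn _) hsum) _.
rewrite leq_mul2l; apply/orP; right; case: (m) => // m'; rewrite leq_exp2r // /X.
by move: (q) q0 qe => q1; lia.
Qed.

End Finite.
End LocalRing.

End Vanishing.

Module RationalPoint.
Import Sumset Embedding Normalization Coordinates NoetherianLocal Vanishing.

(** * Rational points of a graded domain *)

Local Notation homog q := (ishomog1 q mdeg).

Lemma mmap_comp (K F : fieldType) (io : {rmorphism K -> F}) r s (v : 'I_s -> F)
    (h : 'I_r -> mpoly s K) (p : mpoly r K) :
  mmap io v (mmap (@mpolyC s K) h p) = mmap io (fun i => mmap io v (h i)) p.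
Proof.
rewrite [mmap (@mpolyC s K) h p]/mmap (raddf_sum (mmap io v)) /=; apply: eq_bigr => a _.
rewrite rmorphM /= mmapC; congr (_ * _); rewrite /mmap1 rmorph_prod /=.
by apply: eq_bigr => i _; rewrite rmorphXn.
Qed.

Lemma mmap_scale_homog (K F : fieldType) (io : {rmorphism K -> F}) r (z : 'I_r -> F) (x : F)
    q (p : mpoly r K) : x != 0 -> p \is homog q ->
  mmap io (fun i => z i / x) p = mmap io z p / x ^+ q.
Proof.
move=> x0 hp; rewrite /mmap mulr_suml big_seq [RHS]big_seq; apply: eq_bigr => a ap.
have Ea : mdeg a = q := dhomog_mf hp ap.
rewrite -mulrA; congr (_ * _); rewrite /mmap1 -Ea mdegE.
rewrite -prodrXr -prodfV -big_split /=; apply: eq_bigr => i _.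
by rewrite expr_div_n.
Qed.

Definition lift_mon m D (a : multinom m) : multinom m.+1 :=
  Multinom [tuple (if unlift ord0 i is Some j then a j else D - mdeg a)%N | i < m.+1].

Lemma lift_monS m D (a : multinom m) j : lift_mon D a (lift ord0 j) = a j.
Proof. by rewrite mnmE liftK. Qed.

Lemma lift_mon0 m D (a : multinom m) : lift_mon D a ord0 = (D - mdeg a)%N.
Proof. by rewrite mnmE unlift_none. Qed.

Lemma mdeg_lift_mon m D (a : multinom m) : (mdeg a <= D)%N -> mdeg (lift_mon D a) = D.
Proof.
move=> aD; rewrite mdegE big_ord_recl lift_mon0.
by under eq_bigr do rewrite lift_monS; rewrite -mdegE subnK.
Qed.

Lemma lift_mon_inj m D (a b : multinom m) : lift_mon D a = lift_mon D b -> a = b.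
Proof. by move=> E; apply/mnmP => j; rewrite -(lift_monS D) E lift_monS. Qed.

Section RationalPoint.
Variables (K F : fieldType) (io : {rmorphism K -> F}) (n : nat) (X : 'I_n.+1 -> F).
Variable eta : 'I_n.+1 -> K.
Local Notation cl := (mmap io X).
Local Notation S := (S io X).
Hypothesis charK : forall a b : nat, a%:R = b%:R :> K -> a = b.
Hypothesis eta_ker : forall f, cl f = 0 -> meval eta f = 0.
Hypothesis eta_neq0 : exists i, eta i != 0.

Lemma meval_cl f g : cl f = cl g -> meval eta f = meval eta g.
Proof.
move=> h; apply/eqP; rewrite -subr_eq0 -mevalB; apply/eqP/eta_ker.
by rewrite mmapB h subrr.
Qed.

Lemma meval_hom_Xi i : mpolyX K (mnm1 i : multinom n.+1) \is homog 1.
Proof. by have := homogX_mon K (mnm1 i : multinom n.+1); rewrite mdeg1. Qed.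

(** Some form of the normalization is nonzero at [eta], since the forms generate all powers
    $X_i^{N+1}$ and some $X_i$ does not vanish there. It is scaled to value 1, and multiples of it
    are subtracted from the others to make them vanish at [eta]. *)
Lemma point_normalization : exists m (l : 'I_m.+1 -> mpoly n.+1 K),
  [/\ (forall i, l i \is homog 1), meval eta (l ord0) = 1,
      (forall i, meval eta (l (lift ord0 i)) = 0),
      finz io X (fun i => cl (l i)) & zfree io (fun i => cl (l i))].
Proof.
have [r [z [hz hfree]]] := noether_normalization io X charK.
have [hz1 [N hN]] := hz.
have /choice [l hl] i : exists l, l \is homog 1 /\ z i = cl l.
  by have [l h1 h2] := hz1 i; exists l.
have [i0 hi0] : exists i0, meval eta (l i0) != 0.
  apply: contrapT => hno; have [i ei] := eta_neq0.
  have [y [hy E]] := hN N (X i ^+ N.+1) (leqnn _) (S_exp1 _ (S_X io X i)).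
  have /choice [f hf] j : exists f, y j = cl f by have [f _ h] := hy j; exists f.
  have : meval eta (mpolyX K (mnm1 i) ^+ N.+1) = meval eta (\sum_j l j * f j).
    apply: meval_cl; rewrite rmorphXn /= mmapX mmap1U E raddf_sum /=.
    by apply: eq_bigr => j _; rewrite rmorphM /= -hf (hl j).2.
  rewrite rmorphXn /= mevalXU raddf_sum big1 /=; last first.
    move=> j _; rewrite mevalM; suff -> : meval eta (l j) = 0 by rewrite mul0r.
    by apply/eqP; apply: contraT => h; exfalso; apply: hno; exists j.
  by move/eqP; rewrite expf_eq0 (negbTE ei).
case: r z hz hfree hz1 N hN l hl i0 hi0 => [|m] z hz hfree hz1 N hN l hl i0 hi0; first by case: i0 hi0.
pose c i := meval eta (l i).
pose tau := tperm ord0 i0.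
pose l0 := (c i0)^-1 *: l i0.
pose l' j := if j == ord0 then l0 else l (tau j) - c (tau j) *: l0.
have hl0 : l0 \is homog 1 by rewrite dhomogZ //; case: (hl i0).
have hl' j : l' j \is homog 1.
  rewrite /l'; case: eqP => // _; have [h _] := hl (tau j).
  by apply: rpredB => //; rewrite dhomogZ.
have ml0 : meval eta l0 = 1 by rewrite mevalZ mulVf.
have fin' : finz io X (fun i => cl (l' i)).
  pose Mx (i j : 'I_m.+1) : K := (j == tau i)%:R * (if i == i0 then c i0 else 1) +
     (j == ord0)%:R * (if i == i0 then 0 else c i).
  apply: (@finz_iso _ _ io _ X _ z (fun i => cl (l' i)) Mx) => // [i|i].
    by exists (l' i).
  under eq_bigr do rewrite rmorphD !rmorphM !rmorph_nat mulrDl.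
  rewrite big_split /= (bigD1 (tau i)) //= eqxx mul1r big1 ?addr0; last first.
    by move=> j /negbTE ->; rewrite !mul0r.
  rewrite (bigD1 ord0) //= mul1r big1 ?addr0; last by move=> j /negbTE ->; rewrite !mul0r.
  have [->|ii0] := eqVneq i i0.
    rewrite rmorph0 mul0r addr0 /tau tpermR /l' eqxx /l0 mmapZ -(hl i0).2 mulrA -rmorphM mulfV //.
    by rewrite rmorph1 mul1r.
  have ti : tau i != ord0.
    by apply: contraNneq ii0 => h; apply/eqP; rewrite -(tpermK ord0 i0 i) -/tau h tpermL.
  rewrite rmorph1 mul1r {1}/l' (negbTE ti) /tau tpermK -/tau mmapB mmapZ -(hl i).2 /l' eqxx.
  by rewrite subrK.
exists m, l'; split=> //; last exact: hfree.
by move=> i; rewrite /l' /= mevalB mevalZ ml0 mulr1 subrr.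
Qed.

Variables (m : nat) (l : 'I_m.+1 -> mpoly n.+1 K).
Hypotheses (hl : forall i, l i \is homog 1) (l0_eta : meval eta (l ord0) = 1)
  (lS_eta : forall i, meval eta (l (lift ord0 i)) = 0)
  (lfin : finz io X (fun i => cl (l i))) (lfree : zfree io (fun i => cl (l i))).

Let x0 := cl (l ord0).
Let z i := cl (l i).

Lemma x0_neq0 : x0 != 0.
Proof. by apply/eqP => /eta_ker; rewrite l0_eta => /eqP; rewrite oner_eq0. Qed.
Let x0n := x0_neq0.

Lemma S_x0 : S 1 x0. Proof. by exists (l ord0). Qed.
Lemma S_z i : S 1 (z i). Proof. by exists (l i). Qed.

Definition BD (D : nat) : set F := [set y | S D (y * x0 ^+ D)].
Definition Bring : set F := [set y | exists D, BD D y].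

Lemma BD_ksub D : ksub io (BD D).
Proof.
have [S0 SD SZ] := S_ksub io X D; split=> [|x y|c x] /=; rewrite /BD /=.
- by rewrite mul0r.
- by move=> hx hy; rewrite mulrDl; apply: SD.
- by move=> hx; rewrite -mulrA; apply: SZ.
Qed.

Lemma BD_div D s : S D s -> BD D (s / x0 ^+ D).
Proof. by rewrite /BD /= divfK // expf_neq0. Qed.

Lemma BD_leq D D' y : (D <= D')%N -> BD D y -> BD D' y.
Proof.
move=> /subnKC <- hy; rewrite /BD /= exprD mulrA; apply: S_M => //.
by apply: S_exp1; exact: S_x0.
Qed.

Lemma BDM D D' y y' : BD D y -> BD D' y' -> BD (D + D') (y * y').
Proof. by rewrite /BD /= exprD mulrACA; apply: S_M. Qed.

Lemma BDX D y k : BD D y -> BD (k * D) (y ^+ k).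
Proof.
move=> hy; elim: k => [|k IH]; last by rewrite exprS mulSn; apply: BDM.
by rewrite /BD /= expr0 mulr1; apply: S_1.
Qed.

Lemma BD_io D c : BD D (io c).
Proof. by apply: (@BD_leq 0) => //; rewrite /BD /= expr0 mulr1; apply: S_io. Qed.

Lemma B_sring : sring Bring.
Proof.
split.
- by exists 0%N; rewrite -(rmorph1 io); apply: BD_io.
- move=> x y [D hx] [D' hy]; exists (maxn D D'); have [_ h _] := BD_ksub (maxn D D').
  by apply: h; [apply: BD_leq hx|apply: BD_leq hy]; rewrite ?leq_maxl ?leq_maxr.
- by move=> x [D hx]; exists D; have [_ _ h] := BD_ksub D; rewrite -mulN1r -(rmorphN1 io); apply: h.
- by move=> x y [D hx] [D' hy]; exists (D + D')%N; apply: BDM.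
Qed.

Lemma B_io c : Bring (io c). Proof. by exists 0%N; apply: BD_io. Qed.

Definition evB (y : F) : K :=
  if pselect (exists f D, f \is homog D /\ y = cl f / x0 ^+ D) is left h
  then meval eta (projT1 (cid h)) else 0.

Lemma evBE f D : f \is homog D -> evB (cl f / x0 ^+ D) = meval eta f.
Proof.
move=> hf; rewrite /evB; case: pselect => [h|[]]; last by exists f, D.
case: cid => g /= [D' [hg E]].
have : meval eta (f * l ord0 ^+ D') = meval eta (g * l ord0 ^+ D).
  apply: meval_cl; rewrite !rmorphM !rmorphXn /= -/x0.
  by move/eqP: E; rewrite eqr_div ?expf_neq0 // => /eqP.
by rewrite !mevalM !rmorphXn /= l0_eta !expr1n !mulr1.
Qed.

Lemma B_rep y : Bring y -> exists f D, f \is homog D /\ y = cl f / x0 ^+ D.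
Proof. by move=> [D [f hf E]]; exists f, D; rewrite -E mulfK ?expf_neq0. Qed.

Lemma B_rep2 y y' : Bring y -> Bring y' -> exists f f' D,
  [/\ f \is homog D, f' \is homog D, y = cl f / x0 ^+ D & y' = cl f' / x0 ^+ D].
Proof.
move=> [D hy] [D' hy'].
have [f hf E] := BD_leq (leq_maxl D D') hy.
have [f' hf' E'] := BD_leq (leq_maxr D D') hy'.
by exists f, f', (maxn D D'); rewrite -E -E' !mulfK ?expf_neq0.
Qed.

Lemma evB_D x y : Bring x -> Bring y -> evB (x + y) = evB x + evB y.
Proof.
move=> hx hy; have [f [f' [D [hf hf' -> ->]]]] := B_rep2 hx hy.
by rewrite -mulrDl -mmapD !evBE ?mevalD // dhomogD.
Qed.

Lemma evB_M x y : Bring x -> Bring y -> evB (x * y) = evB x * evB y.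
Proof.
move=> hx hy; have [f [f' [D [hf hf' -> ->]]]] := B_rep2 hx hy.
by rewrite mulf_div -rmorphM -exprD !evBE ?mevalM // dhomogM.
Qed.

Lemma evB_io c : evB (io c) = c.
Proof.
have -> : io c = cl (mpolyC n.+1 c) / x0 ^+ 0 by rewrite expr0 divr1 mmapC.
by rewrite evBE ?mevalC // -[mpolyC _ _]mulr1 mul_mpolyC dhomogZ // dhomog1.
Qed.

Definition wB (i : 'I_n.+1) : F := X i / x0 - io (eta i).

Lemma wB_rep i : wB i = cl (mpolyX K (mnm1 i) - eta i *: l ord0) / x0 ^+ 1.
Proof. by rewrite expr1 mmapB mmapX mmap1U mmapZ mulrBl -/x0 mulfK. Qed.

Let hom_w i : mpolyX K (mnm1 i) - eta i *: l ord0 \is homog 1.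
Proof. by apply: rpredB; [exact: meval_hom_Xi|rewrite dhomogZ]. Qed.

Lemma wB_B1 i : BD 1 (wB i).
Proof. by rewrite wB_rep; apply: BD_div; exists (mpolyX K (mnm1 i) - eta i *: l ord0). Qed.

Lemma wB_B i : Bring (wB i). Proof. by exists 1%N; exact: wB_B1. Qed.

Lemma evB_w i : evB (wB i) = 0.
Proof. by rewrite wB_rep evBE // mevalB mevalXU mevalZ l0_eta mulr1 subrr. Qed.

Lemma BD_succ D y : BD D.+1 y -> exists y' : 'I_n.+1 -> F,
  (forall i, BD D (y' i)) /\ y = \sum_i (X i / x0) * y' i.
Proof.
move=> hy; have [s [hs E]] := S_succ hy.
exists (fun i => s i / x0 ^+ D); split=> [i|]; first exact: BD_div.
have -> : y = (y * x0 ^+ D.+1) / x0 ^+ D.+1 by rewrite mulfK ?expf_neq0.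
rewrite E mulr_suml; apply: eq_bigr => i _; rewrite exprS.
by rewrite mulf_div.
Qed.

Lemma wB_gen y : Bring y ->
  exists y' : 'I_n.+1 -> F, (forall i, Bring (y' i)) /\ y - io (evB y) = \sum_i wB i * y' i.
Proof.
move=> [D]; have [B1 Badd BN BM] := B_sring; elim: D y => [|D IH] y hy.
  have [c E] : exists c, y = io c by apply: (@S_0P _ _ io _ X); move: hy; rewrite /BD /= expr0 mulr1.
  exists (fun=> 0); split=> [_|]; first exact: sring0 B_sring.
  by rewrite E evB_io subrr big1 // => i _; rewrite mulr0.
have [y' [hy' E]] := BD_succ hy.
have /choice [t ht] i := IH _ (hy' i).
have By' i : Bring (y' i) by exists D.
exists (fun j => y' j + \sum_i io (eta i) * t i j); split=> [j|].
  apply: Badd => //; refine (sring_sum B_sring _) => i _.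
  by apply: BM; [exact: B_io|case: (ht i)].
have Xw i : X i / x0 = wB i + io (eta i) by rewrite /wB subrK.
have -> : evB y = \sum_i eta i * evB (y' i).
  rewrite E (ev_sum B_sring evB_D evB_io); last first.
    by move=> i _; rewrite Xw; apply: BM => //; apply: Badd; [exact: wB_B|exact: B_io].
  apply: eq_bigr => i _; rewrite Xw evB_M //; last by apply: Badd; [exact: wB_B|exact: B_io].
  by rewrite evB_D ?evB_w ?evB_io ?add0r //; [exact: wB_B|exact: B_io].
rewrite E rmorph_sum -sumrB.
transitivity (\sum_i (wB i * y' i + io (eta i) * (y' i - io (evB (y' i))))).
  by apply: eq_bigr => i _; rewrite Xw rmorphM; ring.
rewrite big_split /=; under [RHS]eq_bigr do rewrite mulrDr.
rewrite [RHS]big_split /=; congr (_ + _).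
under eq_bigr do rewrite (ht _).2 mulr_sumr.
rewrite exchange_big /=; apply: eq_bigr => j _; rewrite mulr_sumr.
by apply: eq_bigr => i _; rewrite mulrCA.
Qed.

Definition vB (i : 'I_m) : F := z (lift ord0 i) / x0.

Lemma vB_rep i : vB i = cl (l (lift ord0 i)) / x0 ^+ 1. Proof. by rewrite expr1. Qed.

Lemma vB_B i : Bring (vB i).
Proof. by exists 1%N; rewrite vB_rep; apply: BD_div; exact: S_z. Qed.

Lemma evB_v i : evB (vB i) = 0. Proof. by rewrite vB_rep evBE. Qed.

(** In the finiteness relation the summand with $z_0=x_0$ lowers the degree and is treated by
    induction; all other summands are multiples of the [vB i]. *)
Lemma vB_fin : exists M0 (b0 : 'I_M0 -> F), forall y, Bring y ->
  exists (c : 'I_M0 -> K) (t : 'I_m -> F), (forall i, Bring (t i)) /\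
    y = \sum_k io (c k) * b0 k + \sum_i vB i * t i.
Proof.
have [_ [N hN]] := lfin.
exists (size (mons n.+1 N)), (fun k => mmap1 X (nth mnm0 (mons n.+1 N) k) / x0 ^+ N) => y [D0 hD0].
have [_ Badd _ _] := B_sring.
have : BD (N + D0) y by apply: BD_leq hD0; exact: leq_addl.
elim: D0 y {hD0} => [|D IH] y.
  rewrite addn0 => -[f hf E].
  exists (fun k : 'I__ => mcoeff (nth mnm0 (mons n.+1 N) k) f), (fun=> 0); split=> [_|].
    exact: sring0 B_sring.
  rewrite [X in _ + X]big1 ?addr0; last by move=> i _; rewrite mulr0.
  have -> : y = (y * x0 ^+ N) / x0 ^+ N by rewrite mulfK ?expf_neq0.
  by rewrite E (mmap_mons io X hf) mulr_suml; apply: eq_bigr => k _; rewrite mulrA.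
rewrite addnS => hy; have [s [hs E]] := hN _ _ (leq_addr D N) hy.
have [c [t [ht Et]]] := IH (s ord0 / x0 ^+ (N + D)) (BD_div (hs ord0)).
exists c, (fun i => t i + s (lift ord0 i) / x0 ^+ (N + D)); split=> [i|].
  by apply: Badd => //; exists (N + D)%N; apply: BD_div.
under [X in _ + X]eq_bigr do rewrite mulrDr.
rewrite big_split /= addrA -Et.
have -> : y = (y * x0 ^+ (N + D).+1) / x0 ^+ (N + D).+1 by rewrite mulfK ?expf_neq0.
rewrite E big_ord_recl mulrDl exprS -/x0 -mulf_div mulfV // mul1r; congr (_ + _).
rewrite mulr_suml; apply: eq_bigr => i _.
by rewrite /vB /z mulf_div.
Qed.

Let dehom (p : mpoly m.+1 K) : mpoly m K :=
  mmap (@mpolyC m K) (fun i => if unlift ord0 i is Some j then mpolyX K (mnm1 j) else 1) p.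

Let dehomE q (p : mpoly m.+1 K) : p \is homog q ->
  mmap io vB (dehom p) = mmap io z p / x0 ^+ q.
Proof.
move=> hp; rewrite /dehom mmap_comp -(mmap_scale_homog io z x0n hp).
congr mmap; apply/funext => i; case: unliftP => [j ->|->].
  by rewrite mmapX mmap1U.
by rewrite rmorph1 mulfV.
Qed.

Let homogenize D (q : mpoly m K) : mpoly m.+1 K :=
  \sum_(a <- msupp q) mcoeff a q *: mpolyX K (lift_mon D a).

Let homogenizeP D (q : mpoly m K) : (msize q <= D)%N ->
  [/\ homogenize D q \is homog D, mmap io z (homogenize D q) = mmap io vB q * x0 ^+ D &
      homogenize D q = 0 -> q = 0].
Proof.
move=> hq.
have aD a : a \in msupp q -> (mdeg a <= D)%N.
  by move=> /msize_mdeg_lt /ltnW h; apply: leq_trans hq.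
split.
- rewrite /homogenize big_seq; apply: homog_sum => a /aD ad; rewrite dhomogZ //.
  by rewrite -{2}(mdeg_lift_mon ad); apply: homogX_mon.
- rewrite /homogenize (raddf_sum (mmap io z)) /= /mmap -/(mmap io z) mulr_suml big_seq [RHS]big_seq.
  apply: eq_bigr => a /aD ad; rewrite -/(mmap io z _) mmapZ mmapX -mulrA; congr (_ * _).
  rewrite /mmap1 big_ord_recl lift_mon0.
  under eq_bigr do rewrite lift_monS.
  have -> : x0 ^+ D = x0 ^+ (D - mdeg a) * x0 ^+ mdeg a by rewrite -exprD subnK.
  rewrite mulrCA; congr (_ * _).
  rewrite mdegE -prodrXr -big_split /=; apply: eq_bigr => i _.
  by rewrite /vB expr_div_n divfK // expf_neq0.
move=> h; apply/mpolyP => b; rewrite mcoeff0.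
have [bq|bq] := boolP (b \in msupp q); last by apply/eqP; rewrite mcoeff_eq0.
move/(congr1 (mcoeff (lift_mon D b))): h; rewrite mcoeff0 /homogenize raddf_sum /=.
rewrite (bigD1_seq b) ?msupp_uniq //= mcoeffZ mcoeffX eqxx mulr1 big1 ?addr0 // => a ab.
rewrite mcoeffZ mcoeffX; case: eqP => [/lift_mon_inj E|_]; last by rewrite mulr0.
by rewrite E eqxx in ab.
Qed.

Lemma B_coords : exists e (be : 'I_e -> F) (g : F) (c0 N : nat),
  [/\ (0 < e)%N, g != 0, Bring g, forall j, Bring (be j) &
  [/\ forall y, Bring y -> exists q : 'I_e -> mpoly m K, g * y = \sum_j mmap io vB (q j) * be j,
      forall q : 'I_e -> mpoly m K, \sum_j mmap io vB (q j) * be j = 0 -> forall j, q j = 0,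
      forall D, (e <= D)%N -> ind io (S D) (e * 'C(D - e + m, D - e)) &
      forall D r, (N <= D)%N -> ind io (S D) r -> (r <= e * 'C(D + c0 + m, D + c0))%N]].
Proof.
have [e [b [a [c0 [N [e0 a0 ha hb [h1 h2 h3 h4]]]]]]] := rank_theorem S_z lfree lfin.
exists e, b, (mmap io z a / x0 ^+ c0), c0, N; split=> //.
- rewrite mulf_neq0 ?invr_eq0 ?expf_neq0 //.
  by apply: contra_neq a0 => h; apply: (lfree ha); exact: h.
- by exists c0; apply: BD_div; apply: S_mmapl => // i; exact: S_z.
- by move=> j; have [q _ hq] := hb j; exists q.
split=> // [y [D hy]|q hq j].
  have hy' : S (N + D) (y * x0 ^+ (N + D)) by apply: BD_leq hy; exact: leq_addl.
  have [p [hp E]] := h2 _ _ (leq_addr D N) hy'.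
  exists (fun j => dehom (p j)).
  have -> : mmap io z a / x0 ^+ c0 * y = (mmap io z a * (y * x0 ^+ (N + D))) / x0 ^+ (N + D + c0).
    rewrite [x0 ^+ (N + D + c0)]exprD.
    have P0 : x0 ^+ (N + D) != 0 by rewrite expf_neq0.
    have Q0 : x0 ^+ c0 != 0 by rewrite expf_neq0.
    move: (x0 ^+ (N + D)) (x0 ^+ c0) P0 Q0 => P Q P0 Q0; field.
    by rewrite P0 Q0.
  rewrite E mulr_suml; apply: eq_bigr => j _.
  by rewrite (dehomE (hp j)) mulrAC.
(* All coefficients of the relation are homogenized to one common degree, where independence over
   the graded polynomial ring applies. *)
pose D := (\max_j msize (q j))%N.
have hD i : (msize (q i) <= D)%N by apply: leq_bigmax.
have [_ _ inj] := homogenizeP (hD j); apply: inj.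
apply: (h1 D (fun j => homogenize D (q j))) => [i|]; first by have [] := homogenizeP (hD i).
transitivity (x0 ^+ D * \sum_j mmap io vB (q j) * b j); last by rewrite hq mulr0.
rewrite mulr_sumr; apply: eq_bigr => i _; have [_ -> _] := homogenizeP (hD i).
by rewrite mulrAC mulrC.
Qed.

Lemma locring_point : locring Bring evB =
  [set y | exists D f g, [/\ f \is homog D, g \is homog D, meval eta g != 0 & y = cl f / cl g]].
Proof.
apply/seteqP; split=> y.
  move=> [a [b [Ba Bb b0 ->]]]; have [f [g [D [hf hg Ef Eg]]]] := B_rep2 Ba Bb.
  exists D, f, g; split=> //; first by rewrite -(evBE hg) -Eg.
  by rewrite Ef Eg invf_div mulrA divfK ?expf_neq0.
move=> [D [f [g [hf hg g0 ->]]]].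
exists (cl f / x0 ^+ D), (cl g / x0 ^+ D); split.
- by exists D; apply: BD_div; exists f.
- by exists D; apply: BD_div; exists g.
- by rewrite evBE.
by rewrite invf_div mulrA divfK ?expf_neq0.
Qed.

Theorem point_order_independent (u : 'I_m -> F) k p :
  noetherian (locring Bring evB) -> (forall i, locring Bring evB (u i)) ->
  gpow (locring Bring evB) u 1 = gpow (locring Bring evB) wB 1 ->
  gpow (locring Bring evB) u k (mmap io u p) -> ordz k p.
Proof.
move=> nR uR ugen; have [e [be [g [c0 [N [e0 g0 gB beB [C1 C2 _ _]]]]]]] := B_coords.
exact: (order_independent B_sring B_io evB_D evB_M evB_io wB_B evB_w wB_gen vB_B evB_v vB_fin
  g0 beB C1 C2 nR uR ugen).
Qed.

End RationalPoint.

End RationalPoint.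

Module Valuation.
Import Sumset Embedding Normalization Coordinates NoetherianLocal Vanishing.

(** * The leading exponent valuation and growth of graded subspaces *)

Local Arguments gpow {F} A {s} g k : simpl never.

Lemma val_mnmD m (a b : multinom m) :
  val (mnm_add a b) = addv (val a) (val b) :> seq nat.
Proof.
apply: (@eq_from_nth _ 0%N).
  by rewrite size_tuple /addv size_map size_zip !size_tuple minnn.
move=> i; rewrite size_tuple => im.
have E (c : multinom m) : nth 0%N (val c) i = c (Ordinal im) by rewrite (mnm_nth 0%N).
rewrite E mnmDE /addv (nth_map (0%N, 0%N)) ?size_zip ?size_tuple ?minnn //.
by rewrite nth_zip ?size_tuple //= !E.
Qed.

Lemma sumset_bound m Mb j (A C : seq (multinom m)) : (0 < j)%N -> uniq A ->
  (forall a, a \in A -> (mdeg a <= Mb)%N) -> uniq C ->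
  (forall s : seq (multinom m), size s = j -> (forall a, a \in s -> a \in A) ->
     foldr (@mnm_add m) mnm0 s \in C) ->
  (j ^ m * size A <= size C + j ^ m * (m * Mb.+1 ^ m.-1))%N.
Proof.
move=> j0 uA hA uC hC; pose f (a : multinom m) : seq nat := val a.
have finj : injective f by move=> a b /val_inj/val_inj.
rewrite -(size_map f A) -(size_map f C); apply: sumset_card => //.
- by rewrite map_inj_uniq.
- move=> _ /mapP[a /hA aM ->]; split; first by rewrite size_tuple.
  apply/allP => x /(nthP 0%N) [i]; rewrite size_tuple => im <-.
  rewrite /geq /=; apply: leq_trans aM.
  have -> : nth 0%N (f a) i = a (Ordinal im) by rewrite (mnm_nth 0%N).
  by rewrite mdegE (bigD1 (Ordinal im)) //= leq_addr.
- by rewrite map_inj_uniq.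
suff h t : forall j, jsum m (fun a => a \in map f A) j t ->
    exists s : seq (multinom m), [/\ size s = j, forall a, a \in s -> a \in A & t = f (foldr (@mnm_add m) mnm0 s)].
  by move=> t /h [s [ss sA ->]]; rewrite map_f // hC.
move: t => + i; elim: i => [|i IH] t /=.
  move=> ->; exists [::]; split=> //; apply: (@eq_from_nth _ 0%N); rewrite size_nseq ?size_tuple //.
  move=> i im; rewrite nth_nseq im.
  have -> : nth 0%N (f mnm0) i = (mnm0 : multinom m) (Ordinal im) by rewrite (mnm_nth 0%N).
  by rewrite mnm0E.
move=> [x [t' [/mapP[a aA ->] /IH [s [ss sA ->]] ->]]].
exists (a :: s); split; [by rewrite /= ss|by move=> b; rewrite inE => /orP[/eqP ->|/sA]|].
by rewrite /= /f val_mnmD.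
Qed.

Section Valuation.
Variables (K F : fieldType) (io : {rmorphism K -> F}) (m : nat) (u : 'I_m -> F) (R : set F).
Hypotheses (sR : sring R) (Rio : forall c, R (io c)) (uR : forall i, R (u i)).
Local Notation U := (gpow R u).
Local Notation pu := (mmap io u).
Hypotheses (Uexp : forall k z, R z -> exists p, U k (z - pu p))
  (Uind : forall k p, U k (pu p) -> ordz k p)
  (Usep : forall z, R z -> (forall k, U k z) -> z = 0).

Lemma R_pu p : R (pu p).
Proof. by apply: (@mmap_gpow _ _ io R m u p 0). Qed.

(** A Taylor polynomial of [z] in the parameters [u]. It is chosen, but by [Uind] its coefficients
    in degrees less than [k] are determined; [cf] therefore truncates just above the degree of the
    exponent that it reads. *)
Definition cfT (z : F) (k : nat) : mpoly m K := xget 0 [set p | U k (z - pu p)].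
Definition cf (z : F) (a : multinom m) : K := mcoeff a (cfT z (mdeg a).+1).

Lemma cfTP z k : R z -> U k (z - pu (cfT z k)).
Proof. by move=> /(Uexp k) [p hp]; rewrite /cfT; case: xgetP => [q -> //|/(_ p)]; case. Qed.

Lemma cfE z k p a : R z -> U k (z - pu p) -> (mdeg a < k)%N -> cf z a = mcoeff a p.
Proof.
move=> Rz hp ak; apply/eqP; rewrite -subr_eq0 -mcoeffB; apply/eqP.
apply: (@Uind (mdeg a).+1 (cfT z (mdeg a).+1 - p)) => //.
rewrite rmorphB /=.
have -> : pu (cfT z (mdeg a).+1) - pu p = (z - pu p) - (z - pu (cfT z (mdeg a).+1)) by ring.
apply: (amod_sub sR (gpow_amod u sR _)); last exact: cfTP.
exact: (gpow_leq sR uR ak).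
Qed.

Lemma cfD z z' a : R z -> R z' -> cf (z + z') a = cf z a + cf z' a.
Proof.
move=> Rz Rz'; have [_ RD _ _] := sR.
rewrite (@cfE (z + z') (mdeg a).+1 (cfT z (mdeg a).+1 + cfT z' (mdeg a).+1)) ?mcoeffD //.
  exact: RD.
rewrite rmorphD /= opprD addrACA; have [_ h _] := gpow_amod u sR (mdeg a).+1.
by apply: h; apply: cfTP.
Qed.

Lemma cfZ c z a : R z -> cf (io c * z) a = c * cf z a.
Proof.
move=> Rz; have [_ _ _ RM] := sR.
rewrite (@cfE (io c * z) (mdeg a).+1 (c *: cfT z (mdeg a).+1)) ?mcoeffZ //.
  exact: RM.
rewrite mmapZ -mulrBr; have [_ _ h] := gpow_amod u sR (mdeg a).+1.
by apply: h => //; apply: cfTP.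
Qed.

Lemma cf0 a : cf 0 a = 0.
Proof. by have := cfZ 0 a (Rio 0); rewrite rmorph0 mul0r => ->; rewrite mul0r. Qed.

Lemma cf_sum (I : Type) (s : seq I) (P : pred I) (f : I -> F) a : (forall i, P i -> R (f i)) ->
  cf (\sum_(i <- s | P i) f i) a = \sum_(i <- s | P i) cf (f i) a.
Proof.
move=> h; suff [_ ->] : R (\sum_(i <- s | P i) f i) /\
  cf (\sum_(i <- s | P i) f i) a = \sum_(i <- s | P i) cf (f i) a by [].
elim/big_ind2: _ => [|x1 x2 y1 y2 [B1 <-] [B2 <-]|i Pi];
  [by rewrite cf0; split=> //; exact: sring0| |by split=> //; exact: h].
by rewrite cfD //; split=> //; have [_ RD _ _] := sR; apply: RD.
Qed.

Lemma cf_U k z : R z -> (U k z <-> forall a, (mdeg a < k)%N -> cf z a = 0).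
Proof.
move=> Rz; split=> [hz a ak|h].
  by rewrite (@cfE z k 0 a) ?mcoeff0 // mmap0 subr0.
have -> : z = (z - pu (cfT z k)) + pu (cfT z k) by rewrite subrK.
have [_ hD _] := gpow_amod u sR k; apply: hD; first exact: cfTP.
apply: mmap_gpow => // a ak; rewrite -(@cfE z k _ a) ?h //; exact: cfTP.
Qed.

(** The value of [z] is [a]. The monomial order compares degrees first, so the degree of the value
    is the order of vanishing, see [isnu_U]. As a relation it leaves 0 without a value. *)
Definition isnu (z : F) (a : multinom m) : Prop :=
  cf z a != 0 /\ forall b, (b < a)%O -> cf z b = 0.

Lemma isnu_ex z : R z -> z != 0 -> exists a, isnu z a.
Proof.
move=> Rz z0; apply: contrapT => hno; move/eqP: z0; apply; apply: Usep => // k.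
apply/cf_U => // a _; elim/(well_founded_ind (@ltom_wf m)): a => a IH.
apply/eqP; apply: contraT => h; exfalso; apply: hno; exists a; split=> // b ba; exact: IH.
Qed.

Lemma isnu_uniq z a b : isnu z a -> isnu z b -> a = b.
Proof.
move=> [ha ha'] [hb hb']; case: (ltgtP a b) => // h; first by rewrite hb' ?eqxx in ha.
by rewrite ha' ?eqxx in hb.
Qed.

Lemma isnu_U z a k : R z -> isnu z a -> (U k z <-> (k <= mdeg a)%N).
Proof.
move=> Rz [ha ha']; split=> [/(cf_U _ Rz) h|h].
  by rewrite leqNgt; apply/negP => /h E; rewrite E eqxx in ha.
by apply/cf_U => // b bk; apply: ha'; apply: lt_mdeg_ltmc; apply: leq_trans h.
Qed.

Lemma isnu_neq0 z a : isnu z a -> z != 0.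
Proof. by move=> [h _]; apply: contraNneq h => ->; rewrite cf0. Qed.

Lemma isnuM z z' a b : R z -> R z' -> isnu z a -> isnu z' b -> isnu (z * z') (mnm_add a b).
Proof.
move=> Rz Rz' [ha ha'] [hb hb']; have [_ RD _ RM] := sR.
pose k := (mdeg (mnm_add a b)).+1; pose p := cfT z k; pose p' := cfT z' k.
have E c : (mdeg c < k)%N -> cf z c = mcoeff c p by move=> ck; apply: cfE ck => //; exact: cfTP.
have E' c : (mdeg c < k)%N -> cf z' c = mcoeff c p' by move=> ck; apply: cfE ck => //; exact: cfTP.
have ak : (mdeg a < k)%N by rewrite /k mdegD ltnS leq_addr.
have bk : (mdeg b < k)%N by rewrite /k mdegD ltnS leq_addl.
have p0 : mlast p = a.
  have pn0 : p != 0 by apply: contraNneq ha; rewrite E // => ->; rewrite mcoeff0.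
  apply/eqP; rewrite eq_le mlast_lemc ?mcoeff_msupp -?E //=.
  rewrite leNgt; apply/negP => lt; have := mlast_supp pn0; rewrite mcoeff_msupp -E ?ha' ?eqxx //.
  exact: leq_ltn_trans (lemc_mdeg (ltW lt)) ak.
have p'0 : mlast p' = b.
  have pn0 : p' != 0 by apply: contraNneq hb; rewrite E' // => ->; rewrite mcoeff0.
  apply/eqP; rewrite eq_le mlast_lemc ?mcoeff_msupp -?E' //=.
  rewrite leNgt; apply/negP => lt; have := mlast_supp pn0; rewrite mcoeff_msupp -E' ?hb' ?eqxx //.
  exact: leq_ltn_trans (lemc_mdeg (ltW lt)) bk.
have EM c : (mdeg c < k)%N -> cf (z * z') c = mcoeff c (p * p').
  move=> ck; apply: cfE ck; first exact: RM.
  rewrite rmorphM /=.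
  have -> : z * z' - pu p * pu p' = z' * (z - pu p) + pu p * (z' - pu p') by ring.
  have [_ hD hM] := gpow_amod u sR k.
  by apply: hD; apply: hM; rewrite ?cfTP //; [exact: cfTP|exact: R_pu|exact: cfTP].
split.
  rewrite EM // -{1}p0 -{1}p'0 mcoeff_mlastM p0 p'0 -E // -E' // mulf_neq0 //.
move=> c cab; rewrite EM; last exact: leq_ltn_trans (lemc_mdeg (ltW cab)) _.
rewrite mcoeffM big1 // => -[c1 c2] /= /eqP Ec.
have [lt1|le1] := ltP (bmnm c1) a; first by rewrite mcoeff_lt_mlast ?p0 // mul0r.
have [lt2|le2] := ltP (bmnm c2) b; first by rewrite [X in _ * X]mcoeff_lt_mlast ?p'0 // mulr0.
by have := lem_add le1 le2; rewrite -Ec leNgt cab.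
Qed.

Lemma isnu1 : isnu 1 mnm0.
Proof.
have E a : cf 1 a = (a == mnm0)%:R.
  rewrite (@cfE 1 (mdeg a).+1 1) ?mcoeff1 //; first by have [] := sR.
  by rewrite rmorph1 subrr; have [] := gpow_amod u sR (mdeg a).+1.
split=> [|b]; first by rewrite E eqxx oner_eq0.
by rewrite ltNge le0m.
Qed.

Lemma isnuX z a k : R z -> isnu z a -> isnu (z ^+ k) (mnm_muln a k).
Proof.
move=> Rz ha; elim: k => [|k IH]; first by rewrite expr0 mulm0n; exact: isnu1.
by rewrite exprS mulmS; apply: isnuM => //; apply: sringX.
Qed.

Definition bounded (V : set F) (Mb : nat) : Prop :=
  forall z a, V z -> isnu z a -> (mdeg a <= Mb)%N.

Definition vals (V : set F) (Mb : nat) : seq (multinom m) :=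
  [seq bmnm b | b <- enum {: bmultinom m Mb.+1} & `[< exists2 z, V z & isnu z (bmnm b) >]].

Lemma vals_uniq V Mb : uniq (vals V Mb).
Proof.
rewrite map_inj_uniq; last by move=> a b /val_inj.
by apply: filter_uniq; rewrite -?enumT enum_uniq.
Qed.

Lemma mem_vals V Mb a : (a \in vals V Mb) <-> (mdeg a <= Mb)%N /\ exists2 z, V z & isnu z a.
Proof.
split=> [/mapP[b]|[aM [z Vz za]]].
  by rewrite mem_filter => /andP[/asboolP h _] ->; split=> //; rewrite -ltnS bmdeg.
apply/mapP; exists (BMultinom (aM : (mdeg a < Mb.+1)%N)) => //.
by rewrite mem_filter mem_enum andbT; apply/asboolP; exists z.
Qed.

Lemma mem_vals_b V Mb a : bounded V Mb -> (a \in vals V Mb) <-> exists2 z, V z & isnu z a.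
Proof.
move=> hb; split=> [/mem_vals [] //|[z Vz za]]; apply/mem_vals; split; last by exists z.
exact: hb za.
Qed.

(** Elements with distinct values are independent. Conversely, a combination whose Taylor
    coefficients vanish at all values of [V] has no value, hence is 0, so there are at most as many
    independent elements as values. *)
Lemma ind_vals V Mb r : V `<=` R -> ksub io V -> bounded V Mb ->
  ind io V r <-> (r <= size (vals V Mb))%N.
Proof.
move=> VR kV hb; split=> [h|h].
  rewrite -(card_ord (size (vals V Mb))); apply: ind_bound h => e Ve.
  exists (fun i (j : 'I_(size (vals V Mb))) => cf (e i) (nth mnm0 (vals V Mb) j)) => c hc.
  apply/eqP; apply: contraT => z0; exfalso.
  have Vz : V (\sum_i io (c i) * e i).
    by apply: (ksub_sum _ kV) => i _; have [_ _ h] := kV; apply: h.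
  have [a ha] := isnu_ex (VR _ Vz) z0.
  have /(nthP mnm0) [j jv E] : a \in vals V Mb by apply/mem_vals_b => //; exists (\sum_i io (c i) * e i).
  have [/eqP ca _] := ha; apply: ca; rewrite cf_sum; last first.
    by move=> i _; have [_ _ _ RM] := sR; apply: RM => //; apply: VR.
  rewrite -[RHS](hc (Ordinal jv)); apply: eq_bigr => i _ /=.
  by rewrite E cfZ //; apply: VR.
apply: ind_le h _.
have /choice [z hz] (j : 'I_(size (vals V Mb))) : exists z, V z /\ isnu z (nth mnm0 (vals V Mb) j).
  have /mem_vals [_ [z h1 h2]] : nth mnm0 (vals V Mb) j \in vals V Mb by rewrite mem_nth.
  by exists z.
exists z; split=> [j|c hc]; first by case: (hz j).
suff h a : forall j : 'I_(size (vals V Mb)), nth mnm0 (vals V Mb) j = a -> c j = 0 by move=> j; apply: h erefl.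
elim/(well_founded_ind (@ltom_wf m)): a => a IH j Ea.
have Rz i : R (z i) by apply: VR; case: (hz i).
have : cf (\sum_i io (c i) * z i) a = 0 by rewrite hc cf0.
rewrite cf_sum; last by move=> i _; have [_ _ _ RM] := sR; apply: RM.
rewrite (bigD1 j) //= cfZ // big1 ?addr0; last first.
  move=> i ij; rewrite cfZ //; have [_ [hi1 hi2]] := hz i.
  have [lt|lt|E] := ltgtP (nth mnm0 (vals V Mb) i) a.
  - by rewrite (IH _ lt i erefl) mul0r.
  - by rewrite hi2 ?mulr0.
  - exfalso; move/eqP: ij; apply; apply/val_inj/eqP.
    by rewrite -(nth_uniq mnm0 (ltn_ord i) (ltn_ord j) (vals_uniq V Mb)) E Ea.
have [_ [hj _]] := hz j; rewrite Ea in hj.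
by move/eqP; rewrite mulf_eq0 (negbTE hj) orbF => /eqP.
Qed.

Lemma vals_sub V W Mb Mb' : V `<=` W -> bounded W Mb' -> (size (vals V Mb) <= size (vals W Mb'))%N.
Proof.
move=> VW hb; apply: uniq_leq_size; first exact: vals_uniq.
move=> a /mem_vals [_ [z Vz za]]; apply/mem_vals_b => //; exists z => //; exact: VW.
Qed.

Lemma isnu_prod (A : seq (multinom m)) (rep : multinom m -> F) (s : seq (multinom m)) :
  (forall a, a \in A -> R (rep a) /\ isnu (rep a) a) -> (forall a, a \in s -> a \in A) ->
  R (\prod_(a <- s) rep a) /\ isnu (\prod_(a <- s) rep a) (foldr (@mnm_add m) mnm0 s).
Proof.
move=> hA; elim: s => [|a s IH] hs; first by rewrite big_nil; split; [case: sR|exact: isnu1].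
have [R1 h1] : R (\prod_(a <- s) rep a) /\ isnu (\prod_(a <- s) rep a) (foldr (@mnm_add m) mnm0 s).
  by apply: IH => b bs; apply: hs; rewrite inE bs orbT.
have [Ra ha] := hA a (hs a (mem_head _ _)).
by rewrite big_cons /=; split; [have [_ _ _ RM] := sR; apply: RM|apply: isnuM].
Qed.

(** ** Growth *)

Variable BD : nat -> set F.
Hypotheses (BDR : forall D, BD D `<=` R) (BDk : forall D, ksub io (BD D))
  (BD_leq : forall D D' y, (D <= D')%N -> BD D y -> BD D' y)
  (BDM : forall D D' y y', BD D y -> BD D' y' -> BD (D + D') (y * y'))
  (BD1 : BD 0 1) (BDu : forall i, exists2 y, BD 1 y & isnu y (mnm1 i)).
Variables (e c0 N0 : nat).
Hypotheses (hlow : forall D, (e <= D)%N -> ind io (BD D) (e * 'C(D - e + m, D - e)))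
  (hup : forall D r, (N0 <= D)%N -> ind io (BD D) r -> (r <= e * 'C(D + c0 + m, D + c0))%N).

Lemma BDX D y k : BD D y -> BD (k * D) (y ^+ k).
Proof. by move=> hy; elim: k => [|k IH] //; rewrite exprS mulSn; apply: BDM. Qed.

Lemma BD_mon (a : multinom m) D : (mdeg a <= D)%N -> exists2 y, BD D y & isnu y a.
Proof.
move=> aD; suff [y h1 h2] : exists2 y, BD (mdeg a) y & isnu y a by exists y => //; apply: BD_leq h1.
have [q] := ubnP (mdeg a); elim: q a {aD} => // q IH a ha.
case E : (mdeg a) => [|k].
  by move/eqP: E; rewrite mdeg_eq0 => /eqP ->; exists 1 => //; exact: isnu1.
have [i [a' [-> da']]] := mdegS_split E.
have [|y' h1 h2] := IH a'; first by rewrite da' -ltnS -E.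
have [y h3 h4] := BDu i; exists (y * y'); first by rewrite -add1n -da'; apply: BDM.
by apply: isnuM => //; [apply: (BDR (D := 1))|apply: (BDR (D := mdeg a'))].
Qed.

(** Slope of the linear bound on orders of vanishing. It involves [e] and [m] but not the
    uncontrolled [c0] and [N0]. *)
Definition C3 := (e * 3 ^ m)%N.

(** An element of too high an order produces too many values: its powers $z^{ri}$ with $i\le C_3$,
    times elements realizing all exponents of degree at most [Xr], have pairwise distinct values and
    lie in degree [2 * Xr]. *)
Lemma order_bound D : (0 < D)%N -> bounded (BD D) (C3 * D).
Proof.
move=> D0 z b hz hb; rewrite leqNgt; apply/negP => hlt.
(* The power [r] absorbs [N0], [c0] and [m]: it yields $2X_r+c_0+m\le3X_r$, whence the factor $3^m$
   in [C3]. *)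
pose r := (N0 + c0 + m + 1)%N; pose Xr := (C3 * (r * D))%N.
have e0 : (0 < e)%N.
  rewrite lt0n; apply/eqP => E; have h := hup (leqnn N0) (r := 1).
  suff /h : ind io (BD N0) 1 by rewrite E mul0n.
  exists (fun=> 1); split=> [_|c]; first exact: BD_leq BD1.
  by rewrite big_ord1 mulr1 => /eqP; rewrite fmorph_eq0 => /eqP ck i; rewrite ord1.
have C30 : (0 < C3)%N by rewrite /C3 muln_gt0 e0 expn_gt0.
have rX : (r <= Xr)%N by rewrite /Xr; nia.
have Xb : (Xr < r * mdeg b)%N.
  by rewrite /Xr mulnCA ltn_pmul2l // /r addn1.
pose W : set F := BD (2 * Xr).
have hc : ind io W #|{: 'I_C3.+1 * bmultinom m Xr.+1}|.
  have /choice [y hy] (a : bmultinom m Xr.+1) : exists y, BD Xr y /\ isnu y (bmnm a).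
    have [|y h1 h2] := @BD_mon (bmnm a) Xr; first by rewrite -ltnS bmdeg.
    by exists y.
  pose nu (ia : 'I_C3.+1 * bmultinom m Xr.+1) := mnm_add (mnm_muln (mnm_muln b r) ia.1) (bmnm ia.2).
  have Rz := BDR hz.
  have hf (ia : 'I_C3.+1 * bmultinom m Xr.+1) : W ((z ^+ r) ^+ ia.1 * y ia.2) /\ isnu ((z ^+ r) ^+ ia.1 * y ia.2) (nu ia).
    have [hy1 hy2] := hy ia.2; split.
      apply: (@BD_leq (ia.1 * (r * D) + Xr)).
        by rewrite mul2n -addnn leq_add2r /Xr leq_mul2r -ltnS ltn_ord orbT.
      by apply: BDM => //; apply: BDX; apply: BDX.
    apply: isnuM => //; [by apply: (sringX _ sR); apply: (sringX _ sR)|exact: (BDR hy1)|].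
    by apply: isnuX; [exact: sringX|exact: isnuX].
  (* Since $|a|\le X_r<r|b|$, the total degree already determines the exponent [i]. *)
  have nuinj : injective nu.
    move=> [i a] [i' a'] /=; rewrite /nu /= => E.
    have := congr1 (@mdeg m) E; rewrite !mdegD !mdegMn => Ed.
    have ai : (mdeg (bmnm a) <= Xr)%N by rewrite -ltnS bmdeg.
    have ai' : (mdeg (bmnm a') <= Xr)%N by rewrite -ltnS bmdeg.
    have Ei : i = i' :> nat by rewrite mulnC in Xb; nia.
    have Ei' : i = i' by apply: val_inj.
    by rewrite Ei' in E *; congr (_, _); apply/val_inj; exact: addmI E.
  apply: (@ind_fin _ _ _ _ _ (fun ia : 'I_C3.+1 * bmultinom m Xr.+1 => (z ^+ r) ^+ ia.1 * y ia.2)) => [ia|c hcc]; first by case: (hf ia).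
  suff h a : forall ia, nu ia = a -> c ia = 0 by move=> ia; apply: h erefl.
  elim/(well_founded_ind (@ltom_wf m)): a => a IH ia Ea.
  have Rf (i : 'I_C3.+1 * bmultinom m Xr.+1) : R ((z ^+ r) ^+ i.1 * y i.2) by apply: (@BDR (2 * Xr)); case: (hf i).
  have : cf (\sum_(i : 'I_C3.+1 * bmultinom m Xr.+1) io (c i) * ((z ^+ r) ^+ i.1 * y i.2)) a = 0 by rewrite hcc cf0.
  rewrite cf_sum; last by move=> i _; have [_ _ _ RM] := sR; apply: RM.
  rewrite (bigD1 ia) //= cfZ // big1 ?addr0; last first.
    move=> i ij; rewrite cfZ //; have [_ [hi1 hi2]] := hf i.
    have [lt|lt|Eq] := ltgtP (nu i) a.
    - by rewrite (IH _ lt i erefl) mul0r.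
    - by rewrite hi2 ?mulr0.
    - by exfalso; move/eqP: ij; apply; apply: nuinj; rewrite Eq.
  have [_ [hj _]] := hf ia; rewrite Ea in hj.
  by move/eqP; rewrite mulf_eq0 (negbTE hj) orbF => /eqP.
move: hc; rewrite card_prod card_ord card_bmultinom => /hup h.
have /h {h} : (N0 <= 2 * Xr)%N by apply: leq_trans (_ : r <= _)%N; [rewrite /r; lia|lia].
have /andP[h1 _] := bin_bounds Xr m; have /andP[_ h2] := bin_bounds (2 * Xr + c0) m.
rewrite leqNgt => /negP; apply.
rewrite -(ltn_pmul2l (fact_gt0 m)) mulnCA [X in (_ < X)%N]mulnCA.
apply: leq_ltn_trans (leq_mul (leqnn e) h2) _.
apply: leq_trans (leq_mul (leqnn C3.+1) h1).
have h3 : ((2 * Xr + c0 + m) ^ m <= (3 * Xr) ^ m)%N.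
  have : (2 * Xr + c0 + m <= 3 * Xr)%N by move: rX; rewrite {1}/r; lia.
  by case: (m) => // m' h; rewrite leq_exp2r.
apply: leq_ltn_trans (leq_mul (leqnn e) h3) _.
rewrite expnMn mulnA -/C3 ltn_pmul2r // expn_gt0.
have -> : (0 < Xr)%N by apply: leq_trans rX; rewrite /r addn1.
by [].
Qed.

Definition valsD D := vals (BD D) (C3 * D).
(** By [ind_Gk] this is the dimension of the elements of degree [D] and order at least [k]. The
    complementary count [Lk] is kept because upper bounds for [Gk] are derived from lower bounds for
    [Lk]. *)
Definition Gk D k := size [seq a <- valsD D | (k <= mdeg a)%N].
Definition Lk D k := size [seq a <- valsD D | (mdeg a < k)%N].
Definition Err D := (m * (C3 * D).+1 ^ m.-1)%N.

Lemma GLk D k : (Gk D k + Lk D k = size (valsD D))%N.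
Proof.
rewrite /Gk /Lk !size_filter -(count_predC (fun a => (k <= mdeg a)%N)); congr addn.
by apply: eq_count => a /=; rewrite ltnNge.
Qed.

Lemma Gk0 D : Gk D 0 = size (valsD D).
Proof. by rewrite /Gk filter_predT. Qed.

Lemma ind_Gk D k r : (0 < D)%N -> ind io (BD D `&` U k) r <-> (r <= Gk D k)%N.
Proof.
move=> D0; have -> : Gk D k = size (vals (BD D `&` U k) (C3 * D)).
  apply/perm_size/uniq_perm; rewrite ?filter_uniq ?vals_uniq // => a.
  rewrite mem_filter; apply/andP/idP => [[ka /mem_vals [aM [z hz za]]]|/mem_vals [aM [z [hz Uz] za]]].
    by apply/mem_vals; split=> //; exists z => //; split=> //; apply/(isnu_U _ (BDR hz) za).
  split; first exact/(isnu_U _ (BDR hz) za).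
  by apply/mem_vals; split=> //; exists z.
apply: ind_vals.
- by move=> z [/BDR].
- have [k0 kD kZ] := BDk D; have [U0 UD UM] := gpow_amod u sR k.
  split=> [|x y [h1 h2] [h3 h4]|c x [h1 h2]]; split; auto.
- by move=> z a [hz _]; apply: order_bound.
Qed.

Lemma reps D : exists rep : multinom m -> F, forall a, a \in valsD D -> BD D (rep a) /\ isnu (rep a) a.
Proof.
suff /choice [rep h] : forall a, exists z, a \in valsD D -> BD D z /\ isnu z a by exists rep.
move=> a; have [/mem_vals [_ [z h1 h2]]|h] := boolP (a \in valsD D); first by exists z.
by exists 0.
Qed.

Lemma BD_prod D (s : seq (multinom m)) (rep : multinom m -> F) :
  (forall a, a \in s -> BD D (rep a)) -> BD (size s * D) (\prod_(a <- s) rep a).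
Proof.
elim: s => [|a s IH] h; first by rewrite big_nil.
rewrite big_cons /= mulSn; apply: BDM; first by apply: h; rewrite mem_head.
by apply: IH => b bs; apply: h; rewrite inE bs orbT.
Qed.

Lemma mdeg_foldr (s : seq (multinom m)) : mdeg (foldr (@mnm_add m) mnm0 s) = (\sum_(a <- s) mdeg a)%N.
Proof. by elim: s => [|a s IH]; rewrite ?big_nil ?mdeg0 // big_cons /= mdegD IH. Qed.

(** A product of [j] representatives has the sum of their values as its value, so the sumset
    inequality applies to any condition on values that is inherited by [j]-fold sums. *)
Lemma sum_vals (Q Q' : pred (multinom m)) D j : (0 < D)%N -> (0 < j)%N ->
  (forall s : seq (multinom m), size s = j -> all Q s -> Q' (foldr (@mnm_add m) mnm0 s)) ->
  (j ^ m * size [seq a <- valsD D | Q a] <= size [seq a <- valsD (j * D) | Q' a] + j ^ m * Err D)%N.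
Proof.
move=> D0 j0 hQ; apply: sumset_bound; rewrite ?filter_uniq ?vals_uniq //.
  by move=> a; rewrite mem_filter => /andP[_ /mem_vals []].
have [rep hrep] := reps D => s ss hs.
have hs' a : a \in s -> a \in valsD D by move=> /hs; rewrite mem_filter => /andP[].
have hrR a : a \in valsD D -> R (rep a) /\ isnu (rep a) a.
  by move=> /hrep [h1 h2]; split=> //; exact: (BDR h1).
have [h1 h2] := isnu_prod hrR hs'.
rewrite mem_filter; apply/andP; split.
  by apply: hQ => //; apply/allP => a /hs; rewrite mem_filter => /andP[].
apply/(mem_vals_b _ (order_bound _)); first by rewrite muln_gt0 j0.
exists (\prod_(a <- s) rep a) => //; rewrite -ss; apply: BD_prod => a /hs' /hrep [] //.
Qed.

Lemma Gk_super D k j : (0 < D)%N -> (0 < j)%N ->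
  (j ^ m * Gk D k <= Gk (j * D) (j * k) + j ^ m * Err D)%N.
Proof.
move=> D0 j0; apply: sum_vals => // s ss /allP hs; rewrite mdeg_foldr -ss.
rewrite -sum1_size big_distrl /= big_seq [leqRHS]big_seq; apply: leq_sum => a /hs.
by rewrite mul1n.
Qed.

Lemma Lk_super D k j : (0 < D)%N -> (0 < j)%N ->
  (j ^ m * Lk D k <= Lk (j * D) (j * k) + j ^ m * Err D)%N.
Proof.
move=> D0 j0; apply: sum_vals => // s ss /allP hs; rewrite mdeg_foldr.
case: k hs => [|k] hs.
  by case: s ss hs => [E|a s _ /(_ a (mem_head _ _))] //; rewrite -E in j0.
apply: (@leq_ltn_trans (j * k)); last by rewrite ltn_pmul2l.
rewrite -ss -sum1_size big_distrl /= big_seq [leqRHS]big_seq; apply: leq_sum => a /hs.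
by rewrite mul1n.
Qed.

Lemma H_low D : (0 < D)%N -> (0 < m)%N ->
  (e * D ^ m <= m`! * size (valsD D) + e ^ 2 * m * D ^ m.-1)%N.
Proof.
move=> D0 m0; have [eD|De] := leqP e D; last first.
  apply: leq_trans (leq_addl _ _); rewrite -{1}(prednK m0) expnS mulnA leq_mul2r.
  by apply/orP; right; rewrite -mulnn; nia.
have : (e * 'C(D - e + m, D - e) <= size (valsD D))%N.
  by apply/(ind_vals _ (@BDR D) (BDk D) (order_bound D0)); exact: hlow.
have /andP[h1 _] := bin_bounds (D - e) m => h2.
have h3 : (e * (D - e) ^ m <= m`! * size (valsD D))%N.
  apply: leq_trans (leq_mul (leqnn _) h1) _; rewrite mulnCA leq_mul2l h2 orbT //.
apply: leq_trans (leq_add h3 (leqnn _)).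
have bern : (D ^ m <= (D - e) ^ m + m * e * D ^ m.-1)%N.
  elim: (m) => [|m' IH]; first by rewrite !expn0.
  case: m' IH => [|m'] IH; first by rewrite !expn1 expn0; lia.
  rewrite expnS; apply: leq_trans (leq_mul (leqnn D) IH) _.
  rewrite /= in IH *; rewrite mulnDr [((D - e) ^ m'.+2)%N]expnS.
  have hle : ((D - e) ^ m'.+1 <= D ^ m'.+1)%N by rewrite leq_exp2r // leq_subr.
  have -> : (D * (m'.+1 * e * D ^ m') = m'.+1 * e * D ^ m'.+1)%N by rewrite expnS; ring.
  have -> : (m'.+2 * e * D ^ m'.+1 = e * D ^ m'.+1 + m'.+1 * e * D ^ m'.+1)%N by ring.
  rewrite addnA leq_add2r -{1}(subnK eD) mulnDl leq_add2l leq_mul2l hle orbT //.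
apply: leq_trans (leq_mul (leqnn e) bern) _; rewrite mulnDr leq_add2l.
by rewrite -mulnn; apply: eq_leq; ring.
Qed.

(** An excess in one degree [D] would propagate by [Gk_super] to all degrees $jD$ and contradict
    [hup] for large [j]. This is how [c0] and [N0] disappear from the upper bound. *)
Lemma H_up D : (0 < D)%N -> (m`! * size (valsD D) <= e * D ^ m + m`! * Err D)%N.
Proof.
move=> D0; rewrite leqNgt; apply/negP => hlt.
have [X0 hX0] := growth (e * D ^ m) (c0 + m) m.
pose j := (X0 + N0 + 1)%N.
have j0 : (0 < j)%N by rewrite /j addn1.
have h1 := Gk_super 0 D0 j0; rewrite muln0 !Gk0 in h1.
have h2 : (size (valsD (j * D)) <= e * 'C(j * D + c0 + m, j * D + c0))%N.
  apply: hup; first by rewrite /j; nia.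
  by apply/(ind_vals _ (@BDR _) (BDk _) (order_bound _)) => //; rewrite muln_gt0 j0.
have /andP[_ h3] := bin_bounds (j * D + c0) m.
have h4 : (m`! * size (valsD (j * D)) <= e * D ^ m * (j + (c0 + m)) ^ m)%N.
  apply: leq_trans (leq_mul (leqnn _) h2) _; rewrite mulnCA -mulnA leq_mul2l; apply/orP; right.
  apply: leq_trans h3 _; rewrite -expnMn; case: (m) => // m'; rewrite leq_exp2r //; nia.
have := hX0 j; rewrite {1}/j -addnA leq_addr => /(_ isT); rewrite ltnNge => /negP; apply.
apply: leq_trans h4.
rewrite -(leq_add2r (j ^ m * (m`! * Err D))).
have h5 : (j ^ m * (m`! * size (valsD D)) <= m`! * size (valsD (j * D)) + j ^ m * (m`! * Err D))%N.
  by rewrite mulnCA [(j ^ m * (m`! * Err D))%N]mulnCA -mulnDr leq_mul2l h1 orbT.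
apply: leq_trans h5; rewrite mulnC -mulnDr leq_mul2l; apply/orP; right.
by rewrite addSn.
Qed.

Definition Cerr := (m * (C3 + 1) ^ m.-1)%N.

Lemma Err_le D : (0 < D)%N -> (Err D <= Cerr * D ^ m.-1)%N.
Proof.
move=> D0; rewrite /Err /Cerr -mulnA leq_mul2l -expnMn; apply/orP; right.
case: (m.-1) => // m'; rewrite leq_exp2r //; nia.
Qed.

(** Collects all errors: two sumset errors and that of [H_low] for [Gk_upper], and the number of
    monomials of a single degree for [Gk_lip]. *)
Definition Cgen := (2 * Cerr + e ^ 2 * m + (C3 + m) ^ m.-1)%N.

Lemma Gk_lower D k j : (0 < D)%N -> (0 < j)%N ->
  (j ^ m * Gk D k <= Gk (j * D) (j * k) + j ^ m * (Cgen * D ^ m.-1))%N.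
Proof.
move=> D0 j0; apply: leq_trans (Gk_super k D0 j0) _; rewrite leq_add2l leq_mul2l.
apply/orP; right; apply: leq_trans (Err_le D0) _; rewrite leq_mul2r; apply/orP; right.
by rewrite /Cgen; lia.
Qed.

(** Subtraction: [H_up] and [H_low] compare the totals in degrees $jD$ and $D$, and [Lk_super]
    bounds from below the values of degree less than $jk$. *)
Lemma Gk_upper D k j : (0 < D)%N -> (0 < j)%N -> (0 < m)%N ->
  (Gk (j * D) (j * k) <= j ^ m * Gk D k + j ^ m * (Cgen * D ^ m.-1))%N.
Proof.
move=> D0 j0 m0; have jD0 : (0 < j * D)%N by rewrite muln_gt0 j0.
have h1 := Lk_super k D0 j0; have h2 := GLk D k; have h3 := GLk (j * D) (j * k).
have h4 := H_up jD0; have h5 := H_low D0 m0.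
have h6 : (Err (j * D) <= j ^ m * (Cerr * D ^ m.-1))%N.
  apply: leq_trans (Err_le jD0) _; rewrite expnMn mulnCA leq_mul2r; apply/orP; right.
  by rewrite leq_pexp2l // leq_pred.
have h7 := Err_le D0.
have f0 := fact_gt0 m.
have h8 : (m`! * size (valsD (j * D)) <= m`! * (j ^ m * (size (valsD D) + Cerr * D ^ m.-1 + e ^ 2 * m * D ^ m.-1)))%N.
  apply: leq_trans h4 _; rewrite expnMn.
  have -> : (e * (j ^ m * D ^ m) = j ^ m * (e * D ^ m))%N by ring.
  have t1 : (j ^ m * (e * D ^ m) <= j ^ m * (m`! * size (valsD D) + e ^ 2 * m * D ^ m.-1))%N.
    by rewrite leq_mul2l h5 orbT.
  have t2 : (m`! * Err (j * D) <= m`! * (j ^ m * (Cerr * D ^ m.-1)))%N by rewrite leq_mul2l h6 orbT.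
  have t3 : (j ^ m * (e ^ 2 * m * D ^ m.-1) <= m`! * (j ^ m * (e ^ 2 * m * D ^ m.-1)))%N.
    by rewrite leq_pmull.
  apply: leq_trans (leq_add t1 t2) _.
  rewrite mulnDr; apply: leq_trans (leq_add (leq_add (leqnn _) t3) (leqnn _)) _.
  by apply: eq_leq; ring.
rewrite leq_pmul2l // in h8.
have h9 : (j ^ m * Err D <= j ^ m * (Cerr * D ^ m.-1))%N by rewrite leq_mul2l h7 orbT.
have h10 : (j ^ m * (2 * Cerr * D ^ m.-1 + e ^ 2 * m * D ^ m.-1) <= j ^ m * (Cgen * D ^ m.-1))%N.
  by rewrite leq_mul2l -mulnDl leq_mul2r /Cgen; apply/orP; right; apply/orP; right; lia.
rewrite -h3 -h2 in h8.
move: h1 h8 h9 h10; rewrite !mulnDr.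
have -> : (j ^ m * (2 * Cerr * D ^ m.-1) = 2 * (j ^ m * (Cerr * D ^ m.-1)))%N by ring.
move: (j ^ m * Lk D k)%N (Lk (j * D) (j * k)) (j ^ m * Err D)%N (Gk (j * D) (j * k)) (j ^ m * Gk D k)%N
  (j ^ m * (Cerr * D ^ m.-1))%N (j ^ m * (e ^ 2 * m * D ^ m.-1))%N (j ^ m * (Cgen * D ^ m.-1))%N.
move=> *; lia.
Qed.

Lemma Gk_mono D k k' : (k <= k')%N -> (Gk D k' <= Gk D k)%N.
Proof.
move=> kk; rewrite /Gk !size_filter; apply: sub_count => a /=; exact: leq_trans.
Qed.

(** The difference counts values of degree exactly [k], at most the number of monomials of that
    degree; this is $O(D^{m-1})$ because values have degree at most [C3 * D]. *)
Lemma Gk_lip D k : (0 < D)%N -> (0 < m)%N -> (Gk D k <= Gk D k.+1 + Cgen * D ^ m.-1)%N.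
Proof.
move=> D0 m0.
have E : (Gk D k = Gk D k.+1 + size [seq a <- valsD D | mdeg a == k])%N.
  rewrite /Gk !size_filter -count_predUI [X in (_ = _ + X)%N](_ : _ = 0%N) ?addn0; last first.
    by apply/eqP; rewrite -leqn0 leqNgt -has_count; apply/hasPn => a _ /=; lia.
  by apply: eq_count => a /=; lia.
rewrite E leq_add2l.
have [kC|kC] := leqP k (C3 * D); last first.
  rewrite (_ : size _ = 0%N) //; apply/eqP; rewrite size_filter -leqn0 leqNgt -has_count.
  by apply/hasPn => a /mem_vals [aM _]; move: kC aM; lia.
apply: leq_trans (_ : size (mons m k) <= _)%N.
  apply: uniq_leq_size; first by rewrite filter_uniq ?vals_uniq.
  by move=> a; rewrite mem_filter mem_mons => /andP[].
have Em : m = m.-1.+1 by rewrite prednK.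
rewrite Em size_mons /=.
have /andP[_ h] := bin_bounds k m.-1.
apply: leq_trans (leq_pmull _ (fact_gt0 m.-1)) _; apply: leq_trans h _.
apply: leq_trans (_ : (C3 + m) ^ m.-1 * D ^ m.-1 <= _)%N; last first.
  by rewrite leq_mul2r /Cgen; apply/orP; right; lia.
have hb : (k + m.-1 <= (C3 + m) * D)%N.
  by rewrite mulnDl leq_add // (leq_trans (leq_pred m)) // leq_pmulr.
by rewrite -expnMn; case: (m.-1) hb => // m' hb; rewrite leq_exp2r.
Qed.

Lemma Gk_zero D k : (C3 * D < k)%N -> Gk D k = 0%N.
Proof.
move=> kC; apply/eqP; rewrite /Gk size_filter -leqn0 leqNgt -has_count.
by apply/hasPn => a /mem_vals [aM _]; rewrite -ltnNge; apply: leq_ltn_trans kC.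
Qed.

(* The elements of degree Q of order k of the saturation of the graded ring. *)
Definition sec (Q k : nat) : set F :=
  [set z | [/\ R z, U k z & exists N, forall N' y, (N <= N')%N -> BD N' y -> BD (N' + Q) (z * y)]].

Lemma sec_ksub Q k : ksub io (sec Q k).
Proof.
have [_ RD _ RM] := sR; have [U0 UD UM] := gpow_amod u sR k; split.
- split=> //; first exact: sring0.
  by exists 0%N => N' y _ _; rewrite mul0r; have [] := BDk (N' + Q).
- move=> x y [Rx Ux [N hN]] [Ry Uy [N1 hN1]]; split; [exact: RD|exact: UD|].
  exists (maxn N N1) => N' t; rewrite geq_max => /andP[h1 h2] ht; rewrite mulrDl.
  by have [_ h _] := BDk (N' + Q); apply: h; auto.
- move=> c x [Rx Ux [N hN]]; split; [exact: RM|exact: UM|].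
  exists N => N' t h1 ht; rewrite -mulrA.
  by have [_ _ h] := BDk (N' + Q); apply: h; auto.
Qed.

Lemma sec_prod Q N (s : seq (multinom m)) (rep : multinom m -> F) :
  (forall a, a \in s -> forall N' y, (N <= N')%N -> BD N' y -> BD (N' + Q) (rep a * y)) ->
  BD (N + size s * Q) (\prod_(a <- s) rep a).
Proof.
elim: s => [|a s IH] h; first by rewrite big_nil; apply: BD_leq BD1.
rewrite big_cons /= mulSn addnCA addnC; apply: (h); rewrite ?mem_head ?leq_addr //.
by apply: IH => b bs; apply: h; rewrite inE bs orbT.
Qed.

(** The power $z^j$ lies in degree $N+jQ$, where orders are at most $C_3(N+jQ)$. An excess of 1 in
    the order of [z] becomes [j], which exceeds $C_3N$ for the chosen [j]. *)
Lemma sec_bounded Q k : (0 < Q)%N -> bounded (sec Q k) (C3 * Q).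
Proof.
move=> Q0 z a [Rz _ [N hN]] za; rewrite leqNgt; apply/negP => hlt.
pose j := (C3 * N).+1.
have hz : BD (N + j * Q) (z ^+ j).
  have := @sec_prod Q N (nseq j a) (fun=> z).
  rewrite size_nseq big_const_seq count_predT size_nseq iter_mulr_1; apply=> b _; exact: hN.
have /order_bound /(_ _ _ hz (isnuX j Rz za)) : (0 < N + j * Q)%N.
  by rewrite addn_gt0 muln_gt0 Q0 orbT.
rewrite mdegMn mulnDr leqNgt => /negP; apply.
have : (j * (C3 * Q).+1 <= mdeg a * j)%N by rewrite mulnC leq_mul2r hlt orbT.
apply: leq_trans; rewrite mulnS mulnCA ltn_add2r /j //.
Qed.

Definition Vk Q k := size (vals (sec Q k) (C3 * Q)).

Lemma ind_sec Q k r : (0 < Q)%N -> ind io (sec Q k) r -> (r <= Vk Q k)%N.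
Proof.
move=> Q0 h; apply/(@ind_vals (sec Q k)) => //; [by move=> z []|exact: sec_ksub|exact: sec_bounded].
Qed.

(** The sumset argument for products of [j] sections. These lie in degree $N+jQ$, with one threshold
    [N] for the finitely many representatives. *)
Lemma Vk_super Q k : (0 < Q)%N -> exists N, forall j, (0 < j)%N ->
  (j ^ m * Vk Q k <= Gk (N + j * Q) (j * k) + j ^ m * (Cgen * Q ^ m.-1))%N.
Proof.
move=> Q0; have /choice [rep /choice [Na hrep]] a : exists z N, a \in vals (sec Q k) (C3 * Q) ->
    [/\ R z, U k z, isnu z a & forall N' y, (N <= N')%N -> BD N' y -> BD (N' + Q) (z * y)].
  have [/mem_vals [_ [z [h1 h2 [N h3]] h4]]|h] := boolP (a \in vals (sec Q k) (C3 * Q)).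
    by exists z, N.
  by exists 0, 0%N.
pose N := (\max_(a <- vals (sec Q k) (C3 * Q)) Na a)%N.
exists N => j j0.
have -> : Cgen = (Cerr + (Cgen - Cerr))%N by rewrite /Cgen; lia.
apply: (@leq_trans (Gk (N + j * Q) (j * k) + j ^ m * Err Q)); last first.
  rewrite leq_add2l leq_mul2l; apply/orP; right; apply: leq_trans (Err_le Q0) _.
  by rewrite leq_mul2r leq_addr orbT.
apply: sumset_bound => //; rewrite ?filter_uniq ?vals_uniq //.
  by move=> a /mem_vals [].
move=> s ss hs.
have hrR a : a \in vals (sec Q k) (C3 * Q) -> R (rep a) /\ isnu (rep a) a by move=> /hrep [].
have [h1 h2] := isnu_prod hrR hs.
rewrite mem_filter; apply/andP; split.
  rewrite mdeg_foldr -ss -sum1_size big_distrl /= big_seq [leqRHS]big_seq; apply: leq_sum => a /hs /hrep.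
  by move=> [ra ua na _]; rewrite mul1n; apply/(isnu_U _ ra na).
apply/(mem_vals_b _ (order_bound _)); first by rewrite addn_gt0 muln_gt0 j0 Q0 orbT.
exists (\prod_(a <- s) rep a) => //; rewrite -ss; apply: sec_prod => a /hs ha N' y hN' hy.
have [_ _ _ h] := hrep _ ha; apply: h => //; apply: leq_trans hN'.
by rewrite /N; apply: (leq_bigmax_seq (F := Na)).
Qed.

End Valuation.

End Valuation.

Module VolumeLimit.

Import numFieldTopology.Exports numFieldNormedType.Exports.

(** * Limits of normalized counts and their integral *)

Section Asymptotics.
Variables (R : realType) (d C C3 : nat) (G V : nat -> nat -> nat).
Hypotheses (hlo : forall D k j, (0 < D)%N -> (0 < j)%N ->
    (j ^ d * G D k <= G (j * D) (j * k) + j ^ d * (C * D ^ d.-1))%N)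
  (hhi : forall D k j, (0 < D)%N -> (0 < j)%N ->
    (G (j * D) (j * k) <= j ^ d * G D k + j ^ d * (C * D ^ d.-1))%N)
  (hmono : forall D k k', (k <= k')%N -> (G D k' <= G D k)%N)
  (hlip : forall D k, (0 < D)%N -> (G D k <= G D k.+1 + C * D ^ d.-1)%N)
  (hzero : forall D k, (C3 * D < k)%N -> G D k = 0%N)
  (d0 : (0 < d)%N).

Definition ga D k : R := (G D k)%:R / D%:R ^+ d.
Definition fD D (x : R) : R := ga D (Num.truncn (x * D%:R)).

Lemma ga_ge0 D k : 0 <= ga D k.
Proof. by rewrite divr_ge0 ?exprn_ge0 ?ler0n. Qed.

Lemma expP D : (0 < D)%N -> (D%:R : R) ^+ d = D%:R ^+ d.-1 * D%:R.
Proof. by move=> _; rewrite -exprSr prednK. Qed.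

Lemma ga_mul D k j : (0 < D)%N -> (0 < j)%N -> `|ga (j * D) (j * k) - ga D k| <= C%:R / D%:R.
Proof.
move=> D0 j0; have D0' : 0 < (D%:R : R) by rewrite ltr0n.
have j0' : 0 < (j%:R : R) by rewrite ltr0n.
have P0 : 0 < (D%:R : R) ^+ d.-1 by rewrite exprn_gt0.
have J0 : 0 < (j%:R : R) ^+ d by rewrite exprn_gt0.
have := hhi k D0 j0; rewrite -(ler_nat R) !natrD !natrM !natrX => h1.
have := hlo k D0 j0; rewrite -(ler_nat R) !natrD !natrM !natrX /ga => h2.
rewrite natrM exprMn; move: h1 h2 P0 J0; rewrite (expP D0).
move: (D%:R ^+ d.-1) (j%:R ^+ d) (G _ _)%:R (G _ _)%:R C%:R => x y z w c h1 h2 x0 y0.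
have -> : w / (y * (x * D%:R)) - z / (x * D%:R) = ((w - y * z) / (y * x)) / D%:R.
  by field; rewrite !gt_eqF.
rewrite normrM [X in _ * X]gtr0_norm ?invr_gt0 // ler_pM2r ?invr_gt0 //.
rewrite normrM [X in _ * X]gtr0_norm ?invr_gt0 ?mulr_gt0 // ler_pdivrMr ?mulr_gt0 //.
by rewrite ler_norml; apply/andP; split; lra.
Qed.

Lemma ga_mono D k k' : (k <= k')%N -> ga D k' <= ga D k.
Proof. by move=> kk; rewrite ler_wpM2r ?invr_ge0 ?exprn_ge0 ?ler0n // ler_nat hmono. Qed.

Lemma ga_lip D k j : (0 < D)%N -> ga D k <= ga D (k + j) + j%:R * (C%:R / D%:R).
Proof.
move=> D0; elim: j => [|j IH]; first by rewrite addn0 mul0r addr0.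
apply: le_trans IH _; rewrite addnS -natr1 mulrDl mul1r addrA [X in _ <= X]addrAC lerD2r.
have D0' : 0 < (D%:R : R) by rewrite ltr0n.
have P0 : 0 < (D%:R : R) ^+ d.-1 by rewrite exprn_gt0.
have := hlip (k + j) D0; rewrite -(ler_nat R) natrD natrM natrX => h.
rewrite /ga (expP D0); move: h P0; move: (D%:R ^+ d.-1) => x h x0.
rewrite ler_pdivrMr ?mulr_gt0 // mulrDl divfK ?gt_eqF ?mulr_gt0 //.
by have -> : C%:R / D%:R * (x * D%:R) = C%:R * x by field; rewrite gt_eqF.
Qed.

Lemma fD_mul D j (x : R) : (0 < D)%N -> (0 < j)%N -> 0 <= x ->
  `|fD (j * D) x - fD D x| <= 2 * C%:R / D%:R.
Proof.
move=> D0 j0 x0; have D0' : 0 < (D%:R : R) by rewrite ltr0n.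
have j0' : 0 < (j%:R : R) by rewrite ltr0n.
rewrite /fD; set t := Num.truncn (x * D%:R); set T := Num.truncn _.
have /andP[h1 h2] := truncn_itv (mulr_ge0 x0 (ltW D0')); rewrite -/t in h1 h2.
have jD0 : 0 <= x * (j * D)%:R by rewrite mulr_ge0.
(* Rounding: $\lfloor xjD\rfloor$ lies between $jt$ and $jt+j$, and these [j] steps at level $jD$
   cost $C/D$ by [ga_lip]. Together with [ga_mul] this gives the factor 2. *)
have h3 : (j * t <= T)%N by rewrite truncn_ge_nat // !natrM mulrCA ler_pM2l.
have h4 : (T <= j * t + j)%N.
  rewrite ltnW // addnC -mulnS -(ltr_nat R).
  have /andP[h5 _] := truncn_itv jD0; apply: le_lt_trans h5 _.
  by rewrite !natrM mulrCA ltr_pM2l.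
have h5 := ga_mul t D0 j0; have h6 := ga_mono (j * D) h3.
have h7 := ga_lip (j * t) j (ltac:(by rewrite muln_gt0 j0) : (0 < j * D)%N).
have h8 := ga_mono (j * D) h4.
have E : j%:R * (C%:R / (j * D)%:R) = C%:R / D%:R :> R by rewrite natrM; field; rewrite !gt_eqF.
rewrite E in h7; move: h5; rewrite -mulrA; move: (C%:R / D%:R) h7 => c h7.
by rewrite !ler_norml => /andP[h9 h10]; apply/andP; split; lra.
Qed.

Lemma fD_cmp D D' (x : R) : (0 < D)%N -> (0 < D')%N -> 0 <= x ->
  fD D x - 2 * C%:R / D%:R <= fD D' x + 2 * C%:R / D'%:R.
Proof.
move=> h1 h2 x0; have := fD_mul h1 h2 x0; have := fD_mul h2 h1 x0.
rewrite [X in fD X x](mulnC D D') !ler_norml => /andP[h3 h4] /andP[h5 h6]; lra.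
Qed.

(** The limit [gam] of [fD D x] as $D\to\infty$ is defined as the infimum of all upper estimates. By
    [fD_cmp] every lower estimate is below every upper one, so both hold for the infimum without a
    separate proof of convergence. *)
Definition gset (x : R) : set R := [set y | exists2 D, (0 < D)%N & y = fD D x + 2 * C%:R / D%:R].
Definition gam (x : R) : R := inf (gset x).

Lemma gset0 x : gset x !=set0.
Proof. by eexists; exists 1%N. Qed.

Lemma CD_ge0 (D : nat) : 0 <= 2 * C%:R / D%:R :> R.
Proof. by rewrite divr_ge0 ?mulr_ge0 ?ler0n. Qed.

Lemma gset_lb x : lbound (gset x) 0.
Proof. by move=> _ [D D0 ->]; rewrite addr_ge0 ?ga_ge0 ?CD_ge0. Qed.

Lemma gam_ge0 x : 0 <= gam x.
Proof. by apply: (lb_le_inf (gset0 x)) => y; exact: gset_lb. Qed.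

Lemma gam_le D x : (0 < D)%N -> gam x <= fD D x + 2 * C%:R / D%:R.
Proof. by move=> D0; apply: ge_inf; [exists 0; exact: gset_lb|exists D]. Qed.

Lemma gam_ge D x : (0 < D)%N -> 0 <= x -> fD D x - 2 * C%:R / D%:R <= gam x.
Proof. by move=> D0 x0; apply: (lb_le_inf (gset0 x)) => _ [D' D'0 ->]; exact: fD_cmp. Qed.

Lemma fD_mono D x y : x <= y -> fD D y <= fD D x.
Proof. by move=> xy; apply: ga_mono; apply: le_truncn; rewrite ler_wpM2r ?ler0n. Qed.

Lemma gam_mono x y : x <= y -> gam y <= gam x.
Proof.
move=> xy; apply: (lb_le_inf (gset0 x)) => _ [D D0 ->]; apply: le_trans (gam_le y D0) _.
by rewrite lerD2r fD_mono.
Qed.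

Lemma le_small (x y c : R) : (forall D, (0 < D)%N -> x <= y + c / D%:R) -> x <= y.
Proof.
move=> h; have hc : (y + c * harmonic n) @[n --> \oo] --> y + c * 0.
  by apply: cvgD; [exact: cvg_cst|apply: cvgM; [exact: cvg_cst|exact: cvg_harmonic]].
rewrite mulr0 addr0 in hc; have hx : (fun _ : nat => x) @ \oo --> x by exact: cvg_cst.
by apply: (ler_cvg_to hx hc); apply: nearW => n; exact: h.
Qed.

Lemma gam_zero x : C3.+1%:R <= x -> gam x = 0.
Proof.
move=> hx; apply/eqP; rewrite eq_le gam_ge0 andbT; apply: (@le_small _ _ (2 * C%:R)) => D D0.
apply: le_trans (gam_le x D0) _; rewrite lerD2r /fD /ga hzero ?mul0r //.
apply: (@leq_trans (C3.+1 * D)); first by rewrite mulSn addnC -[X in (X < _)%N]addn0 ltn_add2l.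
rewrite truncn_ge_nat ?natrM ?ler_wpM2r ?ler0n // mulr_ge0 ?ler0n //.
by apply: le_trans hx; rewrite ler0n.
Qed.

Lemma gam_lip x y : 0 <= x -> x <= y -> gam x <= gam y + C%:R * (y - x).
Proof.
(* The factor 5 is 2 for each of the approximations at [x] and [y], and 1 for the rounding of the
   difference. *)
move=> x0 xy; apply: (@le_small _ _ (5 * C%:R)) => D D0.
have D0' : 0 < (D%:R : R) by rewrite ltr0n.
have h1 := gam_le x D0; have h2 := gam_ge D0 (le_trans x0 xy).
have hx : 0 <= x * D%:R by rewrite mulr_ge0 ?ler0n.
have hy : 0 <= y * D%:R by rewrite mulr_ge0 ?ler0n // (le_trans x0).
have /andP[a1 a2] := truncn_itv hx; have /andP[b1 b2] := truncn_itv hy.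
set s := Num.truncn _ in a1 a2; set t := Num.truncn _ in b1 b2.
have st : (s <= t)%N by apply: le_truncn; rewrite ler_wpM2r ?ler0n.
have h3 := ga_lip s (t - s) D0; rewrite subnKC // in h3.
have h4 : (t - s)%:R * (C%:R / D%:R) <= C%:R * (y - x) + C%:R / D%:R.
  have -> : C%:R * (y - x) + C%:R / D%:R = (y * D%:R - x * D%:R + 1) * (C%:R / D%:R) by field; rewrite gt_eqF.
  rewrite ler_wpM2r ?divr_ge0 ?ler0n // natrB //.
  by move: a2; rewrite -natr1; lra.
have E5 : 5 * C%:R / D%:R = 2 * C%:R / D%:R + 2 * C%:R / D%:R + C%:R / D%:R :> R by field; rewrite gt_eqF.
rewrite E5; rewrite /fD -/s -/t in h1 h2; lra.
Qed.

Lemma gam_norm x y : 0 <= x -> 0 <= y -> `|gam x - gam y| <= C%:R * `|x - y|.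
Proof.
move=> x0 y0; wlog xy : x y x0 y0 / x <= y.
  move=> h; have [xy|/ltW yx] := leP x y; first exact: h.
  by rewrite distrC [`|x - y|]distrC; exact: h.
have h1 := gam_lip x0 xy; have h2 := gam_mono xy.
by rewrite [`|x - y|]distrC !ger0_norm ?subr_ge0 // lerBlDl.
Qed.

Lemma gam_ga D k : (0 < D)%N -> `|gam (k%:R / D%:R) - ga D k| <= 2 * C%:R / D%:R.
Proof.
move=> D0; have x0 : 0 <= (k%:R / D%:R : R) by rewrite divr_ge0 ?ler0n.
have h1 := gam_le (k%:R / D%:R) D0; have h2 := gam_ge D0 x0.
rewrite /fD divfK ?natrK in h1 h2; last by rewrite pnatr_eq0 -lt0n.
by rewrite ler_norml; apply/andP; split; lra.
Qed.

(** The sample is taken at the right end, since the sum to be compared starts at $k=1$. This costs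
    one more Lipschitz step and turns 2 into 3. *)
Lemma gam_piece D k x : (0 < D)%N -> k%:R / D%:R <= x < k.+1%:R / D%:R ->
  `|gam x - ga D k.+1| <= 3 * C%:R / D%:R.
Proof.
move=> D0 /andP[x1 x2]; have D0' : 0 < (D%:R : R) by rewrite ltr0n.
have x0 : 0 <= x by apply: le_trans x1; rewrite divr_ge0 ?ler0n.
have h1 := gam_le x D0; have h2 := gam_ge D0 x0.
have E : Num.truncn (x * D%:R) = k.
  by apply: trunc_def; rewrite -ler_pdivrMr // x1 -ltr_pdivlMr.
rewrite /fD E in h1 h2.
have h3 := ga_lip k 1 D0; rewrite addn1 mul1r in h3; have h4 := ga_mono D (leqnSn k).
move: h1 h2 h3; rewrite -!mulrA; move: (C%:R / D%:R) => c h1 h2 h3.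
by rewrite ler_norml; apply/andP; split; lra.
Qed.

Lemma measurable_gam (A : set R) : measurable A -> measurable_fun A (fun x => (gam x)%:E).
Proof. by move=> mA; apply/measurable_EFinP; apply: nonincreasing_measurable => // x y; exact: gam_mono. Qed.

Lemma integral_piece (a b lo hi : R) : a <= b -> (forall x, a <= x < b -> lo <= gam x <= hi) ->
  ((lo * (b - a))%:E <= \int[lebesgue_measure]_(x in `[a, b[) (gam x)%:E <= (hi * (b - a))%:E)%E.
Proof.
move=> ab h.
have mu : lebesgue_measure (`[a, b[%classic : set R) = (b - a)%:E.
  rewrite lebesgue_measure_itv /= lte_fin; case: ltP => [_|ba]; first by rewrite EFinB.
  by have -> : a = b by [apply/eqP; rewrite eq_le ab]; rewrite subrr.
have ab0 : 0 <= b - a by rewrite subr_ge0.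
apply/andP; split.
  (* Comparison of integrals is available for nonnegative functions, while [lo] may be negative. *)
  apply: (@le_trans _ _ (\int[lebesgue_measure]_(x in `[a, b[) cst ((Num.max 0 lo)%:E) x)%E).
    by rewrite integral_cst //= mu -EFinM lee_fin ler_wpM2r // le_max lexx orbT.
  apply: ge0_le_integral => //=.
  - by move=> x _; rewrite lee_fin le_max lexx.
  - exact: measurable_gam.
  - move=> x; rewrite in_itv /= => hx; have /andP[h1 h2] := h x hx.
    by rewrite lee_fin ge_max gam_ge0 h1.
apply: (@le_trans _ _ (\int[lebesgue_measure]_(x in `[a, b[) cst (hi%:E) x)%E); last first.
  by rewrite integral_cst //= mu -EFinM.
apply: ge0_le_integral => //=.
- by move=> x _; rewrite lee_fin gam_ge0.
- exact: measurable_gam.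
- by move=> x; rewrite in_itv /= => hx; have /andP[h1 h2] := h x hx.
Qed.

Lemma integral_gam_split (a b : R) : 0 <= a -> a <= b ->
  (\int[lebesgue_measure]_(x in `[0%R, b[) (gam x)%:E =
   \int[lebesgue_measure]_(x in `[0%R, a[) (gam x)%:E + \int[lebesgue_measure]_(x in `[a, b[) (gam x)%:E)%E.
Proof.
move=> a0 ab; rewrite -ge0_integral_setU //=.
- congr (integral _ _ _); rewrite -itv_bndbnd_setU //= bnd_simp //.
- by apply: measurable_gam; apply: measurableU.
- by move=> x _; rewrite lee_fin gam_ge0.
- apply/disj_setPS => x [] /=; rewrite !in_itv /= => /andP[_ h1] /andP[h2 _].
  by rewrite ltNge h2 in h1.
Qed.

Lemma integral_steps D q : (0 < D)%N ->
  ((\sum_(k < q) ga D k.+1 / D%:R - q%:R * (3 * C%:R / D%:R / D%:R))%:E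
   <= \int[lebesgue_measure]_(x in `[0%R, (q%:R / D%:R)%R[) (gam x)%:E
   <= (\sum_(k < q) ga D k.+1 / D%:R + q%:R * (3 * C%:R / D%:R / D%:R))%:E)%E.
Proof.
move=> D0; have D0' : 0 < (D%:R : R) by rewrite ltr0n.
elim: q => [|q IH].
  by rewrite !big_ord0 !mul0r subr0 addr0 set_itvco0 integral_set0 lexx.
have q0 : 0 <= (q%:R / D%:R : R) by rewrite divr_ge0 ?ler0n.
have qq : q%:R / D%:R <= (q.+1%:R / D%:R : R) by rewrite ler_wpM2r ?invr_ge0 ?ler_nat ?ler0n.
rewrite (integral_gam_split q0 qq) !big_ord_recr /=.
have := @integral_piece (q%:R / D%:R) (q.+1%:R / D%:R) (ga D q.+1 - 3 * C%:R / D%:R) (ga D q.+1 + 3 * C%:R / D%:R) qq.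
have -> : (q.+1%:R / D%:R - q%:R / D%:R : R) = D%:R^-1 by rewrite -mulrBl -natr1 addrAC subrr add0r mul1r.
move=> hp; have /andP[p1 p2] : ((((ga D q.+1 - 3 * C%:R / D%:R) / D%:R)%:E <= \int[lebesgue_measure]_(x in `[(q%:R / D%:R)%R, (q.+1%:R / D%:R)%R[) (gam x)%:E) && (\int[lebesgue_measure]_(x in `[(q%:R / D%:R)%R, (q.+1%:R / D%:R)%R[) (gam x)%:E <= ((ga D q.+1 + 3 * C%:R / D%:R) / D%:R)%:E))%E.
  apply: hp => x hx; have := gam_piece D0 hx; rewrite ler_norml => /andP[h1 h2].
  by apply/andP; split; lra.
have /andP[i1 i2] := IH; apply/andP; split.
  apply: le_trans (leeD i1 p1); rewrite -EFinD lee_fin -natr1 mulrDl mul1r mulrBl; lra.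
apply: le_trans (leeD i2 p2) _; rewrite -EFinD lee_fin -natr1 mulrDl mul1r [X in _ + X <= _]mulrDl; lra.
Qed.

Lemma integral_gam_cut :
  (\int[lebesgue_measure]_(x in `[0%R, +oo[) (gam x)%:E =
   \int[lebesgue_measure]_(x in `[0%R, C3.+1%:R[) (gam x)%:E)%E.
Proof.
have M0 : 0 <= (C3.+1%:R : R) by rewrite ler0n.
have -> : (`[0%R, +oo[ : set R)%classic = `[0%R, C3.+1%:R[%classic `|` `[C3.+1%:R, +oo[%classic.
  by rewrite -itv_bndbnd_setU //= bnd_simp.
rewrite ge0_integral_setU //=.
- rewrite [X in (_ + X)%E]integral0_eq ?adde0 // => x /=; rewrite in_itv /= andbT => hx.
  by rewrite gam_zero.
- by apply: measurable_gam; apply: measurableU.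
- by move=> x _; rewrite lee_fin gam_ge0.
- apply/disj_setPS => x [] /=; rewrite !in_itv /= => /andP[_ h1] /andP[h2 _].
  by rewrite ltNge h2 in h1.
Qed.

(** The function [gam] vanishes beyond $C_3+1$, so there are $(C_3+1)D$ pieces of length $1/D$, each
    with an error of at most $3C/D$ in the integrand. *)
Lemma sum_integral D : (0 < D)%N -> exists2 I : R,
  (\int[lebesgue_measure]_(x in `[0%R, +oo[) (gam x)%:E)%E = I%:E &
  `|\sum_(1 <= k < (C3.+1 * D).+1) (G D k)%:R - D%:R ^+ d.+1 * I| <= (3 * C * C3.+1)%:R * D%:R ^+ d.
Proof.
move=> D0; have D0' : 0 < (D%:R : R) by rewrite ltr0n.
have := integral_steps (C3.+1 * D) D0; rewrite integral_gam_cut natrM mulfK ?gt_eqF //.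
case: (integral _ _ _) => [I| |]; last by case/andP.
  move=> /andP[h1 h2]; exists I => //; rewrite !lee_fin in h1 h2.
  have P0 : 0 < (D%:R : R) ^+ d by rewrite exprn_gt0.
  rewrite -big_distrl /= in h1 h2.
  have E : \sum_(1 <= k < (C3.+1 * D).+1) (G D k)%:R = D%:R ^+ d * \sum_(k < C3.+1 * D) ga D k.+1.
    rewrite big_add1 /= big_mkord big_distrr /=; apply: eq_bigr => k _.
    by rewrite /ga mulrC divfK ?gt_eqF.
  rewrite E exprSr -mulrA -mulrBr normrM [X in X * _]gtr0_norm // mulrC ler_pM2r // !natrM.
  move: h1 h2; set Sg := \sum_(k < _) _ => h1 h2.
  have e1 : C3.+1%:R * D%:R * (3 * C%:R / D%:R / D%:R) = 3 * C%:R * C3.+1%:R / D%:R :> R by field; rewrite gt_eqF.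
  rewrite e1 -mulrBl in h1; rewrite e1 -mulrDl in h2.
  rewrite ler_pdivrMr // in h1; rewrite ler_pdivlMr // in h2.
  by rewrite ler_norml; apply/andP; split; lra.
by case/andP => _; rewrite leNgt ltry.
Qed.

Hypothesis hV : forall Q k, (0 < Q)%N -> exists N, forall j, (0 < j)%N ->
  (j ^ d * V Q k <= G (N + j * Q) (j * k) + j ^ d * (C * Q ^ d.-1))%N.

(** Divide [hV] by $j^d$ and let $j\to\infty$: the shift [N] becomes negligible against $jQ$. The
    auxiliary [F] is the resulting bound as a function of $1/j$, whose value at 0 is the limit. *)
Lemma V_gam Q k : (0 < Q)%N ->
  (V Q k)%:R <= Q%:R ^+ d * (gam (k%:R / Q%:R) + C%:R / Q%:R).
Proof.
move=> Q0; have Q0' : 0 < (Q%:R : R) by rewrite ltr0n.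
have [N hN] := hV k Q0; set g := gam _.
have P0 : 0 < (Q%:R : R) ^+ d by rewrite exprn_gt0.
rewrite mulrC -ler_pdivrMr //.
pose c1 := C%:R * (k%:R * N%:R) + 2 * C%:R : R.
pose F (x : R) := (g + c1 * x) * (1 + N%:R * x) ^+ d + C%:R / Q%:R.
have hF : F (harmonic n) @[n --> \oo] --> F 0.
  rewrite /F; apply: cvgD; last exact: cvg_cst.
  have hl (a b : R) : (a + b * harmonic n) @[n --> \oo] --> a + b * 0.
    by apply: cvgD; [exact: cvg_cst|apply: cvgM; [exact: cvg_cst|exact: cvg_harmonic]].
  apply: cvgM; first exact: hl.
  exact: (cvg_comp _ _ (hl 1 N%:R) (@exprn_continuous R d _)).
have -> : g + C%:R / Q%:R = F 0 by rewrite /F !mulr0 !addr0 expr1n mulr1.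
have hx : (fun _ : nat => (V Q k)%:R / Q%:R ^+ d : R) @ \oo --> ((V Q k)%:R / Q%:R ^+ d : R) by exact: cvg_cst.
apply: (ler_cvg_to hx hF); apply: nearW => n /=.
pose j := n.+1; have j0 : 0 < (j%:R : R) by rewrite ltr0n.
pose D := (N + j * Q)%N.
have D0 : (0 < D)%N by rewrite /D addn_gt0 muln_gt0 Q0 orbT.
have D0' : 0 < (D%:R : R) by rewrite ltr0n.
have J0 : 0 < (j%:R : R) ^+ d by rewrite exprn_gt0.
have := hN j isT; rewrite -(ler_nat R) natrD !natrM !natrX -/D => h1.
have h2 := gam_ga (j * k) D0; rewrite ler_norml in h2; case/andP: h2 => h2 _.
have jD : j%:R <= (D%:R : R) by rewrite ler_nat /D; nia.
have h3 : gam ((j * k)%:R / D%:R) <= g + C%:R * (k%:R / Q%:R - (j * k)%:R / D%:R).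
  apply: gam_lip; first by rewrite divr_ge0 ?ler0n.
  rewrite ler_pdivrMr // mulrAC ler_pdivlMr // -!natrM ler_nat /D; nia.
have h4 : k%:R / Q%:R - (j * k)%:R / D%:R <= k%:R * N%:R * j%:R^-1 :> R.
  have -> : k%:R / Q%:R - (j * k)%:R / D%:R = k%:R * N%:R / (Q%:R * D%:R) :> R.
    have ED : (D%:R : R) = N%:R + j%:R * Q%:R by rewrite /D natrD natrM.
    have -> : N%:R = D%:R - j%:R * Q%:R :> R by rewrite ED addrK.
    by rewrite natrM; move: (D%:R) D0' {ED} => D' D0''; field; rewrite !gt_eqF.
  rewrite ler_wpM2l ?mulr_ge0 ?ler0n // lef_pV2 ?posrE ?mulr_gt0 //.
  by rewrite -natrM ler_nat /D; nia.
have h5 : 2 * C%:R / D%:R <= 2 * C%:R * j%:R^-1 :> R.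
  by rewrite ler_wpM2l ?mulr_ge0 ?ler0n // lef_pV2 ?posrE.
have h6 : ga D (j * k) <= g + c1 * j%:R^-1.
  have : C%:R * (k%:R / Q%:R - (j * k)%:R / D%:R) <= C%:R * (k%:R * N%:R * j%:R^-1) :> R by rewrite ler_wpM2l ?ler0n.
  by rewrite /c1 mulrDl -!mulrA; move: h2 h3 h5; rewrite -!mulrA; lra.
have h7 : (D%:R : R) <= (1 + N%:R * j%:R^-1) * (j%:R * Q%:R).
  have -> : (1 + N%:R * j%:R^-1) * (j%:R * Q%:R) = j%:R * Q%:R + N%:R * Q%:R :> R by field; rewrite gt_eqF.
  by rewrite -!natrM -natrD ler_nat /D; nia.
have h8 : (D%:R : R) ^+ d <= (1 + N%:R * j%:R^-1) ^+ d * (j%:R ^+ d * Q%:R ^+ d).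
  by rewrite -!exprMn lerXn2r // nnegrE ?ler0n // (le_trans _ h7) ?ler0n.
have E : (G D (j * k))%:R = ga D (j * k) * D%:R ^+ d.
  by rewrite /ga divfK // gt_eqF // exprn_gt0.
have h9 : (G D (j * k))%:R <= (g + c1 * j%:R^-1) * ((1 + N%:R * j%:R^-1) ^+ d * (j%:R ^+ d * Q%:R ^+ d)).
  by rewrite E; apply: ler_pM; rewrite ?ga_ge0 ?exprn_ge0 ?ler0n.
rewrite ler_pdivrMr // -(ler_pM2l J0); apply: le_trans h1 _.
apply: le_trans (lerD h9 (lexx _)) _; rewrite /F /harmonic /= -/j.
by rewrite (expP Q0) le_eqVlt; apply/orP; left; apply/eqP; field; rewrite !gt_eqF.
Qed.

Lemma limn_esup_vol (W : nat -> nat -> \bar R) p0 p1 : (0 < p0)%N -> (0 < p1)%N ->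
  (forall Q k, (0 < Q)%N -> (0 < k)%N -> (((G Q k)%:R)%:E <= W Q k <= ((V Q k)%:R)%:E)%E) ->
  limn_esup (fun D : nat => W (D * p0)%N (D * p1)%N * (d`!%:R / D%:R ^+ d)%:E)%E =
  (d`!%:R * p0%:R ^+ d * gam (p1%:R / p0%:R))%:E.
Proof.
move=> hp0 hp1 hW; have p0' : 0 < (p0%:R : R) by rewrite ltr0n.
have f0 : 0 < (d`!%:R : R) by rewrite ltr0n fact_gt0.
set g := gam _; set A := d`!%:R * p0%:R ^+ d.
have A0 : 0 < A by rewrite mulr_gt0 ?exprn_gt0.
have hc (c : R) : ((A * (g + c / n%:R))%:E) @[n --> \oo] --> (A * g)%:E.
  apply: cvg_EFin; first by apply: nearW.
  rewrite -[X in _ --> A * X]addr0 -[X in _ --> A * (_ + X)](mulr0 c) -cvg_shiftS /=.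
  apply: cvgM; first exact: cvg_cst.
  by apply: cvgD; [exact: cvg_cst|apply: cvgM; [exact: cvg_cst|exact: cvg_harmonic]].
suff hl : (fun D : nat => W (D * p0)%N (D * p1)%N * (d`!%:R / D%:R ^+ d)%:E)%E @ \oo --> (A * g)%:E.
  by have [_ ->] := cvg_limn_einf_sup hl.
apply: squeeze_cvge (hc (- (2 * C%:R / p0%:R))) (hc (C%:R / p0%:R)).
near=> D.
have D0 : (0 < D)%N by near: D; exists 1%N.
have D0' : 0 < (D%:R : R) by rewrite ltr0n.
have P0 : 0 < (D%:R : R) ^+ d by rewrite exprn_gt0.
have Dp0 : (0 < D * p0)%N by rewrite muln_gt0 D0.
have Dp1 : (0 < D * p1)%N by rewrite muln_gt0 D0.
have Eg : (D * p1)%:R / (D * p0)%:R = p1%:R / p0%:R :> R by rewrite !natrM; field; rewrite !gt_eqF.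
have /andP[w1 w2] := hW _ _ Dp0 Dp1.
have c0 : (0 <= (d`!%:R / D%:R ^+ d : R)%:E)%E by rewrite lee_fin divr_ge0 ?ltW.
apply/andP; split.
  apply: le_trans (lee_wpmul2r c0 w1); rewrite -EFinM lee_fin.
  have := gam_ga (D * p1) Dp0; rewrite Eg -/g ler_norml => /andP[_ h].
  have -> : (G (D * p0) (D * p1))%:R = ga (D * p0) (D * p1) * (D%:R ^+ d * p0%:R ^+ d).
    by rewrite /ga natrM exprMn divfK // gt_eqF // mulr_gt0 // exprn_gt0.
  have -> : ga (D * p0) (D * p1) * (D%:R ^+ d * p0%:R ^+ d) * (d`!%:R / D%:R ^+ d) = A * ga (D * p0) (D * p1).
    by rewrite /A; field; rewrite gt_eqF.
  rewrite ler_pM2l //; rewrite natrM in h.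
  by have : 2 * C%:R / (D%:R * p0%:R) = 2 * C%:R / p0%:R / D%:R :> R; [field; rewrite !gt_eqF|lra].
apply: le_trans (lee_wpmul2r c0 w2) _; rewrite -EFinM lee_fin.
have := V_gam (D * p1) Dp0; rewrite Eg -/g natrM exprMn => h.
rewrite mulrA ler_pdivrMr // mulrC -[X in _ <= X]mulrA mulrAC.
rewrite [X in _ <= X](_ : _ = d`!%:R * (D%:R ^+ d * p0%:R ^+ d * (g + C%:R / (D%:R * p0%:R)))) ?ler_pM2l //.
by rewrite /A; field; rewrite !gt_eqF.
Unshelve. all: by end_near.
Qed.

(** * From integral classes to real classes and the integral of volumes *)

Section Volume.
Variables (K : fieldExtType rat) (n : nat) (P : prime_idealr (mpoly n.+1 K)).
Variables (eta : 'I_n.+1 -> K) (L : 'I_2 -> divisor P).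

Definition pair2 (T : Type) (x y : T) (i : 'I_2) : T := if i == ord0 then x else y.

Hypothesis hL : forall Q k, (0 < Q)%N -> (0 < k)%N ->
  (((G Q k)%:R)%:E <= dimK R (div_sections eta (div_comb L (pair2 (Posz Q) (- Posz k)%R))) <= ((V Q k)%:R)%:E)%E.

Lemma vol_int_gam p0 p1 : (0 < p0)%N -> (0 < p1)%N ->
  vol_int eta R d L (pair2 (Posz p0) (- Posz p1)) = (d`!%:R * p0%:R ^+ d * gam (p1%:R / p0%:R))%:E.
Proof.
move=> h0 h1; rewrite -(limn_esup_vol h0 h1 hL) /vol_int; congr limn_esup.
apply/funext => D; congr (_ * _)%E; congr (dimK R (div_sections eta (div_comb L _))).
by apply/funext => i; rewrite /pair2; case: ifP => _; rewrite ?mulrN PoszM.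
Qed.

Lemma vol_rat_gam (a : 'I_2 -> rat) : 0 < a ord0 -> a ord_max < 0 ->
  vol_rat eta R d L a = (d`!%:R * ratr (a ord0) ^+ d * gam (ratr (- a ord_max / a ord0)))%:E.
Proof.
move=> a0 a1; rewrite /vol_rat.
have EN : \prod_i denq (a i) = denq (a ord0) * denq (a ord_max).
  by rewrite !big_ord_recl big_ord0 mulr1; congr (_ * denq (a _)); apply: val_inj.
rewrite EN; set N := _ * _; have N0 : 0 < N by rewrite mulr_gt0 ?denq_gt0.
have N0' : 0 < (N%:~R : rat) by rewrite ltr0z.
have N0'' : 0 < (N%:~R : R) by rewrite ltr0z.
have [p0 h0 E0] : exists2 p0 : nat, (0 < p0)%N & N%:~R * a ord0 = p0%:R.
  have : N%:~R * a ord0 = (denq (a ord_max) * numq (a ord0))%:~R.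
    by rewrite /N rmorphM /= mulrAC -[X in _ * X * _]divq_num_den !intrM; field; rewrite intr_eq0 denq_neq0.
  have : 0 < denq (a ord_max) * numq (a ord0) by rewrite mulr_gt0 ?denq_gt0 // numq_gt0.
  by case: (_ * numq _) => // p hp ->; exists p.
have [p1 h1 E1] : exists2 p1 : nat, (0 < p1)%N & N%:~R * a ord_max = - p1%:R.
  have : N%:~R * a ord_max = - (denq (a ord0) * - numq (a ord_max))%:~R.
    by rewrite /N rmorphM /= -[X in _ * _ * X]divq_num_den !(intrM, mulrN, rmorphN) /=; field; rewrite intr_eq0 denq_neq0.
  have : 0 < denq (a ord0) * - numq (a ord_max) by rewrite mulr_gt0 ?denq_gt0 // oppr_gt0 numq_lt0.
  by case: (_ * - numq _) => // p hp ->; exists p.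
have -> : (fun i => numq (N%:~R * a i)) = pair2 (Posz p0) (- Posz p1).
  apply/funext => i; rewrite /pair2; case: eqP => [->|/eqP i0].
    by rewrite E0 -[p0%:R]/(p0%:Z%:~R) numq_int.
  have -> : i = ord_max by apply: val_inj; case: i i0 => [[|[|i]] hi].
  by rewrite E1 -[p1%:R]/(p1%:Z%:~R) -rmorphN numq_int.
rewrite vol_int_gam // -EFinM; congr EFin.
have a0' : a ord0 = p0%:R / N%:~R by rewrite -E0 mulrAC mulfV ?gt_eqF // mul1r.
have a1' : a ord_max = - p1%:R / N%:~R by rewrite -E1 mulrAC mulfV ?gt_eqF // mul1r.
have p0' : 0 < (p0%:R : rat) by rewrite ltr0n.
have -> : - a ord_max / a ord0 = p1%:R / p0%:R by rewrite a0' a1'; field; rewrite !gt_eqF.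
rewrite a0' !fmorph_div /= !ratr_nat ratr_int expr_div_n; lra.
Qed.

Lemma rat_nbhs_filter (c : 'I_2 -> R) : ProperFilter (rat_nbhs c).
Proof.
split.
  move=> [eps e0 h].
  have /choice [a ha] (i : 'I_2) : exists q : rat, `|ratr q - c i| < eps.
    have [|q] := @rat_in_itvoo R (c i - eps) (c i + eps); first by lra.
    by rewrite in_itv /= => /andP[h1 h2]; exists q; rewrite ltr_norml; apply/andP; split; lra.
  exact: (h a).
split.
- by exists 1.
- move=> A B [e1 h1 hA] [e2 h2 hB]; exists (Num.min e1 e2); first by rewrite lt_min h1.
  by move=> a ha; split; [apply: hA|apply: hB] => i; have := ha i; rewrite lt_min => /andP[].
- by move=> A B AB [e1 h1 hA]; exists e1 => // a /hA /AB.
Qed.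

(** Near $(1,-x)$ with $x>0$ all rational classes have a positive first and a negative second
    coefficient, so [vol_rat_gam] applies to them; the limit exists as [gam] is Lipschitz. *)
Lemma vol_real_gam (x : R) : 0 < x -> vol_real eta d L (pair2 1 (- x)) = (d`!%:R * gam x)%:E.
Proof.
move=> x0; have FF := rat_nbhs_filter (pair2 1 (- x)).
pose FT := rat_nbhs (pair2 1 (- x)).
apply: cvg_lim => //.
have c0 : (fun a : 'I_2 -> rat => ratr (a ord0) : R) @ FT --> (1 : R).
  by apply/cvgrPdist_lt => eps e0; exists eps => // a /(_ ord0); rewrite /pair2 eqxx distrC.
have c1 : (fun a : 'I_2 -> rat => ratr (a ord_max) : R) @ FT --> - x.
  by apply/cvgrPdist_lt => eps e0; exists eps => // a /(_ ord_max); rewrite /pair2 /= distrC.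
have cq : (fun a : 'I_2 -> rat => ratr (- a ord_max / a ord0) : R) @ FT --> x.
  have -> : (fun a : 'I_2 -> rat => ratr (- a ord_max / a ord0) : R) = (fun a => (- ratr (a ord_max)) * (ratr (a ord0))^-1).
    by apply/funext => a; rewrite fmorph_div /= rmorphN.
  suff : (fun a : 'I_2 -> rat => - ratr (a ord_max) * (ratr (a ord0))^-1 : R) @ FT --> - - x * 1^-1 by rewrite invr1 mulr1 opprK.
  by apply: cvgM; [exact: cvgN|apply: cvgV => //; exact: oner_neq0].
have near_pos : \forall a \near FT, 0 < a ord0 /\ a ord_max < 0.
  exists (Num.min 1 x); first by rewrite lt_min ltr01.
  move=> a ha; have := ha ord0; have := ha ord_max; rewrite /pair2 /= !lt_min !ltr_norml.
  move=> /andP[_ /andP[_ h1]] /andP[/andP[h2 _] _].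
  by split; [rewrite -(ltr0q R)|rewrite -(ltrq0 R)]; lra.
apply: (@cvg_trans _ ((fun a : 'I_2 -> rat => (d`!%:R * ratr (a ord0) ^+ d * gam (ratr (- a ord_max / a ord0)))%:E : \bar R) @ FT)).
  apply: near_eq_cvg; apply: filterS near_pos => a [h0 h1].
  by rewrite /= vol_rat_gam.
apply: cvg_EFin; first by apply: nearW.
suff : (fun a : 'I_2 -> rat => d`!%:R * ratr (a ord0) ^+ d * gam (ratr (- a ord_max / a ord0)) : R) @ FT --> d`!%:R * 1 ^+ d * gam x by rewrite expr1n mulr1.
apply: cvgM.
  apply: cvgM; first exact: cvg_cst.
  exact: (cvg_comp _ _ c0 (@exprn_continuous R d _)).
apply/cvgrPdist_lt => eps e0.
have eC : 0 < eps / (C%:R + 1) by rewrite divr_gt0 // -[1]/(1%:R) -natrD ltr0n addn1.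
have near_x : \forall a \near FT, `|x - ratr (- a ord_max / a ord0)| < eps / (C%:R + 1).
  exact: (@cvgr_dist_lt _ _ _ _ _ _ _ cq _ eC).
apply: filterS2 near_pos near_x => a [h2 h3] h1.
apply: le_lt_trans (gam_norm _ _) _; first exact: ltW.
  by rewrite ler0q divr_ge0 ?ltW // oppr_gt0.
have C0 : 0 <= (C%:R : R) by [].
apply: (@le_lt_trans _ _ ((C%:R + 1) * `|x - ratr (- a ord_max / a ord0)|)).
  by rewrite ler_wpM2r // lerDl.
by rewrite mulrC -ltr_pdivlMr //; lra.
Qed.

Lemma sum_volume D : (0 < D)%N ->
  (`| \sum_(1 <= k <oo) ((G D k)%:R)%:E - (D%:R ^+ d.+1 / d`!%:R)%:E *
     \int[@lebesgue_measure R]_(x in `[0%R, +oo[) vol_real eta d L (pair2 1%R (- x)%R) |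
   <= ((3 * C * C3.+1)%:R * D%:R ^+ d)%:E)%E.
Proof.
move=> D0; have [I EI hI] := sum_integral D0.
have f0 : 0 < (d`!%:R : R) by rewrite ltr0n fact_gt0.
have -> : (\int[@lebesgue_measure R]_(x in `[0%R, +oo[) vol_real eta d L (pair2 1%R (- x)%R) = (d`!%:R * I)%:E)%E.
  (* At $\lambda=0$ every neighbourhood contains classes with a positive multiple of the second
     divisor, to which [hL] does not apply. Removing this point does not change the integral. *)
  rewrite -integral_itv_obnd_cbnd; last first.
    apply: (@eq_measurable_fun _ _ _ _ _ (fun x => ((d`!%:R)%:E * (gam x)%:E)%E)).
      by move=> x; rewrite inE /= in_itv /= andbT => x0; rewrite vol_real_gam.
    by apply: emeasurable_funM => //; exact: measurable_gam.
  transitivity (\int[@lebesgue_measure R]_(x in `]0%R, +oo[) ((d`!%:R)%:E * (gam x)%:E))%E.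
    by apply: eq_integral => x; rewrite inE /= in_itv /= andbT => x0; rewrite vol_real_gam.
  rewrite ge0_integralZl_EFin //;
    do ?[by move=> x _; rewrite lee_fin gam_ge0|exact: measurable_gam].
  by rewrite integral_itv_obnd_cbnd ?EI //; exact: measurable_gam.
have -> : (\sum_(1 <= k <oo) ((G D k)%:R)%:E = (\sum_(1 <= k < (C3.+1 * D).+1) (G D k)%:R)%:E :> \bar R)%E.
  rewrite (nneseries_split 1 (C3.+1 * D)); last by move=> k _; rewrite lee_fin ler0n.
  rewrite add1n eseries0 ?adde0 ?sumEFin // => k hk _; rewrite hzero //.
  by apply: leq_trans hk; rewrite ltnS leq_mul2r leqnSn orbT.
rewrite -EFinM -EFinB abse_EFin lee_fin.
by have -> : D%:R ^+ d.+1 / d`!%:R * (d`!%:R * I) = D%:R ^+ d.+1 * I by field; rewrite gt_eqF.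
Qed.

End Volume.
End Asymptotics.

End VolumeLimit.

Module Chains.
Import Sumset Embedding Normalization Coordinates NoetherianLocal Vanishing RationalPoint.

(** * Chains of primes and graded primes *)

Local Notation homog q := (ishomog1 q mdeg).

(** Along a chain of primes with $x_i\in c_{i+1}\setminus c_i$, the $x_i$ satisfy no relation whose
    coefficients avoid the top prime. Primality of $c_0$ allows division by the lowest power of
    $x_0$ that occurs; modulo $c_1$ only the terms with exactly this power survive, and the chain is
    shorter by one. *)
Lemma chain_lex (F : fieldType) (A : set F) : sring A ->
  forall l (c : nat -> set F) (x : nat -> F) (J : finType) (P : pred J) (al : J -> nat -> nat)
    (ka : J -> F) (j0 : J),
  P j0 -> (forall i, (i <= l)%N -> is_prime A (c i)) ->
  (forall i, (i < l)%N -> [/\ c i `<=` c i.+1, c i.+1 (x i) & ~ c i (x i)]) ->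
  (forall j, P j -> A (ka j) /\ ~ c l (ka j)) ->
  (forall j j', P j -> P j' -> (forall i, (i < l)%N -> al j i = al j' i) -> j = j') ->
  c 0%N (\sum_(j | P j) ka j * \prod_(i < l) x i ^+ al j i) -> False.
Proof.
move=> sA; elim=> [|l IH] c x J P al ka j0 Pj0 cp cx hk inj h0.
  have E j : P j = (j == j0).
    by apply/idP/eqP => [Pj|->//]; apply: inj => //.
  by have [_] := hk _ Pj0; apply; move: h0; rewrite (eq_bigl _ _ E) big_pred1_eq big_ord0 mulr1.
have [cc x1 x0] := cx 0%N (ltn0Sn _).
have xA i : (i < l.+1)%N -> A (x i).
  by move=> il; have [_ h _] := cx i il; have [[sub _ _ _] _ _] := cp i.+1 il; apply: sub.
pose e := al [arg min_(j < j0 | P j) al j 0%N] 0%N.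
have [j1 Pj1 [Ej1 mine]] : exists2 j1, P j1 & e = al j1 0%N /\ forall j, P j -> (e <= al j 0%N)%N.
  by rewrite /e; case: arg_minnP => // j1 Pj1 hj1; exists j1.
have [[c0A c00 c0D c0M] c01 c0P] := cp 0%N (leq0n _).
have [c1I _ _] := cp 1%N isT; have c1am := ideal_amod c1I.
pose G j := ka j * (x 0%N ^+ (al j 0%N - e) * \prod_(i < l) x i.+1 ^+ al j i.+1).
have pA j : A (\prod_(i < l) x i.+1 ^+ al j i.+1).
  by refine (sring_prod sA _) => i _; apply: sringX => //; apply: xA; rewrite ltnS.
have GA j : P j -> A (G j).
  have [_ _ _ AM] := sA; move=> Pj; apply: (AM); first by case: (hk _ Pj).
  by apply: (AM) => //; apply: sringX => //; apply: xA.
have S0 : c 0%N (\sum_(j | P j) G j).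
  have E : \sum_(j | P j) ka j * \prod_(i < l.+1) x i ^+ al j i = x 0%N ^+ e * \sum_(j | P j) G j.
    rewrite big_distrr /=; apply: eq_bigr => j Pj.
    rewrite big_ord_recl /G [in RHS]mulrCA; congr (_ * _); rewrite mulrA -exprD subnKC //.
    exact: mine.
  rewrite E in h0; have {}x0 : ~ c 0%N (x 0%N ^+ e).
    by elim: (e) => [//|k IHk]; rewrite exprS => /c0P [] //; [apply: xA|apply: sringX => //; apply: xA].
  have [] := c0P _ _ _ _ h0 => //; first by apply: sringX => //; apply: xA.
  by refine (sring_sum sA _).
move: S0; rewrite (bigID (fun j => al j 0%N == e)) /= => S0.
apply: (IH (fun i => c i.+1) (fun i => x i.+1) J (fun j => P j && (al j 0%N == e)) (fun j i => al j i.+1) ka j1).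
- by rewrite Pj1 Ej1 eqxx.
- by move=> i il; apply: cp.
- by move=> i il; apply: cx.
- by move=> j /andP[Pj _]; apply: hk.
- move=> j j' /andP[Pj /eqP ej] /andP[Pj' /eqP ej'] h; apply: inj => // -[|i] il; first by rewrite ej ej'.
  exact: h.
have -> : \sum_(j | P j && (al j 0%N == e)) ka j * \prod_(i < l) x i.+1 ^+ al j i.+1 =
  \sum_(j | P j && (al j 0%N == e)) G j.
  by apply: eq_bigr => j /andP[_ /eqP ej]; rewrite /G ej subnn expr0 mul1r.
rewrite -[X in c 1%N X](addrK (\sum_(j | P j && (al j 0%N != e)) G j)).
apply: (amod_sub sA c1am); first exact: cc.
refine (amod_sum c1am _) => j /andP[Pj ej].
have lt : (e < al j 0%N)%N by rewrite ltn_neqAle eq_sym ej mine.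
rewrite /G -(subnSK lt) exprSr; have [_ _ c1M] := c1am; have [_ _ _ AM] := sA.
rewrite -!mulrA [x 0%N * _]mulrC !mulrA; apply: (c1M) => //.
by apply: (AM) => //; apply: (AM); [case: (hk _ Pj)|apply: sringX => //; apply: xA].
Qed.

Lemma prime_avoiding (F : fieldType) (A I : set F) (w : F) : sring A -> is_ideal A I -> A w ->
  (forall N, ~ I (w ^+ N)) -> exists q, [/\ is_prime A q, I `<=` q & ~ q w].
Proof.
move=> sA iI Aw hw.
pose T := {J : set F | [/\ is_ideal A J, I `<=` J & forall N, ~ J (w ^+ N)]}.
pose t0 : T := exist _ I (And3 iI (@subset_refl _ I) hw).
have [|||q hq] := @ZL_preorder T t0 (fun a b => `[< sval a `<=` sval b >]).
- by move=> x; apply/asboolP.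
- by move=> y x z /asboolP h1 /asboolP h2; apply/asboolP => t /h1 /h2.
- move=> C tot; have [[c0 Cc0]|noC] := pselect (exists c, C c); last first.
    by exists t0 => s Cs; exfalso; apply: noC; exists s.
  have comp (a b : T) : C a -> C b -> sval a `<=` sval b \/ sval b `<=` sval a.
    by move=> Ca Cb; have [/asboolP h|/asboolP h] := tot a b Ca Cb; [left|right].
  pose J : set F := \bigcup_(c in C) sval c.
  have hJ : [/\ is_ideal A J, I `<=` J & forall N, ~ J (w ^+ N)].
    split.
    - split.
      + by move=> x [c Cc hx]; have [[h _ _ _] _ _] := svalP c; apply: h.
      + by exists c0 => //; have [[_ h _ _] _ _] := svalP c0.
      + move=> x y [c Cc hx] [c' Cc' hy]; have [h|h] := comp c c' Cc Cc'.
          by exists c' => //; have [[_ _ hD _] _ _] := svalP c'; apply: hD => //; apply: h.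
        by exists c => //; have [[_ _ hD _] _ _] := svalP c; apply: hD => //; apply: h.
      + by move=> a x Aa [c Cc hx]; exists c => //; have [[_ _ _ hM] _ _] := svalP c; apply: hM.
    - by move=> x Ix; exists c0 => //; have [_ h _] := svalP c0; apply: h.
    - by move=> N [c Cc hx]; have [_ _ h] := svalP c; exact: (h N).
  exists (exist _ J hJ) => s Cs; apply/asboolP => x hx; exists s => //.
case: q hq => q [iq Iq wq] hq; exists q; have [qA q0 qD qM] := iq.
have big z : A z -> ~ q z -> exists N y a, [/\ q y, A a & w ^+ N = y + a * z].
  move=> Az nz; apply: contrapT => no.
  pose J : set F := [set t | exists y a, [/\ q y, A a & t = y + a * z]].
  have [A1 AD _ AM] := sA; have A0 := sring0 sA.
  have hJ : [/\ is_ideal A J, I `<=` J & forall N, ~ J (w ^+ N)].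
    split.
    - split.
      + by move=> _ [y [a [hy ha ->]]]; apply: AD; [apply: qA|apply: AM].
      + by exists 0, 0; rewrite mul0r addr0.
      + move=> _ _ [y [a [hy ha ->]]] [y' [a' [hy' ha' ->]]]; exists (y + y'), (a + a').
        by split; [apply: qD|apply: AD|rewrite mulrDl addrACA].
      + move=> b _ Ab [y [a [hy ha ->]]]; exists (b * y), (b * a).
        by split; [apply: qM|apply: AM|rewrite mulrDr mulrA].
    - by move=> x Ix; exists x, 0; rewrite mul0r addr0; split=> //; exact: (Iq).
    - by move=> N [y [a [h1 h2 h3]]]; apply: no; exists N, y, a.
  have /asboolP /= h : `[< sval (exist _ q (And3 iq Iq wq) : T) `<=` sval (exist _ J hJ : T) >].
    by apply/asboolP => x /= qx; exists x, 0; rewrite mul0r addr0.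
  have := hq (exist _ J hJ); rewrite /= => h'.
  have /asboolP /= h2 := h' (asboolT h).
  by apply: nz; apply: h2; exists 0, 1; rewrite mul1r add0r.
split=> //; last by have := wq 1%N; rewrite expr1.
split=> //; first by have := wq 0%N; rewrite expr0.
move=> x y Ax Ay qxy; apply: contrapT => /not_orP [nx ny].
have [N [y1 [a [h1 h2 h3]]]] := big x Ax nx; have [M [y2 [b [h4 h5 h6]]]] := big y Ay ny.
have [A1 AD _ AM] := sA.
apply: (wq (N + M)%N); rewrite exprD h3 h6.
have -> : (y1 + a * x) * (y2 + b * y) = (y2 + b * y) * y1 + ((a * x) * y2 + (a * b) * (x * y)) by ring.
by apply: (qD); [apply: qM => //; apply: AD; [apply: qA|apply: AM]|apply: (qD); apply: (qM) => //; apply: AM].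
Qed.

Lemma localization_noetherian (F : fieldType) (A I : set F) : sring A -> is_prime A I ->
  noetherian A -> sring (localization A I) -> noetherian (localization A I).
Proof.
move=> sA [[_ I0 _ _] I1 IP] nA sR J iJ; have [JR J0 JD JM] := iJ.
have [A1 AD AN AM] := sA.
have AR x : A x -> localization A I x by move=> Ax; exists x, 1; rewrite divr1.
pose J' : set F := J `&` A.
have iJ' : is_ideal A J'.
  split=> [x []//||x y [h1 h2] [h3 h4]|a x ha [h1 h2]].
  - by split=> //; exact: sring0.
  - by split; [apply: JD|apply: AD].
  - by split; [apply: JM => //; apply: AR|apply: AM].
have [s [g Eg]] := nA _ iJ'; exists s, g.
apply/seteqP; split=> z; last first.
  apply: lin_span_sub; first exact: ideal_amod.
  move=> _ [i _ <-]; have [] // : J' (g i).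
  by rewrite Eg; apply: lin_span_gen => //; exists i.
move=> Jz; have [x [y [Ax Ay ny E]]] := JR _ Jz.
have y0 : y != 0 by apply/eqP => y0; apply: ny; rewrite y0.
have : J' (y * z) by split; [apply: JM => //; exact: AR|rewrite E mulrCA mulfV ?mulr1].
rewrite Eg => /(lin_span_range _ _ sA) [a [ha Ez]].
apply/(lin_span_range _ _ sR); exists (fun i => a i / y); split.
  by move=> i; exists (a i), y.
by rewrite -[z](mulKf y0) Ez big_distrr /=; apply: eq_bigr => i _; rewrite mulrCA mulrA.
Qed.

(** * Homogeneous primes and primes of an affine chart *)

Section GradedPrimes.
Variables (K F : fieldType) (io : {rmorphism K -> F}) (n : nat) (X : 'I_n -> F).
Local Notation S := (S io X).
Hypothesis sdir : forall p : {poly F}, (forall i, S i p`_i) -> p.[1] = 0 -> p = 0.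

(** The pieces are summed inside the field, so an auxiliary polynomial records the components as its
    coefficients; by [sdir] it is determined by its value at 1. *)
Lemma graded_totalP z : graded_total S z <-> exists2 p : {poly F}, (forall i, S i p`_i) & z = p.[1].
Proof.
split=> [[k [f [hf ->]]]|[p hp ->]].
  exists (\poly_(i < k) f i); first by move=> i; rewrite coef_poly; case: ifP => _ //; exact: S_0.
  by rewrite horner_poly; apply: eq_bigr => i _; rewrite expr1n mulr1.
exists (size p), (fun i => p`_i); split=> //; rewrite horner_coef.
by apply: eq_bigr => i _; rewrite expr1n mulr1.
Qed.

Lemma gp_M (p q : {poly F}) : (forall i, S i p`_i) -> (forall i, S i q`_i) -> forall i, S i (p * q)`_i.
Proof.
move=> hp hq i; rewrite coefM; apply: S_sum => j _.
have ji : (j <= i)%N by rewrite -ltnS.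
by rewrite -[X in S X](subnKC ji); apply: S_M.
Qed.

Lemma gp_D (p q : {poly F}) : (forall i, S i p`_i) -> (forall i, S i q`_i) -> forall i, S i (p + q)`_i.
Proof. by move=> hp hq i; rewrite coefD; apply: S_D. Qed.

Lemma gp_inj (p q : {poly F}) : (forall i, S i p`_i) -> (forall i, S i q`_i) -> p.[1] = q.[1] -> p = q.
Proof.
move=> hp hq E; apply/eqP; rewrite -subr_eq0; apply/eqP; apply: sdir.
  by move=> i; rewrite coefB; apply: S_B.
by rewrite hornerD hornerN E subrr.
Qed.

Lemma graded_total_sring : sring (graded_total S).
Proof.
split.
- apply/graded_totalP; exists 1; last by rewrite hornerE.
  by move=> i; rewrite coef1; case: i => [|i]; [exact: S_1|exact: S_0].
- move=> x y /graded_totalP [p hp ->] /graded_totalP [q hq ->]; apply/graded_totalP.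
  by exists (p + q); [exact: gp_D|rewrite hornerD].
- move=> x /graded_totalP [p hp ->]; apply/graded_totalP; exists (- p); last by rewrite hornerN.
  by move=> i; rewrite coefN; apply: S_N.
- move=> x y /graded_totalP [p hp ->] /graded_totalP [q hq ->]; apply/graded_totalP.
  by exists (p * q); [exact: gp_M|rewrite hornerM].
Qed.

Lemma S_total D x : S D x -> graded_total S x.
Proof.
move=> hx; apply/graded_totalP; exists (x *: 'X^D).
  move=> i; rewrite coefZ coefXn; case: eqP => [->|_]; rewrite ?mulr1 ?mulr0 //; exact: S_0.
by rewrite hornerZ hornerXn expr1n mulr1.
Qed.

Variables (x0 : F) (x0n : x0 != 0) (Sx0 : S 1 x0).

Definition chartB : set F := [set y | exists D, S D (y * x0 ^+ D)].

Lemma chartB_div D s : S D s -> chartB (s / x0 ^+ D).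
Proof. by move=> hs; exists D; rewrite divfK ?expf_neq0. Qed.

Lemma chartB_widen D D' y : (D <= D')%N -> S D (y * x0 ^+ D) -> S D' (y * x0 ^+ D').
Proof.
by move=> h1 h2; rewrite -(subnKC h1) exprD mulrA; apply: S_M => //; apply: S_exp1.
Qed.

Lemma chartB_sring : sring chartB.
Proof.
split.
- by exists 0%N; rewrite mulr1; exact: S_1.
- move=> x y [D hx] [D' hy]; exists (maxn D D'); rewrite mulrDl.
  by apply: S_D; [apply: chartB_widen hx; exact: leq_maxl|apply: chartB_widen hy; exact: leq_maxr].
- by move=> x [D hx]; exists D; rewrite mulNr; apply: S_N.
- by move=> x y [D hx] [D' hy]; exists (D + D')%N; rewrite exprD mulrACA; apply: S_M.
Qed.

Variable q : set F.
Hypothesis qp : is_prime chartB q.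

(** The homogeneous prime that corresponds to the prime [q] of the chart $x_0\ne0$, spanned by the
    forms whose dehomogenization lies in [q]. *)
Definition hompt : set F := [set z | exists p : {poly F},
  [/\ (forall i, S i p`_i), (forall i, q (p`_i / x0 ^+ i)) & z = p.[1]]].

Lemma homptP e g : S e g -> (hompt g <-> q (g / x0 ^+ e)).
Proof.
move=> hg; have hX : forall i, S i (g *: 'X^e)`_i.
  move=> i; rewrite coefZ coefXn; case: eqP => [->|_]; rewrite ?mulr1 ?mulr0 //; exact: S_0.
have h1 : (g *: 'X^e).[1] = g by rewrite hornerZ hornerXn expr1n mulr1.
split=> [[p [hp hq E]]|h].
  have Ep : g *: 'X^e = p by apply: gp_inj; rewrite // h1.
  by have := hq e; rewrite -Ep coefZ coefXn eqxx mulr1.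
exists (g *: 'X^e); split=> // i; rewrite coefZ coefXn; case: eqP => [->|_]; rewrite ?mulr1 ?mulr0 ?mul0r //.
by have [[_ q0 _ _] _ _] := qp.
Qed.

Lemma hompt_point : proj_points S hompt.
Proof.
have [iq q1 qP] := qp; have [qA q0 qD qM] := iq; have qam := ideal_amod iq.
have sB := chartB_sring.
have prodq (p r : {poly F}) k : (p * r)`_k / x0 ^+ k =
    \sum_(j < k.+1) (p`_j / x0 ^+ j) * (r`_(k - j) / x0 ^+ (k - j)).
  rewrite coefM big_distrl /=; apply: eq_bigr => j _; rewrite mulrACA -invfM -exprD subnKC // -ltnS //.
split.
- split.
  + split.
    * by move=> z [p [hp _ ->]]; apply/graded_totalP; exists p.
    * exists 0; split=> [i|i|]; rewrite ?coef0 ?mul0r ?horner0 //; exact: S_0.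
    * move=> _ _ [p [hp hpq ->]] [r [hr hrq ->]]; exists (p + r); split; [exact: gp_D| |by rewrite hornerD].
      by move=> i; rewrite coefD mulrDl; apply: qD.
    * move=> a _ /graded_totalP [r hr ->] [p [hp hpq ->]]; exists (r * p); split; [exact: gp_M| |by rewrite hornerM].
      move=> i; rewrite prodq; refine (amod_sum qam _) => j _; apply: (qM) => //.
      exact: chartB_div.
  + by move=> h; have /homptP := S_1 io X; rewrite expr0 divr1 => -[+ _] => /(_ h).
  + move=> x y /graded_totalP [p hp ->] /graded_totalP [r hr ->] [t [ht htq E]].
    have Et : p * r = t by apply: gp_inj => //; [exact: gp_M|rewrite hornerM].
    apply: contrapT => /not_orP [np nr].
    (* Lowest components outside the ideal: in the product of two elements outside, the component at
       the sum of these degrees contains exactly one term that is not in [q]. *)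
    have ex (s : {poly F}) : (forall i, S i s`_i) -> ~ hompt s.[1] ->
        exists i, ~ q (s`_i / x0 ^+ i) /\ forall j, (j < i)%N -> q (s`_j / x0 ^+ j).
      move=> hs ns; have ex : exists i, `[< ~ q (s`_i / x0 ^+ i) >].
        apply: contrapT => /forallNP h; apply: ns; exists s; split=> // i.
        by apply: contrapT => hq; apply: (h i); apply/asboolP.
      exists (ex_minn ex); case: ex_minnP => i /asboolP hi mini; split=> // j ji.
      by apply: contrapT => hj; have := mini j (asboolT hj); rewrite leqNgt ji.
    have [i0 [ni mi]] := ex _ hp np; have [j0 [nj mj]] := ex _ hr nr.
    have := htq (i0 + j0)%N; rewrite -Et prodq.
    have lt : (i0 < (i0 + j0).+1)%N by rewrite ltnS leq_addr.
    rewrite (bigD1 (Ordinal lt)) //= addKn => hs.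
    have hs2 : q (\sum_(i < (i0 + j0).+1 | i != Ordinal lt) p`_i / x0 ^+ i * (r`_(i0 + j0 - i) / x0 ^+ (i0 + j0 - i))).
      refine (amod_sum qam _) => i ii; have [h|h|h] := ltngtP i i0.
      * by rewrite mulrC; apply: (qM); [exact: chartB_div|exact: mi].
      * apply: (qM); [exact: chartB_div|apply: mj]; rewrite -(ltn_add2l i) subnKC; first by rewrite ltn_add2r.
        by rewrite -ltnS.
      * by move/eqP: ii => ii; exfalso; apply: ii; apply: val_inj.
    have hs3 : q (p`_i0 / x0 ^+ i0 * (r`_j0 / x0 ^+ j0)).
      by have := amod_sub sB qam hs hs2; rewrite addrK.
    by have [] := qP _ _ (chartB_div (hp i0)) (chartB_div (hr j0)) hs3.
- move=> k f hf [p [hp hpq E]] i ik.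
  have Ep : \poly_(j < k) f j = p.
    apply: gp_inj => //; first by move=> j; rewrite coef_poly; case: ifP => _ //; exact: S_0.
    by rewrite -E horner_poly; apply: eq_bigr => j _; rewrite expr1n mulr1.
  apply/(homptP (hf i)); have := hpq i; rewrite -Ep coef_poly ik //.
- exists 1%N, x0; split=> // /(homptP Sx0); rewrite expr1 divff //.
Qed.

Lemma hompt_local : proj_local_ring S hompt = localization chartB q.
Proof.
apply/seteqP; split=> z.
  move=> [e [f [g [hf hg ng ->]]]]; rewrite add0n in hf.
  exists (f / x0 ^+ e), (g / x0 ^+ e); split; [exact: chartB_div|exact: chartB_div|by move/(homptP hg)|].
  have x0e : x0 ^+ e != 0 by rewrite expf_neq0.
  by rewrite invfM invrK mulrACA mulVf // mulr1.
move=> [y [t [[D hy] [D' ht] nt ->]]].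
have x0e k : x0 ^+ k != 0 by rewrite expf_neq0.
exists (maxn D D'), (y * x0 ^+ (maxn D D')), (t * x0 ^+ (maxn D D')); rewrite add0n.
have h1 := chartB_widen (leq_maxl D D') hy; have h2 := chartB_widen (leq_maxr D D') ht.
split=> //; first by move/(homptP h2); rewrite mulfK.
by rewrite invfM mulrACA mulfV // mulr1.
Qed.

End GradedPrimes.

(** * Upper bound for the dimension of Proj *)

Section Dimension.
Variables (K F : fieldType) (io : {rmorphism K -> F}) (n : nat) (X : 'I_n -> F) (m e c0 N : nat).
Local Notation S := (S io X).
Hypothesis hup : forall D r, (N <= D)%N -> ind io (S D) r -> (r <= e * 'C(D + c0 + m, D + c0))%N.

(** The monomials of degree [q] in $m+2$ elements number about $q^{m+1}$, while the space that
    contains them has dimension $O(q^m)$ by [hup]. *)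
Lemma alg_dep E0 (y : 'I_m.+2 -> F) : (0 < E0)%N -> (forall i, S E0 (y i)) ->
  exists q (p : mpoly m.+2 K), [/\ p \is homog q, p != 0 & mmap io y p = 0].
Proof.
move=> E00 hy; apply: contrapT => no.
pose M := (m.+1 * e * (E0 + c0 + m) ^ m)%N; pose q := (M + N + 1)%N.
have : ind io (S (q * E0)) (size (mons m.+2 q)).
  exists (fun i => mmap1 y (nth mnm0 (mons m.+2 q) i)); split=> [i|c hc].
    have : nth mnm0 (mons m.+2 q) i \in mons m.+2 q by rewrite mem_nth.
    by rewrite mem_mons => /eqP dq; rewrite -[X in (X * E0)%N]dq; exact: S_mmap1.
  pose p := \sum_(i < size (mons m.+2 q)) c i *: mpolyX K (nth mnm0 (mons m.+2 q) i).
  have hp : p \is homog q.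
    apply: homog_sum => i _; apply: dhomogZ.
    have : nth mnm0 (mons m.+2 q) i \in mons m.+2 q by rewrite mem_nth.
    by rewrite mem_mons => /eqP dq; have := homogX_mon K (nth mnm0 (mons m.+2 q) i); rewrite dq.
  have p0 : p = 0.
    apply/eqP; apply: contrapT => /negP np; apply: no; exists q, p; split=> //.
    rewrite /p raddf_sum -[RHS]hc /=; apply: eq_bigr => i _.
    by rewrite mmapZ mmapX.
  move=> i; have := congr1 (mcoeff (nth mnm0 (mons m.+2 q) i)) p0; rewrite mcoeff0 /p raddf_sum /=.
  rewrite (bigD1 i) //= big1 ?addr0 => [|j ji].
    by rewrite mcoeffZ mcoeffX eqxx mulr1.
  rewrite mcoeffZ mcoeffX nth_uniq ?mons_uniq // -[(j == i :> nat)]/(j == i) (negbTE ji) mulr0 //.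
have qE : (N <= q * E0)%N by rewrite /q; nia.
rewrite size_mons => /(hup qE) hle.
have /andP[h1 _] := bin_bounds q m.+1; have /andP[_ h2] := bin_bounds (q * E0 + c0) m.
have h3 : (q ^ m.+1 <= M * q ^ m)%N.
  apply: leq_trans h1 _; apply: leq_trans (leq_mul (leqnn _) hle) _.
  rewrite factS mulnCA -mulnA mulnCA; apply: leq_trans (leq_mul (leqnn _) (leq_mul (leqnn _) h2)) _.
  rewrite /M mulnA -[X in (_ <= X)%N]mulnA leq_mul2l -expnMn; apply/orP; right.
  by case: (m) => // m'; rewrite leq_exp2r // /q; nia.
have q0 : (0 < q ^ m)%N by rewrite expn_gt0 /q addn1.
by move: h3; rewrite expnS leq_pmul2r // /q; lia.
Qed.

Hypothesis sdir : forall p : {poly F}, (forall i, S i p`_i) -> p.[1] = 0 -> p = 0.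

(** A chain of length $m+1$ yields $m+1$ homogeneous witnesses of its steps and one form outside the
    top prime. Raised to a common degree, these $m+2$ forms satisfy a homogeneous relation, which
    [chain_lex] forbids. *)
Lemma proj_chain_le s (c : nat -> set F) : (forall i, (i <= s)%N -> proj_points S (c i)) ->
  (forall i, (i < s)%N -> c i `<` c i.+1) -> (s <= m)%N.
Proof.
move=> hc0 hlt0; rewrite leqNgt; apply/negP => ms.
have {hc0} hc i : (i <= m.+1)%N -> proj_points S (c i) by move=> h; apply: hc0; exact: leq_trans ms.
have {hlt0} hlt i : (i < m.+1)%N -> c i `<` c i.+1 by move=> h; apply: hlt0; exact: leq_trans ms.
have sG := graded_total_sring io X.
have /choice [x0 /choice [D0 h0]] i : exists x D, (i < m.+1)%N -> [/\ (0 < D)%N, S D x, c i.+1 x & ~ c i x].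
  have [il|] := boolP (i < m.+1)%N; last by exists 0, 0%N.
  have [sub nsub] := hlt i il.
  have [z cz nz] : exists2 z, c i.+1 z & ~ c i z.
    by apply: contrapT => h; apply: nsub => z cz; apply: contrapT => nz; apply: h; exists z.
  have [p1 p2 _] := hc i.+1 il; have [p1' p2' _] := hc i (ltnW il).
  have [[zA _ _ _] _ _] := p1; have [k [f [hf Ez]]] := zA _ cz.
  have [j nj] : exists j : 'I_k, ~ c i (f j).
    apply: contrapT => h; apply: nz; rewrite Ez; have [iI _ _] := p1'.
    refine (amod_sum (ideal_amod iI) _) => j _; apply: contrapT => hj; apply: h; by exists j.
  exists (f j), j => _; split=> //.
  - case: posnP => // j0; exfalso; have := hf j; rewrite j0 => /S_0P [a Ea].
    have [a0|a0] := eqVneq a 0; first by apply: nj; rewrite j0 Ea a0 rmorph0; have [[_ ? _ _] _ _] := p1'.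
    have := p2 k f hf; rewrite -Ez => /(_ cz j (ltn_ord j)); rewrite j0 Ea.
    have [[_ _ _ cM] c1 _] := p1 => ca; apply: c1.
    have := cM (io a^-1) _ _ ca; rewrite -rmorphM mulVf // rmorph1; apply.
    by apply: (S_total (D := 0)); exact: S_io.
  - by apply: (p2 k f hf) => //; rewrite -Ez.
have [_ _ [Dl [xl [Dl0 hxl nxl]]]] := hc m.+1 (leqnn _).
pose E0 := (Dl * \prod_(i < m.+1) D0 i)%N.
have E0pos : (0 < E0)%N.
  by rewrite /E0 muln_gt0 Dl0; apply: prodn_cond_gt0 => i _; case: (h0 i (ltn_ord i)).
pose x i := x0 i ^+ (E0 %/ D0 i); pose xx := xl ^+ (E0 %/ Dl).
have powp i z k : (i <= m.+1)%N -> graded_total S z -> ~ c i z -> ~ c i (z ^+ k).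
  move=> il gz nz; have [[_ n1 cP] _ _] := hc i il.
  elim: k => [//|k IH]; rewrite exprS => /cP [] //; exact: sringX.
have hx i : (i < m.+1)%N -> [/\ S E0 (x i), c i.+1 (x i) & ~ c i (x i)].
  move=> il; have [d0 Sx cx nx] := h0 i il.
  have dv : (D0 i %| E0)%N by rewrite /E0 dvdn_mull // (bigD1 (Ordinal il)) //= dvdn_mulr.
  have q0 : (0 < E0 %/ D0 i)%N by rewrite divn_gt0 // dvdn_leq.
  split.
  - by rewrite -{1}(divnK dv); exact: S_exp.
  - rewrite /x -(prednK q0) exprSr; have [[[_ _ _ cM] _ _] _ _] := hc i.+1 il.
    by apply: (cM) => //; apply: sringX => //; exact: (S_total Sx).
  - by apply: powp => //; [exact: ltnW|exact: (S_total Sx)].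
have hxx : S E0 xx /\ ~ c m.+1 xx.
  have dv : (Dl %| E0)%N by rewrite /E0 dvdn_mulr.
  split; first by rewrite -{1}(divnK dv); exact: S_exp.
  by apply: powp => //; exact: (S_total hxl).
pose y (i : 'I_m.+2) := if (i < m.+1)%N then x i else xx.
have [|q [p [hp p0 hy]]] := @alg_dep E0 y E0pos.
  move=> i; rewrite /y; case: ifP => im; last by case: hxx.
  by have [] := hx i im.
pose sz := size (msupp p); pose mu (j : 'I_sz) := nth mnm0 (msupp p) j.
have sz0 : (0 < sz)%N by rewrite lt0n size_eq0 msupp_eq0.
have dg j : mdeg (mu j) = q by apply: (dhomog_mf hp); rewrite mem_nth.
have [_ nxx] := hxx.
have gxx := S_total (hxx.1).
(* The form outside the top prime belongs to the coefficients. Its exponent is determined by the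
   others because the relation is homogeneous, so the remaining exponents still separate the
   terms. *)
apply: (@chain_lex F (graded_total S) sG m.+1 c x 'I_sz xpredT
  (fun j i => if insub i is Some i' then mu j (widen_ord (leqnSn _) (i' : 'I_m.+1)) else 0%N)
  (fun j => io (mcoeff (mu j) p) * xx ^+ (mu j ord_max)) (Ordinal sz0)) => //.
- by move=> i /hc [].
- by move=> i il; have [_ h1 h2] := hx i il; split=> //; have [] := hlt i il.
- move=> j _; have [_ _ _ GM] := sG; have gio : graded_total S (io (mcoeff (mu j) p)).
    by apply: (S_total (D := 0)); exact: S_io.
  split; first by apply: GM => //; exact: sringX.
  have [[_ c1 cP] _ _] := hc m.+1 (leqnn _) => /cP [|||h].
  + exact: gio.
  + exact: sringX.
  + have pj : mcoeff (mu j) p != 0 by rewrite -mcoeff_msupp mem_nth.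
    move=> h; apply: c1; have [[[_ _ _ cM] _ _] _ _] := hc m.+1 (leqnn _).
    have := cM (io (mcoeff (mu j) p)^-1) _ _ h; rewrite -rmorphM mulVf // rmorph1; apply.
    by apply: (S_total (D := 0)); exact: S_io.
  + exact: powp h.
- move=> j j' _ _ h; apply: val_inj; apply/eqP.
  rewrite -(nth_uniq mnm0 (ltn_ord j) (ltn_ord j') (msupp_uniq p)) -/(mu j) -/(mu j'); apply/eqP.
  have hw (i : 'I_m.+1) : mu j (widen_ord (leqnSn _) i) = mu j' (widen_ord (leqnSn _) i).
    by have := h i (ltn_ord i); rewrite valK.
  have hm : mu j ord_max = mu j' ord_max.
    have := dg j; rewrite mdegE big_ord_recr /= => E1.
    have := dg j'; rewrite mdegE big_ord_recr /= => E2.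
    have E3 : (\sum_(i < m.+1) mu j (widen_ord (leqnSn _) i) = \sum_(i < m.+1) mu j' (widen_ord (leqnSn _) i))%N.
      by apply: eq_bigr => i _; exact: hw.
    by apply: (@addnI (\sum_(i < m.+1) mu j' (widen_ord (leqnSn _) i))); rewrite E2 -E3.
  apply/mnmP => i; case: (unliftP ord_max i) => [i' ->|->//].
  have -> : lift ord_max i' = widen_ord (leqnSn _) i' by apply: val_inj; rewrite /= /bump leqNgt ltn_ord.
  exact: hw.
have [[[_ c00 _ _] _ _] _ _] := hc 0%N isT.
suff -> : \sum_(j < sz) io (mcoeff (mu j) p) * xx ^+ (mu j ord_max) * \prod_(i < m.+1) x i ^+
  (if insub (i : nat) is Some i' then mu j (widen_ord (leqnSn _) (i' : 'I_m.+1)) else 0%N) = 0 by [].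
rewrite -[RHS]hy /mmap (big_nth mnm0) big_mkord; apply: eq_bigr => j _.
rewrite /mmap1 [in RHS]big_ord_recr /= -mulrA; congr (_ * _); rewrite [LHS]mulrC; congr (_ * _).
  by apply: eq_bigr => i _; rewrite valK /y /= ltn_ord.
by rewrite /y /= ltnn.
Qed.

End Dimension.

End Chains.

Module IntegerLocal.
Import Sumset Embedding Normalization Coordinates NoetherianLocal Vanishing RationalPoint Chains.

(** * Local rings of integers *)

Lemma maximal_prime (F : fieldType) (A I : set F) : sring A -> is_maximal A I -> is_prime A I.
Proof.
move=> sA [iI I1 Imax]; split=> // x y Ax Ay Ixy; apply: contrapT => /not_orP [nx ny].
have [A1 AD _ AM] := sA; have [IA I0 ID IM] := iI.
pose J : set F := [set z | exists i a, [/\ I i, A a & z = i + a * x]].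
have IJ : I `<=` J by move=> i Ii; exists i, 0; rewrite mul0r addr0; split=> //; exact: sring0.
have iJ : is_ideal A J.
  split.
  - by move=> _ [i [a [Ii Aa ->]]]; apply: AD; [exact: IA|exact: AM].
  - exact: IJ.
  - move=> _ _ [i [a [Ii Aa ->]]] [i' [a' [Ii' Aa' ->]]]; exists (i + i'), (a + a').
    by split; [exact: ID|exact: AD|rewrite mulrDl addrACA].
  - move=> b _ Ab [i [a [Ii Aa ->]]]; exists (b * i), (b * a).
    by split; [exact: IM|exact: AM|rewrite mulrDr mulrA].
have [[i [a [Ii Aa E]]]|J1] := pselect (J 1).
  apply: ny; rewrite -[y]mulr1 E mulrDr; apply: (ID); first exact: IM.
  by rewrite mulrCA [y * x]mulrC; exact: IM.
apply: nx; rewrite -(Imax J iJ IJ J1); exists 0, 1; rewrite mul1r add0r; split=> //.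
Qed.

Section Integers.
Variable K : fieldExtType rat.
Local Notation OK := (@ring_of_integers K).

Lemma intrK_eq0 (z : int) : ((z%:~R : K) == 0) = (z == 0).
Proof. by rewrite -(rmorph_int (GRing.in_alg K)) fmorph_eq0 intr_eq0. Qed.

Lemma intrK_inj : injective (intr : int -> K).
Proof. by move=> x y /eqP; rewrite -subr_eq0 -rmorphB intrK_eq0 subr_eq0 => /eqP. Qed.

Lemma OK_sring : sring OK.
Proof.
split; [exact: (integral1 (intr : {rmorphism int -> K}))|exact: (@integral_add _ _ (intr : {rmorphism int -> K}))|exact: (@integral_opp _ _ (intr : {rmorphism int -> K}))|exact: (@integral_mul _ _ (intr : {rmorphism int -> K}))].
Qed.

Lemma OK_int (z : int) : OK z%:~R.
Proof. exact: (integral_id (intr : {rmorphism int -> K}) z). Qed.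

(** Multiplication by $c^k$ turns the relation into a monic one for $cx$. *)
Lemma OK_lead (x c : K) (a : nat -> K) k : OK c -> (forall j, OK (a j)) ->
  c * x ^+ k.+1 + \sum_(j < k.+1) a j * x ^+ j = 0 -> OK (c * x).
Proof.
move=> hc ha E; have [q1 OD _ OM] := OK_sring.
pose s : {poly K} := \poly_(j < k.+1) (a j * c ^+ (k - j)).
pose p : {poly K} := 'X^(k.+1) + s.
have sp : (size s < size ('X^(k.+1) : {poly K}))%N by rewrite size_polyXn ltnS size_poly.
apply: (@integral_root_monic _ _ (intr : {rmorphism int -> K}) _ p).
- by rewrite monicE lead_coefDl // lead_coefXn.
- rewrite /root hornerD hornerXn /s horner_poly; apply/eqP.
  transitivity (c ^+ k * (c * x ^+ k.+1 + \sum_(j < k.+1) a j * x ^+ j)); last by rewrite E mulr0.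
  rewrite mulrDr mulrA -exprSr exprMn; congr (_ + _); rewrite big_distrr /=; apply: eq_bigr => j _.
  have jk : (j <= k)%N by rewrite -ltnS.
  have En : c ^+ k = c ^+ (k - j) * c ^+ j by rewrite -exprD subnK.
  by rewrite exprMn En; ring.
- move=> y /(nthP 0) [i _ <-]; rewrite coefD coefXn /s coef_poly; apply: OD.
    by case: eqP => _; [exact: q1|exact: sring0 OK_sring].
  case: ifP => _; last exact: sring0 OK_sring.
  by apply: OM => //; exact: sringX OK_sring _.
Qed.

Variable p : set K.
Hypothesis pm : is_maximal OK p.
Let pp := maximal_prime OK_sring pm.
Local Notation O := (localization OK p).

Lemma O_sring : sring O.
Proof.
have [q1 OD ON OM] := OK_sring; have [[pO p0 pD pM] p1 pP] := pp.
have nz y : ~ p y -> y != 0 by move=> h; apply/eqP => E; apply: h; rewrite E.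
split.
- by exists 1, 1; rewrite divr1.
- move=> _ _ [x [y [hx hy ny ->]]] [x' [y' [hx' hy' ny' ->]]].
  exists (x * y' + x' * y), (y * y'); split; [by apply: (OD); exact: OM|exact: OM|by move/pP => []|].
  by rewrite addf_div ?nz.
- by move=> _ [x [y [hx hy ny ->]]]; exists (- x), y; split=> //; [exact: ON|rewrite mulNr].
- move=> _ _ [x [y [hx hy ny ->]]] [x' [y' [hx' hy' ny' ->]]].
  exists (x * x'), (y * y'); split; [exact: OM|exact: OM|by move/pP => []|].
  by rewrite mulf_div.
Qed.

Lemma exists_integer_poly (x : K) : exists f : {poly int}, [/\ f != 0, (map_poly (intr : int -> K) f).[x] = 0 & zcontents f = 1].
Proof.
have /polyOver1P [q Eq] := minPolyOver 1%AS x.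
have [f0 [a a0 Ef]] := rat_poly_scale q.
have f00 : f0 != 0.
  apply/eqP => f00; have := monic_neq0 (monic_minPoly 1%AS x).
  by rewrite Eq Ef f00 map_poly0 scaler0 map_poly0 eqxx.
have r0 : (map_poly (intr : int -> K) f0).[x] = 0.
  have := root_minPoly 1%AS x; rewrite Eq Ef /root linearZ /= hornerZ mulf_eq0 => /orP[|/eqP].
    by rewrite scaler_eq0 oner_eq0 orbF invr_eq0 intr_eq0 (negbTE a0).
  rewrite -map_poly_comp => h; rewrite -[RHS]h; congr (_.[_]); apply: eq_map_poly => z.
  exact/esym/(rmorph_int (GRing.in_alg K)).
exists (zprimitive f0); split; [by rewrite zprimitive_eq0| |by rewrite zcontents_primitive f00].
have : map_poly (intr : int -> K) f0 = (zcontents f0)%:~R *: map_poly intr (zprimitive f0).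
  by rewrite [in LHS](zpolyEprim f0) map_polyZ.
move=> E; move: r0; rewrite E hornerZ => /eqP.
by rewrite mulf_eq0 intrK_eq0 zcontents_eq0 (negbTE f00) /= => /eqP.
Qed.

(** The localization is a valuation ring, shown without factorization of ideals. For a primitive
    relation $\sum a_ix^i=0$ the tails $b_i=\sum_ja_{i+j}x^j$ satisfy $b_i=a_i+xb_{i+1}$, and both
    $b_i$ and $xb_{i+1}$ are integral. Some $a_i$ is outside [p], hence so is some $b_i$ or some
    $xb_{i+1}$, which serves as a denominator for [x] or for its inverse. *)
Lemma O_val (x : K) : x != 0 -> O x \/ O x^-1.
Proof.
move=> x0; have [f [f0 fx f1]] := exists_integer_poly x.
have [q1 OD ON OM] := OK_sring; have O0 := sring0 OK_sring; have [[pO p0 pD pM] p1 pP] := pp.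
pose a i : K := (f`_i)%:~R.
have Oa i : OK (a i) by exact: OK_int.
have [i0 na] : exists i, ~ p (a i).
  apply: contrapT => /forallNP h; apply: p1.
  have hp i : p (a i) by apply: contrapT; exact: h.
  have pI z : p (`|z|%N%:Z%:~R : K) <-> p (z%:~R : K).
    rewrite abszE; have [z0|z0] := ger0P z => //.
    rewrite rmorphN /=; split=> hz; last by rewrite -mulN1r; apply: (pM) => //; exact: ON.
    by rewrite -[z%:~R]opprK -mulN1r; apply: (pM) => //; exact: ON.
  have : p ((\big[gcdn/0%N]_(i < size f) absz (f`_i))%:Z%:~R : K).
    apply: (big_ind (fun g : nat => p (g%:Z%:~R : K))) => [//|g1 g2 h1 h2|i _]; last by apply/pI; exact: hp.
    have [u [v E]] := Bezoutz g1%:Z g2%:Z; 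
    have -> : (gcdn g1 g2)%:Z = u * g1%:Z + v * g2%:Z by exact: esym E.
    by rewrite rmorphD !rmorphM /=; apply: (pD); apply: (pM) => //; exact: OK_int.
  move/(congr1 absz): f1; rewrite /zcontents abszM absz_sg lead_coef_eq0 f0 mul1n /= => ->.
  by [].
pose n := size f.
pose b i : K := \sum_(j < n - i) a (i + j)%N * x ^+ j.
have bS i : b i = a i + x * b i.+1.
  rewrite /b; have [ni|ni] := leqP n i.
    have -> : (n - i = 0)%N by apply/eqP; rewrite subn_eq0.
    have -> : (n - i.+1 = 0)%N by apply/eqP; rewrite subn_eq0 ltnW.
    by rewrite !big_ord0 mulr0 addr0 /a nth_default.
  rewrite -(subnSK ni) big_ord_recl expr0 mulr1 addn0 big_distrr /=; congr (_ + _).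
  by apply: eq_bigr => j _; rewrite /bump /= add1n addSnnS exprS; ring.
have b0 : b 0%N = 0.
  rewrite -[RHS]fx /b subn0 horner_coef size_map_inj_poly //; last exact: intrK_inj.
  by apply: eq_bigr => j _; rewrite coef_map add0n.
(* The tail [b i] is the leading coefficient of a relation of degree [i]. By [OK_lead] its product
   with [x] is integral, which carries integrality from one tail to the preceding one. *)
have Eb i : b i * x ^+ i + \sum_(j < i) a j * x ^+ j = 0.
  elim: i => [|i IH]; first by rewrite big_ord0 b0 mul0r addr0.
  transitivity (b i * x ^+ i + \sum_(j < i) a j * x ^+ j) => //.
  by rewrite big_ord_recr /= (bS i) exprS; ring.
have Ob i : OK (b i).
  have [|] := leqP n i => [ni|/ltnW ni].
    rewrite /b; have -> : (n - i = 0)%N by apply/eqP; rewrite subn_eq0.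
    by rewrite big_ord0.
  rewrite -(subKn ni); elim: (n - i)%N => [|k IH].
    by rewrite subn0 /b subnn big_ord0.
  have [nk|nk] := leqP n k.
    have -> : (n - k.+1 = n - k)%N by have := nk; clear; move: n k => n k; lia.
    exact: IH.
  rewrite bS subnSK //; apply: (OD) => //; rewrite mulrC.
  apply: (@OK_lead x _ a (n - k.+1)); rewrite ?subnSK //.
have Oxb i : OK (x * b i.+1) by have -> : x * b i.+1 = b i - a i by [rewrite (bS i) addrAC subrr add0r]; apply: (OD) => //; exact: ON.
have [[i nb]|nb] := pselect (exists i, ~ p (b i)).
  case: i nb => [|i] nb; first by exfalso; apply: nb; rewrite b0.
  left; exists (x * b i.+1), (b i.+1); split=> //; rewrite mulfK //.
  by apply/eqP => E; apply: nb; rewrite E.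
have pb i : p (b i) by apply: contrapT => h; apply: nb; exists i.
have nx : ~ p (x * b i0.+1).
  move=> h; apply: na; have -> : a i0 = b i0 + -1 * (x * b i0.+1) by rewrite bS; ring.
  by apply: (pD) => //; apply: (pM) => //; exact: ON.
right; exists (b i0.+1), (x * b i0.+1); split=> //.
rewrite invfM mulrCA mulfV ?mulr1 //.
by apply/eqP => E; apply: nx; rewrite E mulr0.
Qed.

Lemma half_not_integral : ~ OK (2%:R^-1).
Proof.
case=> q mq; rewrite /root => /eqP hq.
pose n := (size q).-1.
have sq : size q = n.+1 by rewrite /n prednK // size_poly_gt0 monic_neq0.
have E : (\sum_(i < n.+1) q`_i * 2 ^+ (n - i))%R = 0 :> int.
  apply: intrK_inj; rewrite rmorph0 rmorph_sum /=.
  transitivity (2 ^+ n * (map_poly intr q).[2%:R^-1] : K); last by rewrite hq mulr0.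
  rewrite horner_coef size_map_inj_poly //; last exact: intrK_inj.
  rewrite sq big_distrr /=; apply: eq_bigr => i _; rewrite coef_map rmorphM rmorphXn /=.
  have i_n : (i <= n)%N by rewrite -ltnS.
  have t0 : (2%:R : K) != 0 by rewrite -[2%:R]/(2%:Z%:~R) intrK_eq0.
  have En : (2%:R : K) ^+ n = 2%:R ^+ (n - i) * 2%:R ^+ i by rewrite -exprD subnK.
  rewrite En -[2%:~R]/(2%:R : K) exprVn; have := expf_neq0 i t0.
  by move: (2 ^+ (n - i)) (2 ^+ i) => y z z0; field.
move: E; rewrite big_ord_recr /= subnn expr0 mulr1.
have -> : q`_n = 1 by have := mq; rewrite monicE /lead_coef sq => /eqP.
have [c ->] : exists c, \sum_(i < n) q`_i * 2 ^+ (n - i) = 2 * c.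
  exists (\sum_(i < n) q`_i * 2 ^+ (n - i).-1); rewrite big_distrr /=; apply: eq_bigr => i _.
  by rewrite -{1}(prednK (_ : 0 < n - i)%N) ?subn_gt0 // exprS; ring.
lia.
Qed.

(** The ideal [p] is nonzero: otherwise the ideal generated by 2, proper as $1/2$ is not integral,
    would contain it and equal it by maximality. *)
Lemma O_nonunit : exists c, [/\ O c, c != 0 & ~ O c^-1].
Proof.
have [q1 OD ON OM] := OK_sring; have [[pO p0 pD pM] p1 pP] := pp; have [_ _ pmax] := pm.
have t0 : (2%:R : K) != 0 by rewrite -[2%:R]/(2%:Z%:~R) intrK_eq0.
have [c pc c0] : exists2 c, p c & c != 0.
  apply: contrapT => h; have pz c : p c -> c = 0.
    by move=> pc; apply/eqP; apply: contrapT => /negP c0; apply: h; exists c.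
  pose J : set K := [set z | exists2 a, OK a & z = a * 2%:R].
  have J2 : J 2%:R by exists 1; rewrite ?mul1r.
  have EJ : J = p.
    apply: pmax.
    - split.
      + by move=> _ [a Oa ->]; apply: OM => //; exact: (OK_int 2).
      + by exists 0; rewrite ?mul0r //; exact: sring0 OK_sring.
      + by move=> _ _ [a Oa ->] [b Ob ->]; exists (a + b); [exact: OD|rewrite mulrDl].
      + by move=> b _ Ob [a Oa ->]; exists (b * a); [exact: OM|rewrite mulrA].
    - by move=> z /pz ->; exists 0; rewrite ?mul0r //; exact: sring0 OK_sring.
    - move=> [a Oa E]; apply: half_not_integral; rewrite (_ : 2^-1 = a) //.
      by rewrite -[RHS](mulfK t0) -E mul1r.
  by rewrite EJ in J2; move/pz: J2 => E; rewrite E eqxx in t0.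
exists c; split=> //; first by exists c, 1; rewrite divr1; split=> //; exact: pO.
move=> [x [y [Ox Oy ny E]]]; apply: ny.
have y0 : y != 0.
  by apply/eqP => y0; move/eqP: E; rewrite y0 invr0 mulr0 invr_eq0 (negbTE c0).
have -> : y = x * c by rewrite -[x](divfK y0) -E mulrAC mulVf // mul1r.
exact: pM.
Qed.

End Integers.

(** * Generators of the kernel of evaluation at a regular point *)

Section RegularPoint.
Variables (K F : fieldType) (io : {rmorphism K -> F}) (A : set F) (O : set K) (phi : F -> K).
Hypotheses (sA : sring A) (sO : sring O) (AO : forall c, O c -> A (io c))
  (phiO : forall z, A z -> O (phi z))
  (phiD : forall x y, A x -> A y -> phi (x + y) = phi x + phi y)
  (phiM : forall x y, A x -> A y -> phi (x * y) = phi x * phi y)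
  (phiio : forall c, O c -> phi (io c) = c)
  (phil : forall z, nonunits A z -> nonunits O (phi z)).
Hypotheses (valO : forall x, x != 0 -> O x \/ O x^-1) (pO : exists c, [/\ O c, c != 0 & ~ O c^-1]).
Variables (r : nat) (g : 'I_r -> F).
Hypotheses (nA : noetherian A) (kA : has_krull_dim (is_prime A) r)
  (gA : nonunits A = lin_span A (range g)).
Variable m : nat.
Hypothesis adep : forall y : 'I_m.+1 -> F, (forall i, A (y i)) ->
  exists2 p : mpoly m.+1 K, p != 0 & mmap io y p = 0.

Local Notation M := (nonunits A).

Let phi0 : phi 0 = 0.
Proof. by rewrite -(rmorph0 io) phiio //; exact: sring0. Qed.
Let phi1 : phi 1 = 1.
Proof. by rewrite -(rmorph1 io) phiio //; case: sO. Qed.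

Lemma phi_sum (I : Type) (s : seq I) (f : I -> F) : (forall i, A (f i)) ->
  phi (\sum_(i <- s) f i) = \sum_(i <- s) phi (f i).
Proof.
move=> hf; elim: s => [|a s IH]; first by rewrite !big_nil.
by rewrite !big_cons phiD // ?IH //; refine (sring_sum sA _).
Qed.

Lemma M_amod : amod A M.
Proof. by rewrite gA; exact: lin_span_amod. Qed.

Lemma M_jac : jac A M.
Proof.
move=> x Mx; have [A1 AD AN _] := sA; have [Ax _] := Mx.
have A1x : A (1 - x) by apply: (AD) => //; exact: AN.
have [[_ h1 h2]|nu] := pselect (unit_of A (1 - x)); first by [].
have : M 1 by have [_ MD _] := M_amod; rewrite -(subrK x 1); apply: MD.
by move=> [_ []]; split; rewrite ?oner_eq0 ?invr1.
Qed.

Lemma M_prime : is_prime A M.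
Proof.
have [A1 _ _ AM] := sA; have [M0 MD MM] := M_amod; split; first by split=> // x [].
  by move=> [_ []]; split; rewrite ?oner_eq0 ?invr1.
move=> x y Ax Ay [_ nxy]; apply: contrapT => /not_orP [nx ny]; apply: nxy.
have ux z : A z -> ~ M z -> unit_of A z by move=> Az nz; apply: contrapT => h; apply: nz.
have [_ x0 Vx] := ux x Ax nx; have [_ y0 Vy] := ux y Ay ny.
by split; [exact: AM|rewrite mulf_neq0|rewrite invfM; exact: AM].
Qed.

Lemma val_max (s : seq K) : (exists2 x, x \in s & x != 0) ->
  exists x, [/\ x \in s, x != 0 & forall y, y \in s -> O (y / x)].
Proof.
have [q1 _ _ OM] := sO; have O0 := sring0 sO.
elim: s => [[]//|a s IH] h.
have [hs|hs] := pselect (exists2 x, x \in s & x != 0).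
  have [x [xs x0 hx]] := IH hs.
  have [a0|a0] := eqVneq a 0.
    exists x; split=> // [|y]; first by rewrite inE xs orbT.
    by rewrite inE => /orP[/eqP ->|/hx//]; rewrite a0 mul0r.
  have [|ha|ha] := @valO (a / x); first by rewrite mulf_neq0 ?invr_eq0.
    by exists x; split=> // [|y]; [rewrite inE xs orbT|rewrite inE => /orP[/eqP ->|/hx//]].
  exists a; split=> // [|y]; first by rewrite mem_head.
  rewrite inE => /orP[/eqP ->|/hx hy]; first by rewrite divff.
  rewrite invf_div in ha; have -> : y / a = (y / x) * (x / a) by rewrite mulrA divfK.
  exact: OM.
have z y : y \in s -> y = 0 by move=> ys; apply/eqP; apply: contrapT => /negP y0; apply: hs; exists y.
case: h => x; rewrite inE => /orP[/eqP -> a0|xs x0]; last by rewrite (z _ xs) eqxx in x0.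
exists a; split=> // [|y]; first by rewrite mem_head.
by rewrite inE => /orP[/eqP ->|/z ->]; rewrite ?divff ?mul0r.
Qed.

Let gM i : M (g i).
Proof. by rewrite gA; apply: lin_span_gen => //; exists i. Qed.

Lemma O_nonunit_M c : O c -> ~ O c^-1 -> M (io c).
Proof.
move=> Oc nc; split; first exact: AO.
move=> [_ c0 Vc]; apply: nc; rewrite fmorph_eq0 in c0.
suff <- : phi (io c)^-1 = c^-1 by exact: phiO.
have := phiM (AO Oc) Vc; rewrite mulfV ?fmorph_eq0 // phi1 phiio // => E.
by rewrite -[LHS](mulKf c0) -E mulr1.
Qed.

(** The constants in the maximal ideal of [O] lie in that of [A], so the values of the generators
    [g i] generate the former; in a valuation ring one of them suffices. *)
Lemma uniformizer : exists i1 : 'I_r, [/\ phi (g i1) != 0, ~ O (phi (g i1))^-1,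
  forall i, O (phi (g i) / phi (g i1)) & forall c, O c -> ~ O c^-1 -> O (c / phi (g i1))].
Proof.
have comb c : O c -> ~ O c^-1 -> exists a : 'I_r -> F, (forall i, A (a i)) /\ c = \sum_i phi (a i) * phi (g i).
  move=> Oc nc; have := O_nonunit_M Oc nc; rewrite gA => /(lin_span_range _ _ sA) [a [ha E]].
  have gAA i : A (g i) by case: (gM i).
  exists a; split=> //; rewrite -(phiio Oc) E phi_sum; first by apply: eq_bigr => i _; rewrite phiM.
  by move=> i; have [_ _ _ AM] := sA; apply: AM.
have [c [Oc c0 nc]] := pO; have [a [ha E]] := comb c Oc nc.
have [|x [/mapP [i1 _ ->] x0 hx]] := @val_max [seq phi (g i) | i <- enum 'I_r].
  apply: contrapT => h; move/eqP: c0; apply; rewrite E big1 // => i _.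
  have [->|n0] := eqVneq (phi (g i)) 0; rewrite ?mulr0 //; exfalso; apply: h; exists (phi (g i)) => //.
  by rewrite map_f ?mem_enum.
have hx' i : O (phi (g i) / phi (g i1)) by apply: hx; rewrite map_f ?mem_enum.
exists i1; split=> //.
  by have [_ nu] := phil (gM i1) => V; apply: nu; split=> //; apply: phiO; case: (gM i1).
move=> c' Oc' nc'; have [a' [ha' ->]] := comb c' Oc' nc'; rewrite big_distrl /=.
refine (sring_sum sO _) => i _; rewrite -mulrA; have [_ _ _ OM] := sO; apply: OM => //.
by apply: phiO.
Qed.

Section Uniformizer.
Variable (i1 : 'I_r).
Local Notation pi := (phi (g i1)).
Hypotheses (pi0 : pi != 0) (npi : ~ O pi^-1) (hpi : forall i, O (phi (g i) / pi))
  (pidiv : forall c, O c -> ~ O c^-1 -> O (c / pi)).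

Let Opi : O pi.
Proof. by apply: phiO; case: (gM i1). Qed.

(** Krull's theorem in the Noetherian ring [A], applied to the image of [c], shows that only
    finitely many powers of the uniformizer divide [c]. *)
Lemma O_factor c : O c -> c != 0 -> exists e v, [/\ O v, O v^-1, v != 0 & c = v * pi ^+ e].
Proof.
move=> Oc c0; have Mpi := O_nonunit_M Opi npi.
have [A1 _ _ AM] := sA; have Mam := M_amod.
have ex : exists k, `[< ~ O (c / pi ^+ k) >].
  apply: contrapT => /forallNP h; move/eqP: c0; apply; apply/eqP; rewrite -(fmorph_eq0 io); apply/eqP.
  have hO k : O (c / pi ^+ k) by apply: contrapT => nk; apply: (h k); exact/asboolP.
  pose g1 (i : 'I_1) := io pi.
  have g1A i : A (g1 i) by exact: AO.
  have g1M x : gpow A g1 1 x -> M x.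
    move=> /gpow1P [y [hy ->]]; refine (amod_sum Mam _) => i _; rewrite mulrC.
    by have [_ _ MM] := Mam; apply: MM.
  apply: (@krull_intersection _ A _ g1 [set 0] sA nA g1A).
  - by move=> x /g1M; exact: M_jac.
  - split=> [x ->|//|x y -> ->|a x _ ->]; rewrite ?addr0 ?mulr0 //; exact: sring0.
  - move=> k; exists 0, (io c); split=> //; last by rewrite add0r.
    have -> : io c = io (c / pi ^+ k) * (io pi) ^+ k by rewrite -rmorphXn -rmorphM divfK // expf_neq0.
    have [_ _ GM] := gpow_amod g1 sA k; apply: GM; first exact: AO.
    have := @gpowX _ A _ g1 sA 1 (io pi) k; rewrite muln1; apply.
    by apply/gpow1P; exists (fun=> 1); split=> //; rewrite big_ord1 mulr1.
have nk := ex_minnP ex; case: nk => -[|k] /asboolP nk mink; first by rewrite divr1 in nk.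
have Ok : O (c / pi ^+ k) by apply: contrapT => h; have := mink k (asboolT h); rewrite ltnn.
exists k, (c / pi ^+ k); split=> //.
- apply: contrapT => h; apply: nk; have := pidiv Ok h.
  by rewrite -mulrA -invfM -exprSr.
- by rewrite mulf_neq0 // invr_eq0 expf_neq0.
- by rewrite divfK // expf_neq0.
Qed.

(** The uniformizer witnesses one step of a longest chain of primes. The witnesses of the other
    $r-1$ steps are algebraically independent over [K] by [chain_lex], so there are at most [m] of
    them. *)
Lemma krull_dim_le : (r <= m.+1)%N.
Proof.
rewrite leqNgt; apply/negP => mr.
have [[c [cp clt]] cmax] := kA; have [A1 AD _ AM] := sA; have A0 := sring0 sA.
(* A longest chain begins with the zero ideal and ends with a prime that contains the uniformizer;
   otherwise it could be prolonged at one of its ends. *)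
have czero z : c 0%N z -> z = 0.
  move=> cz; apply/eqP; apply: contrapT => /negP z0.
  suff : (r.+1 <= r)%N by rewrite ltnn.
  apply: (cmax r.+1 (fun i => if i is i'.+1 then c i' else [set 0])); split.
    move=> [|i] hi; last exact: cp.
    split; first by split=> [x ->|//|x y -> ->|a x _ ->]; rewrite ?addr0 ?mulr0.
      by move=> /eqP; rewrite oner_eq0.
    by move=> x y _ _ /eqP; rewrite mulf_eq0 => /orP[/eqP|/eqP]; [left|right].
  move=> [|i] hi; last exact: clt.
  split; first by move=> x ->; have [[_ ? _ _] _ _] := cp 0%N isT.
  by move=> /(_ _ cz) /eqP; rewrite (negbTE z0).
have Mpi := O_nonunit_M Opi npi.
have cM i : (i <= r)%N -> c i `<=` M.
  move=> ir z cz; have [[cA _ _ cmul] c1 _] := cp i ir; split; first exact: cA.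
  by move=> [_ z0 Vz]; apply: c1; rewrite -(mulVf z0); exact: cmul.
have cr : c r (io pi).
  apply: contrapT => npr.
  suff : (r.+1 <= r)%N by rewrite ltnn.
  apply: (cmax r.+1 (fun i => if (i <= r)%N then c i else M)); split.
    by move=> i hi; case: ifP => hr; [exact: cp|exact: M_prime].
  move=> i; rewrite ltnS => ir; rewrite ir; case: ifP => hi; first exact: clt.
  have {hi} -> : i = r by apply/eqP; rewrite eqn_leq ir leqNgt hi.
  by split=> [|h]; [exact: cM|apply: npr; apply: h].
have ex : exists i, `[< c i (io pi) >] by exists r; apply/asboolP.
have [i0 i0r [ci0 nci0]] : exists2 i0, (i0 < r)%N & c i0.+1 (io pi) /\ ~ c i0 (io pi).
  case: (ex_minnP ex) => -[|i] /asboolP ci mini.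
    by move/eqP: (czero _ ci); rewrite fmorph_eq0 (negbTE pi0).
  exists i; last by split=> // h; have := mini i (asboolT h); rewrite ltnn.
  by apply: mini; apply/asboolP.
have /choice [x0 h0] i : exists x, (i < r)%N -> c i.+1 x /\ ~ c i x.
  have [ir|] := boolP (i < r)%N; last by exists 0.
  have [_ nsub] := clt i ir; apply: contrapT => h; apply: nsub => z cz; apply: contrapT => nz.
  by apply: h; exists z.
pose x i := if i == i0 then io pi else x0 i.
have hx i : (i < r)%N -> [/\ c i `<=` c i.+1, c i.+1 (x i) & ~ c i (x i)].
  move=> ir; have [sub _] := clt i ir; rewrite /x; case: eqP => [E|_]; first by rewrite E in sub *.
  by have [] := h0 i ir.
have xA i : (i < r)%N -> A (x i).
  by move=> ir; have [_ h _] := hx i ir; have [[sub _ _ _] _ _] := cp i.+1 ir; exact: sub.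
have bump_lt (j : 'I_m.+1) : (bump i0 j < r)%N.
  by apply: leq_trans mr; rewrite /bump; have := ltn_ord j; case: (i0 <= j)%N; lia.
have [|p p0 py] := adep (y := fun j => x (bump i0 j)); first by move=> j; exact: xA.
pose sz := size (msupp p); pose mu (j : 'I_sz) := nth mnm0 (msupp p) j.
have sz0 : (0 < sz)%N by rewrite lt0n size_eq0 msupp_eq0.
have pj (j : 'I_sz) : mcoeff (mu j) p != 0 by rewrite -mcoeff_msupp mem_nth.
(* Division by the coefficient of least valuation puts all coefficients in [O]. Each is then a unit
   times a power of the uniformizer, and this power becomes the exponent at the place [i0] of the
   chain. *)
have [|k0 [k0s k00 hk0]] := @val_max [seq mcoeff (mu j) p | j <- enum 'I_sz].
  by exists (mcoeff (mu (Ordinal sz0)) p) => //; apply/mapP; exists (Ordinal sz0); rewrite ?mem_enum.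
have /choice [ee /choice [vv hv]] (j : 'I_sz) : exists e v, [/\ O v, O v^-1, v != 0 & mcoeff (mu j) p / k0 = v * pi ^+ e].
  by apply: O_factor; [apply: hk0; apply/mapP; exists j; rewrite ?mem_enum|rewrite mulf_neq0 ?invr_eq0].
pose al (j : 'I_sz) i : nat := if i == i0 then ee j else if insub (unbump i0 i) is Some t then mu j (t : 'I_m.+1) else 0%N.
apply: (@chain_lex F A sA r c x 'I_sz xpredT al (fun j => io (vv j)) (Ordinal sz0)) => //.
- move=> j _; have [Ov OV v0 _] := hv j; split; first exact: AO.
  move=> /(cM r (leqnn r)) [_ []]; split; [exact: AO|by rewrite fmorph_eq0|by rewrite -fmorphV; exact: AO].
- move=> j j' _ _ h; apply: val_inj; apply/eqP.
  rewrite -(nth_uniq mnm0 (ltn_ord j) (ltn_ord j') (msupp_uniq p)) -/(mu j) -/(mu j'); apply/eqP.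
  apply/mnmP => t; have := h _ (bump_lt t); rewrite /al bumpK valK.
  by rewrite eq_sym (negbTE (neq_bump _ _)).
suff -> : \sum_j io (vv j) * \prod_(i < r) x i ^+ al j i = 0 by have [[_ ? _ _] _ _] := cp 0%N isT.
have E0 : \sum_j io (mcoeff (mu j) p / k0) * mmap1 (fun j => x (bump i0 j)) (mu j) = 0.
  transitivity (io k0^-1 * mmap io (fun j => x (bump i0 j)) p); last by rewrite py mulr0.
  rewrite /mmap (big_nth mnm0) big_mkord big_distrr /=.
  by apply: eq_bigr => j _; rewrite rmorphM /=; ring.
rewrite -[RHS]E0; apply: eq_bigr => j _; have [_ _ _ ->] := hv j; rewrite rmorphM -mulrA; congr (_ * _).
rewrite (bigD1_ord (Ordinal i0r)) //=; congr (_ * _); first by rewrite /x /al eqxx rmorphXn.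
have mr' : (m.+1 <= r.-1)%N by lia.
pose Ft (t : nat) : F := x (bump i0 t) ^+ (if insub t is Some t' then mu j (t' : 'I_m.+1) else 0%N).
transitivity (\prod_(t < m.+1) Ft t); last by apply: eq_bigr => t _; rewrite /Ft valK.
rewrite (big_ord_widen r.-1 Ft mr') [RHS]big_mkcond /=; apply: eq_bigr => t _.
rewrite /al eq_sym (negbTE (neq_bump _ _)) bumpK /Ft; case: ifP => // tm.
by rewrite insubN ?expr0 // tm.
Qed.

(** Subtracting from each [g i] a multiple of [g i1] gives elements [h i] of the kernel, with [h i1]
    equal to 0. An element of the kernel is a combination of the [h i] plus $b\,g_{i_1}$; the value
    of $b$ is then 0, so $b$ is in the kernel as well, and Nakayama's lemma applies. *)
Lemma kernel_generators_at : exists u : 'I_m -> F, (forall i, A (u i) /\ phi (u i) = 0) /\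
  forall z, A z -> phi z = 0 -> lin_span A (range u) z.
Proof.
have [A1 AD AN AM] := sA; have A0 := sring0 sA.
have gAA i : A (g i) by case: (gM i).
pose h i := g i - io (phi (g i) / pi) * g i1.
have hA i : A (h i) by apply: (AD) => //; apply: (AN); apply: (AM) => //; exact: AO.
have phiN x : A x -> phi (- x) = - phi x.
  move=> Ax; apply/eqP; rewrite -addr_eq0 -phiD ?addNr ?phi0 //; exact: AN.
have hphi i : phi (h i) = 0.
  have h1 : A (io (phi (g i) / pi)) by exact: AO.
  have h2 := AM _ _ h1 (gAA i1).
  by rewrite phiD ?phiN ?phiM ?phiio ?divfK ?subrr //; exact: AN.
pose a0 : set F := [set z | A z /\ phi z = 0].
have ia : is_ideal A a0.
  split=> [x []//||x y [h1 h2] [h3 h4]|a x ha [h1 h2]].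
  - by split.
  - by split; [exact: AD|rewrite phiD // h2 h4 addr0].
  - by split; [exact: AM|rewrite phiM // h2 mulr0].
have [q [y Ey]] := nA ia.
have ya i : a0 (y i) by rewrite Ey; apply: lin_span_gen => //; exists i.
have hI : amod A (lin_span A (range h)) by exact: lin_span_amod.
have yI : forall i, lin_span A (range h) (y i).
  apply: (nakayama sA M_amod _ M_jac hI) => [x []//|i].
  have [Ay py] := ya i.
  have My : M (y i).
    split=> // -[_ y0 Vy]; have := phiM Ay Vy; rewrite mulfV // phi1 py mul0r.
    by move/eqP; rewrite oner_eq0.
  move: My; rewrite {1}gA => /(lin_span_range _ _ sA) [a [ha Ea]].
  pose b := \sum_j a j * io (phi (g j) / pi).
  have Ab : A b by refine (sring_sum sA _) => j _; apply: (AM) => //; exact: AO.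
  have Es : y i = \sum_j a j * h j + b * g i1.
    rewrite Ea /b big_distrl -big_split /=; apply: eq_bigr => j _; rewrite /h; ring.
  have Ah : A (\sum_j a j * h j) by refine (sring_sum sA _) => j _; exact: AM.
  have pb : phi b = 0.
    have : phi (y i) = 0 by []; rewrite Es phiD //; last exact: AM.
    rewrite phi_sum; last by move=> j; exact: AM.
    rewrite big1 ?add0r => [|j _]; last by rewrite phiM // hphi mulr0.
    by rewrite phiM // => /eqP; rewrite mulf_eq0 (negbTE pi0) orbF => /eqP.
  have : a0 b by []; rewrite Ey => /(lin_span_range _ _ sA) [bb [hbb Eb]].
  exists (\sum_j a j * h j), (fun j => bb j * g i1); split.
  - refine (amod_sum hI _) => j _; have [_ _ hM] := hI; apply: hM => //.
    by apply: lin_span_gen => //; exists j.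
  - by move=> j; have [_ _ MM] := M_amod; exact: MM.
  - rewrite Es Eb big_distrl /=; congr (_ + _); apply: eq_bigr => j _; ring.
have rm := krull_dim_le.
(* The index [i1] is skipped; if $r-1$ is less than [m], the list is filled up with zeros. *)
pose u (j : 'I_m) := if insub (bump i1 j) is Some i then h i else 0.
exists u; split.
  by move=> j; rewrite /u; case: insub => [i|] //.
move=> z Az pz; have : a0 z by []; rewrite Ey; apply: lin_span_sub; first exact: lin_span_amod.
move=> _ [j _ <-]; apply: lin_span_sub (yI j); first exact: lin_span_amod.
move=> _ [i _ <-]; case: (unliftP i1 i) => [i' ->|->]; last first.
  by rewrite /h divff // rmorph1 mul1r subrr; have [? _ _] := lin_span_amod (range u) sA.
have i'm : (i' < m)%N by have := ltn_ord i'; lia.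
apply: lin_span_gen => //; exists (Ordinal i'm) => //.
by rewrite /u /= -[bump i1 i']/(val (lift i1 i')) valK.
Qed.

End Uniformizer.

Theorem kernel_generators : exists u : 'I_m -> F, (forall i, A (u i) /\ phi (u i) = 0) /\
  forall z, A z -> phi z = 0 -> lin_span A (range u) z.
Proof. by have [i1 [h1 h2 h3 h4]] := uniformizer; exact: kernel_generators_at h4. Qed.

End RegularPoint.

End IntegerLocal.

Module Variety.
Import Sumset Embedding Normalization Coordinates NoetherianLocal Vanishing RationalPoint Chains IntegerLocal.

(** * The variety and its integral model *)

Local Notation homog q := (ishomog1 q mdeg).

Section GradedRing.
Variables (F : fieldType) (G : nat -> set F).
Hypotheses (G1 : G 0 1) (G0 : forall D, G D 0) (GD : forall D x y, G D x -> G D y -> G D (x + y))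
  (GN : forall D x, G D x -> G D (- x)) (GM : forall a b x y, G a x -> G b y -> G (a + b) (x * y)).

Lemma graded_total_gen D x : G D x -> graded_total G x.
Proof.
move=> hx; exists D.+1, (fun i => if i == D then x else 0); split.
  by move=> i; case: eqP => [->|].
by rewrite big_ord_recr /= eqxx big1 ?add0r // => i _; rewrite ltn_eqF.
Qed.

Lemma proj_notM q e e' g g' : proj_points G q -> G e g -> G e' g' -> ~ q g -> ~ q g' -> ~ q (g * g').
Proof.
by move=> [[_ _ qP] _ _] h1 h2 n1 n2 /(qP _ _ (graded_total_gen h1) (graded_total_gen h2)) [].
Qed.

Lemma proj_neq0 q g : proj_points G q -> ~ q g -> g != 0.
Proof. by move=> [[[_ q0 _ _] _ _] _ _] h; apply/eqP => E; apply: h; rewrite E. Qed.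

Lemma proj_local_sring q : proj_points G q -> sring (proj_local_ring G q).
Proof.
move=> hq; have [[_ q1 _] _ _] := hq; split.
- by exists 0%N, 1, 1; rewrite divr1 add0n.
- move=> _ _ [e [f [g [hf hg ng ->]]]] [e' [f' [g' [hf' hg' ng' ->]]]]; rewrite !add0n in hf hf'.
  exists (e + e')%N, (f * g' + f' * g), (g * g'); split.
  + by rewrite add0n; apply: GD; [exact: GM|rewrite addnC; exact: GM].
  + exact: GM.
  + exact: proj_notM hg hg' ng ng'.
  + by rewrite addf_div ?(proj_neq0 hq).
- move=> _ [e [f [g [hf hg ng ->]]]]; exists e, (- f), g; split=> //; first exact: GN.
  by rewrite mulNr.
- move=> _ _ [e [f [g [hf hg ng ->]]]] [e' [f' [g' [hf' hg' ng' ->]]]]; rewrite !add0n in hf hf'.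
  exists (e + e')%N, (f * f'), (g * g'); split; rewrite ?add0n; [exact: GM|exact: GM| |by rewrite mulf_div].
  exact: proj_notM hg hg' ng ng'.
Qed.

End GradedRing.

Lemma module_powM (F : fieldType) (A B : set F) a b x y : sring A ->
  module_pow A B a x -> module_pow A B b y -> module_pow A B (a + b) (x * y).
Proof.
move=> sA; have amodP k : amod A (module_pow A B k).
  by case: k => [|k]; [exact: sring_amod|exact: lin_span_amod].
elim: a x => [|a IH] x hx hy; first by have [_ _ h] := amodP b; exact: h.
rewrite addSn; case: hx => k [c [t [hc ht ->]]]; rewrite mulr_suml.
refine (amod_sum (amodP (a + b).+1) _) => i _.
have [z [y' [Bz hy' ->]]] := ht i; rewrite -!mulrA; have [_ _ h] := amodP (a + b).+1; apply: h => //.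
by apply: lin_span_gen => //; exists z, (y' * y); split=> //; exact: IH.
Qed.

Section Variety.
Variables (K : fieldExtType rat) (n : nat) (P : prime_idealr (mpoly n.+1 K)).
Local Notation F := (hfield P).

Lemma hclass_is_zmod_morphism : zmod_morphism (@hclass K n P).
Proof. by move=> f g; rewrite /hclass !(rmorphB, raddfB) /=. Qed.
Lemma hclass_is_monoid_morphism : monoid_morphism (@hclass K n P).
Proof. by split=> [|f g]; rewrite /hclass ?(rmorph1, rmorphM) /=. Qed.
HB.instance Definition _ := GRing.isZmodMorphism.Build _ _ (@hclass K n P) hclass_is_zmod_morphism.
HB.instance Definition _ := GRing.isMonoidMorphism.Build _ _ (@hclass K n P) hclass_is_monoid_morphism.

Lemma hconst_is_zmod_morphism : zmod_morphism (@hconst K n P).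
Proof. by move=> f g; rewrite /hconst !rmorphB. Qed.
Lemma hconst_is_monoid_morphism : monoid_morphism (@hconst K n P).
Proof. by split=> [|f g]; rewrite /hconst ?(rmorph1, rmorphM). Qed.
HB.instance Definition _ := GRing.isZmodMorphism.Build _ _ (@hconst K n P) hconst_is_zmod_morphism.
HB.instance Definition _ := GRing.isMonoidMorphism.Build _ _ (@hconst K n P) hconst_is_monoid_morphism.

Definition hio : {rmorphism K -> F} := @hconst K n P.
Definition hX (i : 'I_n.+1) : F := hclass P (mpolyX K (mnm1 i)).
Local Notation cl := (mmap hio hX).
Local Notation S := (S hio hX).

Lemma hclassE f : hclass P f = cl f.
Proof.
rewrite {1}[f]mpolyE raddf_sum /mmap /=; apply: eq_bigr => a _.
rewrite -mul_mpolyC rmorphM /=; congr (_ * _).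
rewrite mpolyXE_id rmorph_prod /mmap1 /=; apply: eq_bigr => i _.
by rewrite rmorphXn.
Qed.

Lemma hclass_eq0 f : hclass P f = 0 <-> f \in P.
Proof.
rewrite /hclass; split=> [/eqP|h].
  by rewrite tofrac_eq0 -(rmorph0 (\pi_({ideal_quot P}))%qT) -Quotient.idealrBE subr0.
apply/eqP; rewrite tofrac_eq0; apply/eqP; rewrite -(rmorph0 (\pi_({ideal_quot P}))%qT).
by apply/eqP; rewrite -Quotient.idealrBE subr0.
Qed.

Lemma hcharK (a b : nat) : a%:R = b%:R :> K -> a = b.
Proof. by move=> E; have := @intrK_inj K a b E => -[]. Qed.

Lemma hlinearE u : hlinear P u = \sum_i hio (u ord0 i) * hX i.
Proof.
rewrite /hlinear raddf_sum /=; apply: eq_bigr => i _.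
by rewrite -mul_mpolyC rmorphM.
Qed.

Lemma hlinear_delta i : hlinear P (delta_mx ord0 i) = hX i.
Proof.
rewrite hlinearE (bigD1 i) //= mxE !eqxx rmorph1 mul1r big1 ?addr0 // => j ji.
by rewrite mxE (negbTE ji) andbF rmorph0 mul0r.
Qed.

Lemma S_hlinear u : S 1 (hlinear P u).
Proof. by rewrite hlinearE; apply: S_sum => i _; apply: S_Z; exact: S_X. Qed.

Lemma range_hio_sring : sring (range (@hconst K n P)).
Proof.
split.
- by exists 1; rewrite ?rmorph1.
- by move=> _ _ [a _ <-] [b _ <-]; exists (a + b); rewrite ?rmorphD.
- by move=> _ [a _ <-]; exists (- a); rewrite ?rmorphN.
- by move=> _ _ [a _ <-] [b _ <-]; exists (a * b); rewrite ?rmorphM.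
Qed.

Lemma S_amod D : amod (range (@hconst K n P)) (S D).
Proof.
by have [h0 hD hZ] := S_ksub hio hX D; split=> // _ x [c _ <-]; exact: hZ.
Qed.

Lemma X_ringE : @X_ring K n P = S.
Proof.
apply/funext => D; elim: D => [|D IH].
  apply/seteqP; split=> [_ [c _ <-]|x /S_0P [c ->]]; first exact: (S_io hio hX c).
  by exists c.
have -> : @X_ring K n P D.+1 = lin_span (range (@hconst K n P)) [set z | exists x y, [/\ range (hlinear P) x, @X_ring K n P D y & z = x * y]] by [].
rewrite IH; apply/seteqP; split=> z.
  apply: lin_span_sub; first exact: S_amod.
  by move=> _ [_ [y [[u _ <-] hy ->]]]; rewrite -[D.+1]add1n; apply: S_M => //; exact: S_hlinear.
move=> /S_succ [y [hy ->]].
refine (amod_sum (lin_span_amod _ range_hio_sring) _) => i _.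
apply: lin_span_gen; first exact: range_hio_sring.
by exists (hX i), (y i); split=> //; exists (delta_mx ord0 i) => //; exact: hlinear_delta.
Qed.

Hypothesis hP : homogeneous_relevant P.

(** [P] contains the homogeneous components of its elements, so forms of different degrees can add
    up to 0 in the quotient only if each of them does. *)
Lemma sdir (p : {poly F}) : (forall i, S i p`_i) -> p.[1] = 0 -> p = 0.
Proof.
move=> hp p1; have /choice [f hf] i : exists f, f \is homog i /\ p`_i = cl f.
  by have [f h1 h2] := hp i; exists f.
have E : hclass P (\sum_(i < size p) f i) = 0.
  rewrite raddf_sum -[RHS]p1 horner_coef /=; apply: eq_bigr => i _.
  by have [_ ->] := hf i; rewrite expr1n mulr1 hclassE.
move/hclass_eq0: E => /= E; apply/polyP => j; rewrite coef0.
have [sj|js] := leqP (size p) j; first by rewrite nth_default.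
have [hj ->] := hf j; rewrite -hclassE; apply/hclass_eq0.
have [hP1 _] := hP; have := hP1 _ j E; rewrite raddf_sum /= (bigD1 (Ordinal js)) //= big1 ?addr0.
  by rewrite pihomog_dE.
move=> i ij; have [hi _] := hf i; apply: (pihomog_ne0 _ hi).
by apply: contra ij => /eqP E'; apply/eqP; apply: val_inj.
Qed.

(** * Generic fibre of the integral model *)

Section Denominators.
Variable E : set 'rV[K]_n.+1.
Hypothesis hE : projective_lattice E.
Local Notation OK := (@ring_of_integers K).
Local Notation OK' := (@hconst K n P @` OK).
Local Notation Cl := (closure_ring P E).

Lemma OK'_sring : sring OK'.
Proof.
have [h1 hD hN hM] := OK_sring K; split.
- by exists 1; rewrite ?rmorph1.
- by move=> _ _ [a ha <-] [b hb <-]; exists (a + b); rewrite ?rmorphD //; exact: hD.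
- by move=> _ [a ha <-]; exists (- a); rewrite ?rmorphN //; exact: hN.
- by move=> _ _ [a ha <-] [b hb <-]; exists (a * b); rewrite ?rmorphM //; exact: hM.
Qed.

Lemma Cl_amod D : amod OK' (Cl D).
Proof. by case: D => [|D]; [exact: sring_amod OK'_sring|exact: lin_span_amod OK'_sring]. Qed.

Lemma Cl1 : Cl 0 1. Proof. by have [] := OK'_sring. Qed.
Lemma Cl0 D : Cl D 0. Proof. by have [] := Cl_amod D. Qed.
Lemma ClD D x y : Cl D x -> Cl D y -> Cl D (x + y). Proof. by have [_ h _] := Cl_amod D; exact: h. Qed.
Lemma ClN D x : Cl D x -> Cl D (- x). Proof. exact: amod_opp OK'_sring (Cl_amod D). Qed.
Lemma ClM a b x y : Cl a x -> Cl b y -> Cl (a + b) (x * y).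
Proof. exact: module_powM OK'_sring. Qed.

Lemma Cl_S D : Cl D `<=` S D.
Proof.
have am k : amod OK' (S k).
  by have [h0 hD hZ] := S_ksub hio hX k; split=> // _ x [c _ <-]; exact: hZ.
elim: D => [|D IH]; first by move=> _ [c _ <-]; exact: (S_io hio hX c).
apply: lin_span_sub; first exact: am.
move=> _ [_ [y [[u _ <-] hy ->]]]; rewrite -[D.+1]add1n; apply: S_M; [exact: S_hlinear|exact: IH].
Qed.

Lemma Cl_hlinear u : E u -> Cl 1 (hlinear P u).
Proof.
move=> Eu; apply: lin_span_gen; first exact: OK'_sring.
by exists (hlinear P u), 1; rewrite mulr1; split=> //; exact: Cl1.
Qed.

Variable p : set K.
Hypothesis pm : is_maximal OK p.

Lemma OK_denominator (c : K) : exists2 a, OK a & a != 0 /\ OK (a * c).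
Proof.
have [[_ p0 _ _] _ _] := pm; have nz y : ~ p y -> y != 0 by move=> h; apply/eqP => y0; apply: h; rewrite y0.
have [->|c0] := eqVneq c 0.
  by exists 1; [case: (OK_sring K)|rewrite oner_eq0 mulr0; split=> //; exact: sring0 (OK_sring K)].
have [[x [y [Ox Oy ny Ec]]]|[x [y [Ox Oy ny Ec]]]] := O_val pm c0.
  by exists y => //; split; [exact: nz|rewrite Ec mulrC divfK ?nz].
have x0 : x != 0.
  by apply/eqP => x0; move/eqP: Ec; rewrite x0 mul0r invr_eq0 (negbTE c0).
by exists x => //; split=> //; rewrite -[c]invrK Ec invf_div mulrC divfK.
Qed.

(** The generic fibre of the module [V], as the set of elements that some nonzero integer of [K]
    multiplies into [V]. *)
Definition den (V : set F) : set F := [set s | exists a, [/\ OK a, a != 0 & V (hconst P a * s)]].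

Lemma den_ksub V : amod OK' V -> ksub hio (den V).
Proof.
move=> [V0 VD VM]; have [q1 _ _ OM] := OK_sring K; split.
- by exists 1; rewrite oner_eq0 mulr0.
- move=> x y [a [Oa a0 ha]] [b [Ob b0 hb]]; exists (a * b); split; [exact: OM|exact: mulf_neq0|].
  rewrite rmorphM mulrDr [X in X * x]mulrC -!mulrA.
  by apply: VD; apply: VM => //; [exists b|exists a].
- move=> c x [a [Oa a0 ha]]; have [b Ob [b0 hb]] := OK_denominator c.
  exists (a * b); split; [exact: OM|exact: mulf_neq0|].
  rewrite [hio c]/(hconst P c) mulrA -rmorphM -mulrA [a * (b * c)]mulrC rmorphM -mulrA.
  by apply: VM => //; exists (b * c).
Qed.

Lemma S_den D : S D `<=` den (Cl D).
Proof.
have [q1 _ _ OM] := OK_sring K; have [[E0 ED EZ] _ hspan] := hE.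
have hXd i : exists a, [/\ OK a, a != 0 & exists2 u, E u & hconst P a * hX i = hlinear P u].
  have [k [c [u [Eu Ed]]]] := hspan (delta_mx ord0 i).
  have [b Ob [b0 hb]] : exists2 b, OK b & b != 0 /\ forall j, OK (b * c j).
    elim: k c {u Eu Ed} => [|k IH] c; first by exists 1 => //; rewrite oner_eq0; split=> // -[].
    have [b Ob [b0 hb]] := IH (fun j => c (lift ord0 j)); have [a Oa [a0 ha]] := OK_denominator (c ord0).
    exists (a * b); first exact: OM.
    split=> [|j]; first exact: mulf_neq0.
    case: (unliftP ord0 j) => [j' ->|->]; first by rewrite -mulrA; exact: OM.
    by rewrite mulrAC; exact: OM.
  exists b; split=> //; exists (b *: delta_mx ord0 i).
    rewrite Ed scaler_sumr.
    by apply: (big_ind E) => // j _; rewrite scalerA; exact: EZ.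
  rewrite -hlinear_delta !hlinearE big_distrr /=; apply: eq_bigr => j _.
  by rewrite !mxE rmorphM mulrA.
elim: D => [|D IH] s.
  move=> /S_0P [c ->]; have [a Oa [a0 ha]] := OK_denominator c; exists a; split=> //.
  by rewrite [hio c]/(hconst P c) -rmorphM; exists (a * c).
move=> /S_succ [y [hy ->]]; apply: ksub_sum; first exact: den_ksub (Cl_amod D.+1).
move=> i _; have [a [Oa a0 [u Eu hu]]] := hXd i; have [b [Ob b0 hb]] := IH _ (hy i).
exists (a * b); split; [exact: OM|exact: mulf_neq0|].
rewrite rmorphM mulrACA hu; apply: lin_span_gen; first exact: OK'_sring.
by exists (hlinear P u), (hconst P b * y i); split=> //; exists u.
Qed.

Lemma lin_span_Cl D : lin_span (range (@hconst K n P)) (Cl D) = S D.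
Proof.
apply/seteqP; split; first by apply: lin_span_sub; [exact: S_amod|exact: Cl_S].
move=> s /S_den [a [_ a0 ha]].
have -> : s = hconst P a^-1 * (hconst P a * s) by rewrite mulrA -rmorphM mulVf // rmorph1 mul1r.
have [_ _ h] := lin_span_amod (Cl D) range_hio_sring; apply: h; first by exists a^-1.
by apply: lin_span_gen => //; exact: range_hio_sring.
Qed.

(** As [F_module] is a union of models, one model has to be exhibited: the sections over the closure
    that restrict to elements of [S D]. It contains the degree [D] part of the integral ring, which
    spans [S D]. *)
Lemma lin_span_F_module D : lin_span (range (@hconst K n P)) (F_module E D) = S D /\ F_module E D `<=` S D.
Proof.
have sub : F_module (P := P) E D `<=` S D.
  move=> s [M [_ _ _ hM] Ms]; rewrite -lin_span_Cl -hM; apply: lin_span_gen => //; exact: range_hio_sring.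
split=> //; apply/seteqP; split; first by apply: lin_span_sub; [exact: S_amod|].
rewrite -[X in X `<=` _]lin_span_Cl; apply: lin_span_sub; first exact: lin_span_amod range_hio_sring.
have [h0 hD hZ] := S_ksub hio hX D.
pose H0 := proj_sections Cl D; pose M := H0 `&` S D.
have Cl_H0 : Cl D `<=` H0.
  move=> s hs q [[_ q1 _] _ _]; exists 0%N, s, 1; rewrite addn0 divr1; split=> //; exact: Cl1.
suff hM : saturated_model E D M.
  move=> s hs; apply: lin_span_gen; first exact: range_hio_sring.
  by exists M => //; split; [exact: Cl_H0|exact: Cl_S].
split.
- by move=> s [].
- split.
  + by split=> //; apply: Cl_H0; exact: Cl0.
  + move=> x y [hx sx] [hy sy]; split; last exact: hD.
    move=> q hq; have [e [f [g [hf hg ng ->]]]] := hx q hq; have [e' [f' [g' [hf' hg' ng' ->]]]] := hy q hq.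
    exists (e + e')%N, (f * g' + f' * g), (g * g'); split.
    * by apply: ClD; rewrite ?addnA; [exact: ClM|rewrite addnAC; exact: ClM].
    * exact: ClM.
    * exact: (proj_notM Cl0 hq hg hg' ng ng').
    * by rewrite addf_div ?(proj_neq0 hq).
  + move=> _ x [c Oc <-] [hx sx]; split; last exact: hZ.
    move=> q hq; have [e [f [g [hf hg ng ->]]]] := hx q hq.
    exists e, (hconst P c * f), g; split=> //; last by rewrite mulrA.
    by have [_ _ h] := Cl_amod (D + e); apply: h => //; exists c.
- move=> _ x [c Oc <-] c0 hx [_ sx]; split=> //.
  rewrite fmorph_eq0 in c0; have : S D (hconst P c^-1 * (hconst P c * x)) := hZ c^-1 _ sx.
  by rewrite mulrA -rmorphM mulVf // rmorph1 mul1r.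
- apply/seteqP; split; rewrite lin_span_Cl.
    by apply: lin_span_sub; [exact: S_amod|move=> s []].
  rewrite -[X in X `<=` _]lin_span_Cl; apply: lin_span_sub; first exact: lin_span_amod range_hio_sring.
  move=> s hs; apply: lin_span_gen; first exact: range_hio_sring.
  by split; [exact: Cl_H0|exact: Cl_S].
Qed.

End Denominators.
End Variety.

End Variety.

Module PointRing.
Import Sumset Embedding Normalization Coordinates NoetherianLocal Vanishing RationalPoint Chains IntegerLocal Variety.

(** * The local ring at the rational point *)

Local Notation homog q := (ishomog1 q mdeg).
Local Arguments gpow {F} A {s} g k : simpl never.

(** A common denominator turns $m+1$ quotients into $m+2$ forms of one degree, to which [alg_dep]
    applies. Setting the denominator to 1 keeps the relation nonzero, since monomials of equal
    degree are determined by all exponents but one. *)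
Lemma rational_alg_dep (K F : fieldType) (io : {rmorphism K -> F}) n (X : 'I_n -> F) m e c0 N (x0 : F) :
  (forall D r, (N <= D)%N -> ind io (S io X D) r -> (r <= e * 'C(D + c0 + m, D + c0))%N) ->
  S io X 1 x0 -> x0 != 0 ->
  forall y : 'I_m.+1 -> F, (forall i, exists k f g, [/\ S io X k f, S io X k g, g != 0 & y i = f / g]) ->
  exists2 p : mpoly m.+1 K, p != 0 & mmap io y p = 0.
Proof.
move=> hup Sx0 x00 y /choice [k /choice [f /choice [g h]]].
pose G := x0 * \prod_i g i; pose E0 := (1 + \sum_i k i)%N.
have Sprod (J : Type) (s : seq J) (Q : pred J) (a : J -> F) (d : J -> nat) :
    (forall j, S io X (d j) (a j)) -> S io X (\sum_(j <- s | Q j) d j)%N (\prod_(j <- s | Q j) a j).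
  move=> ha; elim/big_rec2: _ => [|j d' a' _ IH]; [exact: S_1|exact: S_M].
have G0 : G != 0 by rewrite mulf_neq0 //; apply/prodf_neq0 => i _; have [] := h i.
have SG : S io X E0 G by apply: S_M => //; apply: Sprod => i; have [] := h i.
have Sy i : S io X E0 (y i * G).
  have [hf hg g0 ->] := h i; rewrite /G /E0 (bigD1 i) //= (bigD1 (F := g) i) //=.
  have -> : f i / g i * (x0 * (g i * \prod_(j < m.+1 | j != i) g j)) = x0 * (f i * \prod_(j < m.+1 | j != i) g j) by field.
  by apply: S_M => //; apply: S_M => //; apply: Sprod => j; have [] := h j.
pose Y (i : 'I_m.+2) := if unlift ord0 i is Some j then y j * G else G.
have [||q [p [hp p0 pY]]] := alg_dep hup (E0 := E0) (y := Y) => //.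
  by move=> i; rewrite /Y; case: unlift.
pose Z (i : 'I_m.+2) := if unlift ord0 i is Some j then y j else 1.
have pZ : mmap io Z p = 0.
  have -> : Z = fun i => Y i / G by apply/funext => i; rewrite /Z /Y; case: unlift => [j|]; rewrite ?mulfK ?divff.
  by rewrite (mmap_scale_homog _ _ G0 hp) pY mul0r.
pose res (a : multinom m.+2) : multinom m.+1 := Multinom [tuple a (lift ord0 i) | i < m.+1].
have resE a i : res a i = a (lift ord0 i) by rewrite mnmE.
have res_inj a b : a \in msupp p -> b \in msupp p -> res a = res b -> a = b.
  move=> ha hb E; have da := dhomog_mf hp ha; have db := dhomog_mf hp hb.
  have hl i : a (lift ord0 i) = b (lift ord0 i) by rewrite -!resE E.
  apply/mnmP => i; case: (unliftP ord0 i) => [j ->//|->].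
  have Es : (\sum_(j < m.+1) a (lift ord0 j) = \sum_(j < m.+1) b (lift ord0 j))%N by apply: eq_bigr => j _; exact: hl.
  move: da; rewrite /= mdegE big_ord_recl Es => da; move: db; rewrite /= mdegE big_ord_recl => db.
  by apply: (@addIn (\sum_(j < m.+1) b (lift ord0 j))); rewrite db.
pose p' := \sum_(a <- msupp p) mcoeff a p *: mpolyX K (res a).
exists p'.
  have [a ha] : exists a, a \in msupp p.
    by move: p0; rewrite -msupp_eq0; case: (msupp p) => [|a s] // _; exists a; rewrite mem_head.
  apply/eqP => /(congr1 (mcoeff (res a))); rewrite mcoeff0 /p' raddf_sum /= (bigD1_seq a) ?msupp_uniq //=.
  rewrite mcoeffZ mcoeffX eqxx mulr1 big_seq_cond big1 ?addr0 => [/eqP|b /andP[hb ba]].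
    by apply/negP; rewrite -mcoeff_msupp.
  rewrite mcoeffZ mcoeffX; case: eqP => [E|_]; last by rewrite mulr0.
  by rewrite (res_inj _ _ hb ha E) eqxx in ba.
rewrite /p' raddf_sum -[RHS]pZ /mmap /=; apply: eq_bigr => a _.
rewrite mmapZ mmapX; congr (_ * _); rewrite /mmap1 [RHS]big_ord_recl /Z unlift_none expr1n mul1r.
by apply: eq_bigr => i _; rewrite liftK resE.
Qed.

Lemma frac_scale (F : fieldType) (a b c : F) : b != 0 -> c != 0 -> a / b = (a / c) / (b / c).
Proof. by move=> b0 c0; field; rewrite b0 c0. Qed.

Lemma frac_scale2 (F : fieldType) (a b f g h : F) : a != 0 -> b != 0 -> g != 0 -> h != 0 ->
  f / g = b * (a * f) / h / (a * (b * g) / h).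
Proof. by move=> a0 b0 g0 h0; field; rewrite a0 b0 g0 h0. Qed.

Lemma frac_cross (F : fieldType) (a b c d : F) : b != 0 -> d != 0 -> a / b = c / d -> a * d = c * b.
Proof. by move=> b0 d0 /eqP; rewrite eqr_div // => /eqP. Qed.

Local Arguments hio {K n} P : simpl never.

Section AtXi.
Variables (K : fieldExtType rat) (n : nat) (P : prime_idealr (mpoly n.+1 K)).
Hypothesis hP : homogeneous_relevant P.
Local Notation F := (hfield P).
Local Notation io := (hio P).
Local Notation X := (@hX K n P).
Local Notation cl := (mmap io X).
Local Notation S := (S io X).
Local Notation OK := (@ring_of_integers K).
Variable eta : 'I_n.+1 -> K.
Hypothesis heta : rational_point P eta.

Implicit Types z : F.

Lemma eta_ker f : cl f = 0 -> meval eta f = 0.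
Proof. by rewrite -hclassE => /hclass_eq0; have [_ h] := heta; exact: h. Qed.

Lemma cl_neq0 f : meval eta f != 0 -> cl f != 0.
Proof. by apply: contraNneq => /eta_ker ->. Qed.

Lemma val_uniq z c c' : value_at eta z c -> value_at eta z c' -> c = c'.
Proof.
move=> [e [f [g [_ _ g0 -> ->]]]] [e' [f' [g' [_ _ g'0 E ->]]]].
have n1 : hclass P g != 0 by rewrite hclassE cl_neq0.
have n2 : hclass P g' != 0 by rewrite hclassE cl_neq0.
have : hclass P (f * g' - f' * g) = 0.
  rewrite rmorphB !rmorphM; apply/eqP; rewrite subr_eq0; apply/eqP.
  exact: frac_cross n1 n2 E.
rewrite hclassE.
move/eta_ker; rewrite rmorphB !rmorphM /= => /eqP; rewrite subr_eq0 => /eqP E2.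
by apply/eqP; rewrite eqr_div // E2.
Qed.

Lemma val_D z z' c c' : value_at eta z c -> value_at eta z' c' -> value_at eta (z + z') (c + c').
Proof.
move=> [e [f [g [hf hg g0 -> ->]]]] [e' [f' [g' [hf' hg' g'0 -> ->]]]].
exists (e + e')%N, (f * g' + g * f'), (g * g'); split.
- by apply: dhomogD; exact: dhomogM.
- exact: dhomogM.
- by rewrite rmorphM mulf_neq0.
- by rewrite !hclassE addf_div ?cl_neq0 // !(rmorphD, rmorphM) /= [cl f' * _]mulrC.
- by rewrite addf_div // !(rmorphD, rmorphM) /= [meval eta f' * _]mulrC.
Qed.

Lemma val_M z z' c c' : value_at eta z c -> value_at eta z' c' -> value_at eta (z * z') (c * c').
Proof.
move=> [e [f [g [hf hg g0 -> ->]]]] [e' [f' [g' [hf' hg' g'0 -> ->]]]].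
exists (e + e')%N, (f * f'), (g * g'); split; [exact: dhomogM|exact: dhomogM|by rewrite rmorphM mulf_neq0| |].
- by rewrite !hclassE mulf_div !rmorphM.
- by rewrite mulf_div !rmorphM.
Qed.

Lemma val_io c : value_at eta (io c) c.
Proof.
have hc (a : K) : mpolyC n.+1 a \is homog 0 by rewrite -[mpolyC _ _]mulr1 mul_mpolyC dhomogZ // dhomog1.
exists 0%N, (mpolyC n.+1 c), (mpolyC n.+1 1); rewrite !mevalC oner_eq0 divr1 mpolyC1; split=> //.
- by rewrite -mpolyC1.
- by rewrite rmorph1 divr1.
Qed.

Lemma val_V z c : value_at eta z c -> c != 0 -> value_at eta z^-1 c^-1.
Proof.
move=> [e [f [g [hf hg g0 -> ->]]]]; rewrite mulf_eq0 negb_or => /andP[f0 _].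
by exists e, g, f; rewrite !invf_div.
Qed.

Lemma val_N z c : value_at eta z c -> value_at eta (- z) (- c).
Proof. by move=> h; have := val_M (val_io (-1)) h; rewrite rmorphN1 !mulN1r. Qed.

(** The local ring of [X] at [eta], with maximal ideal [Mv], described through values so that it
    does not refer to the normalizing coordinates. *)
Definition Rv : set F := [set z | exists c, value_at eta z c].
Definition Mv : set F := [set z | value_at eta z 0].

Lemma Rv_sring : sring Rv.
Proof.
split.
- by exists 1; have := val_io 1; rewrite rmorph1.
- by move=> x y [c hc] [c' hc']; exists (c + c'); exact: val_D.
- by move=> x [c hc]; exists (- c); exact: val_N.
- by move=> x y [c hc] [c' hc']; exists (c * c'); exact: val_M.
Qed.

Lemma Mv_amod : amod Rv Mv.
Proof.
split.
- by have := val_io 0; rewrite rmorph0.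
- by move=> x y hx hy; have := val_D hx hy; rewrite addr0.
- by move=> a x [c hc] hx; have := val_M hc hx; rewrite mulr0.
Qed.

Lemma Rv_unit z : Rv z -> ~ Mv z -> z != 0 /\ Rv z^-1.
Proof.
move=> [c hc] nM; have c0 : c != 0 by apply/eqP => c0; apply: nM; rewrite /Mv /= -c0.
split; last by exists c^-1; exact: val_V.
by apply/eqP => z0; move/eqP: c0; apply; apply: val_uniq hc _; rewrite z0 -(rmorph0 io); exact: val_io.
Qed.

Variables (m : nat) (l : 'I_m.+1 -> mpoly n.+1 K).
Hypotheses (hl : forall i, l i \is homog 1) (l0_eta : meval eta (l ord0) = 1)
  (lS_eta : forall i, meval eta (l (lift ord0 i)) = 0)
  (lfin : finz io X (fun i => cl (l i))) (lfree : zfree io (fun i => cl (l i))).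
Local Notation x0 := (cl (l ord0)).
Local Notation B := (Bring io X l).
Local Notation ev := (evB io X eta l).
Local Notation w := (wB io X eta l).

Lemma Rv_locring : Rv = locring B ev.
Proof.
rewrite (locring_point eta_ker hl l0_eta); apply/seteqP; split=> z.
  by move=> [c [e [f [g [hf hg g0 -> _]]]]]; exists e, f, g; rewrite !hclassE.
by move=> [e [f [g [hf hg g0 ->]]]]; exists (meval eta f / meval eta g), e, f, g; rewrite !hclassE.
Qed.

Let sB := B_sring io X hl.
Let evD := @evB_D _ _ _ _ _ _ eta_ker _ _ hl l0_eta.
Let evM := @evB_M _ _ _ _ _ _ eta_ker _ _ hl l0_eta.
Let evio := @evB_io _ _ _ _ _ _ eta_ker _ _ l0_eta.
Let wgen := @wB_gen _ _ _ _ _ _ eta_ker _ _ hl l0_eta.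

Lemma Mv_w : Mv = gpow Rv w 1.
Proof.
apply/seteqP; split=> z.
  move=> [e [f [g [hf hg g0 -> E]]]]; rewrite Rv_locring !hclassE.
  have f0 : meval eta f = 0.
    by move/eqP: (esym E); rewrite mulf_eq0 invr_eq0 (negbTE g0) orbF => /eqP.
  have x0e : x0 ^+ e != 0 by rewrite expf_neq0 // (x0_neq0 eta_ker l0_eta).
  rewrite (frac_scale _ (cl_neq0 g0) x0e).
  apply: (M1_ev sB evM evio wgen); rewrite ?(evBE eta_ker l0_eta) //.
    by exists e; rewrite /BD /= divfK //; exists f.
  by exists e; rewrite /BD /= divfK //; exists g.
move=> /gpow1P [y [hy ->]]; refine (amod_sum Mv_amod _) => i _; rewrite mulrC.
have [_ _ h] := Mv_amod; apply: h => //.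
exists 1%N, (mpolyX K (mnm1 i) - eta i *: l ord0), (l ord0); split=> //.
- by apply: dhomogD; [exact: meval_hom_Xi|rewrite -scaleNr; apply: dhomogZ].
- by rewrite l0_eta oner_eq0.
- by rewrite !hclassE -[X in _ / X]expr1; apply: wB_rep => //; exact: eta_ker.
- by rewrite mevalB mevalXU mevalZ l0_eta mulr1 subrr mul0r.
Qed.

Variables (e c0 N : nat).
Hypothesis hup : forall D r, (N <= D)%N -> ind io (S D) r -> (r <= e * 'C(D + c0 + m, D + c0))%N.

Variables (E : set 'rV[K]_n.+1) (hE : projective_lattice E) (p : set K) (pm : is_maximal OK p).
Variable xi : set F.
Local Notation Cl := (closure_ring P E).
Local Notation A := (proj_local_ring Cl xi).
Local Notation OKp := (localization OK p).
Hypotheses (hxi : proj_points Cl xi) (hres : residue_rational E p xi)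
  (hreg : regular_local_ring A) (hred : reduces_to E p eta xi).

Lemma A_sring : sring A.
Proof.
apply: (@proj_local_sring F Cl) => //;
  [exact: Cl1|exact: Cl0|move=> *; exact: ClD|move=> *; exact: ClN|move=> *; exact: ClM].
Qed.

Let phi (z : F) : K := xget 0 [set c | value_at eta z c].

Let phiE z c : value_at eta z c -> phi z = c.
Proof. by move=> h; rewrite /phi; case: xgetP => [c' _ /val_uniq|/(_ c)]; [exact|case]. Qed.

Let Aval z : A z -> value_at eta z (phi z).
Proof. by move=> /hred [c [h _ _]]; rewrite (phiE h). Qed.

Lemma xi_generators : exists u : 'I_m -> F, (forall i, A (u i) /\ value_at eta (u i) 0) /\
  forall z, A z -> value_at eta z 0 -> lin_span A (range u) z.
Proof.
have [nA [r [kA [g gA]]]] := hreg.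
have AO c : OKp c -> A (io c).
  move=> [x [y [Ox Oy ny ->]]]; rewrite fmorph_div; exists 0%N, (io x), (io y); split=> //.
  - by exists x.
  - by exists y.
  - by have [h _] := hres; move/(h y Oy).
have [||||||u [h1 h2]] := @kernel_generators K F io A OKp phi A_sring (O_sring pm) AO _ _ _ _ _ (O_val pm) (O_nonunit pm) r g nA kA gA m _.
- by move=> z /hred [c [hv hO _]]; rewrite (phiE hv).
- by move=> x y Ax Ay; apply: phiE; apply: val_D; exact: Aval.
- by move=> x y Ax Ay; apply: phiE; apply: val_M; exact: Aval.
- by move=> c _; apply: phiE; exact: val_io.
- by move=> z [Az nz]; have [c [hv _ h]] := hred Az; rewrite (phiE hv); exact: h.
- move=> y Ay; apply: (rational_alg_dep hup (S_x0 io X hl) (x0_neq0 eta_ker l0_eta)) => i.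
  have [k [f [g' [hf hg ng ->]]]] := Ay i; exists k, f, g'; split=> //; [exact: (Cl_S hf)|exact: (Cl_S hg)|].
  exact: (proj_neq0 hxi).
exists u; split=> [i|z Az z0]; last by apply: h2 => //; exact: phiE.
by have [Au <-] := h1 i; split=> //; exact: Aval.
Qed.

(** Some linear form from [E] is nonzero at [xi], as not all elements of positive degree vanish
    there. It is nonzero at [eta] too: for a coordinate $X_i$ with $\eta_i\ne0$, a multiple of $X_i$
    divided by this form is regular at [xi] and therefore has a value at [eta]. *)
Lemma xi_linear : exists2 h, Cl 1 h & ~ xi h /\ exists2 hf, hf \is homog 1 & h = cl hf /\ meval eta hf != 0.
Proof.
have [[[xiT xi0 xiD xiM] xi1 xiP] _ [D [f [D0 Gf nf]]]] := hxi.
have [u0 Eu nu] : exists2 u0, E u0 & ~ xi (hlinear P u0).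
  apply: contrapT => no; apply: nf; case: D D0 Gf => // D _ [k [a [b [ha hb ->]]]].
  have xam : amod (graded_total Cl) xi by split.
  refine (amod_sum xam _) => i _; apply: (xiM).
    by apply: (graded_total_gen (@Cl0 K n P E) (D := 0)); exact: ha.
  have [_ [y [[u Eu <-] hy ->]]] := hb i; rewrite mulrC; apply: (xiM).
    exact: (graded_total_gen (@Cl0 K n P E) hy).
  by apply: contrapT => h; apply: no; exists u.
exists (hlinear P u0); first exact: Cl_hlinear.
split=> //; have [hf hhf Eh] := S_hlinear P u0; exists hf => //; split=> //.
have [[i ei] _] := heta; apply/eqP => h0.
have [a [Oa a0 ha]] := S_den hE pm (S_X io X i).
have hn := proj_neq0 hxi nu.
have /hred [c [[k [f' [g' [_ _ g0 E1 _]]]] _ _]] : A (hconst P a * X i / hlinear P u0).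
  exists 1%N, (hconst P a * X i), (hlinear P u0); split=> //; exact: Cl_hlinear.
have n1 : hclass P g' != 0 by rewrite hclassE cl_neq0.
have Eh' : hclass P hf = hlinear P u0 by rewrite hclassE -Eh.
have : hclass P (mpolyC n.+1 a * mpolyX K (mnm1 i) * g' - hf * f') = 0.
  rewrite rmorphB !rmorphM /=; apply/eqP; rewrite subr_eq0; apply/eqP.
  by rewrite [RHS]mulrC Eh'; exact: (frac_cross hn n1 E1).
rewrite hclassE.
move/eta_ker; rewrite mevalB !mevalM mevalC mevalXU h0 mul0r subr0 => /eqP.
by rewrite !mulf_eq0 (negbTE a0) (negbTE ei) (negbTE g0).
Qed.

(** Numerator and denominator of a function at [eta] are made integral by constants and divided by a
    power of the linear form of [xi_linear]; both then lie in the local ring at [xi]. *)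
Lemma eval_local_ringE : eval_local_ring E eta xi = Rv.
Proof.
have [h Ch [nh [hf hhf [Eh h0]]]] := xi_linear; have hn := proj_neq0 hxi nh.
apply/seteqP; split=> z.
  move=> [x [y [Ax Ay ny ->]]]; have [_ _ _ RM] := Rv_sring; apply: RM; first by exists (phi x); exact: Aval.
  have [||_ //] := @Rv_unit y; first by exists (phi y); exact: Aval.
  by move=> My; apply: ny; split.
move=> [c [k [f [g [hf' hg g0 Ez _]]]]]; rewrite !hclassE in Ez.
have [|a [Oa a0 ha]] := S_den hE pm (_ : S k (cl f)); first by exists f.
have [|b [Ob b0 hb]] := S_den hE pm (_ : S k (cl g)); first by exists g.
have Chk : Cl k (h ^+ k).
  by elim: (k) => [|j IH]; [exact: Cl1|rewrite exprS -[j.+1]add1n; exact: ClM].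
have nhk : ~ xi (h ^+ k).
  elim: {Ez hf' hg ha hb} k Chk => [|j IH] _; first by have [[_ xi1 _] _ _] := hxi.
  rewrite exprS; have Cj : Cl j (h ^+ j).
    by elim: (j) => [|j' IH']; [exact: Cl1|rewrite exprS -[j'.+1]add1n; exact: ClM].
  exact: (proj_notM (@Cl0 K n P E) hxi Ch Cj nh (IH Cj)).
have hkn : h ^+ k != 0 by rewrite expf_neq0.
have mulC c' x : OK c' -> Cl k x -> Cl k (hconst P c' * x).
  by move=> Oc hx; have [_ _ hM] := @Cl_amod K n P E k; apply: hM => //; exists c'.
exists (hconst P b * (hconst P a * cl f) / h ^+ k), (hconst P a * (hconst P b * cl g) / h ^+ k); split.
- by exists k, (hconst P b * (hconst P a * cl f)), (h ^+ k); split=> //; exact: mulC.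
- by exists k, (hconst P a * (hconst P b * cl g)), (h ^+ k); split=> //; exact: mulC.
- move=> [_ v0]; have v1 : value_at eta (hconst P a * (hconst P b * cl g) / h ^+ k) (a * (b * meval eta g) / meval eta hf ^+ k).
    have hX : hf ^+ k \is homog k.
      by elim: (k) => [|j IH]; rewrite ?expr0 ?dhomog1 // exprS -[j.+1]add1n; exact: dhomogM.
    exists k, (a *: (b *: g)), (hf ^+ k); split=> //; rewrite ?dhomogZ ?dhomogZ //.
    + by rewrite rmorphXn expf_neq0.
    + by rewrite !hclassE !mmapZ rmorphXn /= Eh.
    + by rewrite !mevalZ rmorphXn.
  have := val_uniq v0 v1 => /esym/eqP; rewrite !mulf_eq0 invr_eq0 (negbTE a0) (negbTE b0) (negbTE g0).
  by rewrite expf_eq0 (negbTE h0) andbF.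
- rewrite Ez; have n1 := cl_neq0 g0.
  have a0' : hconst P a != 0 by rewrite fmorph_eq0.
  have b0' : hconst P b != 0 by rewrite fmorph_eq0.
  exact: (@frac_scale2 F (hconst P a) (hconst P b) (cl f) (cl g) (h ^+ k) a0' b0' n1 hkn).
Qed.

Lemma eval_max_idealE : eval_max_ideal E eta xi = Mv.
Proof.
rewrite /eval_max_ideal eval_local_ringE; apply/seteqP; split.
  by apply: lin_span_sub; [exact: Mv_amod|move=> z []].
move=> z Mz; have : eval_local_ring E eta xi z by rewrite eval_local_ringE; exists 0.
move=> [x [y [Ax Ay ny Ez]]].
have [||y0 Vy] := @Rv_unit y; [by exists (phi y); exact: Aval|by move=> My; apply: ny; split|].
have [_ _ h] := lin_span_amod (eval_kernel E eta xi) Rv_sring.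
rewrite Ez mulrC; apply: h => //; apply: lin_span_gen; first exact: Rv_sring.
split=> //; have -> : x = y * z by rewrite Ez mulrC divfK.
by have [_ _ hM] := Mv_amod; apply: hM => //; exists (phi y); exact: Aval.
Qed.

Lemma Rv_noetherian : noetherian Rv.
Proof.
rewrite -eval_local_ringE; apply: localization_noetherian; rewrite -/(eval_local_ring E eta xi) ?eval_local_ringE.
- exact: A_sring.
- have [A1 AD _ AM] := A_sring; have [M0 MD MM] := Mv_amod.
  have AR z : A z -> Rv z by move=> Az; exists (phi z); exact: Aval.
  split.
  + split=> [x []//||x y [h1 h2] [h3 h4]|a x ha [h1 h2]].
    * by split; [exact: sring0 A_sring|].
    * by split; [exact: AD|exact: MD].
    * by split; [exact: AM|apply: MM => //; exact: AR].
  + move=> [_ h]; have h1 : value_at eta (1 : F) 1 by have := val_io 1; rewrite rmorph1.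
    by have /esym/eqP := val_uniq h h1; rewrite oner_eq0.
  + move=> x y Ax Ay [_ h]; have := val_uniq h (val_M (Aval Ax) (Aval Ay)) => /esym/eqP.
    rewrite mulf_eq0 => /orP[/eqP E0|/eqP E0]; [left|right]; split=> //; rewrite -E0; exact: Aval.
- by have [] := hreg.
- exact: Rv_sring.
Qed.

Lemma Rv_parameters : exists u : 'I_m -> F, (forall i, Rv (u i)) /\ gpow Rv u 1 = Mv.
Proof.
have [u [h1 h2]] := xi_generators; exists u.
have AR z : A z -> Rv z by move=> Az; exists (phi z); exact: Aval.
split; first by move=> i; have [Au _] := h1 i; exact: AR.
apply/seteqP; split=> z.
  move=> /gpow1P [y [hy ->]]; refine (amod_sum Mv_amod _) => i _; rewrite mulrC.
  by have [_ _ h] := Mv_amod; apply: h => //; have [] := h1 i.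
move=> Mz; have : eval_local_ring E eta xi z by rewrite eval_local_ringE; exists 0.
move=> [x [y [Ax Ay ny Ez]]].
have [||y0 Vy] := @Rv_unit y; [exact: AR|by move=> My; apply: ny; split|].
have Mx : Mv x.
  have -> : x = y * z by rewrite Ez mulrC divfK.
  by have [_ _ hM] := Mv_amod; apply: hM => //; exact: AR.
have /(lin_span_range _ _ A_sring) [a [ha Ea]] := h2 x Ax Mx.
apply/gpow1P; exists (fun i => a i / y); split.
  by move=> i; have [_ _ _ RM] := Rv_sring; apply: RM => //; exact: AR.
by rewrite Ez Ea big_distrl /=; apply: eq_bigr => i _; rewrite mulrA [u i * _]mulrC.
Qed.

End AtXi.

End PointRing.

Module RegularLocal.
Import Sumset Embedding Normalization Coordinates NoetherianLocal Vanishing Valuation.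

(** * Primes and the order valuation of a regular local ring *)

Local Arguments gpow {F} A {s} g k : simpl never.

Section Regular.
Variables (K F : fieldType) (io : {rmorphism K -> F}) (m : nat) (u : 'I_m -> F) (R : set F).
Hypotheses (sR : sring R) (Rio : forall c, R (io c)) (uR : forall i, R (u i)).
Local Notation U := (gpow R u).
Local Notation pu := (mmap io u).
Hypotheses (Uexp : forall k z, R z -> exists p, U k (z - pu p))
  (Uind : forall k p, U k (pu p) -> ordz k p) (nR : noetherian R)
  (Runit : forall z, R z -> ~ U 1 z -> z != 0 /\ R z^-1).

Let Uam k : amod R (U k) := gpow_amod u sR k.
Let Rpu p : R (pu p) := R_pu sR Rio uR p.

Lemma U1_1 : ~ U 1 1.
Proof.
rewrite -(rmorph1 pu) => /Uind /(_ mnm0); rewrite mdeg0 => /(_ isT).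
by rewrite mcoeff1 eqxx => /eqP; rewrite oner_eq0.
Qed.

Lemma U_jac : jac R (U 1).
Proof.
move=> x Ux; have Rx := gpow_sub_A sR uR Ux; have [R1 RD RN _] := sR.
apply: Runit; first by apply: RD => //; exact: RN.
by move=> h; apply: U1_1; rewrite -(subrK x 1); have [_ hD _] := Uam 1; exact: hD.
Qed.

Lemma U_sep z : R z -> (forall k, U k z) -> z = 0.
Proof.
move=> Rz h; apply: (krull_intersection sR nR uR U_jac (I := [set 0])).
  split=> [x ->|//|x y -> ->|a x _ ->]; rewrite ?addr0 ?mulr0 //; exact: sring0.
by move=> k; exists 0, z; rewrite add0r.
Qed.

Local Notation nu := (isnu io u R).

(** Orders of vanishing add because leading exponents do. *)
Lemma U_notM a b x y : R x -> R y -> ~ U a.+1 x -> ~ U b.+1 y -> ~ U (a + b).+1 (x * y).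
Proof.
move=> Rx Ry nx ny.
have nz k z : ~ U k z -> z != 0 by move=> h; apply/eqP => z0; apply: h; rewrite z0; have [] := Uam k.
have [al hal] := isnu_ex sR Rio uR Uexp Uind U_sep Rx (nz _ _ nx).
have [be hbe] := isnu_ex sR Rio uR Uexp Uind U_sep Ry (nz _ _ ny).
have hx := isnu_U sR Rio uR Uexp Uind a.+1 Rx hal; have hy := isnu_U sR Rio uR Uexp Uind b.+1 Ry hbe.
have Rxy : R (x * y) by have [_ _ _ RM] := sR; exact: RM.
have hxy := isnu_U sR Rio uR Uexp Uind (a + b).+1 Rxy (isnuM sR Rio uR Uexp Uind Rx Ry hal hbe).
move/hxy; rewrite mdegD ltnNge => /negP; apply; apply: leq_add.
  by rewrite leqNgt; apply/negP => /hx.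
by rewrite leqNgt; apply/negP => /hy.
Qed.

Lemma isnu_u i y : R y -> U 2 (y - u i) -> nu y (mnm1 i).
Proof.
move=> Ry hy; have E b : (mdeg b < 2)%N -> cf io u R y b = (mnm1 i == b)%:R.
  move=> hb; rewrite (cfE sR uR Uexp Uind Ry (k := 2) (p := mpolyX K (mnm1 i)) _ hb) ?mcoeffX //.
  by rewrite mmapX mmap1U.
split=> [|b lt]; first by rewrite E ?mdeg1 // eqxx oner_eq0.
rewrite E; first by case: eqP lt => // ->; rewrite ltxx.
by have := lemc_mdeg (ltW lt); rewrite mdeg1 ltnS.
Qed.

Lemma u_U1 i : U 1 (u i).
Proof.
have [R1 _ _ _] := sR; have h : U 1 (u i * 1) by apply: gpow_gen => //; exact: R1.
by rewrite mulr1 in h.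
Qed.

Lemma u_notU2 i : ~ U 2 (u i).
Proof.
have h : U 2 (u i - u i) by rewrite subrr; have [] := Uam 2.
move/(isnu_U sR Rio uR Uexp Uind 2 (uR i) (isnu_u (uR i) h)).
by rewrite mdeg1.
Qed.

Lemma u_neq0 i : u i != 0.
Proof. by apply/eqP => E; apply: (u_notU2 (i := i)); rewrite E; have [] := Uam 2. Qed.

Lemma uX_notU i k : ~ U k.+1 (u i ^+ k).
Proof.
elim: k => [|k IH]; first exact: U1_1.
rewrite exprS -[k.+1]add1n; apply: U_notM => //; [exact: sringX|exact: u_notU2].
Qed.

Definition rho (i : nat) (p : mpoly m K) : mpoly m K :=
  mmap (@mpolyC m K) (fun j => if (j < i)%N then 0 else mpolyX K (mnm1 j)) p.

Lemma mcoeff_rho i p a : mcoeff a (rho i p) = if [forall j : 'I_m, (j < i)%N ==> (a j == 0%N)] then mcoeff a p else 0.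
Proof.
rewrite /rho /mmap raddf_sum /=.
have mono b : mmap1 (fun j : 'I_m => if (j < i)%N then 0 else mpolyX K (mnm1 j)) b =
    if [forall j : 'I_m, (j < i)%N ==> (b j == 0%N)] then mpolyX K b else 0.
  case: ifP => [/forallP h|/negbT].
    rewrite [RHS]mpolyXE_id /mmap1; apply: eq_bigr => j _.
    by have := h j; case: ifP => //= _ /eqP ->; rewrite !expr0.
  rewrite negb_forall => /existsP [j]; rewrite negb_imply => /andP[ji bj].
  by rewrite /mmap1 (bigD1 j) //= ji expr0n (negbTE bj) mul0r.
have E b : mcoeff a (mpolyC m (mcoeff b p) * mmap1 (fun j : 'I_m => if (j < i)%N then 0 else mpolyX K (mnm1 j)) b) =
    if [forall j : 'I_m, (j < i)%N ==> (a j == 0%N)] then mcoeff b p * (b == a)%:R else 0.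
  rewrite mono mul_mpolyC mcoeffZ; case: (eqVneq b a) => [->|ba].
    by case: ifP => _; rewrite ?mcoeffX ?eqxx ?mulr1 // mcoeff0 mulr0.
  rewrite mulr0 if_same; case: ifP => _; rewrite ?mcoeff0 ?mulr0 //.
  by rewrite mcoeffX (negbTE ba) mulr0.
under eq_bigr => b _ do rewrite E.
case: ifP => _; last by rewrite big1.
have [ha|ha] := boolP (a \in msupp p).
  rewrite (bigD1_seq a) ?msupp_uniq //= eqxx mulr1 big1 ?addr0 // => b ba.
  by rewrite (negbTE ba) mulr0.
rewrite big_seq big1 ?memN_msupp_eq0 // => b hb; case: eqP => [E'|_]; rewrite ?mulr0 //.
by rewrite -E' hb in ha.
Qed.

Lemma rho_ordz i k p : ordz k p -> ordz k (rho i p).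
Proof. by move=> h a ak; rewrite mcoeff_rho h // if_same. Qed.

Lemma rhoM i p q : rho i (p * q) = rho i p * rho i q.
Proof. exact: rmorphM. Qed.

Lemma rhoD i p q : rho i (p + q) = rho i p + rho i q.
Proof. exact: rmorphD. Qed.

(** The contraction to [R] of the prime $(u_0,\dots,u_{i-1})$ of $K[[u]]$, expressed by Taylor
    polynomials with the first [i] variables set to 0 by [rho]. Primality is inherited from
    polynomials through orders. *)
Definition qideal (i : nat) : set F := [set f | R f /\ forall k, exists2 p, U k (f - pu p) & ordz k (rho i p)].

Lemma qidealP i f k p : qideal i f -> U k (f - pu p) -> ordz k (rho i p).
Proof.
move=> [_ /(_ k) [p' h1 h2]] h3.
have : ordz k (p - p').
  apply: Uind; rewrite rmorphB /=.
  have -> : pu p - pu p' = (f - pu p') - (f - pu p) by ring.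
  exact: amod_sub sR (Uam k) h1 h3.
move/(rho_ordz i) => h4; have -> : p = p' + (p - p') by rewrite addrC subrK.
by rewrite rhoD; exact: ordzD.
Qed.

Lemma UM_approx k f g p q : R f -> R g -> U k (f - pu p) -> U k (g - pu q) -> U k (f * g - pu (p * q)).
Proof.
move=> Rf Rg h1 h2; rewrite rmorphM /=.
have -> : f * g - pu p * pu q = g * (f - pu p) + pu p * (g - pu q) by ring.
by have [_ hD hM] := Uam k; apply: hD; apply: hM.
Qed.

Lemma qideal_prime i : is_prime R (qideal i).
Proof.
have [R1 RD _ RM] := sR; split.
- split.
  + by move=> f [].
  + split; first exact: sring0.
    by move=> k; exists 0; [rewrite mmap0 subr0; have [] := Uam k|move=> a _; rewrite mcoeff_rho mcoeff0 if_same].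
  + move=> f g [Rf hf] [Rg hg]; split; first exact: RD.
    move=> k; have [p h1 h2] := hf k; have [q h3 h4] := hg k; exists (p + q); last by rewrite rhoD; exact: ordzD.
    by rewrite rmorphD /= opprD addrACA; have [_ hD _] := Uam k; exact: hD.
  + move=> a f Ra [Rf hf]; split; first exact: RM.
    move=> k; have [p h1 h2] := hf k; have [q h3] := Uexp k Ra; exists (q * p); first exact: UM_approx.
    by rewrite rhoM -[k]add0n; apply: ordzM => // b.
- move=> h; have := qidealP h (k := 1) (p := 1); rewrite rmorph1 subrr => /(_ _)/= h1.
  have {h1} : ordz 1 (rho i 1) by apply: h1; have [] := Uam 1.
  move/(_ mnm0); rewrite mdeg0 => /(_ isT); rewrite mcoeff_rho.
  case: ifP => [_|/negbT/negP []]; last by apply/forallP => j; rewrite mnm0E implybT.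
  by rewrite mcoeff1 eqxx => /eqP; rewrite oner_eq0.
- move=> f g Rf Rg hfg; have [|ng] := pselect (qideal i g); [by right|left; split=> // k].
  have [k0 [p0 [h0 n0]]] : exists k0 p0, U k0 (g - pu p0) /\ ~ ordz k0 (rho i p0).
    apply: contrapT => h; apply: ng; split=> // j; have [p hp] := Uexp j Rg; exists p => //.
    by apply: contrapT => n; apply: h; exists j, p.
  have [a ak na] : exists2 a, (mdeg a < k0)%N & mcoeff a (rho i p0) != 0.
    apply: contrapT => h; apply: n0 => a ak; apply/eqP; apply: contrapT => /negP n.
    by apply: h; exists a.
  (* Enough precision to retain [k] terms after dividing by a factor with a nonzero coefficient in
     degree [mdeg a], and to see that coefficient, of degree less than [k0]. *)
  pose k1 := (k + mdeg a + k0)%N.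
  have [p hp] := Uexp k1 Rf; have [q hq] := Uexp k1 Rg.
  have h1 := qidealP hfg (UM_approx Rf Rg hp hq); rewrite rhoM in h1.
  have na' : mcoeff a (rho i q) != 0.
    suff -> : mcoeff a (rho i q) = mcoeff a (rho i p0) by [].
    have /(rho_ordz i) : ordz k0 (q - p0).
      apply: Uind; rewrite rmorphB /=.
      have -> : pu q - pu p0 = (g - pu p0) - (g - pu q) by ring.
      apply: amod_sub sR (Uam k0) h0 _; apply: gpow_leq hq => //; exact: leq_addl.
    by move/(_ a ak) => E0; rewrite -[in LHS](subrK p0 q) rhoD mcoeffD E0 add0r.
  have h2 := ordz_div h1 (erefl (mdeg a)) na'.
  exists p; first by apply: gpow_leq hp => //; rewrite /k1 -addnA leq_addr.
  by apply: ordz_leq h2; rewrite /k1; lia.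
Qed.

Lemma qideal_sub i : qideal i `<=` qideal i.+1.
Proof.
move=> f [Rf h]; split=> // k; have [p h1 h2] := h k; exists p => // a ak.
rewrite mcoeff_rho; case: ifP => // /forallP ha; have := h2 a ak; rewrite mcoeff_rho.
case: ifP => // /negbT; rewrite negb_forall => /existsP [j]; rewrite negb_imply => /andP[ji].
by have := ha j; rewrite ltnS ltnW //= => /eqP ->.
Qed.

Lemma qideal_u (i : 'I_m) : qideal i.+1 (u i) /\ forall j, (j <= i)%N -> ~ qideal j (u i).
Proof.
have hX k : U k (u i - pu (mpolyX K (mnm1 i))) by rewrite mmapX mmap1U subrr; have [] := Uam k.
split.
  split=> // k; exists (mpolyX K (mnm1 i)) => // a _; rewrite mcoeff_rho mcoeffX.
  case: ifP => // /forallP /(_ i); rewrite ltnS leqnn /= => /eqP ai.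
  by case: eqP => // E; rewrite -E mnm1E eqxx in ai.
move=> j ji h; have := qidealP h (hX 2) (a := mnm1 i); rewrite mdeg1 => /(_ isT).
rewrite mcoeff_rho mcoeffX eqxx; case: ifP => [_ /eqP|/negbT/negP []]; first by rewrite oner_eq0.
apply/forallP => k; apply/implyP => kj; have ik : i != k by apply/eqP => E; move: kj; rewrite -E ltnNge ji.
by rewrite mnm1E (negbTE ik).
Qed.

Lemma qideal_notU1 i t : R t -> ~ U 1 t -> ~ qideal i t.
Proof.
move=> Rt nt h; apply: nt; have [p hp] := Uexp 1 Rt; have h1 := qidealP h hp.
rewrite -(subrK (pu p) t); have [_ hD _] := Uam 1; apply: hD => //.
apply: mmap_gpow => // a; rewrite ltnS leqn0 mdeg_eq0 => /eqP ->.
have := h1 mnm0; rewrite mdeg0 mcoeff_rho => /(_ isT).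
by case: ifP => // /negbT/negP []; apply/forallP => j; rewrite mnm0E implybT.
Qed.

(** Taylor polynomials show that [f] lies in $u_0R$ modulo every power of the maximal ideal; Krull's
    theorem then gives membership in $u_0R$. *)
Lemma qideal1 (i0 : 'I_m) f : val i0 = 0%N -> qideal 1 f -> exists2 g, R g & f = u i0 * g.
Proof.
move=> i00 [Rf h]; have [R1 RD _ RM] := sR; pose I : set F := [set f | exists2 g, R g & f = u i0 * g].
have iI : is_ideal R I.
  split.
  - by move=> _ [g Rg ->]; exact: RM.
  - by exists 0; rewrite ?mulr0 //; exact: sring0.
  - by move=> _ _ [g Rg ->] [g' Rg' ->]; exists (g + g'); [exact: RD|rewrite mulrDr].
  - by move=> a _ Ra [g Rg ->]; exists (a * g); [exact: RM|rewrite mulrCA].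
apply: (krull_intersection sR nR uR U_jac iI) => k; have [p h1 h2] := h k.
exists (pu (p - rho 1 p)), (pu (rho 1 p) + (f - pu p)); split.
- have -> : pu (p - rho 1 p) = \sum_(a <- msupp (p - rho 1 p)) io (mcoeff a (p - rho 1 p)) * mmap1 u a by [].
  rewrite big_seq; refine (amod_sum (ideal_amod iI) _) => a.
  rewrite mcoeff_msupp mcoeffB mcoeff_rho; case: ifP => [_|/negbT]; first by rewrite subrr eqxx.
  rewrite negb_forall => /existsP [j]; rewrite negb_imply ltnS leqn0 => /andP[/eqP j0 aj] _.
  have Ej : j = i0 by [apply: val_inj; rewrite i00]; rewrite Ej in aj.
  exists (io (mcoeff a p - 0) * (u i0 ^+ (a i0).-1 * \prod_(k' | k' != i0) u k' ^+ a k')).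
    apply: (RM) => //; apply: (RM); first exact: sringX.
    by refine (sring_prod sR _) => k' _; exact: sringX.
  rewrite /mmap1 (bigD1 i0) //= -{1}(prednK (_ : 0 < a i0)%N) ?lt0n // exprS; ring.
- have [_ hD _] := Uam k; apply: hD => //; exact: mmap_gpow.
- by rewrite rmorphB /=; ring.
Qed.

(** Algebraic form of the extension over a point in dimension at least 2: $u_0$ generates a prime
    that does not contain $u_1$, so factors $u_0$ can be cancelled one at a time. *)
Lemma hartogs (i0 i1 : 'I_m) N M al be : val i0 = 0%N -> val i1 = 1%N -> R al -> R be ->
  al * u i1 ^+ M = be * u i0 ^+ N -> exists2 g, R g & al = u i0 ^+ N * g.
Proof.
move=> i00 i11; elim: N al be => [|N IH] al be Ra Rb E; first by exists al; rewrite ?expr0 ?mul1r.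
have [_ _ qP] := qideal_prime 1; have [[qR _ _ qM] _ _] := qideal_prime 1.
have [q1 _] := qideal_u i0; rewrite i00 in q1.
have : qideal 1 (al * u i1 ^+ M) by rewrite E exprS mulrCA mulrC; apply: qM => //; have [_ _ _ RM] := sR; apply: RM => //; exact: sringX.
move/qP => [||h|h] //; first exact: sringX.
  have [g Rg Eg] := qideal1 i00 h; have [|g' Rg' Eg'] := IH g be Rg Rb.
    apply: (mulfI (u_neq0 i0)); rewrite mulrA -Eg E exprS; ring.
  by exists g' => //; rewrite Eg Eg' exprS mulrA.
exfalso; elim: M {E IH} h => [|M' IHM]; first by have [_ n1 _] := qideal_prime 1.
rewrite exprS => /qP [||h|] //; first exact: sringX.
by have [_ /(_ 1%N)] := qideal_u i1; rewrite i11; apply.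
Qed.

(** * The local ring at the generic point of the exceptional divisor *)

Section Exceptional.
Variable i0 : 'I_m.

(** The chart $R[\mathfrak m/u_{i_0}]$ of the blow-up of [R]. Its exceptional prime [excr] consists
    of the fractions whose numerator vanishes to a higher order than the denominator. *)
Definition excC : set F := [set z | exists k, U k (z * u i0 ^+ k)].
Definition excr : set F := [set z | exists k, U k (z * u i0 ^+ k) /\ U k.+1 (z * u i0 ^+ k)].

Let uX j : U j (u i0 ^+ j).
Proof. by have := gpowX sR j (u_U1 i0); rewrite muln1. Qed.

Lemma exc_shift k j d z : U (k + d) (z * u i0 ^+ k) -> U (k + j + d) (z * u i0 ^+ (k + j)).
Proof. by move=> h; rewrite exprD mulrA addnAC; apply: gpowM. Qed.

Lemma exc_descend k j z : R (z * u i0 ^+ k) -> U (k + j).+1 (z * u i0 ^+ (k + j)) -> U k.+1 (z * u i0 ^+ k).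
Proof.
move=> Rz h; apply: contrapT => n; have := U_notM Rz (sringX j sR (uR i0)) n (@uX_notU i0 j); apply.
by rewrite -mulrA -exprD.
Qed.

Lemma excC_sring : sring excC.
Proof.
have [R1 RD RN RM] := sR; split.
- by exists 0%N; rewrite mulr1.
- move=> x y [k hx] [k' hy]; exists (k + k')%N; rewrite mulrDl; have [_ hD _] := Uam (k + k').
  apply: hD; first by have := @exc_shift k k' 0 x; rewrite !addn0; apply.
  by rewrite addnC; have := @exc_shift k' k 0 y; rewrite !addn0; apply.
- by move=> x [k hx]; exists k; rewrite mulNr; exact: amod_opp sR (Uam k) hx.
- by move=> x y [k hx] [k' hy]; exists (k + k')%N; rewrite exprD mulrACA; exact: gpowM.
Qed.

Lemma R_excC x : R x -> excC x.
Proof. by move=> Rx; exists 0%N; rewrite mulr1. Qed.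

Lemma excr_R x : R x -> (excr x <-> U 1 x).
Proof.
move=> Rx; split=> [[k [_ h]]|h]; last by exists 0%N; rewrite mulr1.
by have := @exc_descend 0 k x; rewrite mulr1 add0n; apply.
Qed.

Lemma excr_prime : is_prime excC excr.
Proof.
have [R1 RD RN RM] := sR; have sC := excC_sring; split.
- split.
  + by move=> x [k [h _]]; exists k.
  + by exists 0%N; rewrite mul0r; split; [exact: sring0|have [] := Uam 1].
  + move=> x y [k [h1 h2]] [k' [h3 h4]]; exists (k + k')%N; rewrite mulrDl.
    have [_ hD _] := Uam (k + k'); have [_ hD' _] := Uam (k + k').+1; split.
      apply: hD; first by have := @exc_shift k k' 0 x; rewrite !addn0; apply.
      by rewrite addnC; have := @exc_shift k' k 0 y; rewrite !addn0; apply.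
    apply: hD'; first by have := @exc_shift k k' 1 x; rewrite !addn1; apply.
    by rewrite addnC; have := @exc_shift k' k 1 y; rewrite !addn1; apply.
  + move=> a x [k h] [k' [h3 h4]]; exists (k + k')%N; rewrite exprD mulrACA; split; first exact: gpowM.
    by rewrite -addnS; exact: gpowM.
- by move=> /(excr_R R1); exact: U1_1.
- move=> x y [k hx] [k' hy] [k'' [_ h]]; apply: contrapT => /not_orP [nx ny].
  have Rx := gpow_sub_A sR uR hx; have Ry := gpow_sub_A sR uR hy.
  have nx' : ~ U k.+1 (x * u i0 ^+ k) by move=> h'; apply: nx; exists k.
  have ny' : ~ U k'.+1 (y * u i0 ^+ k') by move=> h'; apply: ny; exists k'.
  apply: (U_notM Rx Ry nx' ny'); rewrite mulrACA -exprD.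
  apply: (@exc_descend (k + k') k''); first by rewrite exprD mulrACA; exact: RM.
  by have := @exc_shift k'' (k + k') 1 (x * y); rewrite !addn1 addnC; apply.
Qed.

(** Membership in the localization is tested by orders: an element outside [excr] has numerator and
    denominator of the same order, so [z] has at least the order of $u_{i_0}^k$. *)
Lemma exc_U k z : R z -> localization excC excr (z / u i0 ^+ k) -> U k z.
Proof.
move=> Rz [a [b [[pa ha] [pb hb] nb E]]].
have ub j : u i0 ^+ j != 0 by rewrite expf_neq0 // u_neq0.
have b0 : b != 0.
  by apply/eqP => b0; apply: nb; rewrite b0; have [[_ ? _ _] _ _] := excr_prime.
have Rb := gpow_sub_A sR uR hb.
have nb' : ~ U pb.+1 (b * u i0 ^+ pb) by move=> h; apply: nb; exists pb.
have E2 : z * (b * u i0 ^+ pb) * u i0 ^+ pa = (a * u i0 ^+ pa) * (u i0 ^+ pb * u i0 ^+ k).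
  have -> : z = (a / b) * u i0 ^+ k by rewrite -E divfK.
  by field.
case: k E E2 => [|k] E E2; first exact: Rz.
apply: contrapT => nz; have [_ _ _ RM] := sR.
have h1 := U_notM (RM _ _ Rz Rb) (sringX pa sR (uR i0)) (U_notM Rz Rb nz nb') (@uX_notU i0 pa).
apply: h1; rewrite E2; have h2 := gpowM sR ha (gpowM sR (uX pb) (uX k.+1)).
by move: h2; have -> : (pa + (pb + k.+1) = (k + pb + pa).+1)%N by lia.
Qed.

(** For a single parameter the maximal ideal is principal, and blowing it up changes nothing. *)
Lemma exc_dim1 z : (m = 1)%N -> localization excC excr z -> R z.
Proof.
move=> m1; have C1 k x : U k x -> exists2 g, R g & x = u i0 ^+ k * g.
  elim: k x => [|k IH] x; first by exists x; rewrite ?mul1r.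
  move=> [y [hy ->]]; have E i : i = i0 by case: i i0 => [i hi] [j hj]; apply: val_inj => /=; move: hi hj; rewrite m1; lia.
  have [g Rg Eg] := IH _ (hy i0); exists g => //.
  by rewrite (bigD1 i0) //= big1 ?addr0 ?Eg ?exprS ?mulrA // => i; rewrite (E i) eqxx.
have CR x : excC x -> R x.
  move=> [k /C1 [g Rg E]]; suff -> : x = g by [].
  by apply: (mulfI (expf_neq0 k (u_neq0 i0))); rewrite mulrC.
move=> [a [b [/CR Ra /CR Rb nb ->]]]; have [|_ Vb] := Runit Rb; first by move=> h; apply: nb; apply/excr_R.
by have [_ _ _ RM] := sR; exact: RM.
Qed.

Lemma exc_ideal : lin_span (localization excC excr) (U 1) = [set u i0 * t | t in localization excC excr].
Proof.
have [[_ r0 _ _] r1 rP] := excr_prime; have [C1 CD _ CM] := excC_sring.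
have CT x : excC x -> localization excC excr x by move=> Cx; exists x, 1; rewrite divr1.
have nz y : ~ excr y -> y != 0 by move=> h; apply/eqP => E; apply: h; rewrite E.
have am : amod (localization excC excr) [set u i0 * t | t in localization excC excr].
  have TM x y : localization excC excr x -> localization excC excr y -> localization excC excr (x * y).
    move=> [a [b [h1 h2 h3 ->]]] [a' [b' [h4 h5 h6 ->]]]; exists (a * a'), (b * b').
    by rewrite mulf_div; split=> //; [exact: CM|exact: CM|move/rP => []].
  split.
  - by exists 0; rewrite ?mulr0 //; apply: CT; exact: sring0 excC_sring.
  - move=> _ _ [_ [a [b [h1 h2 h3 ->]]] <-] [_ [a' [b' [h4 h5 h6 ->]]] <-].
    exists (a / b + a' / b'); last by rewrite mulrDr.
    exists (a * b' + a' * b), (b * b'); rewrite addf_div ?nz //; split=> //; [|exact: CM|by move/rP => []].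
    by apply: CD; exact: CM.
  - by move=> c _ Tc [x Tx <-]; exists (c * x); [exact: TM|rewrite mulrCA].
apply/seteqP; split.
  apply: lin_span_sub => // x Ux; exists (x / u i0); last by rewrite mulrC divfK ?u_neq0.
  by apply: CT; exists 1%N; rewrite divfK ?u_neq0.
move=> _ [t Tt <-]; exists 1%N, (fun=> t), (fun=> u i0); rewrite big_ord1 mulrC.
by split=> // _; exact: u_U1.
Qed.

End Exceptional.
End Regular.

End RegularLocal.

Module BlowupSections.
Import Sumset Embedding Normalization Coordinates NoetherianLocal Vanishing RationalPoint Valuation VolumeLimit Chains IntegerLocal Variety PointRing RegularLocal.

(** * Sections on the blow-up *)

Local Notation homog q := (ishomog1 q mdeg).
Local Arguments gpow {F} A {s} g k : simpl never.
Local Arguments hio {K n} P : simpl never.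
Local Opaque hfield.

Lemma ind_null (K F : fieldType) (io : {rmorphism K -> F}) (V : set F) r :
  (forall z, V z -> z = 0) -> ind io V r -> r = 0%N.
Proof.
move=> h; case: r => // r [v [hv hi]]; exfalso.
have E : \sum_i io ((fun=> 1) i) * v i = 0 by rewrite big1 // => i _; rewrite (h _ (hv i)) mulr0.
by have /eqP := hi (fun=> 1) E ord0; rewrite oner_eq0.
Qed.

Section Abstract.
Variable F : fieldType.

Lemma frac0 (b a : F) : a = 0 -> a / b = 0.
Proof. by move=> ->; rewrite mul0r. Qed.

Lemma frac_eq0 (a b : F) : b != 0 -> a / b = 0 -> a = 0.
Proof. by move=> b0 h; rewrite -(divfK b0 a) h mul0r. Qed.

Lemma localization_sring (C r : set F) : sring C -> is_prime C r ->
  sring (localization C r) /\ C `<=` localization C r.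
Proof.
move=> [C1 CD CN CM] [[_ r0 _ _] r1 rP].
have nz y : ~ r y -> y != 0 by move=> h; apply/eqP => E; apply: h; rewrite E.
split; last by move=> x Cx; exists x, 1; rewrite divr1.
split.
- by exists 1, 1; rewrite divr1.
- move=> _ _ [a [b [h1 h2 h3 ->]]] [a' [b' [h4 h5 h6 ->]]].
  exists (a * b' + a' * b), (b * b'); rewrite addf_div ?nz //; split=> //; [|exact: CM|by move/rP => []].
  by apply: CD; exact: CM.
- by move=> _ [a [b [h1 h2 h3 ->]]]; exists (- a), b; rewrite mulNr; split=> //; exact: CN.
- move=> _ _ [a [b [h1 h2 h3 ->]]] [a' [b' [h4 h5 h6 ->]]]; exists (a * a'), (b * b').
  by rewrite mulf_div; split=> //; [exact: CM|exact: CM|move/rP => []].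
Qed.

Lemma chart_sring (O I : set F) i : sring O -> amod O I -> I i ->
  sring [set z | exists k, module_pow O I k (z * i ^+ k)] /\
  O `<=` [set z | exists k, module_pow O I k (z * i ^+ k)].
Proof.
move=> sO aI Ii; have [q1 OD ON OM] := sO.
have amodP k : amod O (module_pow O I k).
  by case: k => [|k]; [exact: sring_amod|exact: lin_span_amod].
have Ik k : module_pow O I k (i ^+ k).
  elim: k => [|k IH] //; rewrite exprS; apply: lin_span_gen => //.
  by exists i, (i ^+ k).
split; last by move=> x Ox; exists 0%N; rewrite mulr1.
split.
- by exists 0%N; rewrite mulr1.
- move=> x y [k hx] [k' hy]; exists (k + k')%N; have [_ hD _] := amodP (k + k')%N; rewrite mulrDl; apply: hD.
    by rewrite exprD mulrA; exact: module_powM.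
  by rewrite addnC exprD mulrA; exact: module_powM.
- by move=> x [k hx]; exists k; rewrite mulNr; exact: amod_opp sO (amodP k) hx.
- by move=> x y [k hx] [k' hy]; exists (k + k')%N; rewrite exprD mulrACA; exact: module_powM.
Qed.

Lemma section_eqn (z x L v v' l' f : F) Q k : L != 0 -> l' != 0 ->
  z * x ^+ Q / L ^+ Q * ((v * (v' * (L / l'))) ^+ Q / f ^+ k) =
  (v * v') ^+ Q * (z * x ^+ Q / l' ^+ Q / f ^+ k).
Proof.
move=> h1 h2; have h3 := expf_neq0 Q h1; have h4 := expf_neq0 Q h2.
rewrite !exprMn exprVn; move: ((f ^+ k)^-1) => f'.
by move: (x ^+ Q) (L ^+ Q) (l' ^+ Q) (v ^+ Q) (v' ^+ Q) h3 h4 => x1 L1 l1 v1 v1' h3 h4; field; rewrite h3 h4.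
Qed.

Lemma div_pow_swap (z x l' f : F) Q k : z * x ^+ Q / l' ^+ Q / f ^+ k = (z / f ^+ k) * (x / l') ^+ Q.
Proof. by rewrite expr_div_n mulrAC -!mulrA [X in _ * X]mulrCA. Qed.

Lemma prod_pair2 (f : 'I_2 -> F) Q k :
  \prod_i f i ^ pair2 (Posz Q) (- Posz k) i = f ord0 ^+ Q / f ord_max ^+ k.
Proof.
rewrite !big_ord_recl big_ord0 mulr1 /pair2 /=.
have -> : lift ord0 ord0 = ord_max :> 'I_2 by apply: val_inj.
by rewrite -exprnP -exprnN.
Qed.

Lemma sum_comb k (a w y : 'I_k -> F) :
  \sum_j a j * w j - \sum_j w j * y j = \sum_j w j * - (y j - a j).
Proof. by rewrite -sumrB; apply: eq_bigr => j _; ring. Qed.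

Lemma div_of_mul (a t z : F) : a != 0 -> z = a * t -> z / a = t.
Proof. by move=> a0 ->; rewrite mulrC mulKf. Qed.

Lemma mul_div_pow (z b t : F) N : z * (b / t) ^+ N = (z * b ^+ N) * t^-1 ^+ N.
Proof. by rewrite exprMn mulrA. Qed.

Lemma unit_of1 (A : set F) : sring A -> unit_of A 1.
Proof. by move=> [A1 _ _ _]; split; rewrite ?oner_eq0 ?invr1. Qed.

Lemma inv_of_mul1 (a t : F) : a != 0 -> a * t = 1 -> a^-1 = t.
Proof. by move=> a0 E; apply: (mulfI a0); rewrite mulfV. Qed.

Lemma mulVK (a b : F) : b != 0 -> a = b * (a / b).
Proof. by move=> b0; rewrite mulrC divfK. Qed.

Lemma pow_div_mul (s L x : F) Q : x ^+ Q != 0 -> s * (L / x) ^+ Q * x ^+ Q = s * L ^+ Q.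
Proof. by move=> h; rewrite expr_div_n -mulrA divfK. Qed.

Lemma satur_eqn (z y x : F) a b : z * y * x ^+ (a + b) = z * x ^+ b * (y * x ^+ a).
Proof. by rewrite exprD; ring. Qed.

Lemma frac_mul_pow (f G x : F) e Q : f / x ^+ Q * (G / x ^+ e) = f * G / x ^+ (e + Q).
Proof. by rewrite exprD invfM; ring. Qed.

Lemma pow_cancel (f x : F) D Q : x != 0 -> f / x ^+ Q * x ^+ D * x ^+ Q = x ^+ D * f.
Proof. by move=> x0; rewrite mulrAC divfK ?expf_neq0 // mulrC. Qed.

Lemma shift_eqn (z G x t : F) e Q : x != 0 -> z * x ^+ Q = t -> z * (G / x ^+ e) = t * G / x ^+ (e + Q).
Proof.
move=> x0 <-; have h1 := expf_neq0 e x0; have h2 := expf_neq0 Q x0; rewrite exprD.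
by move: (x ^+ e) (x ^+ Q) h1 h2 => y w h1 h2; field; rewrite h1 h2.
Qed.

Lemma triv_eqn1 (x t h a : F) D : t != 0 -> h ^+ D != 0 -> t * a = h ^+ D -> x ^+ D / t = (x / h) ^+ D * a.
Proof.
move=> t0 h0 E; rewrite expr_div_n -[X in _ / X * _]E; rewrite -E mulf_eq0 negb_or in h0; case/andP: h0 => _ a0.
by move: (x ^+ D) => y; field; rewrite t0 a0.
Qed.

Lemma triv_eqn2 (x t h f g : F) D : g != 0 -> h ^+ D != 0 -> t = f / g ->
  t / x ^+ D = f / (g * h ^+ D) * (h / x) ^+ D.
Proof.
move=> g0 h0 ->; rewrite expr_div_n; move: (h ^+ D) h0 ((x ^+ D)^-1) => y y0 z.
by field; rewrite g0 y0.
Qed.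

Lemma triv_eqn4 (a y x t : F) : a * (y * x) / t = a * (x / t) * y.
Proof. by ring. Qed.

Lemma triv_eqn3 (s t y : F) : t != 0 -> y != 0 -> s / t * (t / y) * y = s.
Proof. by move=> t0 y0; field; rewrite t0 y0. Qed.

End Abstract.

Section Blowup.
Variables (K : fieldExtType rat) (n : nat) (P : prime_idealr (mpoly n.+1 K)).
Hypothesis hP : homogeneous_relevant P.
Local Notation F := (hfield P).
Local Notation io := (hio P).
Local Notation X := (@hX K n P).
Local Notation cl := (mmap io X).
Local Notation S := (S io X).
Variable eta : 'I_n.+1 -> K.
Hypothesis heta : rational_point P eta.
Variables (m : nat) (l : 'I_m.+1 -> mpoly n.+1 K).
Hypotheses (hl : forall i, l i \is homog 1) (l0_eta : meval eta (l ord0) = 1)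
  (lS_eta : forall i, meval eta (l (lift ord0 i)) = 0)
  (lfin : finz io X (fun i => cl (l i))) (lfree : zfree io (fun i => cl (l i))).
Local Notation x0 := (cl (l ord0)).
Local Notation B := (Bring io X l).
Local Notation BD := (BD io X l).
Local Notation R := (@Rv K n P eta).
Local Notation M := (@Mv K n P eta).
Variable u : 'I_m -> F.
Hypotheses (uR : forall i, R (u i)) (Eu : gpow R u 1 = M) (nR : noetherian R).
Local Notation U := (gpow R u).
Local Notation pu := (mmap io u).

Lemma sRv : sring R.
Proof. exact: Rv_sring. Qed.
Lemma aMv : amod R M.
Proof. exact: Mv_amod. Qed.
Lemma Rv_io c : R (io c).
Proof. by exists c; exact: val_io. Qed.
Lemma x0n : x0 != 0.
Proof. by apply: (cl_neq0 heta); rewrite l0_eta oner_eq0. Qed.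

Let Eloc : R = locring B (evB io X eta l).
Proof. exact: Rv_locring. Qed.
Let Eu' : gpow (locring B (evB io X eta l)) u 1 = gpow (locring B (evB io X eta l)) (wB io X eta l) 1.
Proof. by rewrite -Eloc Eu; exact: Mv_w. Qed.

Lemma Uexp k z : R z -> exists p, U k (z - pu p).
Proof.
rewrite Eloc; apply: (expand (B_sring io X hl) (B_io io X hl) _ _ _ _ Eu').
- by move=> x y hx hy; exact: (evB_D (eta_ker heta) hl l0_eta hx hy).
- by move=> x y hx hy; exact: (evB_M (eta_ker heta) hl l0_eta hx hy).
- by move=> c; exact: (evB_io (eta_ker heta) l0_eta c).
- by move=> y hy; exact: (wB_gen (eta_ker heta) hl l0_eta hy).
Qed.

Lemma Uind k p : U k (pu p) -> ordz k p.
Proof.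
rewrite Eloc; apply: (point_order_independent (eta_ker heta) hl l0_eta lS_eta lfin lfree) => //.
  by rewrite -Eloc.
by move=> i; rewrite -Eloc.
Qed.

Lemma Runit z : R z -> ~ U 1 z -> z != 0 /\ R z^-1.
Proof. by rewrite Eu; exact: Rv_unit. Qed.

Lemma BD_R D : BD D `<=` R.
Proof.
move=> y [f hf E]; exists (meval eta f), D, f, (l ord0 ^+ D); split=> //.
- by elim: (D) => [|j IH]; rewrite ?expr0 ?dhomog1 // exprS -[j.+1]add1n; exact: dhomogM.
- by rewrite rmorphXn /= l0_eta expr1n oner_eq0.
- by rewrite !hclassE rmorphXn /= -E mulfK // expf_neq0 // x0n.
- by rewrite rmorphXn /= l0_eta expr1n divr1.
Qed.

Lemma BDu i : exists2 y, BD 1 y & isnu io u R y (mnm1 i).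
Proof.
have : M (u i) by rewrite -Eu; apply: u_U1 => //; exact: sRv.
rewrite (Mv_w heta hl l0_eta) => /gpow1P [y [hy Ey]].
have /choice [c hc] j : exists c, M (y j - io c).
  have [c hv] := hy j; exists c; have := val_D heta hv (val_N (val_io P eta c)).
  by rewrite subrr.
have [k0 kD kZ] := BD_ksub io X l 1.
have wM j : M (wB io X eta l j).
  rewrite (Mv_w heta hl l0_eta); apply/gpow1P; exists (fun k => (k == j)%:R); split.
    by move=> k; case: eqP => _; [case: sRv|exact: sring0 sRv].
  by rewrite (bigD1 j) //= eqxx mulr1 big1 ?addr0 // => k kj; rewrite (negbTE kj) mulr0.
exists (\sum_j io (c j) * wB io X eta l j).
  apply: (ksub_sum _ (BD_ksub io X l 1)) => j _; apply: kZ.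
  exact: (wB_B1 (eta_ker heta) hl l0_eta j).
have RM x : M x -> R x by move=> h; exists 0.
apply: (@isnu_u _ _ io m u R); do ?[exact: sRv|exact: Rv_io|exact: uR|exact: Uexp|exact: Uind].
  refine (sring_sum sRv _) => j _; have [_ _ _ h] := sRv; apply: h; first exact: Rv_io.
  exact: RM.
have -> : \sum_j io (c j) * wB io X eta l j - u i = \sum_j wB io X eta l j * (- (y j - io (c j))).
  by rewrite Ey sum_comb.
refine (amod_sum (gpow_amod u sRv 2) _) => j _; rewrite mulrN; apply: (amod_opp sRv (gpow_amod u sRv 2)).
by apply: (gpowM sRv (k := 1) (l := 1)); rewrite Eu.
Qed.

(** ** Points *)

Let S0 := S_0 io X.
Let SG := @graded_total_gen F S S0.

Lemma point_relevant x : proj_points S x -> exists i, ~ x (X i).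
Proof.
move=> [[[_ x00 xD xM] _ _] _ [D [f [D0 Sf nf]]]]; apply: contrapT => /forallNP h; apply: nf.
case: D D0 Sf => // D _ /S_succ [y [hy ->]].
have am : amod (graded_total S) x by split.
refine (amod_sum am _) => i _; rewrite mulrC; apply: (xM); first exact: SG (hy i).
by apply: contrapT; exact: h.
Qed.

Definition at_eta (x : set F) : Prop := forall e f, f \is homog e -> (x (cl f) <-> meval eta f = 0).

(** If the ideal of [eta] is proper at [x], all forms vanishing at [eta] are in [x]. A form [f] in
    [x] with $f(\eta)\ne0$ would then put every $X_i^e$ in [x], as $f(\eta)X_i^e-\eta_i^ef$ vanishes
    at [eta]; but [x] is relevant. *)
Lemma point_cases x : proj_points S x -> eta_ideal eta x 1 \/ at_eta x.
Proof.
move=> hx; have [|ha] := pselect (eta_ideal eta x 1); [by left|right].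
have sub e f : f \is homog e -> meval eta f = 0 -> x (cl f).
  move=> hf f0; apply: contrapT => nf; apply: ha; exists e, f, f; split=> //; first by rewrite hclassE.
  by rewrite hclassE divff // (proj_neq0 hx).
move=> e f hf; split; last by move=> h; exact: (sub e).
move=> xf; apply/eqP; apply: contrapT => /negP f0; have [i ni] := point_relevant hx; apply: ni.
have [[[_ x00 xD xM] x1 xP] _ _] := hx.
have hXe : mpolyX K (mnm1 i) ^+ e \is homog e.
  elim: (e) => [|j IH]; rewrite ?expr0 ?dhomog1 // exprS -[j.+1]add1n; apply: dhomogM => //.
  exact: meval_hom_Xi.
have : x (cl (meval eta f *: mpolyX K (mnm1 i) ^+ e - eta i ^+ e *: f)).
  apply: (sub e); first by apply: dhomogD; [exact: dhomogZ|rewrite -scaleNr; exact: dhomogZ].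
  by rewrite mevalB !mevalZ rmorphXn /= mevalXU mulrC subrr.
have S0io c : graded_total S (io c) by apply: (SG (D := 0)); exact: S_io.
move=> h1; have h2 : x (cl (eta i ^+ e *: f)) by rewrite mmapZ; apply: (xM).
have h3 : x (cl (meval eta f *: mpolyX K (mnm1 i) ^+ e)).
  rewrite -[X in cl X](subrK (eta i ^+ e *: f)) mmapD; exact: xD.
have h4 : x (X i ^+ e).
  have -> : X i ^+ e = io (meval eta f)^-1 * cl (meval eta f *: mpolyX K (mnm1 i) ^+ e).
    by rewrite mmapZ mulrA -rmorphM mulVf // rmorph1 mul1r rmorphXn /= mmapX mmap1U.
  exact: xM.
elim: (e) h4 => [|j IH]; first by rewrite expr0.
rewrite exprS => /xP [||//|//]; first exact: (SG (S_X io X i)).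
by apply: (SG (D := j)); apply: S_exp1; exact: S_X.
Qed.

Lemma local_at_eta x : proj_points S x -> at_eta x ->
  proj_local_ring S x = R /\ eta_ideal eta x = M.
Proof.
move=> hx hb; split; apply/seteqP; split=> z.
- move=> [e [_ [_ [[f hf ->] [g hg ->] ng ->]]]]; rewrite add0n in hf.
  exists (meval eta f / meval eta g), e, f, g; rewrite !hclassE; split=> //.
  by apply/eqP => g0; apply: ng; apply/(hb e).
- move=> [c [e [f [g [hf hg g0 -> _]]]]]; exists e, (cl f), (cl g); rewrite !hclassE add0n.
  by split=> //; [exists f|exists g|move/(hb e g hg)/eqP; rewrite (negbTE g0)].
- move=> [e [f [g [hf hg f0 ng ->]]]]; exists e, f, g; split=> //.
    by apply/eqP => g0; apply: ng; rewrite hclassE; apply/(hb e).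
  by rewrite f0 mul0r.
- move=> [e [f [g [hf hg g0 -> E]]]]; exists e, f, g; split=> //.
    by move/eqP: (esym E); rewrite mulf_eq0 invr_eq0 (negbTE g0) orbF => /eqP.
  by rewrite hclassE => /(hb e g hg)/eqP; rewrite (negbTE g0).
Qed.

Lemma OX_sring x : proj_points S x -> sring (proj_local_ring S x).
Proof.
move=> hx; apply: (@proj_local_sring F S) => //; first exact: S_1.
- by move=> *; exact: S_D.
- by move=> *; exact: S_N.
- by move=> *; exact: S_M.
Qed.

Lemma eta_ideal_amod x : proj_points S x -> amod (proj_local_ring S x) (eta_ideal eta x).
Proof.
move=> hx; have [[_ x1 _] _ _] := hx; have sx e g : g \is homog e -> S e (hclass P g) by move=> hg; exists g; rewrite ?hclassE.
split.
- exists 0%N, 0, 1; split; [exact: dhomog0|exact: dhomog1|exact: meval0|by rewrite rmorph1|by rewrite rmorph0 mul0r].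
- move=> _ _ [e [f [g [hf hg f0 ng ->]]]] [e' [f' [g' [hf' hg' f0' ng' ->]]]].
  exists (e + e')%N, (f * g' + g * f'), (g * g'); split.
  + by apply: dhomogD; exact: dhomogM.
  + exact: dhomogM.
  + by rewrite mevalD !mevalM f0 f0' mul0r mulr0 addr0.
  + by rewrite rmorphM; exact: (proj_notM S0 hx (sx _ _ hg) (sx _ _ hg') ng ng').
  + by rewrite addf_div ?(proj_neq0 hx) // rmorphD !rmorphM /= [hclass P f' * _]mulrC.
- move=> _ _ [e [_ [_ [[f hf ->] [g hg ->] ng ->]]]] [e' [f' [g' [hf' hg' f0' ng' ->]]]]; rewrite add0n in hf.
  rewrite -!hclassE in ng *; exists (e + e')%N, (f * f'), (g * g'); split; [exact: dhomogM|exact: dhomogM| | |].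
  + by rewrite mevalM f0' mulr0.
  + by rewrite rmorphM; exact: (proj_notM S0 hx (sx _ _ hg) (sx _ _ hg') ng ng').
  + by rewrite mulf_div !rmorphM.
Qed.

Lemma over_facts x T : blowup_over eta x T -> [/\ proj_points S x, sring T & proj_local_ring S x `<=` T].
Proof.
rewrite /blowup_over /blowup_chart X_ringE => -[hx [i [r [Ii i0 rp _ ->]]]].
have [sC OC] := chart_sring (OX_sring hx) (eta_ideal_amod hx) Ii.
by have [sT CT] := localization_sring sC rp; split=> // z /OC /CT.
Qed.

(** Away from [eta] the ideal is trivial; with 1 as the chosen element the chart is the local ring
    of [X] itself. *)
Lemma over_unit x : proj_points S x -> eta_ideal eta x 1 -> blowup_over eta x (proj_local_ring S x).
Proof.
move=> hx h1; have sO := OX_sring hx; have [q1 OD ON OM] := sO.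
have aI := eta_ideal_amod hx; have [[[_ x00 xD xM] x1 xP] _ _] := hx.
have IO : eta_ideal eta x `<=` proj_local_ring S x.
  move=> _ [e [f [g [hf hg _ ng ->]]]]; exists e, (hclass P f), (hclass P g); rewrite add0n.
  by split=> //; [exists f; rewrite ?hclassE|exists g; rewrite ?hclassE].
have Ech : blowup_chart eta x 1 = proj_local_ring S x.
  rewrite /blowup_chart X_ringE; apply/seteqP; split=> z; last by exists 0%N; rewrite mulr1.
  move=> [k]; rewrite expr1n mulr1; elim: k z => [//|k IH] z.
  apply: lin_span_sub; first exact: sring_amod.
  by move=> _ [a [b [/IO ha /IH hb ->]]]; exact: OM.
have nuP e f g : S e f -> S e g -> ~ x g -> (nonunits (proj_local_ring S x) (f / g) <-> x f).
  move=> hf hg ng; have g0 := proj_neq0 hx ng.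
  have Ofg : proj_local_ring S x (f / g) by exists e, f, g; rewrite add0n.
  split=> [[_ nu]|xf].
    apply: contrapT => nf; apply: nu; have f0 := proj_neq0 hx nf.
    split; [exact: Ofg|exact: (mulf_neq0 f0 (invr_neq0 g0))|].
    by rewrite invf_div; exists e, g, f; rewrite add0n.
  split=> // -[_ fg0 [e' [f' [g' [hf' hg' ng' E]]]]]; rewrite add0n in hf'.
  have f0 : f != 0 by apply: contraNneq fg0 => ->; rewrite mul0r.
  apply: (proj_notM S0 hx hg hg' ng ng').
  have <- : f' * f = g * g'.
    have := frac_cross f0 (proj_neq0 hx ng') (esym (etrans (esym E) (invf_div f g))).
    by move=> <-.
  by apply: xM => //; exact: SG hf'.
have nup : is_prime (proj_local_ring S x) (nonunits (proj_local_ring S x)).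
  split.
  - split.
    + by move=> z [].
    + by split; [exact: sring0|move=> [_ /eqP]].
    + move=> _ _ [[e [f [g [hf hg ng ->]]]] nz] [[e' [f' [g' [hf' hg' ng' ->]]]] nz']; rewrite !add0n in hf hf'.
      have xf : x f by apply/(nuP e f g) => //; split=> //; exists e, f, g; rewrite add0n.
      have xf' : x f' by apply/(nuP e' f' g') => //; split=> //; exists e', f', g'; rewrite add0n.
      rewrite addf_div ?(proj_neq0 hx) //; apply/(nuP (e + e')%N).
      * by apply: S_D; [exact: S_M|rewrite addnC; exact: S_M].
      * exact: S_M.
      * exact: (proj_notM S0 hx hg hg' ng ng').
      * by apply: xD; rewrite mulrC; apply: xM => //; [exact: SG hg'|exact: SG hg].
    + move=> _ _ [e [f [g [hf hg ng ->]]]] [[e' [f' [g' [hf' hg' ng' ->]]]] nz']; rewrite !add0n in hf hf'.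
      have xf' : x f' by apply/(nuP e' f' g') => //; split=> //; exists e', f', g'; rewrite add0n.
      rewrite mulf_div; apply/(nuP (e + e')%N); [exact: S_M|exact: S_M|exact: (proj_notM S0 hx hg hg' ng ng')|].
      by apply: xM => //; exact: SG hf.
  - by move=> [_ []]; split; rewrite ?oner_eq0 ?invr1.
  - move=> y z Oy Oz [_ nyz]; apply: contrapT => /not_orP [ny nz]; apply: nyz.
    have ux t : proj_local_ring S x t -> ~ nonunits (proj_local_ring S x) t -> unit_of (proj_local_ring S x) t.
      by move=> Ot nt; apply: contrapT => h; apply: nt.
    have [_ y0 Vy] := ux y Oy ny; have [_ z0 Vz] := ux z Oz nz.
    by split; [exact: OM|exact: (mulf_neq0 y0 z0)|rewrite invfM; exact: OM].
split; first by rewrite X_ringE.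
exists 1, (nonunits (proj_local_ring S x)); rewrite Ech X_ringE oner_eq0; split=> //.
  by apply/seteqP; split=> z [] // h1' h2; split=> //; case: h1'.
apply/seteqP; split=> z; first by move=> Oz; exists z, 1; rewrite divr1; split=> //; have [_ ? _] := nup.
move=> [a [b [Oa Ob nb ->]]]; apply: OM => //; apply: contrapT => h; apply: nb; split=> // -[_ _ Vb].
exact: h.
Qed.

Definition xeta : set F := hompt io X x0 (M `&` B).

Lemma xeta_prime : is_prime (chartB io X x0) (M `&` B).
Proof.
have [M0 MD MM] := aMv; have sB := B_sring io X hl; have [B1 BDD _ BM] := sB.
have BR b : B b -> R b by move=> [D]; exact: BD_R.
split.
- split=> [x []//||x y [h1 h2] [h3 h4]|a x ha [h1 h2]].
  + by split=> //; exact: sring0.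
  + by split; [exact: MD|exact: BDD].
  + by split; [apply: MM => //; exact: BR|exact: BM].
- by move=> [h _]; rewrite -Eu in h; exact: (U1_1 Uind h).
- move=> x y Bx By [h _]; have [|nx] := pselect (M x); [by left|right; split=> //].
  have [x00 Vx] := Rv_unit heta (BR _ Bx) nx.
  by rewrite -[y](mulKf x00); exact: MM.
Qed.

Lemma xeta_point : proj_points S xeta.
Proof. exact: (hompt_point (sdir hP) x0n (S_x0 io X hl) xeta_prime). Qed.

Lemma xeta_at : at_eta xeta.
Proof.
move=> e f hf; have Sf : S e (cl f) by exists f.
have hv : value_at eta (cl f / x0 ^+ e) (meval eta f).
  exists e, f, (l ord0 ^+ e); split=> //.
  - by elim: (e) => [|j IH]; rewrite ?expr0 ?dhomog1 // exprS -[j.+1]add1n; exact: dhomogM.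
  - by rewrite rmorphXn /= l0_eta expr1n oner_eq0.
  - by rewrite !hclassE rmorphXn.
  - by rewrite rmorphXn /= l0_eta expr1n divr1.
rewrite /xeta (homptP (sdir hP) xeta_prime Sf); split=> [[h _]|h].
  exact: (val_uniq heta hv h).
split; first by rewrite /Mv /= -h.
exact: (chartB_div x0n Sf).
Qed.

(** * Sections of $Q\pi^*H-kE$ as functions of bounded degree and prescribed order *)

Section Sections.
Variables (i0 : 'I_m) (i00 : val i0 = 0%N).
Variables (Hl : 'rV[K]_n.+1) (L0n : hlinear P Hl != 0).
Local Notation L0 := (hlinear P Hl).
Local Notation T1 := (localization (excC u R i0) (excr u R i0)).

Definition divHE : 'I_2 -> divisor P :=
  fun i => if i == ord0 then hyperplane_pullback eta Hl else exceptional_divisor eta.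

Let excp := excr_prime sRv Rv_io uR Uexp Uind nR Runit i0.
Let un0 := u_neq0 sRv Rv_io uR Uexp Uind i0.

(** The generic point of the exceptional divisor is a point of the blow-up above [eta]; the order of
    a section along this divisor is read off there. *)
Lemma exc_over : blowup_over eta xeta T1.
Proof.
have [EO EI] := local_at_eta xeta_point xeta_at.
have Ech : blowup_chart eta xeta (u i0) = excC u R i0.
  rewrite /blowup_chart X_ringE EO EI; apply/seteqP; split=> z [k hk]; exists k; move: hk.
    by rewrite (module_powE sRv (esym Eu)).
  by rewrite (module_powE sRv (esym Eu)).
split; first by rewrite X_ringE; exact: xeta_point.
exists (u i0), (excr u R i0); rewrite Ech X_ringE EO EI; split=> //.
- by rewrite -Eu; apply: u_U1 => //; exact: sRv.
- apply/seteqP; split=> z.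
    move=> [rz Rz]; split=> // -[_ z0 Vz].
    have /(excr_R sRv Rv_io uR Uexp Uind nR Runit i0 Rz) U1z := rz.
    apply: (U1_1 Uind); rewrite -(mulVf z0); have [_ _ h] := gpow_amod u sRv 1; exact: h.
  move=> [Rz nz]; split=> //; apply/(excr_R sRv Rv_io uR Uexp Uind nR Runit i0 Rz).
  by apply: contrapT => h; apply: nz; have [] := Runit Rz h.
Qed.

Lemma hyperplaneP T w : hyperplane_pullback eta Hl T w <-> exists x v v' l',
  [/\ blowup_over eta x T, unit_of T v, unit_of (proj_local_ring S x) v' &
      [/\ S 1 l', ~ x l' & w = v * (v' * (L0 / l'))]].
Proof.
rewrite /hyperplane_pullback /hyperplane_section X_ringE; split.
  move=> [x [h [v [h1 [v' [l' [h2 h3 h4 ->]]] h5 ->]]]]; exists x, v, v', l'; split=> //.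
move=> [x [v [v' [l' [h1 h2 h3 [h4 h5 ->]]]]]]; exists x, (v' * (L0 / l')), v; split=> //.
by exists v', l'.
Qed.

Lemma gpow_dvd T f k z : sring T -> R `<=` T -> (forall i, exists2 t, T t & u i = f * t) ->
  U k z -> exists2 t, T t & z = f ^+ k * t.
Proof.
move=> sT RT hu; elim: k z => [|k IH] z; first by move=> /RT Tz; exists z; rewrite ?expr0 ?mul1r.
move=> [y [hy ->]]; have /choice [t ht] i : exists t, T t /\ u i * y i = f ^+ k.+1 * t.
  have [a Ta ->] := hu i; have [b Tb ->] := IH _ (hy i); exists (a * b).
  by split; [have [_ _ _ TM] := sT; exact: TM|rewrite exprS mulrACA].
exists (\sum_i t i); first by refine (sring_sum sT _) => i _; have [] := ht i.
by rewrite big_distrr /=; apply: eq_bigr => i _; have [_] := ht i.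
Qed.

Lemma sections_lower Q k z : BD Q z -> U k z ->
  div_sections eta (div_comb divHE (pair2 (Posz Q) (- Posz k))) (z * x0 ^+ Q / L0 ^+ Q).
Proof.
move=> Bz Uz; right; split; first by exists T1, xeta; exact: exc_over.
move=> T _ _ [f [hf ->]]; rewrite prod_pair2.
have /hyperplaneP [x' [v [v' [l' [ov [Tv _ _] [Ov' _ _] [Sl' nl' ->]]]]]] : hyperplane_pullback eta Hl T (f ord0) := hf ord0.
have [f1n [x'' [ov'' Ef]]] : exceptional_divisor eta T (f ord_max) := hf ord_max.
have [hx' sT OT] := over_facts ov; have [hx'' _ OT''] := over_facts ov''.
have [T1' _ _ TM] := sT; have l'0 := proj_neq0 hx' nl'.
rewrite section_eqn //; apply: (TM); first by apply: sringX => //; apply: TM => //; exact: OT.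
(* Away from [eta] the equation of the exceptional divisor is invertible. Above [eta] it divides all
   parameters, so its power [k] divides every element of order at least [k]. *)
have [h1|hb] := point_cases hx''.
  have : lin_span T (eta_ideal eta x'') 1 by apply: lin_span_gen.
  rewrite Ef => -[t Tt E1].
  have Vf := inv_of_mul1 f1n E1.
  rewrite -[(f ord_max ^+ k)^-1]exprVn Vf; apply: (TM); last exact: sringX.
  apply: OT; exists Q, (z * x0 ^+ Q), (l' ^+ Q); rewrite add0n; split=> //; first exact: S_exp1.
  have [[_ x1 xP] _ _] := hx'.
  elim: (Q) => [|j IH]; rewrite ?expr0 // exprS => /xP [||//|//]; first exact: SG Sl'.
  by apply: (SG (D := j)); exact: S_exp1.
have [EO EI] := local_at_eta hx'' hb; rewrite EO in OT''; rewrite EI in Ef.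
have [|t Tt Ez] := gpow_dvd sT OT'' _ Uz (f := f ord_max).
  move=> i; have : lin_span T M (u i) by apply: lin_span_gen => //; rewrite -Eu; apply: u_U1 => //; exact: sRv.
  by rewrite Ef => -[t Tt <-]; exists t.
rewrite div_pow_swap; apply: (TM).
  by rewrite (div_of_mul (expf_neq0 k f1n) Ez).
apply: sringX => //; apply: OT; exists 1%N, x0, l'; rewrite add0n; split=> //.
exact: (S_x0 io X hl).
Qed.

Section Upper.
Variables (Q k : nat) (s : F).
Hypotheses (hs : div_sections eta (div_comb divHE (pair2 (Posz Q) (- Posz k))) s) (s0 : s != 0).
Local Notation z := (s * (L0 / x0) ^+ Q).

Let secT T f0 f1 : blowup eta T -> hyperplane_pullback eta Hl T f0 -> exceptional_divisor eta T f1 ->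
  T (s * (f0 ^+ Q / f1 ^+ k)).
Proof.
move=> bT h0 h1; have [E|[_ h]] := hs; first by have := s0; rewrite E eqxx.
apply: h => //; exists (fun i : 'I_2 => if i == ord0 then f0 else f1); split.
  by move=> i; rewrite /divHE; case: eqP.
by rewrite prod_pair2.
Qed.

Let x0Q : x0 ^+ Q != 0.
Proof. exact: (expf_neq0 Q x0n). Qed.

Let zE : z * x0 ^+ Q = s * L0 ^+ Q.
Proof. exact: (pow_div_mul s L0 x0Q). Qed.

Definition good (x : set F) : Prop := exists e G, [/\ S e G, ~ x G & S (e + Q) (s * L0 ^+ Q * G)].

Lemma good_unit x : proj_points S x -> eta_ideal eta x 1 -> good x.
Proof.
move=> hx h1; have ov := over_unit hx h1; have [i ni] := point_relevant hx.
have xi0 := proj_neq0 hx ni; have sO := OX_sring hx; have [q1 _ _ _] := sO.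
have u1 := unit_of1 sO.
have [|||e [f [g [hf hg ng E]]]] := @secT (proj_local_ring S x) (L0 / X i) 1.
- by exists x.
- apply/hyperplaneP; exists x, 1, 1, (X i); split; [exact: ov|exact: u1|exact: u1|].
  by split; [exact: S_X|exact: ni|rewrite !mul1r].
- split; first exact: oner_neq0.
  exists x; split=> //; apply/seteqP; split=> t; last first.
    move=> [t' Ot <-]; rewrite mul1r -[t']mulr1; have [_ _ h] := lin_span_amod (eta_ideal eta x) sO.
    by apply: h => //; exact: lin_span_gen.
  move=> ht; exists t; rewrite ?mul1r //; apply: lin_span_sub ht; first exact: sring_amod.
  move=> _ [e [f [g [hf hg _ ng ->]]]]; exists e, (hclass P f), (hclass P g); rewrite add0n.
  by split=> //; [exists f; rewrite ?hclassE|exists g; rewrite ?hclassE].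
rewrite add0n in hf; exists e, g; split=> //.
have g0 := proj_neq0 hx ng; have xQ := expf_neq0 Q xi0.
suff -> : s * L0 ^+ Q * g = f * X i ^+ Q by apply: S_M => //; apply: S_exp1; exact: S_X.
move: E; rewrite expr1n divr1 expr_div_n mulrA => E.
exact: (frac_cross xQ g0 E).
Qed.

Let z_T1 : T1 (z / u i0 ^+ k).
Proof.
have [EO EI] := local_at_eta xeta_point xeta_at.
have -> : z / u i0 ^+ k = s * ((L0 / x0) ^+ Q / u i0 ^+ k) by rewrite mulrA.
have sO := OX_sring xeta_point; have [q1 _ _ _] := sO.
have [_ sT _] := over_facts exc_over; have [t1 _ _ _] := sT.
apply: secT.
- by exists xeta; exact: exc_over.
- apply/hyperplaneP; exists xeta, 1, 1, x0; split; [exact: exc_over|exact: (unit_of1 sT)|exact: (unit_of1 sO)|].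
  split; [exact: (S_x0 io X hl)| |by rewrite !mul1r].
  by move/(xeta_at (hl ord0)); rewrite l0_eta => /eqP; rewrite oner_eq0.
- split; first exact: un0.
  exists xeta; split; first exact: exc_over.
  by rewrite EI -Eu; exact: (exc_ideal sRv Rv_io uR Uexp Uind nR Runit i0).
Qed.

(** A section of the twisted sheaf is regular on [X] away from [eta]. If $m=1$, the local ring of
    the blow-up is [R]. If $m\ge2$, powers of two parameters multiply [z] into [R], and [hartogs]
    removes the pole. *)
Lemma section_regular : R z.
Proof.
have [m1|m1] := eqVneq m 1%N.
  have Rz := exc_dim1 sRv Rv_io uR Uexp Uind nR Runit m1 z_T1.
  have E := mulVK z (expf_neq0 k un0); rewrite E; have [_ _ _ RM] := sRv; apply: RM => //.
  by apply: sringX => //; exact: sRv.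
have m2 : (1 < m)%N by rewrite ltn_neqAle eq_sym m1 (leq_ltn_trans (leq0n i0) (ltn_ord i0)).
pose i1 := Ordinal m2.
have sB := B_sring io X hl; have [B1 BDD BN BM] := sB.
have BR b : B b -> R b by move=> [D]; exact: BD_R.
pose dB : set F := [set b | B b /\ B (z * b)].
have idB : is_ideal B dB.
  split.
  - by move=> b [].
  - by split; rewrite ?mulr0; exact: sring0.
  - by move=> b b' [h1 h2] [h3 h4]; split; [exact: BDD|rewrite mulrDr; exact: BDD].
  - by move=> a b Ba [h1 h2]; split; [exact: BM|rewrite mulrCA; exact: BM].
(* A prime that contains all denominators of [z] but not [w] is a point other than [eta], and there
   [z] has a denominator outside the prime by [good_unit]. *)
have pow w : B w -> M w -> exists N, dB (w ^+ N).
  move=> Bw Mw; apply: contrapT => /forallNP h.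
  have [q [qp dq nq]] := prime_avoiding sB idB Bw h.
  have hx := hompt_point (sdir hP) x0n (S_x0 io X hl) qp.
  have hxP e g (Sg : S e g) := homptP (sdir hP) qp Sg.
  have [h1|hb] := point_cases hx.
    have [e [G [SGe nG SGG]]] := good_unit hx h1.
    apply: nG; apply/(hxP e G SGe); apply: dq; split; first exact: (chartB_div x0n SGe).
    rewrite (shift_eqn G e x0n zE).
    exact: (chartB_div x0n SGG).
  have [D [f hf E]] := Bw.
  have Ew : w = cl f / x0 ^+ D := esym (etrans (congr1 (fun t => t / x0 ^+ D) (esym E)) (mulfK (expf_neq0 D x0n) w)).
  apply: nq; rewrite Ew; apply/(hxP D (cl f)); first by exists f.
  apply/(hb D f hf).
  have hv : value_at eta w (meval eta f).
    exists D, f, (l ord0 ^+ D); split=> //.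
    - by elim: (D) => [|j IH]; rewrite ?expr0 ?dhomog1 // exprS -[j.+1]add1n; exact: dhomogM.
    - by rewrite rmorphXn /= l0_eta expr1n oner_eq0.
    - by rewrite !hclassE rmorphXn.
    - by rewrite rmorphXn /= l0_eta expr1n divr1.
  exact: (val_uniq heta hv Mw).
have upow i : exists N, R (z * u i ^+ N).
  have Mu : M (u i) by rewrite -Eu; apply: u_U1 => //; exact: sRv.
  have : locring B (evB io X eta l) (u i) by rewrite -Eloc.
  move=> [b [t [Bb Bt et Eut]]].
  have t0 : t != 0.
    by apply/eqP => t00; move: et; rewrite t00 -(rmorph0 io) (evB_io (eta_ker heta) l0_eta) eqxx.
  have Vt : R t^-1 by rewrite Eloc; exact: (locring_V sB Bt et).
  have Mb : M b.
    by have -> : b = t * u i by [rewrite Eut mulrC divfK]; have [_ _ h] := aMv; apply: h => //; exact: BR.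
  have [N [h1 h2]] := pow b Bb Mb; exists N.
  rewrite Eut mul_div_pow; have [_ _ _ RM] := sRv; apply: RM; first exact: BR.
  by apply: sringX => //; exact: sRv.
have [N hN] := upow i0; have [N' hN'] := upow i1.
have [|g Rg E] := hartogs sRv Rv_io uR Uexp Uind nR Runit i00 (erefl : val i1 = 1%N) hN hN' (N := N) (M := N').
  by rewrite mulrAC.
suff -> : z = g by [].
by apply: (mulfI (expf_neq0 N un0)); rewrite -E mulrC.
Qed.

Lemma section_order : U k z.
Proof. exact: (exc_U sRv Rv_io uR Uexp Uind nR Runit section_regular z_T1). Qed.

Lemma good_all x : proj_points S x -> good x.
Proof.
move=> hx; have [|hb] := point_cases hx; first exact: good_unit.
have [c [e [f [g [hf hg g0 E _]]]]] := section_regular; rewrite !hclassE in E.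
exists e, (cl g); split; first by exists g.
  by move/(hb e g hg)/eqP; rewrite (negbTE g0).
have g0' := cl_neq0 heta g0.
have -> : s * L0 ^+ Q * cl g = cl f * x0 ^+ Q by rewrite -zE E mulrAC divfK.
by apply: S_M; [exists f|apply: S_exp1; exact: (S_x0 io X hl)].
Qed.

(** On each chart $X_i\ne0$ regularity at all points makes some power of $X_i$ multiply the section
    into the graded ring. A monomial of degree at least $(n+1)N_0$ in the $n+1$ variables is
    divisible by some $X_i^{N_0}$. *)
Lemma section_saturated : exists N, forall N' y, (N <= N')%N -> BD N' y -> BD (N' + Q) (z * y).
Proof.
pose f := s * L0 ^+ Q.
have chart i : exists N, S (N + Q) (X i ^+ N * f).
  have [Xi0|Xn] := eqVneq (X i) 0.
    by exists 1%N; rewrite Xi0 expr1 mul0r; exact: S_0.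
  have Sx := S_X io X i; have sC := chartB_sring Sx; have [C1 CD CN CM] := sC.
  pose dC : set F := [set b | chartB io X (X i) b /\ chartB io X (X i) (f / X i ^+ Q * b)].
  have idC : is_ideal (chartB io X (X i)) dC.
    split.
    - by move=> b [].
    - by split; rewrite ?mulr0; exact: sring0.
    - by move=> b b' [h1 h2] [h3 h4]; split; [exact: CD|rewrite mulrDr; exact: CD].
    - by move=> a b Ba [h1 h2]; split; [exact: CM|rewrite mulrCA; exact: CM].
  have [[_ [D hD]]|nd] := pselect (dC 1).
    exists D; rewrite mulr1 in hD; have := S_M hD (S_exp1 Q Sx).
    by rewrite pow_cancel.
  exfalso; have nd' N : ~ dC (1 ^+ N) by rewrite expr1n.
  have [q [qp dq _]] := prime_avoiding sC idC C1 nd'.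
  have hx := hompt_point (sdir hP) Xn Sx qp.
  have [e [G [SGe nG SGG]]] := good_all hx.
  apply: nG; apply/(homptP (sdir hP) qp SGe); apply: dq; split; first exact: (chartB_div Xn SGe).
  by have := chartB_div Xn SGG; rewrite -/f -frac_mul_pow.
have /choice [Ni hNi] := chart.
pose N0 := (\max_i Ni i)%N.
have hN0 i : S (N0 + Q) (X i ^+ N0 * f).
  have le : (Ni i <= N0)%N by exact: leq_bigmax.
  rewrite -{2}(subnK le) exprD -mulrA -{1}(subnK le) -addnA; apply: S_M => //.
  by apply: S_exp1; exact: S_X.
exists (n.+1 * N0)%N => N' y hN' By.
suff hS t : S N' t -> S (N' + Q) (f * t).
  have := hS _ By; rewrite /RationalPoint.BD /= /f -zE => h.
  by rewrite satur_eqn.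
move=> [g hg ->]; rewrite /mmap big_distrr /= big_seq; apply: S_sum => a ha.
have da : mdeg a = N' := dhomog_mf hg ha.
have [i hi] : exists i, (N0 <= a i)%N.
  apply: contrapT => /forallNP h; have h' i : (a i < N0)%N by rewrite ltnNge; apply/negP; exact: h.
  move: hN'; rewrite -da mdegE leqNgt => /negP; apply.
  have N00 : (0 < N0)%N by exact: leq_ltn_trans (h' ord0).
  apply: (@leq_ltn_trans (\sum_(j < n.+1) N0.-1)%N).
    by apply: leq_sum => j _; rewrite -ltnS prednK.
  by rewrite sum_nat_const card_ord ltn_pmul2l // prednK.
pose b : multinom n.+1 := mnm_sub a (mnm_muln (mnm1 i) N0).
have Eab : a = mnm_add (mnm_muln (mnm1 i) N0) b.
  rewrite mpoly.addmC submK //; apply/mnm_lepP => j; rewrite mulmnE mnm1E.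
  by case: eqP => [<-|_]; rewrite ?mul1n ?mul0n.
rewrite mulrCA; apply: S_Z; rewrite Eab mmap1D.
have -> : mmap1 X (mnm_muln (mnm1 i) N0) = X i ^+ N0.
  rewrite /mmap1 (bigD1 i) //= mulmnE mnm1E eqxx mul1n big1 ?mulr1 // => j ji.
  by rewrite mulmnE mnm1E eq_sym (negbTE ji) mul0n expr0.
rewrite mulrA [f * _]mulrC.
have db : (N' + Q = (N0 + Q) + mdeg b * 1)%N.
  by rewrite muln1 -da [in LHS]Eab mdegD mdegMn mdeg1 mul1n addnAC.
by rewrite db; apply: S_M => //; apply: S_mmap1 => j; exact: S_X.
Qed.

End Upper.
End Sections.

(** * Dimensions of section spaces and the estimate for the volume integral *)

Section Growth.
Variables (e c0 N0 : nat).
Hypotheses (hlow : forall D, (e <= D)%N -> ind io (S D) (e * 'C(D - e + m, D - e)))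
  (hup : forall D r, (N0 <= D)%N -> ind io (S D) r -> (r <= e * 'C(D + c0 + m, D + c0))%N).

Lemma ind_BD D r : ind io (BD D) r <-> ind io (S D) r.
Proof.
have h0 := expf_neq0 D x0n; split.
  by apply: (ind_scale h0) => y.
apply: (ind_scale (invr_neq0 h0)) => y hy.
by rewrite /RationalPoint.BD /= (divfK h0).
Qed.

Let BDlow D : (e <= D)%N -> ind io (BD D) (e * 'C(D - e + m, D - e)).
Proof. by move=> h; apply/ind_BD; exact: hlow. Qed.
Let BDup D r : (N0 <= D)%N -> ind io (BD D) r -> (r <= e * 'C(D + c0 + m, D + c0))%N.
Proof. by move=> h /ind_BD; exact: hup. Qed.
Let BDl D D' y : (D <= D')%N -> BD D y -> BD D' y.
Proof. exact: BD_leq. Qed.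
Let BDMM D D' y y' : BD D y -> BD D' y' -> BD (D + D') (y * y').
Proof. exact: RationalPoint.BDM. Qed.
Let BD1 : BD 0 1.
Proof. by have := BD_io io X hl 0 1; rewrite rmorph1. Qed.
Let Us z : R z -> (forall k, U k z) -> z = 0.
Proof.
move=> h1 h2; apply: (@U_sep _ _ io m u R);
  do ?[exact: h1|exact: h2|exact: sRv|exact: Rv_io|exact: uR|exact: Uexp|exact: Uind|exact: nR|exact: Runit].
Qed.

Local Notation Gf := (Gk io u R BD e).
Local Notation Vf := (Vk io u R BD e).

Lemma ind_G D k r : (0 < D)%N -> ind io (BD D `&` U k) r <-> (r <= Gf D k)%N.
Proof. exact: (ind_Gk sRv Rv_io uR Uexp Uind Us BD_R (BD_ksub io X l) BDl BDMM BD1 BDu BDup k r). Qed.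

Lemma dimK_ge (RR : realType) (V : set F) r : ind io V r -> ((r%:R)%:E <= dimK RR V)%E.
Proof. by move=> h; apply: ereal_sup_ubound; exists r. Qed.

Lemma dimK_le (RR : realType) (V : set F) q : (forall r, ind io V r -> (r <= q)%N) -> (dimK RR V <= (q%:R)%:E)%E.
Proof. by move=> h; apply: ge_ereal_sup => _ [r [-> hr]]; rewrite lee_fin ler_nat; exact: h. Qed.

(** The contracted primes [qideal] of the local ring, restricted to the chart and homogenized, form
    a chain in [X]. The numerator of the parameter [u i] shows that step [i] is strict. *)
Lemma chain_m : exists c : nat -> set F, (forall i, (i <= m)%N -> proj_points S (c i)) /\
  (forall i, (i < m)%N -> c i `<` c i.+1).
Proof.
have sB := B_sring io X hl; have BR b : B b -> R b by move=> [D]; exact: BD_R.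
pose q i := qideal io u R i.
have qp i : is_prime R (q i) by exact: (qideal_prime sRv Rv_io uR Uexp Uind).
have qBp i : is_prime (chartB io X x0) (q i `&` B).
  have [B1 BDD BN BM] := sB; have [[qR q0 qD qM] q1 qP] := qp i; split.
  - split=> [x []//||x y [h1 h2] [h3 h4]|a x ha [h1 h2]].
    + by split=> //; exact: sring0 sB.
    + by split; [exact: qD|exact: BDD].
    + by split; [apply: qM => //; exact: BR|exact: BM].
  - by move=> [].
  - move=> x y Bx By [h _]; have [||h'|h'] := qP x y _ _ h; [exact: BR|exact: BR|by left|by right].
exists (fun i => hompt io X x0 (q i `&` B)); split.
  by move=> i _; exact: (hompt_point (sdir hP) x0n (S_x0 io X hl) (qBp i)).
move=> i im; split.
  move=> t [p [h1 h2 E]]; exists p; split; [exact: h1| |exact: E].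
  by move=> j; have [h3 h4] := h2 j; split; [exact: (qideal_sub h3)|exact: h4].
move=> sub; pose ii := Ordinal im.
have : locring B (evB io X eta l) (u ii) by rewrite -Eloc.
move=> [b [t [Bb Bt et Eut]]].
have t0 : t != 0.
  by apply/eqP => t00; move: et; rewrite t00 -(rmorph0 io) (evB_io (eta_ker heta) l0_eta) eqxx.
have Vt : R t^-1 by rewrite Eloc; exact: (locring_V sB Bt et).
have nt : ~ U 1 t.
  move=> h; apply: (U1_1 Uind); rewrite -(mulVf t0); have [_ _ hM] := gpow_amod u sRv 1; exact: hM.
have Eb : b = t * u ii by rewrite Eut; exact: (mulVK b t0).
have [hu1 hu2] := qideal_u sRv uR Uind ii.
have qb : q i.+1 b.
  by rewrite Eb; have [[_ _ _ qM] _ _] := qp i.+1; apply: qM => //; exact: BR.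
have nqb : ~ q i b.
  rewrite Eb; have [_ _ qP] := qp i; move=> /(qP _ _ (BR _ Bt) (uR ii)) [h|h].
    exact: (qideal_notU1 sRv Rv_io uR Uexp Uind (BR _ Bt) nt h).
  exact: (hu2 i (leqnn i) h).
have [D hD] := Bb; have hD' : S D (b * x0 ^+ D) := hD.
have hbx : b * x0 ^+ D / x0 ^+ D = b := mulfK (expf_neq0 D x0n) b.
apply: nqb; have : hompt io X x0 (q i `&` B) (b * x0 ^+ D).
  by apply: sub; apply/(homptP (sdir hP) (qBp i.+1) hD'); rewrite hbx.
by move/(homptP (sdir hP) (qBp i) hD'); rewrite hbx => -[].
Qed.

Section Volumes.
Variables (i0 : 'I_m) (i00 : val i0 = 0%N) (Hl : 'rV[K]_n.+1) (L0n : hlinear P Hl != 0).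
Local Notation L0 := (hlinear P Hl).

Lemma sections_bounds (RR : realType) Q k : (0 < Q)%N -> (0 < k)%N ->
  (((Gf Q k)%:R)%:E <= dimK RR (div_sections eta (div_comb (divHE Hl) (pair2 (Posz Q) (- Posz k)%R))) <= ((Vf Q k)%:R)%:E)%E.
Proof.
move=> Q0 _; have hx := expf_neq0 Q x0n; have hL := expf_neq0 Q L0n.
apply/andP; split.
  apply: dimK_ge; have /(ind_G k _ Q0) : (Gf Q k <= Gf Q k)%N by [].
  apply: (ind_scale (mulf_neq0 hx (invr_neq0 hL))) => y [By Uy]; rewrite mulrA.
  first [exact: (sections_lower i0 L0n By Uy)|exact: (sections_lower i00 L0n By Uy)].
apply: dimK_le => r h.
apply: (ind_sec sRv Rv_io uR Uexp Uind Us BD_R (BD_ksub io X l) BDl BDMM BD1 BDu BDup Q0).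
apply: (ind_scale (expf_neq0 Q (mulf_neq0 L0n (invr_neq0 x0n))) _ h) => s hs.
have [->|sn] := eqVneq s 0.
  rewrite mul0r; split; first exact: (sring0 sRv).
    by have [] := gpow_amod u sRv k.
  by exists 0%N => N' y _ _; rewrite mul0r; have [] := BD_ksub io X l (N' + Q).
split.
- first [exact: (section_regular i00 hs sn)|exact: (section_regular i00 L0n hs sn)|exact: (section_regular i0 L0n hs sn)].
- first [exact: (section_order i00 hs sn)|exact: (section_order i00 L0n hs sn)|exact: (section_order i0 L0n hs sn)].
- first [exact: (section_saturated i00 hs sn)|exact: (section_saturated i00 L0n hs sn)|exact: (section_saturated i0 L0n hs sn)].
Qed.

Lemma growth_volume (RR : realType) D : (0 < m)%N -> (0 < D)%N ->
  (`| \sum_(1 <= k <oo) ((Gf D k)%:R)%:E - (D%:R ^+ m.+1 / m`!%:R)%:E * I_X P eta RR m Hl |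
   <= ((3 * Cgen m e * (C3 m e).+1)%:R * D%:R ^+ m)%:E)%E.
Proof.
move=> m0 D0.
apply: (@sum_volume RR m (Cgen m e) (C3 m e) Gf Vf) => //.
- by move=> D' k j h1 h2; exact: (Gk_lower sRv Rv_io uR Uexp Uind BD_R BDl BDMM BD1 BDu BDup).
- by move=> D' k j h1 h2; exact: (Gk_upper sRv Rv_io uR Uexp Uind Us BD_R (BD_ksub io X l) BDl BDMM BD1 BDu BDlow BDup).
- by move=> D' k k' h; exact: Gk_mono.
- by move=> D' k h; exact: Gk_lip.
- by move=> D' k h; exact: Gk_zero.
- by move=> Q k h; exact: (Vk_super sRv Rv_io uR Uexp Uind BD_R BDl BDMM BD1 BDu BDup).
- by move=> Q k h1 h2; exact: sections_bounds.
Qed.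

End Volumes.

Section Xi.
Variables (E : set 'rV[K]_n.+1) (hE : projective_lattice E) (p : set K)
  (pm : is_maximal (@ring_of_integers K) p) (xi : set F).
Local Notation Cl := (closure_ring P E).
Local Notation A := (proj_local_ring Cl xi).
Hypotheses (hxi : proj_points Cl xi) (hred : reduces_to E p eta xi).
Variables (D : nat) (t : F).
Hypothesis ht : trivializes E xi D t.

(** Both [t] and $x_0^D$ are compared with $h^D$, where [h] is a linear form nonzero at [xi] and at
    [eta]; hence their quotient is a unit at [eta]. *)
Lemma trivialization : t != 0 /\ R (x0 ^+ D / t) /\ R (t / x0 ^+ D).
Proof.
have [h Ch [nh [hf hhf [Eh h0]]]] := xi_linear heta hE pm hxi hred.
have hn := proj_neq0 hxi nh; have hDn := expf_neq0 D hn; have xD := expf_neq0 D x0n.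
have AR z : A z -> R z by move=> /hred [c [hc _ _]]; exists c.
have [A1 _ _ _] := A_sring hxi; have [[_ xi1 _] _ _] := hxi.
have ChD : Cl D (h ^+ D).
  by elim: (D) => [|j IH]; [exact: Cl1|rewrite exprS -[j.+1]add1n; exact: ClM].
have nhD : ~ xi (h ^+ D).
  have Cj j : Cl j (h ^+ j).
    by elim: j => [|j IH]; [exact: Cl1|rewrite exprS -[j.+1]add1n; exact: ClM].
  elim: (D) => [|j IH]; rewrite ?expr0 // exprS.
  exact: (proj_notM (@Cl0 K n P E) hxi Ch (Cj j) nh IH).
have [a Aa Ea] : [set t * z | z in A] (h ^+ D).
  by rewrite -ht; exists 0%N, (h ^+ D), 1; rewrite addn0 divr1; split=> //; exact: Cl1.
have [e' [f [g [Cf Cg ng Et]]]] : proj_stalk Cl D xi t by rewrite ht; exists 1; rewrite ?mulr1.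
have tn : t != 0 by apply: contraNneq hDn => tz; rewrite -Ea tz mul0r.
have gn := proj_neq0 hxi ng.
have Ab : A (f / (g * h ^+ D)).
  exists (e' + D)%N, f, (g * h ^+ D); split=> //; [by rewrite add0n addnC|exact: ClM|].
  exact: (proj_notM (@Cl0 K n P E) hxi Cg ChD ng nhD).
have vxh : R (x0 / h).
  by exists (1 / meval eta hf), 1%N, (l ord0), hf; rewrite !hclassE -Eh l0_eta.
have vhx : R (h / x0).
  by exists (meval eta hf / 1), 1%N, hf, (l ord0); rewrite !hclassE -Eh l0_eta oner_eq0.
have [_ _ _ RM] := sRv; split=> //; split.
  rewrite (triv_eqn1 x0 tn hDn Ea); apply: RM; first by apply: sringX => //; exact: sRv.
  exact: AR.
rewrite (triv_eqn2 x0 gn hDn Et); apply: RM; first exact: AR.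
by apply: sringX => //; exact: sRv.
Qed.

(** Passing from [t] to $x_0^D$ multiplies by a unit at [eta] and preserves orders. The localized
    module and [S D] have the same span over [K], and the denominators are constants, which do not
    affect orders either. *)
Lemma xi_ind k r :
  ind io (lin_span (range (@hconst K n P)) (localized_F E p D t `&`
    module_pow (eval_local_ring E eta xi) (eval_max_ideal E eta xi) k)) r <->
  ind io (BD D `&` U k) r.
Proof.
have [tn [Rr Rr']] := trivialization; have xD := expf_neq0 D x0n.
rewrite (eval_local_ringE heta hE pm hxi hred) (eval_max_idealE heta hE pm hxi hred).
rewrite (module_powE sRv (esym Eu)).
have [k0 kD kZ] := BD_ksub io X l D; have [U0 UD UM] := gpow_amod u sRv k.
have [EF FS] := lin_span_F_module P hE pm D.
pose OKp' : set F := @hconst K n P @` localization (@ring_of_integers K) p.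
split.
  apply: (ind_scale (mulf_neq0 tn (invr_neq0 xD))).
  pose W : set F := [set v | (BD D `&` U k) (v * (t / x0 ^+ D))].
  suff sub : lin_span (range (@hconst K n P)) (localized_F E p D t `&` U k) `<=` W by move=> y /sub.
  apply: lin_span_sub.
    split.
    - by rewrite /W /= mul0r.
    - by move=> x y [h1 h2] [h3 h4]; rewrite /W /= mulrDl; split; [exact: kD|exact: UD].
    - move=> _ x [c _ <-] [h1 h2]; rewrite /W /= -mulrA; split; first exact: (kZ c).
      by apply: UM => //; exact: Rv_io.
  move=> _ [[s hs <-] Us']; rewrite /W /=; split; last by rewrite mulrC; exact: UM.
  rewrite /RationalPoint.BD /= (triv_eqn3 s tn xD).
  suff sub : lin_span OKp' (F_module E D) `<=` S D by exact: sub.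
  apply: lin_span_sub FS; have [s0 sD sZ] := S_ksub io X D; split=> // _ x [c _ <-]; exact: (sZ c).
apply: (ind_scale (mulf_neq0 xD (invr_neq0 tn))) => y [By Uy].
pose V' : set F := lin_span OKp' (F_module E D).
have sOK := OK_sring K; have [q1 qD qN qM] := sOK.
have sOKp : sring OKp'.
  have [h1 hD hN hM] := O_sring pm; split.
  - by exists 1; rewrite ?rmorph1.
  - by move=> _ _ [a ha <-] [b hb <-]; exists (a + b); rewrite ?rmorphD //; exact: hD.
  - by move=> _ [a ha <-]; exists (- a); rewrite ?rmorphN //; exact: hN.
  - by move=> _ _ [a ha <-] [b hb <-]; exists (a * b); rewrite ?rmorphM //; exact: hM.
have amV : amod (@hconst K n P @` @ring_of_integers K) V'.
  have [v0 vD vM] := lin_span_amod (F_module (P := P) E D) sOKp; split=> // _ x [c Oc <-] hx; apply: vM => //.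
  by exists c => //; exists c, 1; rewrite divr1; split=> //; have [_ ? _] := pm.
have [d0 dD dZ] := den_ksub pm amV.
have : S D (y * x0 ^+ D) by [].
rewrite -EF => hs.
have [a [Oa a0 ha]] : den V' (y * x0 ^+ D).
  have sub : lin_span (range (@hconst K n P)) (F_module E D) `<=` den V'.
    apply: lin_span_sub; first by split=> // _ x [c _ <-]; exact: (dZ c).
    move=> x hx; exists 1; split; [exact: q1|exact: oner_neq0|rewrite rmorph1 mul1r].
    by apply: lin_span_gen.
  exact: sub.
rewrite mulrA.
have -> : y * x0 ^+ D / t = hconst P a^-1 * (hconst P a * (y * x0 ^+ D) / t).
  by rewrite !mulrA -rmorphM mulVf // rmorph1 mul1r.
have [_ _ hM] := lin_span_amod (localized_F E p D t `&` U k) (range_hio_sring P).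
apply: hM; first by exists a^-1.
apply: lin_span_gen; first exact: range_hio_sring.
split; first by exists (hconst P a * (y * x0 ^+ D)).
rewrite triv_eqn4.
by apply: UM => //; have [_ _ _ RM] := sRv; apply: RM => //; exact: Rv_io.
Qed.

End Xi.
(** Without parameters the maximal ideal at [eta] is zero, so no chart of the blow-up exists and all
    section spaces vanish. *)
Lemma I_X_dim0 (RR : realType) (d : nat) (Hl : 'rV[K]_n.+1) : m = 0%N -> I_X P eta RR d Hl = 0%E.
Proof.
move=> m0; have no (T : set F) : ~ blowup eta T.
  move=> [x [_ [i [r [[e' [f [g [hf hg f0 _ Ei]]]] in0 _ _ _]]]]].
  have : M (cl f / x0 ^+ e').
    exists e', f, (l ord0 ^+ e'); split=> //.
    - by elim: (e') => [|j IH]; rewrite ?expr0 ?dhomog1 // exprS -[j.+1]add1n; exact: dhomogM.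
    - by rewrite rmorphXn /= l0_eta expr1n oner_eq0.
    - by rewrite !hclassE rmorphXn.
    - by rewrite f0 mul0r.
  rewrite -Eu => /gpow1P [y [_ Ey]].
  have hm (j : 'I_m) : False by case: j => j hj; move: hj; rewrite m0.
  have cf0 : cl f / x0 ^+ e' = 0 by rewrite Ey big1 // => j; case: (hm j).
  have clf : hclass P f = 0 by rewrite hclassE; exact: (frac_eq0 (expf_neq0 e' x0n) cf0).
  have i0 : i = 0 := etrans Ei (frac0 (hclass P g) clf).
  by move/negP: in0; apply; apply/eqP.
have dim0 (L : divisor P) : dimK RR (div_sections eta L) = 0%E.
  apply/eqP; rewrite eq_le; apply/andP; split.
    have hz z : div_sections eta L z -> z = 0.
      by case=> [h|[[T hT] _]]; [exact: h|case: (no T hT)].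
    by apply: (@dimK_le RR _ 0%N) => r hr; rewrite (ind_null hz hr).
  apply: (@dimK_ge RR _ 0%N); exists (fun=> 0); split=> [[]//|c _ []//].
have vi k (L : 'I_k -> divisor P) a : vol_int eta RR d L a = 0%E.
  rewrite /vol_int (_ : (fun D : nat => _) = (fun=> 0%E)); last by apply/funext => D; rewrite dim0 mul0e.
  by have [_ ->] := cvg_limn_einf_sup (cvg_cst (0%E : \bar RR)).
rewrite /I_X (eq_integral (fun=> 0%E)) ?integral0 // => x _.
rewrite /vol_real; have FF := rat_nbhs_filter (fun i : 'I_2 => if i == ord0 then 1%R else (- x)%R : RR).
apply: cvg_lim => //.
rewrite (_ : vol_rat eta RR d _ = (fun=> 0%E)); first exact: cvg_cst.
by apply/funext => a; rewrite /vol_rat vi mul0e.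
Qed.

Lemma growth_summary : [/\ (exists c : nat -> set F, (forall i, (i <= m)%N -> proj_points S (c i)) /\
      (forall i, (i < m)%N -> c i `<` c i.+1)),
    (forall D k r, (0 < D)%N -> ind io (BD D `&` U k) r <-> (r <= Gf D k)%N),
    (forall (RR : realType) (Hl : 'rV[K]_n.+1) D, hlinear P Hl != 0 -> (0 < m)%N -> (0 < D)%N ->
      (`| \sum_(1 <= k <oo) ((Gf D k)%:R)%:E - (D%:R ^+ m.+1 / m`!%:R)%:E * I_X P eta RR m Hl |
      <= ((3 * Cgen m e * (C3 m e).+1)%:R * D%:R ^+ m)%:E)%E),
    (forall (RR : realType) d (Hl : 'rV[K]_n.+1), m = 0%N -> I_X P eta RR d Hl = 0%E) &
    (forall E, projective_lattice E -> forall p, is_maximal (@ring_of_integers K) p ->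
     forall xi, proj_points (closure_ring P E) xi -> reduces_to E p eta xi ->
     forall D t, trivializes E xi D t -> forall k r,
     ind io (lin_span (range (@hconst K n P)) (localized_F E p D t `&`
       module_pow (eval_local_ring E eta xi) (eval_max_ideal E eta xi) k)) r <->
     ind io (BD D `&` U k) r)].
Proof.
split.
- exact: chain_m.
- by move=> *; exact: ind_G.
- by move=> RR Hl D h1 h2 h3; exact: (growth_volume (i0 := Ordinal h2) erefl h1).
- exact: I_X_dim0.
- by move=> E hE p pm xi hxi hred D t ht k r; exact: xi_ind.
Qed.

End Growth.

End Blowup.

End BlowupSections.

Module HilbertPolynomial.
Import Sumset Embedding Normalization Coordinates NoetherianLocal Vanishing RationalPoint Valuation.

(** * Leading coefficients of Hilbert polynomials *)

Lemma poly_ge_eventually (p : {poly rat}) : 0 < lead_coef p ->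
  exists (N : nat) (eps : rat), 0 < eps /\ forall D : nat, (N <= D)%N -> eps <= p.[D%:R].
Proof.
elim/poly_ind: p => [|p c IH]; first by rewrite lead_coef0 ltxx.
case: (eqVneq p 0) => [->|pn].
  rewrite mul0r add0r lead_coefC => c0; exists 0%N, c; split=> // D _; by rewrite hornerC.
have sz : (size (c%:P : {poly rat}) < size (p * 'X)%R)%N.
  by rewrite size_mulX //; apply: leq_ltn_trans (size_polyC_leq1 c) _; rewrite ltnS size_poly_gt0.
rewrite lead_coefDl // lead_coefMX => /IH [N [eps [e0 h]]].
exists (maxn N (Num.bound (`|1 - c| / eps))), 1; split=> // D; rewrite geq_max => /andP[h1 h2].
have hM : `|1 - c| / eps < D%:R.
  apply: lt_le_trans (archi_boundP _) _; last by rewrite ler_nat.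
  by apply: divr_ge0; [exact: normr_ge0|exact: ltW].
have hM' : `|1 - c| < D%:R * eps by rewrite -ltr_pdivrMr.
have h3 : eps * D%:R <= p.[D%:R] * D%:R by apply: ler_wpM2r => //; exact: h.
have h4 := ler_norm (1 - c).
rewrite hornerD hornerMX hornerC; lra.
Qed.

Lemma lead_coef_ge0 (p : {poly rat}) (N : nat) :
  (forall D : nat, (N <= D)%N -> 0 <= p.[D%:R]) -> 0 <= lead_coef p.
Proof.
move=> h; rewrite leNgt; apply/negP => p0.
have [N' [eps [e0 h']]] : exists (N : nat) (eps : rat), 0 < eps /\
    forall D : nat, (N <= D)%N -> eps <= (- p).[D%:R].
  by apply: poly_ge_eventually; rewrite lead_coefN oppr_gt0.
have h1 := h _ (leq_maxl N N'); have h2 := h' _ (leq_maxr N N').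
rewrite hornerN in h2; lra.
Qed.

(** After multiplication by $m!$, the polynomial lies eventually between two polynomials of degree
    [m] with leading coefficient [e]. Its degree is not assumed but follows from the comparison. *)
Lemma lead_coef_growth (m e c0 N : nat) (h : {poly rat}) : (0 < e)%N ->
  (forall D : nat, (N <= D)%N -> ((e * 'C(D - e + m, D - e))%:R <= h.[D%:R])) ->
  (forall D : nat, (N <= D)%N -> (h.[D%:R] <= (e * 'C(D + c0 + m, D + c0))%:R)) ->
  m`!%:R * lead_coef h = e%:R.
Proof.
move=> e0 hlow hup.
pose pw (a : rat) : {poly rat} := ('X - a%:P) ^+ m.
have spw a : size (pw a) = m.+1 by exact: size_exp_XsubC.
have mpw a : (pw a)`_m = 1.
  by have /monicP := monic_exp m (monicXsubC a); rewrite /lead_coef -/(pw a) spw.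
have en : (e%:R : rat) != 0 by rewrite pnatr_eq0 -lt0n.
pose A := e%:R *: pw e%:R; pose B := e%:R *: pw (- (c0 + m)%:R); pose h' := m`!%:R *: h.
have sA : size A = m.+1 by rewrite size_scale // spw.
have lA : lead_coef A = e%:R by rewrite /lead_coef sA /= coefZ mpw mulr1.
have sr : (size (B - A)%R <= m)%N.
  apply/leq_sizeP => j; rewrite leq_eqVlt => /predU1P[<-|mj].
    by rewrite coefB !coefZ !mpw subrr.
  by rewrite coefB !coefZ !nth_default ?spw // mulr0 subrr.
have l1 : 0 <= lead_coef (h' - A).
  apply: (@lead_coef_ge0 _ (maxn N e)) => D; rewrite geq_max => /andP[h1 h2].
  rewrite hornerD hornerN !hornerZ horner_exp hornerXsubC -natrB // subr_ge0 -natrX.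
  have /andP[h3 _] := bin_bounds (D - e) m.
  apply: le_trans (ler_wpM2l (ler0n _ _) (hlow D h1)).
  by rewrite -!natrM ler_nat mulnCA leq_mul2l h3 orbT.
have l2 : 0 <= lead_coef (B - h').
  apply: (@lead_coef_ge0 _ N) => D h1.
  rewrite hornerD hornerN !hornerZ horner_exp hornerXsubC opprK -natrD subr_ge0 -natrX.
  have /andP[_ h3] := bin_bounds (D + c0) m.
  apply: le_trans (ler_wpM2l (ler0n _ _) (hup D h1)) _.
  by rewrite -!natrM ler_nat mulnCA leq_mul2l addnA h3 orbT.
have s1 : (size (h' - A)%R <= m)%N.
  (* If $h'-A$ had degree at least [m], its leading coefficient would also be, up to sign, that of
     $B-h'$; both being nonnegative, it would vanish. *)
  rewrite leqNgt; apply/negP => lt.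
  have E : B - h' = - (h' - A) + (B - A) by rewrite opprB [RHS]addrC [RHS]addrA subrK.
  have : lead_coef (B - h') = - lead_coef (h' - A).
    by rewrite E lead_coefDl ?lead_coefN // size_polyN; exact: leq_ltn_trans sr lt.
  move=> E2; move: l2; rewrite E2 oppr_ge0 => l3.
  have /eqP : lead_coef (h' - A) = 0 by apply/eqP; rewrite eq_le l3 l1.
  by rewrite lead_coef_eq0 => /eqP E3; rewrite E3 size_poly0 in lt.
have <- : lead_coef h' = e%:R.
  have -> : h' = A + (h' - A) by rewrite addrC subrK.
  by rewrite lead_coefDl ?lA // sA ltnS.
by rewrite /h' lead_coefZ.
Qed.

Lemma gpow_dim0 (F : fieldType) (A : set F) (s : nat) (g : 'I_s -> F) k z :
  s = 0%N -> gpow A g k.+1 z -> z = 0.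
Proof.
move=> s0 [y [_ ->]]; rewrite big1 // => -[j hj] _; exfalso; move: hj; by rewrite s0.
Qed.

End HilbertPolynomial.

(** * The asymptotic formula with constants depending on dimension and degree *)

Import Sumset Embedding Normalization Coordinates NoetherianLocal Vanishing RationalPoint Valuation VolumeLimit Chains IntegerLocal Variety PointRing RegularLocal BlowupSections HilbertPolynomial.

Theorem theorem4p7 (R : realType) (d delta : nat) :
  exists (C : R) (D0 : nat),
  forall (K : fieldExtType rat) (n : nat)
    (E : set 'rV[K]_n.+1) (P : prime_idealr (mpoly n.+1 K)),
    projective_lattice E ->
    homogeneous_relevant P ->
    has_dimension P d ->
    has_degree P R d delta ->
  forall (p : set K) (xi : set (hfield P)) (eta : 'I_n.+1 -> K),
    is_maximal (@ring_of_integers K) p ->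
    proj_points (closure_ring P E) xi ->
    residue_rational E p xi ->
    regular_local_ring (proj_local_ring (closure_ring P E) xi) ->
    rational_point P eta ->
    reduces_to E p eta xi ->
  forall (l : 'rV[K]_n.+1),
    hlinear P l != 0 ->
  forall (D : nat) (t : hfield P),
    (D0 <= D)%N ->
    trivializes E xi D t ->
    (`| R_xi E p eta xi R D t
        - (D%:R ^+ d.+1 / d`!%:R)%:E * I_X P eta R d l |
     <= (C * D%:R ^+ d)%:E)%E.
Proof.
(* The constant of [growth_volume] for $m=d$ and $e=\delta$; neither [c0] nor [N] occurs in it. The
   threshold 1 excludes only $D=0$. *)
exists (3 * Cgen d delta * (C3 d delta).+1)%:R, 1%N.
move=> K n E P hE hP hdim hdeg p xi eta pm hxi hres hreg heta hred Hl Hl0 D t D1 ht.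
have ek := eta_ker heta.
have [m [l [hl l0 lS lfin lfree]]] := point_normalization (@hcharK K) ek heta.1.
have [e [be [g [c0 [N [e0 _ _ _ [_ _ hlow hup]]]]]]] := B_coords ek hl l0 lfin lfree.
have [u [uR Eu]] := Rv_parameters heta hl l0 hup hE pm hxi hres hreg hred.
have nR := Rv_noetherian heta hE pm hxi hreg hred.
have [chm h2 h3 h4 h5] := growth_summary hP heta hl l0 lS lfin lfree uR Eu nR hlow hup.
(* Algebraic dependence bounds all chains by [m], and the parameters at [eta] provide a chain of
   length [m]. *)
have Em : m = d.
  move: hdim; rewrite /has_dimension X_ringE => -[[c [c1 c2]] dmax].
  apply/eqP; rewrite eqn_leq (proj_chain_le hup c1 c2) andbT.
  by have [c' hc'] := chm; exact: (dmax m c' hc').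
have Ee : e = delta.
  have [h [[N' hN'] Ed]] := hdeg.
  have EL : m`!%:R * lead_coef h = e%:R.
    apply: (@lead_coef_growth m e c0 (maxn N (maxn N' e)) h e0) => D'; rewrite !geq_max => /and3P[n1 n2 n3].
      have := @dimK_ge K n P R _ _ (hlow D' n3).
      by rewrite -X_ringE (hN' D' n2) lee_fin -[X in X <= _](ratr_nat R) ler_rat.
    have := @dimK_le K n P R _ _ (fun r => hup D' r n1).
    by rewrite -X_ringE (hN' D' n2) lee_fin -[X in _ <= X](ratr_nat R) ler_rat.
  by apply/eqP; rewrite -(eqr_nat rat) -EL Ed Em.
subst m e.
pose G := Gk (hio P) u (@Rv K n P eta) (RationalPoint.BD (hio P) (@hX K n P) l) delta.
have key k : dimK R (lin_span (range (@hconst K n P)) (localized_F E p D t `&`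
    module_pow (eval_local_ring E eta xi) (eval_max_ideal E eta xi) k)) = ((G D k)%:R)%:E.
  apply/eqP; rewrite eq_le; apply/andP; split.
    apply: (@dimK_le K n P R) => r hr.
    exact: (proj1 (h2 D k r D1) (proj1 (h5 E hE p pm xi hxi hred D t ht k r) hr)).
  apply: (@dimK_ge K n P R).
  exact: (proj2 (h5 E hE p pm xi hxi hred D t ht k _) (proj2 (h2 D k _ D1) (leqnn _))).
have -> : R_xi E p eta xi R D t = (\sum_(1 <= k <oo) ((G D k)%:R)%:E)%E.
  by rewrite /R_xi; apply: eq_eseriesr => k _; exact: key.
(* For $d=0$ the maximal ideal at [eta] is zero, so there are no nonzero elements of order at least
   1, and the integral vanishes by [I_X_dim0]. *)
have [d0|dp] := posnP d; last exact: (h3 R Hl D Hl0 dp D1).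
rewrite (h4 R d Hl d0) mule0 sube0.
have -> : (\sum_(1 <= k <oo) ((G D k)%:R)%:E)%E = 0%E :> \bar R.
  apply: eseries0 => k k1 _.
  suff -> : G D k = 0%N by [].
  apply: (@ind_null _ _ (hio P) (RationalPoint.BD (hio P) (@hX K n P) l D `&` gpow (@Rv K n P eta) u k)).
    by case: k k1 => // k _ z [_]; exact: (gpow_dim0 d0).
  exact: (proj2 (h2 D k _ D1) (leqnn _)).
by rewrite abse0 lee_fin mulr_ge0 ?exprn_ge0 ?ler0n.
Qed.
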